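(* Let $\bar\Omega\in C_c^\infty(\mathbb{R}^2)$ be the unstable, zero-mean vortex described in the context and let $0<a\le1$. Then $\bar\Omega$ is self-similarly unstable for some $b>0$: there exist $b>0$, $m\in\mathbb{N}$, $\lambda\in\mathbb{C}$ with $\Re\lambda>0$, and $0\ne W\in U_m$ such that $L_bW=\lambda W$. Moreover, the corresponding eigenfunction satisfies $W\in C_c^2(\mathbb{R}^2)$.
   Context: Polar coordinates $X=Re^{i\theta}$ on $\mathbb{R}^2\cong\mathbb{C}$, $e_\theta=ie^{i\theta}$. For $m\in\mathbb{N}=\{1,2,\dots\}$, $U_m=\{w\in L^2(\mathbb{R}^2;\mathbb{C}):w(X)=w_m(R)e^{im\theta}\}$. $\nabla^\perp\Delta^{-1}$ is the Biot-Savart operator (the divergence-free velocity with given curl). The vortex. Fix an integer $n\ge2$ and radii $0<r_1<r_2<\infty$; put $\xi=(r_1/r_2)^2$, $c=\xi^{-1}-1$, and assume the polynomial $z^2-\frac{n-1}{n}\frac{1-\xi}{2\xi}z+\frac{1-\xi}{4n\xi}-\frac{1-\xi^n}{4n^2\xi}$ has non-real roots. Let $\bar v_{\theta,1}(R)=\frac{cR}2$, $\bar v_{\theta,2}(R)=\frac R2\big((r_2/R)^2-1\big)$, let $\eta\in C_c^\infty((-1,1))$ be a standard mollifier with $\int\eta=1$, $\eta^\varepsilon(\cdot)=\varepsilon^{-1}\eta(\cdot/\varepsilon)$, and for $0<\varepsilon<\frac13\min\{r_1,r_2-r_1\}$ define the smooth profile $\bar V_\theta(R)$ equal to $\bar v_{\theta,1}$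 for $R\le r_1-\varepsilon$, to $\bar v_{\theta,1}+(\bar v_{\theta,2}-\bar v_{\theta,1})(1_{[r_1,r_2)}*\eta^\varepsilon)$ for $|R-r_1|<\varepsilon$, to $\bar v_{\theta,2}$ for $r_1+\varepsilon\le R\le r_2-\varepsilon$, to $\bar v_{\theta,2}(1_{[r_1,r_2)}*\eta^\varepsilon)$ for $|R-r_2|<\varepsilon$, and to $0$ for $R\ge r_2+\varepsilon$. Set $\bar V=\bar V_\theta e_\theta$ and $\bar\Omega(X)=\bar W(R)=\frac1R\partial_R(R\bar V_\theta)$. The number $\varepsilon$ is fixed so small that $\bar\Omega$ is unstable with an eigenfunction in $U_n$: there are $0\neq w\in U_n$ and $\lambda_0$ with $\Re\lambda_0>0$ and $Lw=\lambda_0w$, where $L\Omega=-\bar V\cdot\nabla\Omega-V\cdot\nabla\bar\Omega$ with $V=\nabla^\perp\Delta^{-1}\Omega$. Self-similar linearization. For parameters $a,b\in(0,1]$, $L_b\Omega=L\Omega+b(a+X\cdot\nabla)\Omega$, understood in the sense of distributions (the eigenfunction being in the domain of $L_b$, i.e. $L_bW\in L^2$). The vortex $\bar\Omega$ is called self-similarly unstable (for the given $a,b$) if for some $m\in\mathbb{N}$ there are $0\ne W\in U_m$ and $\lambda$ with $\Re\lambda>0$ such that $L_bW=\lambda W$. *)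

(* Defs.v *)
From HB Require Import structures.
From mathcomp Require Import all_boot all_order all_algebra.
From mathcomp Require Import complex.
From mathcomp Require Import all_classical all_reals all_analysis.

Set Implicit Arguments.
Unset Strict Implicit.
Unset Printing Implicit Defensive.

Import Order.TTheory GRing.Theory Num.Theory.
Import numFieldNormedType.Exports.

Local Open Scope classical_set_scope.
Local Open Scope ring_scope.
Local Open Scope complex_scope.

Section PlaneAnalysis.
Context {R : realType}.

Local Notation mu := (@lebesgue_measure R \x @lebesgue_measure R)%E.

(* The library's norm on a product is the max norm, not the Euclidean one. *)
Definition enorm (X : R * R) : R := Num.sqrt (X.1 ^+ 2 + X.2 ^+ 2).

Definition d1 (f : R * R -> R) (X : R * R) : R := 'D_((1 : R), (0 : R)) f X.
Definition d2 (f : R * R -> R) (X : R * R) : R := 'D_((0 : R), (1 : R)) f X.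

Definition div (A : R * R -> R * R) (X : R * R) : R :=
  d1 (fun Y => (A Y).1) X + d2 (fun Y => (A Y).2) X.

Fixpoint Ck (k : nat) (f : R * R -> R) : Prop :=
  match k with
  | 0%N => continuous f
  | k'.+1 => [/\ continuous f,
      forall X, derivable f X ((1 : R), (0 : R)),
      forall X, derivable f X ((0 : R), (1 : R)),
      Ck k' (d1 f) & Ck k' (d2 f)]
  end.

Definition Cck (k : nat) (f : R * R -> R) : Prop :=
  Ck k f /\ compact (closure [set X | f X != 0]).

Definition test_function (f : R * R -> R) : Prop := forall k, Cck k f.

Definition Cck_complex (k : nat) (w : R * R -> R[i]) : Prop :=
  Cck k (fun X => complex.Re (w X)) /\ Cck k (fun X => complex.Im (w X)).

Definition cint (f : R * R -> R[i]) : R[i] :=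
  (\int[mu]_X complex.Re (f X)) +i* (\int[mu]_X complex.Im (f X)).

Definition L2 (w : R * R -> R[i]) : Prop :=
  (fun X : R * R => complex.Re (w X)) \in Lfun mu 2%:E /\
  (fun X : R * R => complex.Im (w X)) \in Lfun mu 2%:E.

(* Elements of L2 are identified up to null sets, hence the "almost every". *)
Definition U (m : nat) (w : R * R -> R[i]) : Prop :=
  L2 w /\
  exists wm : R -> R[i], {ae mu, forall X : R * R, forall r theta : R,
    0 <= r -> X = (r * cos theta, r * sin theta) ->
    w X = wm r * (cos (m%:R * theta) +i* sin (m%:R * theta))}.

Definition loc_integrable (f : R * R -> R) : Prop :=
  measurable_fun [set: measurableTypeR R * measurableTypeR R] f /\
  forall K : set (R * R), compact K -> (\int[mu]_(X in K) `|f X|%:E < +oo)%E.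

Definition loc_integrable_complex (f : R * R -> R[i]) : Prop :=
  loc_integrable (fun X => complex.Re (f X)) /\
  loc_integrable (fun X => complex.Im (f X)).

Definition vanishes_at_infinity (f : R * R -> R[i]) : Prop :=
  forall delta : R, 0 < delta -> exists rho : R,
    {ae mu, forall X : R * R, rho < enorm X -> `|f X| < delta%:C}.

(* biot_savart w V states that V is (a representative of) the velocity
   nabla^perp Delta^{-1} w: div V = 0 and d1 V2 - d2 V1 = w as distributions.
   Decay at infinity removes the harmonic fields, so V is unique up to a null
   set; for w in U m it exists for all m >= 2, and for m = 1 it exists when,
   e.g., w is compactly supported. *)
Definition biot_savart (w : R * R -> R[i]) (V : R * R -> R[i] * R[i]) : Prop :=
  [/\ loc_integrable_complex (fun X => (V X).1) /\
      loc_integrable_complex (fun X => (V X).2),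
      vanishes_at_infinity (fun X => (V X).1) /\
      vanishes_at_infinity (fun X => (V X).2),
      forall phi, test_function phi ->
        cint (fun X => (V X).1 * (d1 phi X)%:C + (V X).2 * (d2 phi X)%:C) = 0 &
      forall phi, test_function phi ->
        cint (fun X => (V X).1 * (d2 phi X)%:C - (V X).2 * (d1 phi X)%:C)
        = cint (fun X => w X * (phi X)%:C)].

(* The distribution A . nabla w, for a smooth field A, tested against phi. *)
Definition transport (A : R * R -> R * R) (w : R * R -> R[i])
    (phi : R * R -> R) : R[i] :=
  - cint (fun X => w X *
      (div (fun Y => (phi Y * (A Y).1, phi Y * (A Y).2)) X)%:C).

(* The distribution L w tested against phi, where V stands for the velocity of
   w. *)
Definition linearized (barV : R * R -> R * R) (barOmega : R * R -> R)
    (w : R * R -> R[i]) (V : R * R -> R[i] * R[i]) (phi : R * R -> R) : R[i] :=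
  - transport barV w phi
  - cint (fun X => ((V X).1 * (d1 barOmega X)%:C
                    + (V X).2 * (d2 barOmega X)%:C) * (phi X)%:C).

Definition self_similar_linearized (a b : R)
    (barV : R * R -> R * R) (barOmega : R * R -> R)
    (w : R * R -> R[i]) (V : R * R -> R[i] * R[i]) (phi : R * R -> R) : R[i] :=
  linearized barV barOmega w V phi
  + b%:C * (a%:C * cint (fun X => w X * (phi X)%:C)
            + transport (fun X => X) w phi).

(* 0 <> w in U m and T w = lambda w as distributions; since the right-hand side
   is in L2, w is in particular in the domain of T. *)
Definition eigenfunction
    (T : (R * R -> R[i]) -> (R * R -> R[i] * R[i]) -> (R * R -> R) -> R[i])
    (m : nat) (lambda : R[i]) (w : R * R -> R[i]) : Prop :=
  [/\ U m w,
      ~ {ae mu, forall X : R * R, w X = 0} &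
      exists2 V, biot_savart w V &
        forall phi, test_function phi ->
          T w V phi = lambda * cint (fun X => w X * (phi X)%:C)].

Definition standard_mollifier (eta : R -> R) : Prop :=
  [/\ forall k x, derivable (derive1n k eta) x 1,
      compact (closure [set x | eta x != 0])
      /\ closure [set x | eta x != 0] `<=` `]-1, 1[,
      forall x, 0 <= eta x &
      \int[lebesgue_measure]_x eta x = 1].

End PlaneAnalysis.

Section Vortex.
Context {R : realType}.
Variables r1 r2 : R.

Definition xi : R := (r1 / r2) ^+ 2.
Definition c : R := xi^-1 - 1.

Definition vortex_poly (n : nat) : {poly R} :=
  'X ^+ 2
  - ((n%:R - 1) / n%:R * ((1 - xi) / (2 * xi))) *: 'X
  + ((1 - xi) / (4 * n%:R * xi)
     - (1 - xi ^+ n) / (4 * n%:R ^+ 2 * xi))%:P.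

Definition nonreal_roots (p : {poly R}) : Prop :=
  forall z : R[i], root (map_poly (real_complex R) p) z -> complex.Im z != 0.

Variables (eta : R -> R) (eps : R).

Definition v1 (s : R) : R := c * s / 2.
Definition v2 (s : R) : R := s / 2 * ((r2 / s) ^+ 2 - 1).

Definition eta_eps (s : R) : R := eps^-1 * eta (s / eps).

Definition mollified_indic (s : R) : R :=
  \int[lebesgue_measure]_t (\1_(`[r1, r2[%classic) t * eta_eps (s - t)).

Definition barVtheta (s : R) : R :=
  if s <= r1 - eps then v1 s
  else if s < r1 + eps then v1 s + (v2 s - v1 s) * mollified_indic s
  else if s <= r2 - eps then v2 s
  else if s < r2 + eps then v2 s * mollified_indic s
  else 0.

Definition barV (X : R * R) : R * R :=
  (barVtheta (enorm X) * (- X.2 / enorm X),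
   barVtheta (enorm X) * (X.1 / enorm X)).

(* At s = 0, where the formula is 0 / 0, the value is the limit c. *)
Definition barW (s : R) : R :=
  if s == 0 then c else s^-1 * derive1 (fun t => t * barVtheta t) s.

Definition barOmega (X : R * R) : R := barW (enorm X).

Definition vortex_L := linearized barV barOmega.
Definition vortex_Lb (a b : R) := self_similar_linearized a b barV barOmega.

End Vortex.

(* Main.v *)
(* In the variable t = ln |X|^2, an eigenfunction of L in the mode n amounts to a
   solution of the Rayleigh equation, and lambda is an eigenvalue when the
   shooting function obtained by integrating inward from the decaying exterior
   solution vanishes. The given eigenfunction w is only an L2 distribution, so
   this is proved by duality: if the shooting function does not vanish at
   lambda_0, the adjoint equation is solvable for every radial datum g, which
   gives int w (x - iy)^n g(|X|^2) dX = 0 for all g, hence w = 0.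
   For L_b the parameter b multiplies the derivative of the vorticity. Starting
   from zero vorticity outside the vortex, an energy estimate with damping rate
   Re lambda / b shows that the shooting function of L_b tends, locally
   uniformly in Re lambda > 0, to that of L as b -> 0. By a Hurwitz argument
   L_b has an eigenvalue near an eigenvalue of L with maximal real part on the
   horizontal line through lambda_0. To the left of the support of the
   vorticity gradient the eigenfunction is an explicit power of |X| of order Re
   lambda / b, which makes it C^2 at the origin for small b. *)
Require Import Defs.
From mathcomp Require Import all_boot all_order all_algebra.
From mathcomp Require Import complex.
From mathcomp Require Import all_classical all_reals all_analysis.
From mathcomp Require Import measurable_realfun ring lra.

Set Implicit Arguments.
Unset Strict Implicit.
Unset Printing Implicit Defensive.

Import Order.TTheory GRing.Theory Num.Theory.
Import numFieldNormedType.Exports.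

Local Open Scope classical_set_scope.
Local Open Scope ring_scope.
Local Open Scope complex_scope.

(** The limit b -> 0 is singular, since b multiplies the only derivative of the vorticity. It is
    tame because the vorticity variable [q] relaxes to its Rayleigh value [rho psi] and both vanish
    at [be], so that no initial layer forms. Holomorphy in lambda enters only through second-order
    expansions with cubic error, which Gronwall's inequality gives for linear systems. A maximum
    principle follows from them; in place of an identity theorem, the rightmost zero on a horizontal
    line is used, the limit function being non-zero on the ray beyond it. Such a zero exists because
    for large Re lambda the solution is close to the one without vorticity gradient. In the duality
    argument the adjoint stream function decays only like |X|^(-n) and must be cut off before it can
    serve as a test function; n >= 2 and the decay of the velocity pay for the cut-off. Finally, the
    radial factor of an element of [U n] comes without measurability, so a Borel version of it has
    to be found before vanishing radial moments can give w = 0. *)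

Section Continuity.
Context {T : topologicalType} {R : realType}.
Implicit Types f g : T -> R.

Lemma cont_cst (c : R) : continuous (fun _ : T => c).
Proof. exact: cst_continuous. Qed.

Lemma contD f g : continuous f -> continuous g -> continuous (fun t => f t + g t).
Proof. by move=> cf cg t; exact: (@continuousD R R T f g t (cf t) (cg t)). Qed.

Lemma contN f : continuous f -> continuous (fun t => - f t).
Proof. by move=> cf t; exact: (@continuousN R R T f t (cf t)). Qed.

Lemma contB f g : continuous f -> continuous g -> continuous (fun t => f t - g t).
Proof. by move=> cf cg; exact: contD cf (contN cg). Qed.

Lemma contM f g : continuous f -> continuous g -> continuous (fun t => f t * g t).
Proof. by move=> cf cg t; exact: (@continuousM R T f g t (cf t) (cg t)). Qed.

Lemma contX f n : continuous f -> continuous (fun t => f t ^+ n).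
Proof.
move=> cf; elim: n => [|n IH]; first exact: cont_cst.
by under eq_fun do rewrite exprS; exact: contM.
Qed.

Lemma cont_comp f (h : R -> R) : continuous f -> continuous h ->
  continuous (fun t => h (f t)).
Proof. by move=> cf ch t; apply: continuous_comp; [exact: cf|exact: ch]. Qed.

Lemma cont_norm f : continuous f -> continuous (fun t => `|f t|).
Proof. by move=> cf; apply: cont_comp => //; exact: norm_continuous. Qed.

Lemma continuous_sum (J : Type) (r : seq J) (f : J -> T -> R) :
  (forall j, continuous (f j)) -> continuous (fun t => \sum_(j <- r) f j t).
Proof.
move=> h; elim: r => [|j r IH].
  by under eq_fun do rewrite big_nil; exact: cont_cst.
by under eq_fun do rewrite big_cons; apply: contD; [exact: h|exact: IH].
Qed.

End Continuity.

(** * Derivatives, mean value estimates and antiderivatives on the line *)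

Section Calculus.
Context {R : realType}.
Implicit Types (f g F : R -> R) (t a b : R).

Definition hasder f t (d : R) := is_derive t (1 : R) f d.

Lemma hasder_eq f t d d' : hasder f t d -> d = d' -> hasder f t d'.
Proof. by move=> h <-. Qed.

Lemma hasder_cst c t : hasder (fun=> c) t 0.
Proof. exact: is_derive_cst. Qed.

Lemma hasder_id t : hasder (fun x => x) t 1.
Proof. exact: is_derive_id. Qed.

Lemma hasderD f g t (df dg : R) : hasder f t df -> hasder g t dg ->
  hasder (fun x => f x + g x) t (df + dg).
Proof. exact: is_deriveD. Qed.

Lemma hasderN f t (df : R) : hasder f t df -> hasder (fun x => - f x) t (- df).
Proof. exact: is_deriveN. Qed.

Lemma hasderB f g t (df dg : R) : hasder f t df -> hasder g t dg ->
  hasder (fun x => f x - g x) t (df - dg).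
Proof. exact: is_deriveB. Qed.

Lemma hasderM f g t (df dg : R) : hasder f t df -> hasder g t dg ->
  hasder (fun x => f x * g x) t (df * g t + f t * dg).
Proof.
move=> hf hg; have h := @is_deriveM _ _ f g t 1 df dg hf hg.
by apply: hasder_eq h _; rewrite /GRing.scale /=; ring.
Qed.

Lemma hasderZ c f t (df : R) : hasder f t df ->
  hasder (fun x => c * f x) t (c * df).
Proof.
by move=> h; apply: hasder_eq (hasderM (hasder_cst c t) h) _; rewrite mul0r add0r.
Qed.

Lemma hasderX f n t (df : R) : hasder f t df ->
  hasder (fun x => f x ^+ n) t (n%:R * f t ^+ n.-1 * df).
Proof.
move=> hf; have h := @is_deriveX _ _ f n t 1 df hf.
rewrite /hasder; suff -> : (fun x => f x ^+ n) = f ^+ n by [].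
by apply/funext => x; rewrite fctE.
Qed.

Lemma hasder_comp f g t (df dg : R) : hasder g t dg -> hasder f (g t) df ->
  hasder (fun x => f (g x)) t (df * dg).
Proof.
move=> hg hf; have := @is_derive1_comp _ f g t df dg; exact.
Qed.

Lemma hasder_exp f t (df : R) : hasder f t df ->
  hasder (fun x => expR (f x)) t (expR (f t) * df).
Proof. by move=> hf; apply: hasder_comp hf _; exact: is_derive_expR. Qed.

Lemma hasder_sin f t (df : R) : hasder f t df ->
  hasder (fun x => sin (f x)) t (cos (f t) * df).
Proof. by move=> hf; apply: hasder_comp hf _; exact: is_derive_sin. Qed.

Lemma hasder_cos f t (df : R) : hasder f t df ->
  hasder (fun x => cos (f x)) t (- sin (f t) * df).
Proof. by move=> hf; apply: hasder_comp hf _; exact: is_derive_cos. Qed.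

Lemma hasder_ln f t (df : R) : 0 < f t -> hasder f t df ->
  hasder (fun x => ln (f x)) t ((f t)^-1 * df).
Proof. by move=> f0 hf; apply: hasder_comp hf _; exact: is_derive1_ln. Qed.

Lemma hasderV f t (df : R) : f t != 0 -> hasder f t df ->
  hasder (fun x => (f x)^-1) t (- df / f t ^+ 2).
Proof.
move=> f0 hf; have h := @is_deriveV _ f t df 1 f0 hf.
by apply: hasder_eq h _; rewrite /GRing.scale /=; field.
Qed.

Lemma hasder_sum (I : Type) (r : seq I) (f : I -> R -> R) t (df : I -> R) :
  (forall i, hasder (f i) t (df i)) ->
  hasder (fun x => \sum_(i <- r) f i x) t (\sum_(i <- r) df i).
Proof.
move=> h; elim: r => [|i r IH].
  by rewrite big_nil; under eq_fun do rewrite big_nil; exact: hasder_cst.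
by rewrite big_cons; under eq_fun do rewrite big_cons; exact: hasderD.
Qed.

Lemma hasder_near f g t d : (\forall x \near t, f x = g x) ->
  hasder f t d -> hasder g t d.
Proof. by move=> h; apply: near_eq_is_derive. Qed.

Lemma hasder_cont f t d : hasder f t d -> {for t, continuous f}.
Proof.
by move=> hf; apply/differentiable_continuous/derivable1_diffP; case: hf.
Qed.

Lemma hasder_derivable f t d : hasder f t d -> derivable f t 1.
Proof. by case. Qed.

Lemma hasder_derive1 f t d : hasder f t d -> derive1 f t = d.
Proof. by move=> hf; rewrite derive1E; apply: derive_val. Qed.

Lemma derivable_hasder f t : derivable f t 1 -> hasder f t (derive1 f t).
Proof. by move=> /derivableP; rewrite derive1E. Qed.

Lemma hasder_uniq f t d d' : hasder f t d -> hasder f t d' -> d = d'.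
Proof. by move=> /hasder_derive1 <- /hasder_derive1 <-. Qed.

Lemma nondecreasing_hasder f f' a b : a <= b ->
  (forall t, a <= t <= b -> hasder f t (f' t)) ->
  (forall t, a <= t <= b -> 0 <= f' t) -> f a <= f b.
Proof.
move=> ab hf h0.
have [||c cab E] := @MVT_segment R f f' a b ab.
- by move=> x; rewrite in_itv /= => /andP[/ltW ? /ltW ?]; apply: hf; apply/andP.
- apply: continuous_in_subspaceT => x; rewrite inE /= in_itv /= => xab.
  exact: hasder_cont (hf _ xab).
- rewrite -subr_ge0 E mulr_ge0 ?subr_ge0//; apply: h0.
  by move: cab; rewrite in_itv.
Qed.

Lemma hasder_le f g f' g' a b : a <= b ->
  (forall t, a <= t <= b -> hasder f t (f' t)) ->
  (forall t, a <= t <= b -> hasder g t (g' t)) ->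
  (forall t, a <= t <= b -> f' t <= g' t) -> f b - f a <= g b - g a.
Proof.
move=> ab hf hg h.
suff : g a - f a <= g b - f b by lra.
apply: (@nondecreasing_hasder (fun t => g t - f t) (fun t => g' t - f' t)) => //.
- by move=> t tab; apply: hasderB; [exact: hg|exact: hf].
- by move=> t tab; rewrite subr_ge0 h.
Qed.

Lemma hasder_le_norm f g f' g' a b : a <= b ->
  (forall t, a <= t <= b -> hasder f t (f' t)) ->
  (forall t, a <= t <= b -> hasder g t (g' t)) ->
  (forall t, a <= t <= b -> `|f' t| <= g' t) -> `|f b - f a| <= g b - g a.
Proof.
move=> ab hf hg h; rewrite ler_norml; apply/andP; split.
- suff : (- f b) - (- f a) <= g b - g a by lra.
  apply: (@hasder_le (fun x => - f x) g (fun t => - f' t) g') => // t tab.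
    by apply: hasderN; apply: hf.
  by rewrite (le_trans _ (h _ tab))// -normrN ler_norm.
- apply: (@hasder_le _ _ f' g') => // t tab.
  by rewrite (le_trans _ (h _ tab))// ler_norm.
Qed.

Lemma hasder0_cst f a b : a <= b ->
  (forall t, a <= t <= b -> hasder f t 0) -> f a = f b.
Proof.
move=> ab hf; have := @hasder_le_norm f (fun=> 0) (fun=> 0) (fun=> 0) a b ab hf.
move=> /(_ (fun t _ => hasder_cst 0 t)) h.
have /h : forall t, a <= t <= b -> `|0 : R| <= 0 by move=> *; rewrite normr0.
by rewrite subrr normr_le0 subr_eq0 => /eqP.
Qed.

(** The integral starts at [t0 - 1] and not at [t0], so that differentiability holds on a
    neighbourhood of [t0]; further left the interval of integration is empty. *)
Lemma antiderivative_right f t0 : continuous f -> exists F, F t0 = 0 /\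
  forall t, t0 - 1 < t -> hasder F t (f t).
Proof.
move=> cf.
pose F0 x := (\int[lebesgue_measure]_(u in [set` `[t0 - 1, x]]) f u)%R.
have D t : t0 - 1 < t -> hasder F0 t (f t).
  move=> tt; have := @continuous_FTC1_closed R f (t0 - 1) t (t + 1).
  rewrite ltrDl ltr01 => /(_ isT) [].
  - apply: continuous_compact_integrable; first exact: segment_compact.
    exact: continuous_subspaceT.
  - by [].
  - exact: cf.
  - by move=> /derivable_hasder + <-.
exists (fun t => F0 t - F0 t0); split; first by rewrite subrr.
move=> t tt; rewrite -[f t]subr0; apply: hasderB; [exact: D|exact: hasder_cst].
Qed.

(** The left half comes from reflection. On the overlap (t0 - 1, t0 + 1) both halves have the
    derivative f and the value 0 at [t0], so they agree there and glue. *)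
Lemma antiderivative f t0 : continuous f -> exists F, F t0 = 0 /\
  forall t, hasder F t (f t).
Proof.
move=> cf.
have [F [F0 DF]] := antiderivative_right t0 cf.
have [|G [G0 DG]] := @antiderivative_right (fun x => f (- x)) (- t0).
  by move=> x; apply: continuous_comp; [exact: opp_continuous|exact: cf].
pose G' t := - G (- t).
have DG' t : t < t0 + 1 -> hasder G' t (f t).
  move=> tt; apply: hasder_eq.
    apply: hasderN; apply: (@hasder_comp G (fun x => - x)).
      by apply: hasderN; exact: hasder_id.
    by apply: DG; lra.
  by rewrite opprK; ring.
have FG t : t0 - 1 < t -> t < t0 + 1 -> F t = G' t.
  move=> t1 t2.
  have G'0 : G' t0 = 0 by rewrite /G' G0 oppr0.
  suff E u v : u <= v -> t0 - 1 < u -> v < t0 + 1 -> F u - G' u = F v - G' v.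
    have [h|h] := leP t t0; first by have := E _ _ h; lra.
    by have := E _ _ (ltW h); lra.
  move=> uv u1 v1; apply: (@hasder0_cst (fun x => F x - G' x)) => // x xuv.
  by rewrite -(subrr (f x)); apply: hasderB; [apply: DF|apply: DG']; lra.
exists (fun t => if t < t0 then G' t else F t); split; first by rewrite ltxx.
move=> t; have [h|h] := ltP t t0.
- apply: (@hasder_near G'); last by apply: DG'; lra.
  near=> x; have -> // : x < t0.
  near: x; exact: lt_nbhsl.
- apply: (@hasder_near F); last by apply: DF; lra.
  near=> x; case: ifPn => // xt; apply: FG; last by lra.
  near: x; apply: lt_nbhsr; lra.
Unshelve. all: by end_near. Qed.

End Calculus.

(** * Global solutions of linear systems on the line *)

Section LinearODE.
Context {R : realType} {I : finType}.
Implicit Types (M : I -> I -> R -> R) (g y : I -> R -> R).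

Lemma hasder_continuous (f df : R -> R) : (forall t, hasder f t (df t)) ->
  continuous f.
Proof. by move=> h t; exact: hasder_cont (h t). Qed.

(** Geometric convergence in a weighted norm is locally uniform, because a continuous weight is
    bounded near each point. *)
Lemma locally_uniform_limit_continuous (u : nat -> R -> R) (f w : R -> R) :
  (forall k, continuous (u k)) -> continuous w ->
  (forall k t, `|f t - u k t| <= 2^-1 ^+ k * w t) -> continuous f.
Proof.
move=> cu cw h t; apply/(@cvgrPdist_lt _ R) => e e0.
have wp : 0 < `|w t| + 1 by rewrite ltr_wpDl.
have [k hk] : exists k, 2^-1 ^+ k < e / 4 / (`|w t| + 1).
  have hc : (2^-1 ^+ k : R) @[k --> \oo] --> 0.
    by apply: cvg_expr; rewrite ger0_norm; lra.
  have ep : 0 < e / 4 / (`|w t| + 1) by rewrite divr_gt0 ?divr_gt0.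
  move/cvgrPdist_lt : hc => /(_ _ ep)[N _ hN].
  exists N; have := hN N (leqnn _).
  by rewrite sub0r normrN ger0_norm ?exprn_ge0 ?invr_ge0.
have k0 : 0 < (2^-1 : R) ^+ k by rewrite exprn_gt0 ?invr_gt0.
move: hk; rewrite ltr_pdivlMr// => hk.
near=> s.
have hs : `|u k t - u k s| < e / 4.
  by near: s; move/cvgrPdist_lt : (cu k t) => /(_ (e/4)); apply; lra.
have hw : `|w t - w s| < 1.
  by near: s; move/cvgrPdist_lt : (cw t) => /(_ 1); apply.
have w1 : w t <= `|w t| + 1 by rewrite ler_wpDr// ler_norm.
have w2 : w s <= `|w t| + 1.
  by rewrite -[w s](subrK (w t)) addrC lerD ?ler_norm// (le_trans (ler_norm _))// distrC ltW.
have := h k t; have := h k s.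
move=> h1 h2; have h1' := le_trans h1 (ler_wpM2l (ltW k0) w2).
have h2' := le_trans h2 (ler_wpM2l (ltW k0) w1).
rewrite (_ : f t - f s = (f t - u k t) + (u k t - u k s) - (f s - u k s)); last by ring.
rewrite (le_lt_trans (ler_normB _ _))// (le_lt_trans (lerD (ler_normD _ _) (lexx _)))//.
lra.
Unshelve. all: by end_near. Qed.

(* The weight w is adapted to the majorant k of the coefficients, so that the
   Picard map contracts by 1/2 in the w-weighted norm on the whole line. *)
Lemma picard_weight (k : R -> R) (t0 : R) : continuous k -> (forall t, 0 <= k t) ->
  exists w : R -> R, [/\ continuous w, forall t, 2 <= w t &
    forall (f f' : R -> R) (B : R), 0 <= B -> f t0 = 0 ->
      (forall t, hasder f t (f' t)) ->
      (forall t, `|f' t| <= B * (k t * w t)) ->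
      forall t, `|f t| <= B * w t / 2].
Proof.
move=> ck k0; have [K [K0 DK]] := antiderivative t0 ck.
pose w t := expR (2 * K t) + expR (- (2 * K t)).
pose p t := (expR (2 * K t) - expR (- (2 * K t))) / 2.
have D2 t : hasder (fun t => 2 * K t) t (2 * k t).
  by apply: hasder_eq; first exact: hasderM (hasder_cst 2 t) (DK t); ring.
have De t : hasder (fun t => expR (2 * K t)) t (expR (2 * K t) * (2 * k t)).
  exact: hasder_exp.
have De' t : hasder (fun t => expR (- (2 * K t))) t (expR (- (2 * K t)) * (- (2 * k t))).
  by apply: hasder_exp; apply: hasderN.
have Dp t : hasder p t (k t * w t).
  apply: hasder_eq; first by apply: hasderM (hasder_cst _ _); apply: hasderB.
  by rewrite /w; field.
have p0 : p t0 = 0 by rewrite /p K0 mulr0 oppr0 subrr mul0r.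
have pw t : `|p t| <= w t / 2.
  have := expR_gt0 (2 * K t); have := expR_gt0 (- (2 * K t)).
  by rewrite ler_norml /p /w => *; apply/andP; split; lra.
exists w; split.
- by apply: hasder_continuous => t; apply: hasderD.
- move=> t; rewrite /w expRN.
  have e0 := expR_gt0 (2 * K t); set x := expR _ in e0 *.
  rewrite -subr_ge0 (_ : _ - _ = (x - 1) ^+ 2 / x); last by field; rewrite gt_eqF.
  by rewrite divr_ge0 ?sqr_ge0 ?ltW.
- move=> f f' B B0 f0 Df hf t.
  have DB s : hasder (fun t => B * p t) s (B * (k s * w s)).
    exact: hasderZ.
  rewrite -mulrA; apply: (@le_trans _ _ (B * `|p t|)); last first.
    by rewrite ler_wpM2l.
  rewrite -[X in X * `|_|](ger0_norm B0) -normrM.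
  have [tt|tt] := leP t0 t.
  + have := @hasder_le_norm _ f (fun t => B * p t) f' (fun s => B * (k s * w s)) t0 t tt.
    rewrite f0 p0 mulr0 !subr0 => /(_ (fun s _ => Df s) (fun s _ => DB s) (fun s _ => hf s)).
    by move=> /le_trans; apply; exact: ler_norm.
  + have := @hasder_le_norm _ f (fun t => B * p t) f' (fun s => B * (k s * w s)) t t0 (ltW tt).
    rewrite f0 p0 mulr0 !sub0r normrN => /(_ (fun s _ => Df s) (fun s _ => DB s) (fun s _ => hf s)).
    by move=> /le_trans; apply; rewrite -normrN; exact: ler_norm.
Qed.

Definition linear_field M g (y : I -> R -> R) i t := \sum_j M i j t * y j t + g i t.

Lemma linear_field_continuous M g y i :
  (forall i j, continuous (M i j)) -> (forall i, continuous (g i)) ->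
  (forall i, continuous (y i)) -> continuous (linear_field M g y i).
Proof.
move=> cM cg cy t; apply: continuousD (cg i t).
by apply: continuous_sum => j s; apply: continuousM; [exact: cM|exact: cy].
Qed.

(** Picard iteration on the whole line at once: in the norm weighted by [picard_weight] every step
    halves the distance, so no continuation of local solutions is required. *)
Theorem linear_ode_solution M g (y0 : I -> R) t0 :
  (forall i j, continuous (M i j)) -> (forall i, continuous (g i)) ->
  exists y, (forall i, y i t0 = y0 i) /\
    forall i t, hasder (y i) t (linear_field M g y i t).
Proof.
move=> cM cg.
(* [k] dominates every row of [M] and every component of the source, so one weight serves all
   components. *)
pose k t := (\sum_i \sum_j `|M i j t|) + \sum_i `|g i t|.
have ck : continuous k.
  apply: contD; last by apply: continuous_sum => i; exact: cont_norm.
  by apply: continuous_sum => i; apply: continuous_sum => j; exact: cont_norm.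
have k0 t : 0 <= k t by rewrite addr_ge0 ?sumr_ge0// => i _; rewrite sumr_ge0.
have kM t i : \sum_j `|M i j t| <= k t.
  rewrite ler_wpDr ?sumr_ge0// [leRHS](bigD1 i)//= lerDl sumr_ge0// => l _.
  by rewrite sumr_ge0.
have kg t i : `|g i t| <= k t.
  rewrite ler_wpDl ?sumr_ge0//; first by move=> l _; rewrite sumr_ge0.
  by rewrite (bigD1 i)//= lerDl sumr_ge0.
have [w [cw w2 hw]] := picard_weight t0 ck k0.
(* An iterate carries the proof of its continuity, since the next one is an antiderivative of the
   field along it. *)
have /choice[P HP] : forall y : {y : I -> R -> R | forall i, continuous (y i)},
    exists z : {y : I -> R -> R | forall i, continuous (y i)},
    (forall i, projT1 z i t0 = y0 i) /\
    forall i t, hasder (projT1 z i) t (linear_field M g (projT1 y) i t).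
  move=> [y cy] /=.
  have /choice[Y HY] i := antiderivative t0 (linear_field_continuous (i := i) cM cg cy).
  have D i t : hasder (fun t => y0 i + Y i t) t (linear_field M g y i t).
    rewrite -[linear_field _ _ _ _ _]add0r; apply: hasderD; first exact: hasder_cst.
    by case: (HY i).
  have cY i : continuous (fun t => y0 i + Y i t) by exact: hasder_continuous (D i).
  by exists (exist _ (fun i t => y0 i + Y i t) cY); split => //= i; case: (HY i) => -> _; rewrite addr0.
have c0 : forall i, continuous (fun _ : R => y0 i) by move=> i; exact: cst_continuous.
pose u n := iter n P (exist _ (fun i (_ : R) => y0 i) c0).
pose U n := projT1 (u n).
have cU n i : continuous (U n i) by exact: (projT2 (u n)).
have U0 n i : U n i t0 = y0 i by case: n => [//|n]; case: (HP (u n)) => + _; exact.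
have DU n i t : hasder (U n.+1 i) t (linear_field M g (U n) i t).
  by case: (HP (u n)) => _; exact.
(* The summand 1 absorbs the source in the first step, where [k * (B - 1) + k = B * k]. *)
pose B : R := \sum_i `|y0 i| + 1.
have B0 : 0 <= B by rewrite addr_ge0// sumr_ge0.
have yB i : `|y0 i| + 1 <= B.
  by rewrite lerD2r (bigD1 i)//= lerDl sumr_ge0.
have fieldB y z i t C : (forall j, `|y j t - z j t| <= C) ->
    `|linear_field M g y i t - linear_field M g z i t| <= k t * C.
  move=> h; rewrite /linear_field opprD addrACA subrr addr0 -sumrB.
  apply: le_trans (ler_norm_sum _ _ _) _.
  apply: (@le_trans _ _ (\sum_j `|M i j t| * C)).
    by apply: ler_sum => j _; rewrite -mulrBr normrM ler_wpM2l.
  rewrite -mulr_suml; apply: ler_wpM2r; last exact: kM.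
  exact: le_trans (normr_ge0 _) (h i).
have step n i t : `|U n.+1 i t - U n i t| <= 2^-1 ^+ n.+1 * B * w t.
  elim: n i t => [|n IH] i t.
    suff : `|U 1%N i t - U 0%N i t| <= B * w t / 2 by lra.
    apply: (hw (fun t => U 1%N i t - U 0%N i t) (fun t => linear_field M g (U 0%N) i t)) => //.
    - by rewrite !U0 subrr.
    - move=> s; rewrite -[linear_field _ _ _ _ _]subr0; apply: hasderB; first exact: DU.
      exact: hasder_cst.
    - move=> s; rewrite (le_trans (ler_normD _ _))//.
      rewrite (le_trans (lerD (ler_norm_sum _ _ _) (kg s i)))//.
      apply: (@le_trans _ _ (\sum_j `|M i j s| * (B - 1) + k s)).
        rewrite lerD2r; apply: ler_sum => j _; rewrite normrM ler_wpM2l//.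
        by have := yB j; rewrite /U /=; lra.
      rewrite -mulr_suml.
      apply: (@le_trans _ _ (k s * (B - 1) + k s)).
        rewrite lerD2r; apply: ler_wpM2r; last exact: kM.
        by have := yB i; have := normr_ge0 (y0 i); lra.
      have -> : k s * (B - 1) + k s = B * (k s * 1) by ring.
      by do 2! apply: ler_wpM2l => //; have := w2 s; lra.
  pose C := 2^-1 ^+ n.+1 * B.
  have -> : 2^-1 ^+ n.+2 * B * w t = C * w t / 2 by rewrite /C exprS; field.
  apply: (hw (fun t => U n.+2 i t - U n.+1 i t)
    (fun t => linear_field M g (U n.+1) i t - linear_field M g (U n) i t)) => //.
  - by rewrite mulr_ge0 ?exprn_ge0 ?invr_ge0.
  - by rewrite !U0 subrr.
  - by move=> s; apply: hasderB; exact: DU.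
  - move=> s; rewrite (_ : C * (k s * w s) = k s * (C * w s)); last by ring.
    by apply: fieldB => j; exact: IH.
have wp t : 0 <= B * w t by rewrite mulr_ge0//; have := w2 t; lra.
have tele n m i t : `|U (n + m)%N i t - U n i t| <= 2^-1 ^+ n * (B * w t) * (1 - 2^-1 ^+ m).
  elim: m => [|m IH]; first by rewrite addn0 subrr normr0 expr0 subrr mulr0.
  rewrite addnS (_ : U (n + m).+1 i t - U n i t =
    (U (n + m).+1 i t - U (n + m)%N i t) + (U (n + m)%N i t - U n i t)); last by ring.
  rewrite (le_trans (ler_normD _ _))// (le_trans (lerD (step _ _ _) IH))//.
  by rewrite !exprS exprD le_eqVlt; apply/orP; left; apply/eqP; field.
have tele' n m i t : `|U (n + m)%N i t - U n i t| <= 2^-1 ^+ n * (B * w t).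
  rewrite (le_trans (tele _ _ _ _))// ler_piMr//.
  by rewrite mulr_ge0 ?exprn_ge0 ?invr_ge0.
have half : (2^-1 ^+ n : R) @[n --> \oo] --> 0.
  by apply: cvg_expr; rewrite ger0_norm; lra.
have cvgU i t : cvgn (fun n => U n i t).
  apply: cauchy_cvg; apply: cauchy_exP => e e0.
  have : (2^-1 ^+ n * (B * w t) : R) @[n --> \oo] --> 0.
    by rewrite -[X in _ --> X](mul0r (B * w t)); apply: cvgMl.
  move/cvgrPdist_lt => /(_ _ e0)[N _ hN]; exists (U N i t); exists N => // m /= Nm.
  rewrite /ball /= distrC -(subnKC Nm); apply: le_lt_trans (tele' _ _ _ _) _.
  have := hN N (leqnn _); rewrite sub0r normrN ger0_norm//.
  by rewrite mulr_ge0 ?exprn_ge0 ?invr_ge0.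
pose y (i : I) (t : R) : R := limn (fun n => U n i t).
have yU i n t : `|y i t - U n i t| <= 2^-1 ^+ n * (B * w t).
  have hc : `|U m i t - U n i t| @[m --> \oo] --> `|y i t - U n i t|.
    by apply: cvg_norm; apply: cvgB; [exact: cvgU|exact: cvg_cst].
  rewrite -(cvg_lim (@Rhausdorff R) hc); apply: limr_le; first exact: cvgP hc.
  exists n => // m /= nm; rewrite -(subnKC nm); exact: tele'.
have cBw : continuous (fun t : R => B * w t).
  exact: contM (@cont_cst _ _ B) cw.
have cy i : continuous (y i).
  by apply: (locally_uniform_limit_continuous (u := fun n => U n i) _ cBw).
have /choice[Y HY] i := antiderivative t0 (linear_field_continuous (i := i) cM cg cy).
have DY i t : hasder (fun t => y0 i + Y i t) t (linear_field M g y i t).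
  rewrite -[linear_field _ _ _ _ _]add0r; apply: hasderD; first exact: hasder_cst.
  by case: (HY i).
have YU i n t : `|(y0 i + Y i t) - U n.+1 i t| <= 2^-1 ^+ n * (B * w t).
  apply: (@le_trans _ _ ((2^-1 ^+ n * B) * w t / 2)); last first.
    have := wp t; have : 0 <= (2^-1 : R) ^+ n by rewrite exprn_ge0 ?invr_ge0.
    by move=> h1 h2; have := mulr_ge0 h1 h2; lra.
  apply: (hw (fun t => y0 i + Y i t - U n.+1 i t)
    (fun t => linear_field M g y i t - linear_field M g (U n) i t)) => //.
  - by rewrite mulr_ge0 ?exprn_ge0 ?invr_ge0.
  - by case: (HY i) => -> _; rewrite U0 addr0 subrr.
  - by move=> s; apply: hasderB; [exact: DY|exact: DU].
  - move=> s; rewrite (_ : 2^-1 ^+ n * B * (k s * w s) = k s * (2^-1 ^+ n * (B * w s))); last by ring.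
    by apply: fieldB => j; exact: yU.
(* The limit and its Picard image are approximated by the same iterates with geometrically small
   error, hence they coincide; this is the fixed point equation. *)
have yY i t : y i t = y0 i + Y i t.
  apply/eqP; rewrite -subr_eq0 -normr_le0; apply/ler_addgt0Pl => e e0; rewrite addr0.
  have : (2^-1 ^+ n * (2 * (B * w t)) : R) @[n --> \oo] --> 0.
    by rewrite -[X in _ --> X](mul0r (2 * (B * w t))); apply: cvgMl.
  move/cvgrPdist_lt => /(_ _ e0)[N _ /(_ N (leqnn _))] /=.
  rewrite sub0r normrN ger0_norm; last first.
    by apply: mulr_ge0; [rewrite exprn_ge0 ?invr_ge0|apply: mulr_ge0].
  have h1 := yU i N.+1 t; have h2 := YU i N t.
  have h3 : 0 <= (2^-1 : R) ^+ N * (B * w t) by rewrite mulr_ge0 ?exprn_ge0 ?invr_ge0.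
  move: h1; rewrite exprS => h1 h4; apply/ltW; apply: le_lt_trans h4.
  rewrite (_ : y i t - _ = (y i t - U N.+1 i t) - (y0 i + Y i t - U N.+1 i t)); last by ring.
  rewrite (le_trans (ler_normB _ _))//; lra.
exists y; split; first by move=> i; rewrite yY; case: (HY i) => -> _; rewrite addr0.
by move=> i t; rewrite (_ : y i = fun t => y0 i + Y i t)//; apply/funext => s; rewrite yY.
Qed.

End LinearODE.

(** * Calculus of complex-valued functions of a real variable *)

Section ComplexCalculus.
Context {R : realType}.
Local Notation C := R[i].
Implicit Types (z w : C) (f g : R -> C) (t : R).

(** The squared modulus as a real number. The norm on [R[i]] takes values in [R[i]], and squares
    keep all estimates polynomial in the real and imaginary parts; the price is the factor 2 in
    [sqnD_le]. *)
Definition sqn z : R := complex.Re z ^+ 2 + complex.Im z ^+ 2.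

Lemma Re_add z w : complex.Re (z + w) = complex.Re z + complex.Re w.
Proof. by case: z w => [a b] [c d]. Qed.
Lemma Im_add z w : complex.Im (z + w) = complex.Im z + complex.Im w.
Proof. by case: z w => [a b] [c d]. Qed.
Lemma Re_opp z : complex.Re (- z) = - complex.Re z.
Proof. by case: z. Qed.
Lemma Im_opp z : complex.Im (- z) = - complex.Im z.
Proof. by case: z. Qed.
Lemma Re_mul z w : complex.Re (z * w) =
  complex.Re z * complex.Re w - complex.Im z * complex.Im w.
Proof. by case: z w => [a b] [c d]. Qed.
Lemma Im_mul z w : complex.Im (z * w) =
  complex.Re z * complex.Im w + complex.Im z * complex.Re w.
Proof. by case: z w => [a b] [c d]. Qed.
Lemma Re_inv z : complex.Re z^-1 = complex.Re z / sqn z.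
Proof. by case: z => [a b]. Qed.
Lemma Im_inv z : complex.Im z^-1 = - complex.Im z / sqn z.
Proof. by case: z => [a b] /=; rewrite mulNr. Qed.
Lemma Re_nat n : complex.Re (n%:R : C) = n%:R.
Proof. by elim: n => [//|n IH]; rewrite -addn1 !natrD Re_add IH. Qed.
Lemma Im_nat n : complex.Im (n%:R : C) = 0.
Proof. by elim: n => [//|n IH]; rewrite -addn1 !natrD Im_add IH addr0. Qed.
Lemma Re_sum (I : Type) (r : seq I) (F : I -> C) :
  complex.Re (\sum_(i <- r) F i) = \sum_(i <- r) complex.Re (F i).
Proof. by elim/big_ind2 : _ => // x1 x2 y1 y2 <- <-; rewrite Re_add. Qed.
Lemma Im_sum (I : Type) (r : seq I) (F : I -> C) :
  complex.Im (\sum_(i <- r) F i) = \sum_(i <- r) complex.Im (F i).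
Proof. by elim/big_ind2 : _ => // x1 x2 y1 y2 <- <-; rewrite Im_add. Qed.

Definition ReImE := (Re_add, Im_add, Re_opp, Im_opp, Re_mul, Im_mul, Re_nat, Im_nat).

Lemma complex_eq z w : complex.Re z = complex.Re w ->
  complex.Im z = complex.Im w -> z = w.
Proof. by case: z w => [a b] [c d] /= -> ->. Qed.

Lemma sqn_ge0 z : 0 <= sqn z.
Proof. by rewrite addr_ge0 ?sqr_ge0. Qed.

Lemma sqn_eq0 z : (sqn z == 0) = (z == 0).
Proof.
by case: z => a b; rewrite paddr_eq0 ?sqr_ge0// !sqrf_eq0 /= eq_complex.
Qed.

Lemma sqn_gt0 z : (0 < sqn z) = (z != 0).
Proof. by rewrite lt_def sqn_ge0 andbT sqn_eq0. Qed.

Lemma sqn0 : sqn 0 = 0.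
Proof. by rewrite /sqn /= expr0n addr0. Qed.

Lemma sqn1 : sqn 1 = 1.
Proof. by rewrite /sqn /= expr0n addr0 expr1n. Qed.

Lemma sqnM z w : sqn (z * w) = sqn z * sqn w.
Proof. by rewrite /sqn !ReImE; ring. Qed.

Lemma sqnN z : sqn (- z) = sqn z.
Proof. by rewrite /sqn !ReImE; ring. Qed.

Lemma sqnX z n : sqn (z ^+ n) = sqn z ^+ n.
Proof.
by elim: n => [|n IH]; rewrite ?expr0 ?sqn1// !exprS sqnM IH.
Qed.

Lemma sqnV z : sqn z^-1 = (sqn z)^-1.
Proof.
have [->|z0] := eqVneq z 0; first by rewrite invr0 sqn0 invr0.
apply: (@mulfI _ (sqn z)); first by rewrite sqn_eq0.
by rewrite -sqnM divff// sqn1 divff// sqn_eq0.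
Qed.

Lemma sqn_real (x : R) : sqn x%:C = x ^+ 2.
Proof. by rewrite /sqn /= expr0n addr0. Qed.

Lemma sqnD_le z w : sqn (z + w) <= 2 * (sqn z + sqn w).
Proof.
rewrite /sqn !ReImE; set a := complex.Re z; set b := complex.Im z.
set c := complex.Re w; set d := complex.Im w.
rewrite -subr_ge0 [leRHS](_ : _ = (a - c) ^+ 2 + (b - d) ^+ 2); last by ring.
by rewrite addr_ge0 ?sqr_ge0.
Qed.

Lemma sqnB_le z w : sqn (z - w) <= 2 * (sqn z + sqn w).
Proof. by rewrite -[sqn w]sqnN sqnD_le. Qed.

Definition cdot z w : R := complex.Re z * complex.Re w + complex.Im z * complex.Im w.

Lemma sqnD z w : sqn (z + w) = sqn z + 2 * cdot z w + sqn w.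
Proof. by rewrite /sqn /cdot !ReImE; ring. Qed.

(** Young's inequality with a free weight: the difference of the two sides is |e z + w|^2 / e or |e
    z - w|^2 / e. *)
Lemma cdot_le z w (e : R) : 0 < e -> `|2 * cdot z w| <= e * sqn z + e^-1 * sqn w.
Proof.
move=> e0; rewrite /cdot /sqn ler_norml.
set a := complex.Re z; set b := complex.Im z.
set c := complex.Re w; set d := complex.Im w.
apply/andP; split; rewrite -subr_ge0.
- rewrite [leRHS](_ : _ = e^-1 * ((e * a + c) ^+ 2 + (e * b + d) ^+ 2)); last by field; lra.
  by apply: mulr_ge0; [rewrite invr_ge0 ltW|rewrite addr_ge0 ?sqr_ge0].
- rewrite [leRHS](_ : _ = e^-1 * ((e * a - c) ^+ 2 + (e * b - d) ^+ 2)); last by field; lra.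
  by apply: mulr_ge0; [rewrite invr_ge0 ltW|rewrite addr_ge0 ?sqr_ge0].
Qed.

Lemma Re_sqr_le z : complex.Re z ^+ 2 <= sqn z.
Proof. by rewrite lerDl sqr_ge0. Qed.

Lemma Im_sqr_le z : complex.Im z ^+ 2 <= sqn z.
Proof. by rewrite lerDr sqr_ge0. Qed.

Definition chasder f t (d : C) :=
  hasder (fun x => complex.Re (f x)) t (complex.Re d) /\
  hasder (fun x => complex.Im (f x)) t (complex.Im d).

Definition ccontinuous f := continuous (fun x => complex.Re (f x)) /\
  continuous (fun x => complex.Im (f x)).

Lemma chasder_eq f t d d' : chasder f t d -> d = d' -> chasder f t d'.
Proof. by move=> h <-. Qed.

Lemma chasder_cst c t : chasder (fun=> c) t 0.
Proof. by split; exact: hasder_cst. Qed.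

Lemma chasderD f g t df dg : chasder f t df -> chasder g t dg ->
  chasder (fun x => f x + g x) t (df + dg).
Proof.
move=> [h1 h2] [h3 h4]; split; rewrite !ReImE.
  by under eq_fun do rewrite ReImE; exact: hasderD.
by under eq_fun do rewrite ReImE; exact: hasderD.
Qed.

Lemma chasderN f t df : chasder f t df -> chasder (fun x => - f x) t (- df).
Proof.
move=> [h1 h2]; split; rewrite !ReImE.
  by under eq_fun do rewrite ReImE; exact: hasderN.
by under eq_fun do rewrite ReImE; exact: hasderN.
Qed.

Lemma chasderB f g t df dg : chasder f t df -> chasder g t dg ->
  chasder (fun x => f x - g x) t (df - dg).
Proof. by move=> h1 h2; apply: chasderD => //; exact: chasderN. Qed.

Lemma chasderM f g t df dg : chasder f t df -> chasder g t dg ->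
  chasder (fun x => f x * g x) t (df * g t + f t * dg).
Proof.
move=> [h1 h2] [h3 h4]; split; rewrite !ReImE.
  under eq_fun do rewrite ReImE.
  apply: hasder_eq; first by apply: hasderB; apply: hasderM; eassumption.
  ring.
under eq_fun do rewrite ReImE.
apply: hasder_eq; first by apply: hasderD; apply: hasderM; eassumption.
ring.
Qed.

Lemma chasderZ (c : C) f t df : chasder f t df ->
  chasder (fun x => c * f x) t (c * df).
Proof.
move=> h; apply: chasder_eq (chasderM (chasder_cst c t) h) _.
by rewrite mul0r add0r.
Qed.

Lemma chasder_real (f : R -> R) t (d : R) : hasder f t d ->
  chasder (fun x => (f x)%:C) t d%:C.
Proof. by move=> h; split => //=; exact: hasder_cst. Qed.

Lemma hasder_sqn f t d : chasder f t d ->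
  hasder (fun x => sqn (f x)) t (2 * cdot (f t) d).
Proof.
move=> [h1 h2]; apply: hasder_eq.
  by apply: hasderD; apply: hasderX; eassumption.
by rewrite /cdot /=; ring.
Qed.

Lemma chasderV f t d : f t != 0 -> chasder f t d ->
  chasder (fun x => (f x)^-1) t (- d / f t ^+ 2).
Proof.
move=> f0 h; have hs := hasder_sqn h; case: h => h1 h2.
have s0 : sqn (f t) != 0 by rewrite sqn_eq0.
have hV := @hasderV R (fun x => sqn (f x)) t _ s0 hs.
(* Expanding by the squared conjugate makes the denominator real, so that real and imaginary parts
   can be compared separately. *)
have E : - d / f t ^+ 2 = (- d * (complex.Re (f t) -i* complex.Im (f t)) ^+ 2)
    / (sqn (f t) ^+ 2)%:C.
  have -> : (sqn (f t) ^+ 2)%:C = f t ^+ 2 * (complex.Re (f t) -i* complex.Im (f t)) ^+ 2.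
    rewrite /sqn; case: (f t) => a b /=; apply: complex_eq; rewrite /= ?ReImE /=; ring.
  have f0' : (complex.Re (f t) -i* complex.Im (f t)) != 0.
    by rewrite -sqn_eq0 /sqn /= sqrrN -/(sqn (f t)).
  by field; rewrite f0 f0'.
rewrite E; split.
  under eq_fun do rewrite Re_inv.
  apply: hasder_eq; first exact: hasderM h1 hV.
  rewrite !(Re_mul, Im_mul) Re_inv Im_inv sqn_real /= expr2 !ReImE /= /cdot; move: s0.
  rewrite /sqn; set a := complex.Re (f t); set b := complex.Im (f t) => s0; field.
  by rewrite s0.
under eq_fun do rewrite Im_inv.
apply: hasder_eq; first exact: hasderM (hasderN h2) hV.
rewrite !(Re_mul, Im_mul) Re_inv Im_inv sqn_real /= expr2 !ReImE /= /cdot; move: s0.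
rewrite /sqn; set a := complex.Re (f t); set b := complex.Im (f t) => s0; field.
by rewrite s0.
Qed.

Lemma chasder_continuous f df : (forall t, chasder f t (df t)) -> ccontinuous f.
Proof.
move=> h; split; [apply: (@hasder_continuous _ _ (fun t => complex.Re (df t)))|
  apply: (@hasder_continuous _ _ (fun t => complex.Im (df t)))] => t;
  by case: (h t).
Qed.

Lemma ccontinuousD f g : ccontinuous f -> ccontinuous g ->
  ccontinuous (fun t => f t + g t).
Proof.
move=> [h1 h2] [h3 h4]; split.
  by under eq_fun do rewrite Re_add; exact: contD.
by under eq_fun do rewrite Im_add; exact: contD.
Qed.

Lemma ccontinuousM f g : ccontinuous f -> ccontinuous g ->
  ccontinuous (fun t => f t * g t).
Proof.
move=> [h1 h2] [h3 h4]; split.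
  by under eq_fun do rewrite Re_mul; apply: contB; exact: contM.
by under eq_fun do rewrite Im_mul; apply: contD; exact: contM.
Qed.

Lemma ccontinuous_cst c : ccontinuous (fun=> c).
Proof. by split; exact: cst_continuous. Qed.

Lemma ccontinuous_real (f : R -> R) : continuous f -> ccontinuous (fun t => (f t)%:C).
Proof. by move=> h; split => //=; exact: cst_continuous. Qed.

Lemma ccontinuous_sum (J : Type) (r : seq J) (f : J -> R -> C) :
  (forall j, ccontinuous (f j)) -> ccontinuous (fun t => \sum_(j <- r) f j t).
Proof.
move=> h; elim: r => [|j r IH].
  by under eq_fun do rewrite big_nil; exact: ccontinuous_cst.
by under eq_fun do rewrite big_cons; apply: ccontinuousD.
Qed.

Lemma ccontinuous_sqn f : ccontinuous f -> continuous (fun t => sqn (f t)).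
Proof.
by move=> [h1 h2]; apply: contD; exact: contX.
Qed.

Lemma continuous_bounded (f : R -> R) a b : continuous f ->
  exists2 K, 0 <= K & forall t, a <= t <= b -> f t <= K.
Proof.
move=> cf; have [ab|ab] := leP a b; last by exists 0 => // t; lra.
have [|c _ hc] := @EVT_max R f a b ab; first exact: continuous_subspaceT.
exists `|f c| => // t tab; apply: le_trans (ler_norm _).
by apply: hc; rewrite in_itv.
Qed.

Lemma ccontinuous_bounded f a b : ccontinuous f ->
  exists2 K, 0 <= K & forall t, a <= t <= b -> sqn (f t) <= K.
Proof. by move=> /ccontinuous_sqn /continuous_bounded; exact. Qed.

(** Runs backward in time, because the systems below start from data at the right end: the lower
    bound on the derivative makes exp(L t) (E + c / L) nondecreasing. *)
Lemma gronwall (E E' : R -> R) (L c : R) a b : 1 <= L -> 0 <= c -> a <= b ->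
  (forall t, a <= t <= b -> hasder E t (E' t)) ->
  (forall t, a <= t <= b -> - (L * E t) - c <= E' t) ->
  E a <= expR (L * (b - a)) * (E b + c) .
Proof.
move=> L1 c0 ab DE hE.
have L0 : 0 < L by lra.
pose G t := expR (L * t) * (E t + c / L).
pose G' t := expR (L * t) * L * (E t + c / L) + expR (L * t) * E' t.
have DL t : hasder (fun t => L * t) t L.
  by apply: hasder_eq; [apply: hasderZ; exact: hasder_id|rewrite mulr1].
have : G a <= G b.
  apply: (@nondecreasing_hasder _ G G') => // t tab.
    apply: hasderM; first exact: hasder_exp.
    rewrite -[E' t]addr0; apply: hasderD (hasder_cst _ _); exact: DE.
  rewrite /G' -mulrA -mulrDr mulr_ge0 ?expR_ge0//.
  have -> : L * (E t + c / L) = L * E t + c by field; lra.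
  by have := hE _ tab; lra.
rewrite /G => h.
have cL : 0 <= c / L by rewrite divr_ge0// ltW.
have cL' : c / L <= c by rewrite ler_piMr// invf_le1.
have : E a + c / L <= expR (L * (b - a)) * (E b + c / L).
  rewrite -(ler_pM2l (expR_gt0 (L * a))) mulrA -expRD.
  by have -> : L * a + L * (b - a) = L * b by ring.
move=> h'; apply: (@le_trans _ _ (E a + c / L)); first lra.
apply: le_trans h' _; apply: ler_wpM2l; [exact: expR_ge0|lra].
Qed.

End ComplexCalculus.

(** * Complex linear systems: existence and Gronwall bound *)

Section ComplexODE.
Context {R : realType} {I : finType}.
Local Notation C := R[i].
Implicit Types (M : I -> I -> R -> C) (g y : I -> R -> C).

Definition cfield M g y i t := \sum_j M i j t * y j t + g i t.

(** Real and imaginary parts form a real system over the index set [I * bool], the flag marking the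
    imaginary part. *)
Theorem complex_ode_solution M g (y0 : I -> C) t0 :
  (forall i j, ccontinuous (M i j)) -> (forall i, ccontinuous (g i)) ->
  exists y, (forall i, y i t0 = y0 i) /\
    forall i t, chasder (y i) t (cfield M g y i t).
Proof.
move=> cM cg.
pose J := (I * bool)%type.
pose N (p q : J) t := match p.2, q.2 with
  | false, false => complex.Re (M p.1 q.1 t)
  | false, true => - complex.Im (M p.1 q.1 t)
  | true, false => complex.Im (M p.1 q.1 t)
  | true, true => complex.Re (M p.1 q.1 t) end.
pose h (p : J) t := if p.2 then complex.Im (g p.1 t) else complex.Re (g p.1 t).
pose x0 (p : J) := if p.2 then complex.Im (y0 p.1) else complex.Re (y0 p.1).
have [||x [xt Dx]] := @linear_ode_solution R J N h x0 t0.
- move=> [i [|]] [j [|]]; rewrite /N /=; case: (cM i j) => // h1 h2.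
  by move=> t; apply: continuousN; exact: h2.
- by move=> [i [|]]; rewrite /h /=; case: (cg i).
exists (fun i t => x (i, false) t +i* x (i, true) t); split.
  by move=> i; apply: complex_eq; rewrite /= xt.
have sumJ i b t : \sum_(p : J) N (i, b) p t * x p t =
    \sum_j (N (i, b) (j, true) t * x (j, true) t +
            N (i, b) (j, false) t * x (j, false) t).
  rewrite (eq_bigr (fun p : I * bool => N (i, b) (p.1, p.2) t * x (p.1, p.2) t)); last by case.
  rewrite -(pair_bigA _ (fun j c => N (i, b) (j, c) t * x (j, c) t)) /=.
  by under eq_bigr do rewrite big_bool.
move=> i t; split => /=; apply: hasder_eq (Dx _ t) _;
  rewrite /linear_field /cfield ?Re_add ?Im_add ?Re_sum ?Im_sum; congr (_ + _);
  rewrite sumJ; apply: eq_bigr => j _; rewrite /N /= ?Re_mul ?Im_mul /=; ring.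
Qed.

(** The energy is the sum of the |y_i|^2. Young's inequality bounds the coupling of components i and
    j by K |y_i|^2 + |y_j|^2; summing over both indices produces the rate [#|I| (K + 1) + 1]. *)
Lemma cfield_gronwall M g y (K d a b : R) : 0 <= K -> 0 <= d -> a <= b ->
  (forall i j t, a <= t <= b -> sqn (M i j t) <= K) ->
  (forall i t, a <= t <= b -> sqn (g i t) <= d) ->
  (forall i t, a <= t <= b -> chasder (y i) t (cfield M g y i t)) ->
  (forall i, y i b = 0) ->
  \sum_i sqn (y i a) <= expR ((#|I|%:R * (K + 1) + 1) * (b - a)) * (#|I|%:R * d).
Proof.
move=> K0 d0 ab hM hg Dy y0.
set L := _ + 1; set c := _ * d.
have L1 : 1 <= L by rewrite lerDr mulr_ge0// addr_ge0.
have c0 : 0 <= c by rewrite mulr_ge0.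
pose E t := \sum_i sqn (y i t).
pose E' t := \sum_i 2 * cdot (y i t) (cfield M g y i t).
have -> : expR (L * (b - a)) * c = expR (L * (b - a)) * (E b + c).
  by rewrite /E big1 ?add0r// => i _; rewrite y0 sqn0.
apply: (@gronwall R E E') => //.
  by move=> t tab; apply: hasder_sum => i; apply: hasder_sqn; exact: Dy.
move=> t tab; rewrite -lerN2 opprD !opprK.
apply: le_trans (ler_norm _) _; rewrite normrN.
apply: le_trans (ler_norm_sum _ _ _) _.
have E0 : 0 <= E t by rewrite sumr_ge0// => i _; exact: sqn_ge0.
have step i : `|2 * cdot (y i t) (cfield M g y i t)| <=
    (#|I|%:R * K + 1) * sqn (y i t) + E t + d.
  have -> : 2 * cdot (y i t) (cfield M g y i t) =
      (\sum_j 2 * cdot (y i t) (M i j t * y j t)) + 2 * cdot (y i t) (g i t).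
    have -> : \sum_j 2 * cdot (y i t) (M i j t * y j t) =
        2 * (complex.Re (y i t) * \sum_j complex.Re (M i j t * y j t)
           + complex.Im (y i t) * \sum_j complex.Im (M i j t * y j t)).
      by rewrite !mulr_sumr -big_split /= mulr_sumr.
    by rewrite /cfield /cdot Re_add Im_add Re_sum Im_sum; ring.
  apply: le_trans (ler_normD _ _) _.
  have h2 : `|2 * cdot (y i t) (g i t)| <= sqn (y i t) + d.
    apply: le_trans (cdot_le _ _ ltr01) _.
    by rewrite mul1r invr1 mul1r lerD2l; exact: hg.
  suff h1 : `|\sum_j 2 * cdot (y i t) (M i j t * y j t)| <=
      #|I|%:R * K * sqn (y i t) + E t by lra.
  apply: le_trans (ler_norm_sum _ _ _) _.
  apply: (@le_trans _ _ (\sum_j (K * sqn (y i t) + sqn (y j t)))).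
    apply: ler_sum => j _.
    (* Moving the coefficient, conjugated, onto the other factor puts its bound K on |y_i|^2 and
       leaves |y_j|^2 bare. *)
    have -> : 2 * cdot (y i t) (M i j t * y j t) = 2 * cdot (y i t * (complex.Re (M i j t) -i* complex.Im (M i j t))) (y j t).
      by rewrite /cdot !ReImE /=; ring.
    apply: le_trans (cdot_le _ _ ltr01) _.
    rewrite mul1r invr1 mul1r lerD2r sqnM mulrC ler_wpM2r ?sqn_ge0//.
    by rewrite /sqn /= sqrrN; exact: hM.
  by rewrite big_split /= sumr_const -mulrA mulr_natl.
apply: (@le_trans _ _ (\sum_i ((#|I|%:R * K + 1) * sqn (y i t) + E t + d))).
  by apply: ler_sum => i _; exact: step.
have hs (x : R) : \sum_(i : I) x = #|I|%:R * x by rewrite sumr_const mulr_natl.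
rewrite !big_split /= !hs -mulr_sumr -/(E t) /L /c.
by rewrite le_eqVlt; apply/orP; left; apply/eqP; ring.
Qed.

End ComplexODE.

(** * Second-order expansions and the maximum principle on squares *)

Section Holomorphy.
Context {R : realType}.
Local Notation C := R[i].
Implicit Types (f g r : C -> C) (z h c : C).

Definition loc_bounded (b : C -> C) :=
  exists K d : R, [/\ 0 <= K, 0 < d & forall h, sqn h <= d -> sqn (b h) <= K].

(** A remainder of order |h|^3: in squared moduli the bound is the sixth power of |h|. *)
Definition O3 r :=
  exists K d : R, [/\ 0 <= K, 0 < d & forall h, sqn h <= d -> sqn (r h) <= K * sqn h ^+ 3].

(* Stands in for holomorphy: second-order expansions at every point are all
   that the maximum principle and the Hurwitz argument need. *)
Definition taylor2 g z := exists c0 c1 c2,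
  O3 (fun h => g (z + h) - (c0 + c1 * h + c2 * h ^+ 2)).

Lemma loc_bounded_cst c : loc_bounded (fun=> c).
Proof. by exists (sqn c), 1; split => //; exact: sqn_ge0. Qed.

Lemma loc_bounded_id : loc_bounded (fun h => h).
Proof. by exists 1, 1. Qed.

Lemma loc_boundedD b1 b2 : loc_bounded b1 -> loc_bounded b2 ->
  loc_bounded (fun h => b1 h + b2 h).
Proof.
move=> [K1 [d1 [K10 d10 h1]]] [K2 [d2 [K20 d20 h2]]].
exists (2 * (K1 + K2)), (Num.min d1 d2); split.
- by rewrite mulr_ge0// addr_ge0.
- by rewrite lt_min d10.
- move=> h; rewrite le_min => /andP[l1 l2]; apply: le_trans (sqnD_le _ _) _.
  by rewrite ler_pM2l// lerD// ?h1 ?h2.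
Qed.

Lemma loc_boundedM b1 b2 : loc_bounded b1 -> loc_bounded b2 ->
  loc_bounded (fun h => b1 h * b2 h).
Proof.
move=> [K1 [d1 [K10 d10 h1]]] [K2 [d2 [K20 d20 h2]]].
exists (K1 * K2), (Num.min d1 d2); split.
- by rewrite mulr_ge0.
- by rewrite lt_min d10.
- move=> h; rewrite le_min => /andP[l1 l2]; rewrite sqnM.
  by rewrite ler_pM ?sqn_ge0// ?h1 ?h2.
Qed.

Lemma loc_boundedX b n : loc_bounded b -> loc_bounded (fun h => b h ^+ n).
Proof.
move=> hb; elim: n => [|n IH]; first exact: (loc_bounded_cst 1).
by under eq_fun do rewrite exprS; exact: loc_boundedM.
Qed.

Lemma O3_loc_bounded r : O3 r -> loc_bounded r.
Proof.
move=> [K [d [K0 d0 hr]]]; exists (K * d ^+ 3), d; split => //.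
- by rewrite mulr_ge0// exprn_ge0// ltW.
- move=> h hd; apply: le_trans (hr _ hd) _; apply: ler_wpM2l => //.
  by apply: lerXn2r; rewrite ?nnegrE ?sqn_ge0// ltW.
Qed.

Lemma O3M b r : loc_bounded b -> O3 r -> O3 (fun h => b h * r h).
Proof.
move=> [K1 [d1 [K10 d10 h1]]] [K2 [d2 [K20 d20 h2]]].
exists (K1 * K2), (Num.min d1 d2); split.
- by rewrite mulr_ge0.
- by rewrite lt_min d10.
- move=> h; rewrite le_min => /andP[l1 l2]; rewrite sqnM -mulrA.
  by rewrite ler_pM ?sqn_ge0// ?h1 ?h2.
Qed.

Lemma O3D r1 r2 : O3 r1 -> O3 r2 -> O3 (fun h => r1 h + r2 h).
Proof.
move=> [K1 [d1 [K10 d10 h1]]] [K2 [d2 [K20 d20 h2]]].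
exists (2 * (K1 + K2)), (Num.min d1 d2); split.
- by rewrite mulr_ge0// addr_ge0.
- by rewrite lt_min d10.
- move=> h; rewrite le_min => /andP[l1 l2]; apply: le_trans (sqnD_le _ _) _.
  by rewrite -mulrA ler_pM2l// mulrDl lerD// ?h1 ?h2.
Qed.

Lemma O3_cube b : loc_bounded b -> O3 (fun h => h ^+ 3 * b h).
Proof.
move=> [K [d [K0 d0 hb]]]; exists K, d; split => // h hd.
by rewrite sqnM sqnX mulrC ler_wpM2r ?exprn_ge0 ?sqn_ge0// hb.
Qed.

Lemma O3_0 : O3 (fun=> 0).
Proof. by exists 0, 1; split => // h _; rewrite sqn0 mul0r. Qed.

Lemma eq_O3 r1 r2 : r1 =1 r2 -> O3 r1 -> O3 r2.
Proof. by move=> /funext ->. Qed.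

Lemma taylor2_cst c z : taylor2 (fun=> c) z.
Proof.
by exists c, 0, 0; apply: eq_O3 O3_0 => h; ring.
Qed.

Lemma taylor2_id z : taylor2 (fun x => x) z.
Proof. by exists z, 1, 0; apply: eq_O3 O3_0 => h; ring. Qed.

Lemma taylor2D f g z : taylor2 f z -> taylor2 g z -> taylor2 (fun x => f x + g x) z.
Proof.
move=> [a0 [a1 [a2 ha]]] [b0 [b1 [b2 hb]]].
exists (a0 + b0), (a1 + b1), (a2 + b2).
by apply: eq_O3 (O3D ha hb) => h; ring.
Qed.

Lemma quadratic_loc_bounded a b c : loc_bounded (fun h => a + b * h + c * h ^+ 2).
Proof.
apply: loc_boundedD; last first.
  by apply: loc_boundedM (loc_bounded_cst c) (loc_boundedX 2 loc_bounded_id).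
apply: loc_boundedD (loc_bounded_cst a) _.
exact: loc_boundedM (loc_bounded_cst b) loc_bounded_id.
Qed.

Lemma taylor2_loc_bounded f z : taylor2 f z -> loc_bounded (fun h => f (z + h)).
Proof.
move=> [a0 [a1 [a2 ha]]].
have := loc_boundedD (O3_loc_bounded ha) (quadratic_loc_bounded a0 a1 a2).
by under eq_fun do rewrite subrK.
Qed.

Lemma taylor2M f g z : taylor2 f z -> taylor2 g z -> taylor2 (fun x => f x * g x) z.
Proof.
move=> hf hg; have bg := taylor2_loc_bounded hg.
case: hf hg => [a0 [a1 [a2 ha]]] [b0 [b1 [b2 hb]]].
exists (a0 * b0), (a0 * b1 + a1 * b0), (a0 * b2 + a1 * b1 + a2 * b0).
have h1 := O3M bg ha; have h2 := O3M (quadratic_loc_bounded a0 a1 a2) hb.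
have h3 : O3 (fun h => h ^+ 3 * ((a1 * b2 + a2 * b1) + a2 * b2 * h)).
  apply: O3_cube; apply: loc_boundedD (loc_bounded_cst _) _.
  exact: loc_boundedM (loc_bounded_cst _) loc_bounded_id.
by apply: eq_O3 (O3D (O3D h1 h2) h3) => h; ring.
Qed.

Lemma taylor2X f n z : taylor2 f z -> taylor2 (fun x => f x ^+ n) z.
Proof.
move=> hf; elim: n => [|n IH]; first exact: (taylor2_cst 1).
by under eq_fun do rewrite exprS; exact: taylor2M.
Qed.

Lemma taylor2_prod (J : Type) (s : seq J) (P : pred J) (f : J -> C -> C) z :
  (forall j, P j -> taylor2 (f j) z) -> taylor2 (fun x => \prod_(j <- s | P j) f j x) z.
Proof.
move=> h; elim: s => [|j s IH].
  by under eq_fun do rewrite big_nil; exact: taylor2_cst.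
under eq_fun do rewrite big_cons.
by case Pj : (P j) => //; apply: taylor2M => //; exact: h.
Qed.

Lemma taylor2_lipschitz g z : taylor2 g z -> exists K d : R,
  [/\ 0 <= K, 0 < d & forall h, sqn h <= d -> sqn (g (z + h) - g z) <= K * sqn h].
Proof.
move=> [c0 [c1 [c2 [K [d [K0 d0 hK]]]]]].
have c0E : g z = c0.
  have := hK 0; rewrite sqn0 => /(_ (ltW d0)).
  rewrite expr0n mulr0 !(mulr0, addr0, expr0n) /= => h.
  by apply/eqP; rewrite -subr_eq0 -sqn_eq0 eq_le sqn_ge0 andbT.
have [K' [d' [K'0 d'0 hK']]] : loc_bounded (fun h => c1 + c2 * h).
  apply: loc_boundedD (loc_bounded_cst _) _.
  exact: loc_boundedM (loc_bounded_cst _) loc_bounded_id.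
exists (2 * (K + K')), (Num.min 1 (Num.min d d')); split.
- by rewrite mulr_ge0// addr_ge0.
- by rewrite !lt_min ltr01 d0.
- move=> h; rewrite !le_min => /and3P[l1 l2 l3].
  have -> : g (z + h) - g z =
      (g (z + h) - (c0 + c1 * h + c2 * h ^+ 2)) + (c1 + c2 * h) * h.
    by rewrite c0E; ring.
  apply: le_trans (sqnD_le _ _) _; rewrite -mulrA ler_pM2l// [leRHS]mulrDl.
  apply: lerD; last by rewrite sqnM ler_wpM2r ?sqn_ge0// hK'.
  apply: le_trans (hK _ l2) _; apply: ler_wpM2l => //.
  by rewrite exprS ler_piMr ?sqn_ge0// exprn_ile1 ?sqn_ge0.
Qed.

(** The coefficients are those of the inverse power series. The error is 1/g times a multiple of the
    error of g plus explicit cubic terms, and 1/g is bounded near z because |g|^2 stays above a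
    quarter of |g(z)|^2 there. *)
Lemma taylor2V g z : g z != 0 -> taylor2 g z -> taylor2 (fun x => (g x)^-1) z.
Proof.
move=> gz0 hg.
have s0 : 0 < sqn (g z) by rewrite sqn_gt0.
have [K [d [K0 d0 hK]]] := taylor2_lipschitz hg.
pose d1 := Num.min d (sqn (g z) / 4 / (K + 1)).
have Kp : 0 < K + 1 by lra.
have d10 : 0 < d1 by rewrite lt_min d0 /= !divr_gt0.
have low h : sqn h <= d1 -> sqn (g z) / 4 <= sqn (g (z + h)).
  rewrite le_min => /andP[l1]; rewrite ler_pdivlMr ?ltr_wpDl// => l2.
  have := hK _ l1; have := sqnB_le (g (z + h)) (g (z + h) - g z).
  have -> : g (z + h) - (g (z + h) - g z) = g z by ring.
  have := sqn_ge0 h; lra.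
have lV : loc_bounded (fun h => (g (z + h))^-1).
  exists (sqn (g z) / 4)^-1, d1; split => //.
    by rewrite invr_ge0 divr_ge0// ltW.
  move=> h hd; rewrite sqnV lef_pV2 ?low// ?posrE ?divr_gt0//.
  by apply: lt_le_trans (low _ hd); rewrite divr_gt0.
case: (hg) => c0 [c1 [c2 hO]].
have c0E : g z = c0.
  case: hO => K' [d' [_ d'0 hK']].
  have := hK' 0; rewrite sqn0 => /(_ (ltW d'0)).
  rewrite expr0n mulr0 !(mulr0, addr0, expr0n) /= => h.
  by apply/eqP; rewrite -subr_eq0 -sqn_eq0 eq_le sqn_ge0 andbT.
have c00 : c0 != 0 by rewrite -c0E.
pose e1 := - c1 / c0 ^+ 2; pose e2 := c1 ^+ 2 / c0 ^+ 3 - c2 / c0 ^+ 2.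
exists c0^-1, e1, e2.
have O := O3M (quadratic_loc_bounded (- c0^-1) (- e1) (- e2)) hO.
have O' : O3 (fun h => h ^+ 3 * ((- (c1 * e2 + c2 * e1)) + (- (c2 * e2)) * h)).
  apply: O3_cube; apply: loc_boundedD (loc_bounded_cst _) _.
  exact: loc_boundedM (loc_bounded_cst _) loc_bounded_id.
have [K1 [d2 [K10 d20 hO']]] := O3M lV (O3D O O').
exists K1, (Num.min d1 d2); split => //; first by rewrite lt_min d10.
move=> h; rewrite le_min => /andP[l1 l2].
apply: le_trans (hO' _ l2).
have gh : g (z + h) != 0.
  by rewrite -sqn_gt0; apply: lt_le_trans (low _ l1); rewrite divr_gt0.
suff <- : (g (z + h))^-1 - (c0^-1 + e1 * h + e2 * h ^+ 2) = (g (z + h))^-1 *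
  (((- c0^-1 + - e1 * h + - e2 * h ^+ 2) * (g (z + h) - (c0 + c1 * h + c2 * h ^+ 2))) +
   h ^+ 3 * (- (c1 * e2 + c2 * e1) + - (c2 * e2) * h)) by [].
by rewrite /e1 /e2; field; rewrite gh c00.
Qed.

(** Continuity phrased with [sqn], the form in which expansions supply it; [econt_continuous]
    converts it for the compactness arguments. *)
Definition econt (phi : C -> R) z := forall e : R, 0 < e -> exists2 d : R, 0 < d &
  forall h, sqn h <= d -> `|phi (z + h) - phi z| <= e.

Lemma sqn_econt g z (K d : R) : 0 <= K -> 0 < d ->
  (forall h, sqn h <= d -> sqn (g (z + h) - g z) <= K * sqn h) ->
  econt (fun x => sqn (g x)) z.
Proof.
move=> K0 d0 hK e e0.
pose s := e / 2 / (sqn (g z) + 1).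
have gz := sqn_ge0 (g z).
have s0 : 0 < s by rewrite !divr_gt0// ltr_wpDl.
have si : 0 < 1 + s^-1 by rewrite addr_gt0// invr_gt0.
pose d1 := e / 2 / (1 + s^-1) / (K + 1).
have d10 : 0 < d1 by rewrite !divr_gt0// ltr_wpDl.
exists (Num.min d d1); first by rewrite lt_min d0.
move=> h; rewrite le_min => /andP[l1 l2].
set w := g (z + h) - g z in hK *.
have -> : g (z + h) = g z + w by rewrite /w; ring.
have -> : sqn (g z + w) - sqn (g z) = 2 * cdot (g z) w + sqn w by rewrite sqnD; ring.
apply: le_trans (ler_normD _ _) _; rewrite (ger0_norm (sqn_ge0 w)).
have h1 := cdot_le (g z) w s0.
have h2 : s * sqn (g z) <= e / 2.
  rewrite /s -mulrA ler_piMr//; first by rewrite divr_ge0// ltW.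
  by rewrite mulrC ler_pdivrMr ?mul1r ?ltr_wpDl// lerDl.
have h3 : (1 + s^-1) * sqn w <= e / 2.
  rewrite -ler_pdivlMl//; apply: le_trans (hK _ l1) _.
  apply: (@le_trans _ _ ((K + 1) * d1)).
    by apply: ler_pM => //; [exact: sqn_ge0|rewrite lerDl].
  by rewrite /d1 mulrC divfK ?gt_eqF ?ltr_wpDl// mulrC.
lra.
Qed.

Lemma taylor2_econt g z : taylor2 g z -> econt (fun x => sqn (g x)) z.
Proof. by move=> /taylor2_lipschitz[K [d [K0 d0 h]]]; exact: sqn_econt h. Qed.

Lemma econt_continuous (phi : C -> R) (p : R * R) : econt phi (p.1 +i* p.2) ->
  {for p, continuous (fun q : R * R => phi (q.1 +i* q.2))}.
Proof.
move=> h; apply/(@cvgrPdist_le _ R) => e e0.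
have [d d0 hd] := h _ e0.
pose s := Num.min 1 (d / 2).
have s0 : 0 < s by rewrite lt_min ltr01 divr_gt0.
exists (ball p.1 s, ball p.2 s); first by split; exact: nbhsx_ballx.
move=> [x y] [/= h1 h2].
rewrite distrC (_ : x +i* y = (p.1 +i* p.2) + ((x - p.1) +i* (y - p.2))); last first.
  by apply: complex_eq => /=; ring.
apply: hd; rewrite /sqn /=.
have sq (u v : R) : ball u s v -> (v - u) ^+ 2 <= d / 2.
  rewrite /ball /= distrC => huv.
  apply: (@le_trans _ _ s); last by rewrite ge_min lexx orbT.
  rewrite -real_normK ?num_real// expr2.
  apply: (@le_trans _ _ (`|v - u| * 1)); last by rewrite mulr1 ltW.
  by rewrite ler_wpM2l// (le_trans (ltW huv))// ge_min lexx.
by have := sq _ _ h1; have := sq _ _ h2; lra.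
Qed.

(** Squares take the place of discs: a square and its boundary frame are built from products of
    segments, whose compactness is immediate. *)
Definition sup_dist z w : R := Num.max `|complex.Re z - complex.Re w| `|complex.Im z - complex.Im w|.

Lemma sup_dist_le_sqn z w (s : R) : sup_dist z w <= s -> sqn (z - w) <= 2 * s ^+ 2.
Proof.
rewrite /sup_dist ge_max => /andP[h1 h2]; rewrite /sqn !ReImE.
have s0 : 0 <= s by rewrite (le_trans _ h1).
have := lerXn2r 2 (normr_ge0 _) s0 h1; have := lerXn2r 2 (normr_ge0 _) s0 h2.
by rewrite !real_normK ?num_real//; lra.
Qed.

Lemma sup_dist_ge_sqn z w : sup_dist z w ^+ 2 <= sqn (z - w).
Proof.
rewrite /sup_dist /sqn !ReImE.
have h1 := sqr_ge0 (complex.Re z - complex.Re w); have h2 := sqr_ge0 (complex.Im z - complex.Im w).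
by case: (leP `|complex.Re z - complex.Re w| `|complex.Im z - complex.Im w|) => _;
  rewrite real_normK ?num_real//; lra.
Qed.

Lemma sup_dist_triangle u z w : sup_dist u w <= sup_dist u z + sup_dist z w.
Proof.
rewrite /sup_dist ge_max; apply/andP; split.
  rewrite (le_trans (ler_distD (complex.Re z) _ _))// lerD// le_max lexx//.
rewrite (le_trans (ler_distD (complex.Im z) _ _))// lerD// le_max lexx orbT//.
Qed.

Lemma sup_distC z w : sup_dist z w = sup_dist w z.
Proof. by rewrite /sup_dist; congr Num.max; exact: distrC. Qed.

Lemma square_max (phi : C -> R) z0 (s : R) : 0 <= s ->
  (forall z, sup_dist z z0 <= s -> econt phi z) ->
  exists2 z, sup_dist z z0 <= s & forall w, sup_dist w z0 <= s -> phi w <= phi z.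
Proof.
move=> s0 hphi.
pose A := `[complex.Re z0 - s, complex.Re z0 + s] `*` `[complex.Im z0 - s, complex.Im z0 + s] : set (R * R).
have inA x y : A (x, y) <-> sup_dist (x +i* y) z0 <= s.
  rewrite /A /sup_dist /= ge_max !ler_norml !in_itv /=.
  split=> [[/andP[a b] /andP[c d]]|/andP[/andP[a b] /andP[c d]]].
    by apply/andP; split; apply/andP; split; lra.
  by split; apply/andP; split; lra.
have cA : compact A by apply: compact_setX; exact: segment_compact.
have [|||[x y] hxy hmax] := @compact_EVT_max _ R (fun q : R * R => phi (q.1 +i* q.2)) A.
- by exists (complex.Re z0, complex.Im z0); rewrite inA /sup_dist /= !subrr normr0 maxxx.
- by [].
- apply: continuous_in_subspaceT => -[x y]; rewrite inE => /inA h.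
  by apply: econt_continuous; exact: hphi.
exists (x +i* y); first by apply/inA; move: hxy; rewrite inE.
move=> w hw; have := hmax (complex.Re w, complex.Im w).
by case: w hw => a b /= hw; apply; rewrite inE; apply/inA.
Qed.

Lemma frame_min (phi : C -> R) z0 (s : R) : 0 <= s ->
  (forall z, sup_dist z z0 = s -> econt phi z) ->
  exists2 z, sup_dist z z0 = s & forall w, sup_dist w z0 = s -> phi z <= phi w.
Proof.
move=> s0 hphi.
pose X := complex.Re z0; pose Y := complex.Im z0.
pose A := (`[X - s, X + s] `*` [set Y - s] `|` `[X - s, X + s] `*` [set Y + s])
  `|` ([set X - s] `*` `[Y - s, Y + s] `|` [set X + s] `*` `[Y - s, Y + s]) : set (R * R).
have inA x y : A (x, y) <-> sup_dist (x +i* y) z0 = s.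
  rewrite /A /sup_dist /= -/X -/Y !in_itv /=; split.
    have hs : `|s| = s by rewrite ger0_norm.
    case=> [[[/andP[a b] ->]|[/andP[a b] ->]]|[[-> /andP[a b]]|[-> /andP[a b]]]].
    - rewrite (_ : Y - s - Y = - s) ?normrN ?hs; last ring.
      by apply/max_idPr; rewrite ler_norml; apply/andP; split; lra.
    - rewrite (_ : Y + s - Y = s) ?hs; last ring.
      by apply/max_idPr; rewrite ler_norml; apply/andP; split; lra.
    - rewrite (_ : X - s - X = - s) ?normrN ?hs; last ring.
      by apply/max_idPl; rewrite ler_norml; apply/andP; split; lra.
    - rewrite (_ : X + s - X = s) ?hs; last ring.
      by apply/max_idPl; rewrite ler_norml; apply/andP; split; lra.
  case: (leP `|x - X| `|y - Y|) => h E.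
    left; have hx : X - s <= x <= X + s.
      by move: h; rewrite E ler_norml => /andP[? ?]; apply/andP; split; lra.
    have [h0|h0] := leP 0 (y - Y); [right|left]; split => //=.
      by move: E; rewrite ger0_norm//; lra.
    by move: E; rewrite ltr0_norm//; lra.
  right; have hy : Y - s <= y <= Y + s.
    by move: h; rewrite E ltr_norml => /andP[? ?]; apply/andP; split; lra.
  have [h0|h0] := leP 0 (x - X); [right|left]; split => //=.
    by move: E; rewrite ger0_norm//; lra.
  by move: E; rewrite ltr0_norm//; lra.
have cA : compact A.
  by apply: compactU; apply: compactU; apply: compact_setX;
    rewrite ?set_itv1; try exact: segment_compact; try exact: compact_set1.
have [|||[x y] hxy hmin] := @compact_EVT_min _ R (fun q : R * R => phi (q.1 +i* q.2)) A.
- exists (X - s, Y - s); left; left; split => //=; rewrite in_itv /=; apply/andP; split; lra.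
- by [].
- apply: continuous_in_subspaceT => -[x y]; rewrite inE => /inA h.
  by apply: econt_continuous; exact: hphi.
exists (x +i* y); first by apply/inA; move: hxy; rewrite inE.
move=> w hw; have := hmin (complex.Re w, complex.Im w).
by case: w hw => a b /= hw; apply; rewrite inE; apply/inA.
Qed.

Lemma parallelogram z w : sqn (z + w) + sqn (z - w) = 2 * (sqn z + sqn w).
Proof. by rewrite /sqn !ReImE; ring. Qed.

(* The sum of |g|^2 over the four points z + t, z - t, z + it, z - it exceeds
   4 |g z|^2 up to a third-order error, as in the mean value property. *)
Lemma four_point_sum g z : taylor2 g z -> exists K d : R, [/\ 0 <= K, 0 < d &
  forall t : R, 0 < t -> t <= d ->
    4 * sqn (g z) - K * t ^+ 3 <=
    sqn (g (z + t%:C)) + sqn (g (z - t%:C))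
    + sqn (g (z + 'i%C * t%:C)) + sqn (g (z - 'i%C * t%:C))].
Proof.
move=> hg.
case: (hg) => c0 [c1 [c2 [K [d [K0 d0 hK]]]]].
have c0E : g z = c0.
  have := hK 0; rewrite sqn0 => /(_ (ltW d0)).
  rewrite expr0n mulr0 !(mulr0, addr0, expr0n) /= => h.
  by apply/eqP; rewrite -subr_eq0 -sqn_eq0 eq_le sqn_ge0 andbT.
have [B [d' [B0 d'0 hB]]] := quadratic_loc_bounded c0 c1 c2.
pose e := Num.min 1 (Num.min d d').
have e0 : 0 < e by rewrite !lt_min ltr01 d0.
exists (4 * (B + K)), e; split => //; first by rewrite mulr_ge0// addr_ge0.
move=> t t0; rewrite /e !le_min => /and3P[t1 td td'].
have tt : t ^+ 2 <= t by rewrite expr2 ler_piMr// ltW.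
pose p h := c0 + c1 * h + c2 * h ^+ 2.
have low h : sqn h = t ^+ 2 -> sqn (p h) - (B + K) * t ^+ 3 <= sqn (g (z + h)).
  move=> ht; have ht1 : sqn h <= d by rewrite ht (le_trans tt).
  have ht2 : sqn h <= d' by rewrite ht (le_trans tt).
  have -> : g (z + h) = p h + (g (z + h) - p h) by ring.
  rewrite sqnD.
  have t30 : 0 < t ^+ 3 by rewrite exprn_gt0.
  have := cdot_le (p h) (g (z + h) - p h) t30.
  have h1 := hB _ ht2; have h2 := hK _ ht1; rewrite -/(p h) in h1 h2.
  have h3 : t ^+ 3 * sqn (p h) <= t ^+ 3 * B by rewrite ler_pM2l.
  have h4 : (t ^+ 3)^-1 * sqn (g (z + h) - p h) <= K * t ^+ 3.
    rewrite mulrC ler_pdivrMr//; apply: le_trans h2 _; rewrite ht.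
    by rewrite le_eqVlt; apply/orP; left; apply/eqP; ring.
  rewrite ler_norml => /andP[h5 _].
  by have := sqn_ge0 (g (z + h) - p h); lra.
have s1 : sqn t%:C = t ^+ 2 by rewrite sqn_real.
have si : sqn ('i%C * t%:C) = t ^+ 2.
  by rewrite sqnM s1 /sqn /= expr0n expr1n add0r mul1r.
have := low t%:C s1; have := low (- t%:C); rewrite sqnN => /(_ s1).
have := low ('i%C * t%:C) si; have := low (- ('i%C * t%:C)); rewrite sqnN => /(_ si).
have : sqn (p t%:C) + sqn (p (- t%:C)) + sqn (p ('i%C * t%:C)) + sqn (p (- ('i%C * t%:C)))
   = 4 * (sqn c0 + t ^+ 2 * sqn c1 + t ^+ 4 * sqn c2).
  have ii : 'i%C * 'i%C = -1 :> C by apply: complex_eq; rewrite /=; ring.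
  have p1 : p t%:C = (c0 + c2 * t%:C ^+ 2) + c1 * t%:C by rewrite /p; ring.
  have p2 : p (- t%:C) = (c0 + c2 * t%:C ^+ 2) - c1 * t%:C by rewrite /p; ring.
  have p3 : p ('i%C * t%:C) = (c0 - c2 * t%:C ^+ 2) + c1 * ('i%C * t%:C).
    by rewrite /p exprMn [_ ^+ 2]expr2 ii; ring.
  have p4 : p (- ('i%C * t%:C)) = (c0 - c2 * t%:C ^+ 2) - c1 * ('i%C * t%:C).
    by rewrite /p sqrrN exprMn [_ ^+ 2]expr2 ii; ring.
  rewrite p1 p2 p3 p4 parallelogram -addrA parallelogram.
  have sq : sqn (c2 * t%:C ^+ 2) = sqn c2 * (t ^+ 2) ^+ 2 by rewrite sqnM -s1 -sqnX.
  have E := parallelogram c0 (c2 * t%:C ^+ 2); rewrite sq in E.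
  by rewrite (sqnM c1 t%:C) (sqnM c1 ('i%C * t%:C)) s1 si; lra.
rewrite c0E.
have := mulr_ge0 (sqr_ge0 t) (sqn_ge0 c1).
have : 0 <= t ^+ 4 * sqn c2 by rewrite mulr_ge0 ?sqn_ge0 ?exprn_ge0 ?ltW.
lra.
Qed.

(** Adding k |z - z0|^2 makes |g|^2 strictly subharmonic, so that an interior maximum contradicts
    [four_point_sum]. At a zero of g the bound is trivial, which is why expansions are asked for
    only where g does not vanish; this lets the principle be applied to quotients at their removable
    singularities. *)
Theorem maximum_principle g z0 (s m : R) : 0 < s ->
  (forall z, sup_dist z z0 <= s -> econt (fun x => sqn (g x)) z) ->
  (forall z, sup_dist z z0 < s -> g z != 0 -> taylor2 g z) ->
  (forall z, sup_dist z z0 = s -> sqn (g z) <= m) ->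
  forall z, sup_dist z z0 <= s -> sqn (g z) <= m.
Proof.
move=> s0 cg hg hm z hz.
have m0 : 0 <= m.
  apply: le_trans (hm (z0 + s%:C) _); first exact: sqn_ge0.
  by rewrite /sup_dist !ReImE /= addr0 subrr normr0 addrAC subrr add0r gtr0_norm//; apply/max_idPl; exact: ltW.
apply/ler_addgt0Pl => e e0; rewrite addrC.
(* On the square |z - z0|^2 is at most 2 s^2, so the added term is at most e. *)
pose k := e / (2 * s ^+ 2).
have s20 : 0 < 2 * s ^+ 2 by rewrite mulr_gt0// exprn_gt0.
have k0 : 0 < k by rewrite divr_gt0.
pose phi x := sqn (g x) + k * sqn (x - z0).
have [|zm hzm hmax] := @square_max phi z0 s (ltW s0).
  move=> x hx e' e'0; have e2 : 0 < e' / 2 by rewrite divr_gt0.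
  have [d d0 hd] := cg x hx _ e2.
  have hT : taylor2 (fun x => x - z0) x.
    by apply: taylor2D; [exact: taylor2_id|exact: taylor2_cst].
  have [d' d'0 hd'] := taylor2_econt hT (divr_gt0 e2 k0).
  exists (Num.min d d'); first by rewrite lt_min d0.
  move=> h; rewrite le_min => /andP[l1 l2].
  have := hd _ l1; have := hd' _ l2; rewrite /phi ler_pdivlMr// mulrC => a b.
  rewrite opprD addrACA -mulrBr (le_trans (ler_normD _ _))//.
  by rewrite normrM (gtr0_norm k0); lra.
have far x : sup_dist x z0 <= s -> k * sqn (x - z0) <= e.
  by move=> /sup_dist_le_sqn h; rewrite /k mulrAC ler_pdivrMr// ler_pM2l.
suff h : phi zm <= m + e.
  apply: le_trans h; apply: le_trans (hmax _ hz).
  by rewrite lerDl mulr_ge0 ?sqn_ge0 ?ltW.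
have [E|ne] := eqVneq (sup_dist zm z0) s.
  by apply: lerD; [exact: hm|exact: far].
have zms : sup_dist zm z0 < s by rewrite lt_neqAle ne.
have [g0|g0] := eqVneq (g zm) 0.
  by rewrite /phi g0 sqn0 add0r (le_trans (far _ hzm))// lerDr.
have [K [d [K0 d0 hK]]] := four_point_sum (hg _ zms g0).
exfalso.
(* The three bounds keep t in the range of the expansion, keep the four points in the square, and
   make the error K t^3 at most k t^2, whereas the added term gains 4 k t^2 over the four points. *)
pose t := Num.min d (Num.min (s - sup_dist zm z0) (k / (K + 1))).
have t0 : 0 < t by rewrite !lt_min d0 subr_gt0 zms divr_gt0// ltr_wpDl.
have : t <= d by rewrite ge_min lexx.
have ts : t <= s - sup_dist zm z0 by rewrite !ge_min lexx !orbT.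
have tk : t <= k / (K + 1) by rewrite !ge_min lexx !orbT.
move=> /(hK t t0) h4.
have inQ h : sup_dist (zm + h) zm <= t -> phi (zm + h) <= phi zm.
  move=> hh; apply: hmax; apply: le_trans (sup_dist_triangle _ zm _) _; lra.
have nt : `|t| = t by rewrite gtr0_norm.
have := inQ t%:C; have := inQ (- t%:C); have := inQ ('i%C * t%:C); have := inQ (- ('i%C * t%:C)).
rewrite /sup_dist !ReImE /=.
have sub0 (a : R) : a + 0 - a = 0 by ring.
have subt (a b : R) : a + b - a = b by ring.
rewrite !(mul0r, mul1r, mulr0, subr0, oppr0, addr0, add0r) !subt !subrr normrN !normr0 !nt.
rewrite !ge_max lexx (ltW t0) /= => /(_ isT) i1 /(_ isT) i2 /(_ isT) i3 /(_ isT) i4.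
have P : sqn (zm + t%:C - z0) + sqn (zm - t%:C - z0) + sqn (zm + 'i%C * t%:C - z0)
   + sqn (zm - 'i%C * t%:C - z0) = 4 * sqn (zm - z0) + 4 * t ^+ 2.
  by rewrite /sqn !ReImE /=; ring.
have : k * (sqn (zm + t%:C - z0) + sqn (zm - t%:C - z0) + sqn (zm + 'i%C * t%:C - z0)
   + sqn (zm - 'i%C * t%:C - z0)) = k * (4 * sqn (zm - z0) + 4 * t ^+ 2) by rewrite P.
move: i1 i2 i3 i4; rewrite /phi => i1 i2 i3 i4 P'.
have kt : 0 < k * t ^+ 2 by rewrite mulr_gt0// exprn_gt0.
have : K * t ^+ 3 <= k * t ^+ 2.
  rewrite (_ : K * t ^+ 3 = K * t * t ^+ 2); last by ring.
  rewrite ler_pM2r ?exprn_gt0//.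
  move: tk; rewrite ler_pdivlMr ?ltr_wpDl// => /(le_trans _); apply.
  by rewrite mulrC ler_wpM2l ?lerDl// ltW.
clear -h4 i1 i2 i3 i4 P' kt; lra.
Qed.

End Holomorphy.

(** * Isolation and persistence of zeros *)

Section Hurwitz.
Context {R : realType}.
Local Notation C := R[i].
Implicit Types (f g : C -> C) (z : C).

Lemma taylor2_subr g c z : taylor2 g z -> taylor2 (fun x => g x - c) z.
Proof. by move=> h; apply: taylor2D h _; exact: taylor2_cst. Qed.

Lemma sqn_prod (J : Type) (s : seq J) (P : pred J) (F : J -> C) :
  sqn (\prod_(j <- s | P j) F j) = \prod_(j <- s | P j) sqn (F j).
Proof. by elim/big_ind2 : _ => [|x1 x2 y1 y2 <- <-|//]; rewrite ?sqn1 ?sqnM. Qed.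

(* Otherwise f would have infinitely many zeros z_k near z0; the maximum
   principle for f^2 / prod_(k < N) (z - z_k) then forces f to vanish. *)
Lemma zero_free_frame f z0 (rho : R) : 0 < rho ->
  (forall z, sup_dist z z0 <= rho -> taylor2 f z) ->
  (forall x : R, 0 < x -> x <= rho -> f (z0 + x%:C) != 0) ->
  exists s, [/\ 0 < s, s <= rho & forall z, sup_dist z z0 = s -> f z != 0].
Proof.
move=> rho0 hf fne; apply: contrapT => hno.
have /choice[Z hZ] : forall s : R, exists z, 0 < s -> s <= rho ->
    sup_dist z z0 = s /\ f z = 0.
  move=> s; have [s0|s0] := ltP 0 s; last by exists 0 => ? _; exfalso; lra.
  have [s1|s1] := leP s rho; last by exists 0 => _ ?; exfalso; lra.
  apply: contrapT => hz; apply: hno; exists s; split => // z zs.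
  by apply/eqP => fz; apply: hz; exists z.
(* The zeros lie within rho/8 of the centre and [zeta] at distance rho/8. On the outer frame |z -
   a_k|^2 >= 49/64 rho^2, at [zeta] it is at most rho^2/8; the ratio 8/49 is below 1/2, so each zero
   gains a factor 1/2. *)
pose r k : R := rho / 8 / k.+1%:R.
have r0 k : 0 < r k by rewrite !divr_gt0.
have r8 k : r k <= rho / 8.
  by rewrite /r ler_pdivrMr// ler_peMr ?ler1n//; lra.
have rr k : r k <= rho by rewrite (le_trans (r8 k)); lra.
pose a k := Z (r k).
have aD k : sup_dist (a k) z0 = r k by case: (hZ (r k) (r0 k) (rr k)).
have fa k : f (a k) = 0 by case: (hZ (r k) (r0 k) (rr k)).
have a_inj k j : k != j -> a k != a j.
  apply: contra_neqN => /eqP akj; have := aD k; rewrite akj aD /r.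
  have r80 : rho / 8 != 0 by rewrite gt_eqF// divr_gt0.
  by move=> /(mulfI r80) /invr_inj /eqP; rewrite eqr_nat eqSS => /eqP ->.
pose zeta := z0 + (rho / 8)%:C.
have fz : f zeta != 0 by apply: fne; lra.
have zetaD : sup_dist zeta z0 = rho / 8.
  rewrite /sup_dist !ReImE /= addr0 subrr normr0 addrAC subrr add0r gtr0_norm ?divr_gt0//.
  by apply/max_idPl; rewrite divr_ge0// ltW.
have [|zM _ hM] := @square_max R (fun x => sqn (f x)) z0 rho (ltW rho0).
  by move=> z hz; apply: taylor2_econt; exact: hf.
set M := sqn (f zM) in hM.
have M0 : 0 <= M by exact: sqn_ge0.
suff main N : sqn (f zeta) ^+ 2 <= M ^+ 2 * (1 / 2) ^+ N.
  have fz2 : 0 < sqn (f zeta) ^+ 2 by rewrite exprn_gt0// sqn_gt0.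
  have hc : (M ^+ 2 * (1 / 2) ^+ N : R) @[N --> \oo] --> 0.
    rewrite -[X in _ --> X](mulr0 (M ^+ 2)); apply: cvgMr; apply: cvg_expr.
    by rewrite ger0_norm; lra.
  move/cvgrPdist_lt : hc => /(_ _ fz2)[N _ /(_ N (leqnn N))].
  rewrite sub0r normrN ger0_norm ?mulr_ge0 ?exprn_ge0//.
  by rewrite ltNge main.
(* Squaring f spares the division of f by z - a_j: near a_j one factor f is used up by the
   denominator and the other still makes F small. The convention for the inverse of 0 gives F the
   value 0 at a_j, which is the correct limit. *)
pose F z := f z ^+ 2 * \prod_(k < N) (z - a k)^-1.
have q0 : 0 < 49 / 64 * rho ^+ 2 by rewrite mulr_gt0// exprn_gt0.
have T2F z : sup_dist z z0 <= rho -> (forall k : 'I_N, z != a k) -> taylor2 F z.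
  move=> hz hk; apply: taylor2M; first by apply: taylor2X; exact: hf.
  apply: taylor2_prod => k _; apply: taylor2V; first by rewrite subr_eq0.
  by apply: taylor2_subr; exact: taylor2_id.
have hF : sqn (F zeta) <= M ^+ 2 * ((49 / 64 * rho ^+ 2)^-1) ^+ N.
  apply: (@maximum_principle R F z0 rho) => //; last by rewrite zetaD; lra.
  - move=> z hz; have [hk|] := pselect (forall k : 'I_N, z != a k).
      by apply: taylor2_econt; exact: T2F.
    move=> /existsNP[j /negP]; rewrite negbK => /eqP zj.
    have [K1 [d1 [K10 d10 h1]]] := taylor2_lipschitz (hf _ hz).
    have T2G : taylor2 (fun x => f x * \prod_(k < N | k != j) (x - a k)^-1) z.
      apply: taylor2M; first exact: hf.
      apply: taylor2_prod => k kj; apply: taylor2V.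
        by rewrite subr_eq0 zj a_inj// eq_sym.
      by apply: taylor2_subr; exact: taylor2_id.
    have [K2 [d2 [K20 d20 h2]]] := taylor2_lipschitz T2G.
    apply: (@sqn_econt _ F z (K1 * K2) (Num.min d1 d2)).
    + by rewrite mulr_ge0.
    + by rewrite lt_min d10.
    move=> h; rewrite le_min => /andP[l1 l2].
    have fz0 : f z = 0 by rewrite zj fa.
    have Fz0 : F z = 0 by rewrite /F fz0 expr0n mul0r.
    have := h2 _ l2; have := h1 _ l1; rewrite fz0 mul0r Fz0 !subr0 => g1 g2.
    have [->|hn0] := eqVneq h 0; first by rewrite addr0 Fz0 sqn0 mulr0.
    have -> : F (z + h) = f (z + h) *
        (f (z + h) * \prod_(k < N | k != j) (z + h - a k)^-1) * h^-1.
      by rewrite /F (bigD1 j)//= {2}zj addrAC subrr add0r; ring.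
    rewrite sqnM sqnV ler_pdivrMr ?sqn_gt0//.
    apply: (@le_trans _ _ ((K1 * sqn h) * (K2 * sqn h))).
      by rewrite sqnM ler_pM ?sqn_ge0.
    by rewrite le_eqVlt; apply/orP; left; apply/eqP; ring.
  - move=> z hz; rewrite /F mulf_eq0 negb_or => /andP[_ /prodf_neq0 hp].
    apply: T2F => [|k]; first exact: ltW.
    by have := hp k isT; rewrite invr_eq0 subr_eq0.
  - move=> z hz; rewrite sqnM sqn_prod sqnX; apply: ler_pM.
    + by rewrite exprn_ge0 ?sqn_ge0.
    + by rewrite prodr_ge0// => k _; exact: sqn_ge0.
    + by apply: lerXn2r; rewrite ?nnegrE ?sqn_ge0//; apply: hM; rewrite hz.
    rewrite -[N in leRHS]card_ord -prodr_const; apply: ler_prod => k _.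
    rewrite sqn_ge0 sqnV lef_pV2 ?posrE//; last first.
      rewrite sqn_gt0 subr_eq0; apply/eqP => zk; move: hz; rewrite zk aD => /eqP.
      by rewrite lt_eqF// (le_lt_trans (r8 _))//; lra.
    apply: le_trans (sup_dist_ge_sqn _ _).
    have := sup_dist_triangle z (a k) z0; rewrite hz aD => h.
    have h' : 7 / 8 * rho <= sup_dist z (a k) by have := r8 k; lra.
    have -> : 49 / 64 * rho ^+ 2 = (7 / 8 * rho) ^+ 2 by field.
    have p0 : 0 <= 7 / 8 * rho by rewrite mulr_ge0// ltW.
    by apply: lerXn2r; rewrite ?nnegrE// (le_trans p0).
have zk (k : 'I_N) : 0 < sqn (zeta - a k).
  by rewrite sqn_gt0 subr_eq0; apply: contraNneq fz => ->; rewrite fa.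
have -> : sqn (f zeta) ^+ 2 = sqn (F zeta) * \prod_(k < N) sqn (zeta - a k).
  rewrite /F sqnM sqnX -mulrA sqn_prod -big_split /= big1 ?mulr1// => k _.
  by rewrite sqnV mulVf// gt_eqF.
apply: (@le_trans _ _ (M ^+ 2 * ((49 / 64 * rho ^+ 2)^-1) ^+ N * (rho ^+ 2 / 8) ^+ N)).
  apply: ler_pM => //; [exact: sqn_ge0|by rewrite prodr_ge0// => k _; exact: sqn_ge0|].
  rewrite -[N in leRHS]card_ord -prodr_const; apply: ler_prod => k _.
  rewrite sqn_ge0 /=.
  have := sup_dist_triangle zeta z0 (a k); rewrite zetaD (sup_distC z0) aD => h.
  have /sup_dist_le_sqn : sup_dist zeta (a k) <= rho / 4.
    by apply: (le_trans h); have := r8 k; lra.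
  by move=> /le_trans; apply; rewrite le_eqVlt; apply/orP; left; apply/eqP; field.
rewrite -mulrA -exprMn ler_wpM2l ?sqr_ge0//.
apply: lerXn2r; rewrite ?nnegrE ?divr_ge0//.
  by rewrite mulr_ge0 ?invr_ge0 ?divr_ge0 ?sqr_ge0// ltW.
have -> : (49 / 64 * rho ^+ 2)^-1 * (rho ^+ 2 / 8) = 8 / 49 by field; rewrite gt_eqF.
lra.
Qed.

(** If g had no zero, 1/g would obey the maximum principle inside a frame on which f does not
    vanish, although |g| is small at the centre. Non-vanishing on a segment to the right of z0 takes
    the place of f not being identically zero. *)
Theorem hurwitz f z0 (rho : R) : 0 < rho ->
  (forall z, sup_dist z z0 <= rho -> taylor2 f z) -> f z0 = 0 ->
  (forall x : R, 0 < x -> x <= rho -> f (z0 + x%:C) != 0) ->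
  exists2 e : R, 0 < e & forall g,
    (forall z, sup_dist z z0 <= rho -> taylor2 g z) ->
    (forall z, sup_dist z z0 <= rho -> sqn (g z - f z) <= e) ->
    exists2 z, sup_dist z z0 <= rho & g z = 0.
Proof.
move=> rho0 hf f0 fne.
have [s [s0 srho hs]] := zero_free_frame rho0 hf fne.
have [|zm zms hm] := @frame_min R (fun x => sqn (f x)) z0 s (ltW s0).
  by move=> z hz; apply: taylor2_econt; apply: hf; rewrite hz.
set m := sqn (f zm) in hm.
have m0 : 0 < m by rewrite sqn_gt0 hs.
(* On the frame |g|^2 >= m/2 - m/16 >= m/4, while |g(z0)|^2 <= m/16 because f vanishes at z0. *)
exists (m / 16); first by rewrite divr_gt0.
move=> g hg gf; apply: contrapT => hno.
have gne z : sup_dist z z0 <= rho -> g z != 0.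
  by move=> hz; apply/eqP => gz; apply: hno; exists z.
have zz : sup_dist z0 z0 = 0 by rewrite /sup_dist !subrr normr0 maxxx.
have h0 : sqn (g z0)^-1 <= 4 / m.
  apply: (@maximum_principle R (fun x => (g x)^-1) z0 s) => //; last by rewrite zz ltW.
  - move=> z hz; have hz' := le_trans hz srho.
    by apply: taylor2_econt; apply: taylor2V; [exact: gne|exact: hg].
  - move=> z /ltW hz _; have hz' := le_trans hz srho.
    by apply: taylor2V; [exact: gne|exact: hg].
  - move=> z hz; have hz' : sup_dist z z0 <= rho by rewrite hz.
    have gp : 0 < sqn (g z) by rewrite sqn_gt0 gne.
    have mp : 0 < (4 / m)^-1 by rewrite invr_gt0 divr_gt0.
    rewrite sqnV -[4 / m]invrK lef_pV2 ?posrE//.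
    rewrite invfM invrK.
    have := hm _ hz; have := gf _ hz'; have := sqnB_le (g z) (g z - f z).
    have -> : g z - (g z - f z) = f z by ring.
    lra.
have := gf z0; rewrite zz f0 subr0 => /(_ (ltW rho0)) h1.
move: h0; rewrite sqnV => h0.
have gz0 : 0 < sqn (g z0) by rewrite sqn_gt0 gne// zz ltW.
have : (sqn (g z0))^-1 * sqn (g z0) <= 4 / m * (m / 16).
  by apply: ler_pM => //; rewrite ?invr_ge0 ltW.
rewrite mulVf ?gt_eqF// (_ : 4 / m * (m / 16) = 1 / 4); first lra.
by field; rewrite gt_eqF.
Qed.

End Hurwitz.

(** * Expansion of solutions in a complex parameter *)

Section ParameterDependence.
Context {R : realType} {I : finType}.
Local Notation C := R[i].

Lemma family_bounded (J : finType) (f : J -> R -> C) a b : (forall j, ccontinuous (f j)) ->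
  exists2 K : R, 0 <= K & forall j t, a <= t <= b -> sqn (f j t) <= K.
Proof.
move=> cf; have /choice[K hK] j : exists K : R, 0 <= K /\ forall t, a <= t <= b -> sqn (f j t) <= K.
  by have [K K0 hK] := @ccontinuous_bounded R (f j) a b (cf j); exists K.
exists (\sum_j K j) => [|j t tab]; first by rewrite sumr_ge0// => j _; case: (hK j).
case: (hK j) => K0 /(_ t tab) /le_trans; apply.
by rewrite (bigD1 j)//= lerDl sumr_ge0// => i _; case: (hK i).
Qed.

Lemma sqn_sum_le (J : finType) (F : J -> C) (B : R) : 0 <= B ->
  (forall j, sqn (F j) <= B) -> sqn (\sum_j F j) <= 4 ^+ #|J| * B.
Proof.
move=> B0 hF; rewrite cardT -big_enum.
elim: (enum J) => [|j s IH]; first by rewrite big_nil sqn0 mulr_ge0.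
rewrite big_cons; apply: le_trans (sqnD_le _ _) _ => /=.
have : 1 <= (4 : R) ^+ size s by apply: exprn_ege1; lra.
move=> h1; have := hF j; rewrite exprS.
have : B <= 4 ^+ size s * B by rewrite ler_peMl.
lra.
Qed.

(** Subtracting the terminal value leaves a problem with zero data and source M y(b), to which
    [cfield_gronwall] applies. *)
Lemma cfield0_bounded (M : I -> I -> R -> C) (y : I -> R -> C) (K Y a b : R) :
  0 <= K -> 0 <= Y ->
  (forall i j t, a <= t <= b -> sqn (M i j t) <= K) ->
  (forall i t, a <= t <= b -> chasder (y i) t (\sum_j M i j t * y j t)) ->
  (forall i, sqn (y i b) <= Y) ->
  forall i t, a <= t <= b -> sqn (y i t) <=
    2 * (expR ((#|I|%:R * (K + 1) + 1) * (b - a)) * (#|I|%:R * (4 ^+ #|I| * (K * Y))) + Y).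
Proof.
move=> K0 Y0 hM Dy yb i t /andP[at_ tb].
pose g i s := \sum_j M i j s * y j b.
have sub s : t <= s <= b -> a <= s <= b.
  by move=> /andP[h1 h2]; rewrite h2 (le_trans at_).
have d0 : 0 <= 4 ^+ #|I| * (K * Y) by rewrite mulr_ge0 ?exprn_ge0 ?mulr_ge0.
have := @cfield_gronwall R I M g (fun i s => y i s - y i b) K (4 ^+ #|I| * (K * Y)) t b K0 d0 tb.
move=> /(_ (fun i j s hs => hM i j s (sub s hs))).
have hg i' s : t <= s <= b -> sqn (g i' s) <= 4 ^+ #|I| * (K * Y).
  move=> hs; apply: sqn_sum_le => [|j]; first by rewrite mulr_ge0.
  by rewrite sqnM ler_pM ?sqn_ge0 ?yb//; apply: hM; exact: sub.
move=> /(_ hg) G.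
have {}G : \sum_i sqn (y i t - y i b) <= expR ((#|I|%:R * (K + 1) + 1) * (b - a)) * (#|I|%:R * (4 ^+ #|I| * (K * Y))).
  apply: le_trans (G _ _) _.
  - move=> i' s hs; apply: chasder_eq; first exact: chasderB (Dy i' s (sub s hs)) (chasder_cst _ _).
    by rewrite subr0 /cfield /g -big_split /=; apply: eq_bigr => j _; ring.
  - by move=> i'; rewrite subrr.
  - rewrite ler_wpM2r ?mulr_ge0 ?exprn_ge0 ?mulr_ge0// ler_expR ler_wpM2l//; last lra.
    by rewrite addr_ge0// mulr_ge0// addr_ge0.
have -> : y i t = (y i t - y i b) + y i b by ring.
apply: le_trans (sqnD_le _ _) _; rewrite ler_pM2l// lerD//.
apply: le_trans G; rewrite (bigD1 i)//= lerDl sumr_ge0// => j _; exact: sqn_ge0.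
Qed.

(** The coefficients solve the systems obtained by expanding the equation in powers of h. The
    remainder solves the perturbed system with zero data and a source of order |h|^3, so the
    Gronwall bound turns into the cubic error. *)
Theorem ode_taylor2 (M : C -> I -> I -> R -> C) (N0 N1 N2 : I -> I -> R -> C)
    (y : C -> I -> R -> C) (y0 : I -> C) lam (a b K d : R) :
  a <= b -> 0 <= K -> 0 < d ->
  (forall i j, ccontinuous (N0 i j)) -> (forall i j, ccontinuous (N1 i j)) ->
  (forall i j, ccontinuous (N2 i j)) ->
  (forall h i j t, sqn h <= d -> a <= t <= b ->
     sqn (M (lam + h) i j t - (N0 i j t + N1 i j t * h + N2 i j t * h ^+ 2))
       <= K * sqn h ^+ 3) ->
  (forall h i t, sqn h <= d -> a <= t <= b ->
     chasder (y (lam + h) i) t (\sum_j M (lam + h) i j t * y (lam + h) j t)) ->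
  (forall h i, sqn h <= d -> y (lam + h) i b = y0 i) ->
  forall i, taylor2 (fun z => y z i a) lam.
Proof.
move=> ab K0 d0 c0 c1 c2 hM Dy yb i0.
have csum (N : I -> I -> R -> C) (x : I -> R -> C) i :
    (forall i j, ccontinuous (N i j)) -> (forall i, ccontinuous (x i)) ->
    ccontinuous (fun t => \sum_j N i j t * x j t).
  by move=> cN cx; apply: ccontinuous_sum => j; apply: ccontinuousM.
have [x0 [x0b Dx0]] := @complex_ode_solution R I N0 (fun _ _ => 0) y0 b c0
  (fun _ => ccontinuous_cst 0).
have cx0 i : ccontinuous (x0 i) by apply: chasder_continuous; exact: Dx0.
pose g1 i t := \sum_j N1 i j t * x0 j t.
have [||x1 [x1b Dx1]] := @complex_ode_solution R I N0 g1 (fun=> 0) b => //.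
  by move=> i; exact: csum.
have cx1 i : ccontinuous (x1 i) by apply: chasder_continuous; exact: Dx1.
pose g2 i t := \sum_j N1 i j t * x1 j t + \sum_j N2 i j t * x0 j t.
have [||x2 [x2b Dx2]] := @complex_ode_solution R I N0 g2 (fun=> 0) b => //.
  by move=> i; apply: ccontinuousD; exact: csum.
have cx2 i : ccontinuous (x2 i) by apply: chasder_continuous; exact: Dx2.
have bp (N : I -> I -> R -> C) : (forall i j, ccontinuous (N i j)) ->
    exists2 B : R, 0 <= B & forall i j t, a <= t <= b -> sqn (N i j t) <= B.
  move=> cN; have [|B B0 hB] := @family_bounded (I * I)%type (fun p => N p.1 p.2) a b.
    by move=> p; exact: cN.
  by exists B => // i j t; exact: (hB (i, j)).
have [B0 B00 hB0] := bp _ c0; have [B1 B10 hB1] := bp _ c1; have [B2 B20 hB2] := bp _ c2.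
have [X0 X00 hX0] := @family_bounded I x0 a b cx0.
have [X1 X10 hX1] := @family_bounded I x1 a b cx1.
have [X2 X20 hX2] := @family_bounded I x2 a b cx2.
pose e := Num.min 1 d.
have e0 : 0 < e by rewrite lt_min ltr01.
pose KM := 2 * (K + 2 * (2 * (B0 + B1) + B2)).
have s1 (h : C) : sqn h <= 1 -> sqn h ^+ 3 <= 1 /\ sqn (h ^+ 2) <= 1.
  by move=> h1; rewrite sqnX !exprn_ile1 ?sqn_ge0.
have small (u : C) (B : R) (h : C) : 0 <= B -> sqn u <= B -> sqn h <= 1 -> sqn (u * h) <= B.
  by move=> B' uB h1; rewrite sqnM -[leRHS]mulr1 ler_pM ?sqn_ge0.
have hKM h i j t : sqn h <= e -> a <= t <= b -> sqn (M (lam + h) i j t) <= KM.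
  rewrite le_min => /andP[h1 hd] tab; have [h3 h2] := s1 _ h1.
  have := hM h i j t hd tab.
  set P := N0 i j t + _ + _ => hMP.
  have -> : M (lam + h) i j t = (M (lam + h) i j t - P) + P by ring.
  apply: le_trans (sqnD_le _ _) _; rewrite ler_pM2l//; apply: lerD.
    by apply: (le_trans hMP); rewrite ler_piMr.
  apply: le_trans (sqnD_le _ _) _; rewrite ler_pM2l//; apply: lerD.
    apply: le_trans (sqnD_le _ _) _; rewrite ler_pM2l//; apply: lerD; first exact: hB0.
    by apply: small => //; exact: hB1.
  by apply: small => //; exact: hB2.
pose X := 2 * (2 * (X0 + X1) + X2).
have hX h j t : sqn h <= e -> a <= t <= b ->
    sqn (x0 j t + x1 j t * h + x2 j t * h ^+ 2) <= X.
  rewrite le_min => /andP[h1 hd] tab; have [h3 h2] := s1 _ h1.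
  apply: le_trans (sqnD_le _ _) _; rewrite ler_pM2l//; apply: lerD.
    apply: le_trans (sqnD_le _ _) _; rewrite ler_pM2l//; apply: lerD; first exact: hX0.
    by apply: small => //; exact: hX1.
  by apply: small => //; exact: hX2.
have X_0 : 0 <= X by rewrite /X; lra.
pose G := 2 * (K * X + 2 * (2 * (B1 * X2 + B2 * X1) + B2 * X2)).
have G0 : 0 <= G by rewrite /G; have := mulr_ge0 K0 X_0; have := mulr_ge0 B10 X20;
  have := mulr_ge0 B20 X10; have := mulr_ge0 B20 X20; lra.
pose r h i t := y (lam + h) i t - (x0 i t + x1 i t * h + x2 i t * h ^+ 2).
(* The first summand is the error of the matrix expansion, the second collects the products of order
   h^3 and h^4 that the truncation drops. *)
pose g h i t := \sum_j ((M (lam + h) i j t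
     - (N0 i j t + N1 i j t * h + N2 i j t * h ^+ 2))
     * (x0 j t + x1 j t * h + x2 j t * h ^+ 2)
   + h ^+ 3 * (N1 i j t * x2 j t + N2 i j t * x1 j t + N2 i j t * x2 j t * h)).
have Dr h i t : sqn h <= e -> a <= t <= b ->
    chasder (r h i) t (cfield (M (lam + h)) (g h) (r h) i t).
  rewrite le_min => /andP[h1 hd] tab; apply: chasder_eq.
    apply: chasderB; first exact: Dy.
    apply: chasderD; first apply: chasderD.
    - exact: Dx0.
    - by apply: chasderM (chasder_cst h t); exact: Dx1.
    - by apply: chasderM (chasder_cst (h ^+ 2) t); exact: Dx2.
  rewrite /cfield /g /g1 /g2 /r !mulr0 !addr0 !mulrDl !mulr_suml -!big_split /= -sumrB.
  by apply: eq_bigr => j _; ring.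
have hg h i t : sqn h <= e -> a <= t <= b ->
    sqn (g h i t) <= 4 ^+ #|I| * (G * sqn h ^+ 3).
  move=> he tab; move: (he); rewrite le_min => /andP[h1 hd].
  have [h3 h2] := s1 _ h1.
  have q0 : 0 <= sqn h ^+ 3 by rewrite exprn_ge0 ?sqn_ge0.
  apply: sqn_sum_le => [|j]; first by rewrite mulr_ge0.
  apply: le_trans (sqnD_le _ _) _; rewrite -[leRHS]mulrA ler_pM2l// [leRHS]mulrDl; apply: lerD.
    rewrite sqnM (_ : K * X * _ = K * sqn h ^+ 3 * X); last by ring.
    apply: ler_pM; rewrite ?sqn_ge0//.
      exact: hM.
    exact: hX.
  rewrite sqnM sqnX mulrC; apply: ler_wpM2r => //.
  apply: le_trans (sqnD_le _ _) _; rewrite ler_pM2l//; apply: lerD.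
    apply: le_trans (sqnD_le _ _) _; rewrite ler_pM2l//; apply: lerD;
      rewrite sqnM; apply: ler_pM; rewrite ?sqn_ge0 ?hB1 ?hB2 ?hX1 ?hX2//.
  apply: small => //; first by rewrite mulr_ge0.
  by rewrite sqnM; apply: ler_pM; rewrite ?sqn_ge0 ?hB1 ?hB2 ?hX1 ?hX2.
have KM0 : 0 <= KM by rewrite /KM; lra.
exists (x0 i0 a), (x1 i0 a), (x2 i0 a).
exists (expR ((#|I|%:R * (KM + 1) + 1) * (b - a)) * (#|I|%:R * (4 ^+ #|I| * G))), e.
split => //.
  by rewrite mulr_ge0 ?expR_ge0// mulr_ge0// mulr_ge0 ?exprn_ge0.
move=> h he; move: (he); rewrite le_min => /andP[h1 hd].
have := @cfield_gronwall R I (M (lam + h)) (g h) (r h) KM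
  (4 ^+ #|I| * (G * sqn h ^+ 3)) a b KM0.
have q0 : 0 <= 4 ^+ #|I| * (G * sqn h ^+ 3).
  by apply: mulr_ge0; [exact: exprn_ge0|rewrite mulr_ge0// exprn_ge0 ?sqn_ge0].
move=> /(_ q0 ab (fun i j t tab => hKM h i j t he tab) (fun i t tab => hg h i t he tab)).
move=> /(_ (fun i t tab => Dr h i t he tab)).
have rb i : r h i b = 0 by rewrite /r yb// x0b x1b x2b; ring.
move=> /(_ rb); rewrite (bigD1 i0)//= => h4.
apply: (@le_trans _ _ (sqn (r h i0 a))); first by [].
apply: (@le_trans _ _ (sqn (r h i0 a) + \sum_(i | i != i0) sqn (r h i a))).
  by rewrite lerDl sumr_ge0// => i _; exact: sqn_ge0.
by apply: (le_trans h4); rewrite -!mulrA.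
Qed.

End ParameterDependence.

(** * Energy estimate for the singularly perturbed system *)

Section SingularEnergy.
Context {R : realType}.
Local Notation C := R[i].

(* The fast variable e is damped backward in time at rate Re mu / (2 b); the
   weight 2 b in front of |e|^2 makes this damping absorb the coupling k e. *)
Lemma singular_energy (sig A T : R) : 0 < sig -> 0 <= A -> 0 <= T ->
  exists2 K : R, 0 <= K & forall (b al be : R) (u v e u' w e' mu S : R -> C) (k : R -> R),
  0 < b -> b <= 1 -> b * (1 + A) <= sig -> al <= be -> be - al <= T ->
  (forall t, al <= t <= be -> [/\ chasder u t (u' t),
     chasder v t ((k t)%:C * e t + w t), chasder e t (e' t) &
     (2 * b)%:C * e' t = mu t * e t - S t]) ->
  (forall t, al <= t <= be -> [/\ sqn (u' t) <= A * sqn (v t),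
     sqn (w t) <= A * sqn (u t), k t ^+ 2 <= A, sig <= complex.Re (mu t) &
     sqn (S t) <= b ^+ 2 * (A * (1 + sqn (u t) + sqn (v t) + sqn (e t)))]) ->
  u be = 0 -> v be = 0 -> e be = 0 ->
  sqn (u al) + sqn (v al) + 2 * b * sqn (e al) <= K * b.
Proof.
move=> sig0 A0 T0.
pose L := 2 + 3 * A + A / sig.
have As : 0 <= A / sig by rewrite divr_ge0// ltW.
have L1 : 1 <= L by rewrite /L; lra.
exists (expR (L * T) * A); first by rewrite mulr_ge0 ?expR_ge0.
move=> b al be u v e u' w e' mu S k b0 b1 bA ab abT HD HB ub vb eb.
pose E t := sqn (u t) + sqn (v t) + 2 * b * sqn (e t).
pose E' t := 2 * cdot (u t) (u' t) + 2 * cdot (v t) ((k t)%:C * e t + w t)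
  + 2 * b * (2 * cdot (e t) (e' t)).
have := @gronwall R E E' L (b * A) al be L1.
have bA0 : 0 <= b * A by rewrite mulr_ge0// ltW.
have Eb : E be = 0 by rewrite /E ub vb eb sqn0; ring.
move=> /(_ bA0 ab); rewrite Eb add0r => G.
apply: (@le_trans _ _ (expR (L * (be - al)) * (b * A))); last first.
  rewrite [b * A]mulrC mulrA ler_pM2r// ler_wpM2r// ler_expR ler_wpM2l//; lra.
apply: G => t tab; case: (HD _ tab) => h1 h2 h3 h4.
  apply: hasderD; last by apply: hasderZ; exact: hasder_sqn.
  by apply: hasderD; exact: hasder_sqn.
case: (HB _ tab) => i1 i2 i3 i4 i5.
have j1 := cdot_le (u t) (u' t) ltr01.
have j2 := cdot_le (v t) (w t) ltr01.
(* The damping supplies at least 2 sig |e|^2. With the weight 1/sig the coupling of v and e spends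
   sig |e|^2 of it; with the weight b the source spends b (1 + A) |e|^2, which is at most sig
   |e|^2. *)
have sigV : 0 < sig^-1 by rewrite invr_gt0.
have j3 := cdot_le ((k t)%:C * v t) (e t) sigV.
have j4 := cdot_le (e t) (S t) b0.
have k1 : 2 * cdot (v t) ((k t)%:C * e t + w t) =
    2 * cdot ((k t)%:C * v t) (e t) + 2 * cdot (v t) (w t).
  by rewrite /cdot !ReImE /=; ring.
have k2 : 2 * b * (2 * cdot (e t) (e' t)) =
    2 * complex.Re (mu t) * sqn (e t) - 2 * cdot (e t) (S t).
  have -> : 2 * b * (2 * cdot (e t) (e' t)) = 2 * cdot (e t) ((2 * b)%:C * e' t).
    by rewrite /cdot !ReImE /=; ring.
  by rewrite h4 /cdot /sqn !ReImE; ring.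
rewrite /E' k1 k2 /E.
move: j1 j2 j3 j4; rewrite !ler_norml invr1 !mul1r invrK sqnM sqn_real.
move=> /andP[j1 _] /andP[j2 _] /andP[j3 _] /andP[_ j4].
have eS : b^-1 * sqn (S t) <= b * (A * (1 + sqn (u t) + sqn (v t) + sqn (e t))).
  rewrite mulrC ler_pdivrMr//; apply: le_trans i5 _.
  by rewrite le_eqVlt; apply/orP; left; apply/eqP; ring.
have := sqn_ge0 (u t); have := sqn_ge0 (v t); have := sqn_ge0 (e t).
move: (sqn (u t)) (sqn (v t)) (sqn (e t)) i1 i2 i5 j1 j2 j3 j4 eS => U V W i1 i2 i5 j1 j2 j3 j4 eS W0 V0 U0.
have l1 : sig^-1 * (k t ^+ 2 * V) <= A / sig * V.
  by rewrite mulrA [A / sig]mulrC ler_wpM2r// ler_wpM2l ?invr_ge0// ltW.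
have l2 : b * (A * (1 + U + V + W)) <= b * A + A * U + A * V + b * A * W.
  rewrite (_ : b * (A * (1 + U + V + W)) = b * A + b * (A * U) + b * (A * V) + b * A * W); last by ring.
  rewrite !lerD2r.
  have bU : b * (A * U) <= A * U by rewrite ler_piMl// mulr_ge0.
  have bV : b * (A * V) <= A * V by rewrite ler_piMl// mulr_ge0.
  clear -bU bV; lra.
have l3 : (b + b * A) * W <= sig * W by rewrite ler_wpM2r// -[X in X + _]mulr1 -mulrDr.
have l4 : sig * W <= complex.Re (mu t) * W by rewrite ler_wpM2r.
have l5 : 0 <= L * (2 * b * W) by rewrite mulr_ge0 ?(le_trans ler01 L1)// !mulr_ge0// ltW.
have l6 : L * (U + V + 2 * b * W) = (2 + 3 * A + A / sig) * U + (2 + 3 * A + A / sig) * V + L * (2 * b * W).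
  by rewrite /L; ring.
have l7 : 0 <= A / sig * U by rewrite mulr_ge0.
have l8 := mulr_ge0 A0 U0; have l9 := mulr_ge0 A0 V0.
rewrite l6 -subr_ge0; clear -i1 i2 j1 j2 j3 j4 eS l1 l2 l3 l4 l5 l7 l8 l9 V0 U0 W0.
lra.
Qed.

End SingularEnergy.

(** * The Rayleigh equation in logarithmic radius *)

Section RayleighODE.
Context {R : realType}.
Local Notation C := R[i].
Context (n : nat) (th th1 th2 th3 : R -> R) (al be c2 : R).
Hypothesis n0 : (0 < n)%N.
Hypothesis albe : al <= be.
Hypothesis Dth : forall t, hasder th t (th1 t).
Hypothesis Dth1 : forall t, hasder th1 t (th2 t).
Hypothesis Dth2 : forall t, hasder th2 t (th3 t).
Hypothesis cth3 : continuous th3.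
Hypothesis p_right : forall t, be <= t -> th1 t + th2 t = 0.
Hypothesis p_left : forall t, t <= al -> th1 t + th2 t = 0.
Hypothesis th_left : forall t, t <= al -> th t = c2.

Local Notation nn := (n%:R : R).
Let p t := th1 t + th2 t.
Let p1 t := th2 t + th3 t.

(** Here [th] is the angular velocity of the background. On the mode n transport by the background
    is multiplication by i n theta, so this is lambda - L without its nonlocal part; its real part
    is Re lambda, which keeps it away from 0. *)
Definition ray_mu (lam : C) t : C := lam + 'i%C * (nn * th t)%:C.
(** The ratio of [q] to [psi] in the Rayleigh equation mu q = i n p psi, where 2 p = 2 (theta' +
    theta'') is the t-derivative of the background vorticity. *)
Definition ray_rho (lam : C) t : C := 'i%C * (nn * (th1 t + th2 t))%:C / ray_mu lam t.

Lemma Re_ray_mu lam t : complex.Re (ray_mu lam t) = complex.Re lam.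
Proof. by rewrite /ray_mu !ReImE /=; ring. Qed.

Lemma ray_mu_neq0 lam t : 0 < complex.Re lam -> ray_mu lam t != 0.
Proof.
by move=> h; apply: contraTneq h => h; rewrite -(Re_ray_mu lam t) h ltxx.
Qed.

Lemma chasder_ray_mu lam t : chasder (ray_mu lam) t ('i%C * (nn * th1 t)%:C).
Proof.
apply: chasder_eq; first apply: chasderD (chasder_cst _ _) _.
  by apply: chasderZ; apply: chasder_real; apply: hasderZ; exact: Dth.
by rewrite add0r.
Qed.

Definition ray_rho' lam t : C := 'i%C * (nn * (th2 t + th3 t))%:C / ray_mu lam t
  - 'i%C * (nn * (th1 t + th2 t))%:C * ('i%C * (nn * th1 t)%:C) / ray_mu lam t ^+ 2.

Lemma chasder_ray_rho lam t : 0 < complex.Re lam ->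
  chasder (ray_rho lam) t (ray_rho' lam t).
Proof.
move=> h; apply: chasder_eq.
  apply: chasderM.
    by apply: chasderZ; apply: chasder_real; apply: hasderZ; apply: hasderD; [exact: Dth1|exact: Dth2].
  apply: chasderV (chasder_ray_mu lam t); exact: ray_mu_neq0.
by rewrite /ray_rho' /=; ring.
Qed.

Lemma ray_rho_mu lam t : 0 < complex.Re lam ->
  ray_mu lam t * ray_rho lam t = 'i%C * (nn * (th1 t + th2 t))%:C.
Proof. by move=> h; rewrite /ray_rho mulrC divfK// ray_mu_neq0. Qed.

Lemma hasder_expn (x : R) t : hasder (fun s => expR (x * s)) t (x * expR (x * t)).
Proof.
apply: hasder_eq; first apply: hasder_exp; first by apply: hasderZ; exact: hasder_id.
by rewrite mulr1 mulrC.
Qed.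

Lemma expn_continuous (x : R) : continuous (fun s : R => expR (x * s)).
Proof. by apply: hasder_continuous => t; exact: hasder_expn. Qed.

(* With t = ln |X|^2 the stream function is psi(t) (x + iy)^n, and
   eta = e^(nt) psi'. The data at be are those of the decaying exterior
   solution |X|^(-2n) (x + iy)^n. *)
Definition is_rayleigh (lam : C) (psi eta : R -> C) := [/\
  psi be = (expR (- nn * be))%:C, eta be = - n%:R,
  forall t, chasder psi t ((expR (- nn * t))%:C * eta t) &
  forall t, chasder eta t ((expR (nn * t))%:C * ray_rho lam t * psi t)].

Definition ray_coef (lam : C) (i j : bool) t : C := match i, j with
  | false, true => (expR (- nn * t))%:C
  | true, false => (expR (nn * t))%:C * ray_rho lam t
  | _, _ => 0 end.

Lemma ray_coef_continuous lam i j : 0 < complex.Re lam ->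
  ccontinuous (ray_coef lam i j).
Proof.
move=> h; case: i j => -[] /=; last exact: (ccontinuous_cst 0).
- exact: (ccontinuous_cst 0).
- apply: ccontinuousM; first by apply: ccontinuous_real; exact: expn_continuous.
  by apply: chasder_continuous => t; exact: chasder_ray_rho.
- by apply: ccontinuous_real; exact: expn_continuous.
Qed.

Lemma ray_sumE lam (y : bool -> R -> C) i t :
  \sum_j ray_coef lam i j t * y j t = if i then (expR (nn * t))%:C * ray_rho lam t * y false t
    else (expR (- nn * t))%:C * y true t.
Proof. by rewrite big_bool; case: i => /=; rewrite ?mul0r ?add0r ?addr0. Qed.

(** Serves the adjoint problem, where the source carries the radial datum. *)
Lemma rayleigh_inhomogeneous lam (s : R -> C) : 0 < complex.Re lam -> ccontinuous s ->
  exists psi eta : R -> C, [/\ psi be = 0, eta be = 0,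
  forall t, chasder psi t ((expR (- nn * t))%:C * eta t) &
  forall t, chasder eta t ((expR (nn * t))%:C * ray_rho lam t * psi t + s t)].
Proof.
move=> h cs.
have [| |y [yb Dy]] := @complex_ode_solution R bool (ray_coef lam)
  (fun i t => if i then s t else 0) (fun=> 0) be.
- by move=> i j; exact: ray_coef_continuous.
- by case => //; exact: ccontinuous_cst.
exists (y false), (y true); split => // t.
  by have := Dy false t; rewrite /cfield ray_sumE addr0.
by have := Dy true t; rewrite /cfield ray_sumE.
Qed.

Lemma rayleigh_exists lam : 0 < complex.Re lam -> exists psi eta, is_rayleigh lam psi eta.
Proof.
move=> h.
have [| |y [yb Dy]] := @complex_ode_solution R bool (ray_coef lam) (fun _ _ => 0)
  (fun i => if i then - n%:R else (expR (- nn * be))%:C) be.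
- by move=> i j; exact: ray_coef_continuous.
- by move=> i; exact: ccontinuous_cst.
exists (y false), (y true); split; rewrite ?yb// => t.
  by have := Dy false t; rewrite /cfield ray_sumE addr0.
by have := Dy true t; rewrite /cfield ray_sumE addr0.
Qed.

Lemma rayleigh_der lam psi eta : is_rayleigh lam psi eta -> forall i t,
  chasder ((fun i => if i then eta else psi) i) t
    (\sum_j ray_coef lam i j t * (fun i => if i then eta else psi) j t).
Proof. by move=> [_ _ h1 h2] i t; rewrite (ray_sumE lam (fun i => if i then eta else psi)); case: i. Qed.

(** Makes the shooting value [eta al] a function of lambda alone, so that a solution may be chosen
    for each lambda. *)
Lemma rayleigh_uniq lam psi eta psi' eta' : 0 < complex.Re lam ->
  is_rayleigh lam psi eta -> is_rayleigh lam psi' eta' -> eta al = eta' al.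
Proof.
move=> h r1 r2.
pose y1 i := if i then eta else psi; pose y2 i := if i then eta' else psi'.
have cM (q : bool * bool) : ccontinuous (fun t => ray_coef lam q.1 q.2 t).
  exact: ray_coef_continuous.
have [K K0 hK] := @family_bounded R (bool * bool)%type _ al be cM.
have := @cfield_gronwall R bool (ray_coef lam) (fun _ _ => 0) (fun i t => y1 i t - y2 i t)
  K 0 al be K0 (lexx _) albe (fun i j t tab => hK (i, j) t tab).
have h0 : forall (i : bool) t, al <= t <= be -> sqn (0 : C) <= 0 by move=> *; rewrite sqn0.
move=> /(_ h0); rewrite !mulr0 => G.
suff : \sum_i sqn (y1 i al - y2 i al) <= 0.
  rewrite big_bool => h0'.
  have h1 : sqn (y1 true al - y2 true al) + sqn (y1 false al - y2 false al) <= 0 by exact: h0'.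
  have := sqn_ge0 (y1 false al - y2 false al); have := sqn_ge0 (y1 true al - y2 true al).
  move=> h2 h3; apply/eqP; rewrite -subr_eq0 -sqn_eq0 eq_le sqn_ge0 andbT.
  by change (sqn (y1 true al - y2 true al) <= 0); lra.
apply: G => [i t _|i]; last first.
  rewrite /y1 /y2; case: r1 => e1 e2 _ _; case: r2 => e3 e4 _ _.
  by case: i; rewrite ?e1 ?e2 ?e3 ?e4 subrr.
apply: chasder_eq; first exact: chasderB (rayleigh_der r1 i t) (rayleigh_der r2 i t).
by rewrite /cfield addr0 -sumrB; apply: eq_bigr => j _; rewrite mulrBr.
Qed.

Lemma ray_bounds : exists P : R, 1 <= P /\ forall t, al <= t <= be ->
  [/\ (nn * p t) ^+ 2 <= P, (nn * p1 t) ^+ 2 <= P, (nn * th1 t) ^+ 2 <= P,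
      expR (- nn * t) ^+ 2 <= P & expR (nn * t) ^+ 2 <= P].
Proof.
have c1 : continuous th1 by apply: hasder_continuous; exact: Dth1.
have c2' : continuous th2 by apply: hasder_continuous; exact: Dth2.
have cc (f : R -> R) : continuous f -> continuous (fun t => (nn * f t) ^+ 2).
  by move=> cf; apply: contX; apply: contM => //; exact: cont_cst.
have [K1 K10 h1] := @continuous_bounded R _ al be (cc _ (contD c1 c2')).
have [K2 K20 h2] := @continuous_bounded R _ al be (cc _ (contD c2' cth3)).
have [K3 K30 h3] := @continuous_bounded R _ al be (cc _ c1).
have [K4 K40 h4] := @continuous_bounded R _ al be (contX (n := 2) (@expn_continuous (- nn))).
have [K5 K50 h5] := @continuous_bounded R _ al be (contX (n := 2) (@expn_continuous nn)).
exists (1 + K1 + K2 + K3 + K4 + K5); split; first lra.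
move=> t tab; have := h1 _ tab; have := h2 _ tab; have := h3 _ tab.
have := h4 _ tab; have := h5 _ tab; rewrite /p /p1 => *; split; lra.
Qed.

Lemma sqn_ray_mu_ge lam t (sig : R) : 0 < sig -> sig <= complex.Re lam ->
  sqn (ray_mu lam t)^-1 <= (sig ^+ 2)^-1.
Proof.
move=> s0 hs; have h0 := lt_le_trans s0 hs.
rewrite sqnV lef_pV2 ?posrE ?exprn_gt0 ?sqn_gt0 ?ray_mu_neq0//.
apply: le_trans (Re_sqr_le _); rewrite Re_ray_mu; apply: lerXn2r => //; rewrite nnegrE ltW//.
Qed.

Lemma sqn_imag (x : R) : sqn ('i%C * x%:C) = x ^+ 2.
Proof. by rewrite /sqn !ReImE /=; ring. Qed.

Lemma ray_rho_bounds lam t (sig P : R) : 0 < sig -> sig <= complex.Re lam -> 0 <= P ->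
  (nn * p t) ^+ 2 <= P -> (nn * p1 t) ^+ 2 <= P -> (nn * th1 t) ^+ 2 <= P ->
  sqn (ray_rho lam t) <= P / sig ^+ 2 /\
  sqn (ray_rho' lam t) <= 2 * (P / sig ^+ 2 + P ^+ 2 / sig ^+ 2 / sig ^+ 2).
Proof.
move=> s0 hs P0 h1 h2 h3; have hm := sqn_ray_mu_ge t s0 hs; split.
  by rewrite sqnM sqn_imag; apply: ler_pM; rewrite ?sqr_ge0 ?sqn_ge0.
apply: le_trans (sqnB_le _ _) _; rewrite ler_pM2l//; apply: lerD.
  by rewrite sqnM sqn_imag; apply: ler_pM; rewrite ?sqr_ge0 ?sqn_ge0.
rewrite sqnM (sqnM ('i%C * _)) !sqn_imag sqnV sqnX.
rewrite sqnV in hm.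
have q0 : 0 <= (sqn (ray_mu lam t))^-1 by rewrite invr_ge0 sqn_ge0.
rewrite [sqn _ ^+ 2]expr2 invfM [P ^+ 2]expr2 -[leRHS]mulrA.
have ab : (nn * p t) ^+ 2 * (nn * th1 t) ^+ 2 <= P * P by rewrite ler_pM ?sqr_ge0.
have qq := ler_pM q0 q0 hm hm.
by apply: ler_pM ab qq; rewrite mulr_ge0 ?sqr_ge0.
Qed.

End RayleighODE.

(** * The self-similar system and the expansions of its shooting function *)

Section SelfSimilarODE.
Context {R : realType}.
Local Notation C := R[i].
Context (n : nat) (th th1 th2 th3 : R -> R) (al be c2 a : R).
Hypothesis n0 : (0 < n)%N.
Hypothesis albe : al <= be.
Hypothesis Dth : forall t, hasder th t (th1 t).
Hypothesis Dth1 : forall t, hasder th1 t (th2 t).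
Hypothesis Dth2 : forall t, hasder th2 t (th3 t).
Hypothesis cth3 : continuous th3.
Hypothesis p_right : forall t, be <= t -> th1 t + th2 t = 0.
Hypothesis p_left : forall t, t <= al -> th1 t + th2 t = 0.
Hypothesis th_left : forall t, t <= al -> th t = c2.

Local Notation nn := (n%:R : R).
Local Notation p t := (th1 t + th2 t).
Local Notation mu := (ray_mu n th).
Local Notation rho := (ray_rho n th th1 th2).
Local Notation rho' := (ray_rho' n th th1 th2 th3).
Local Notation rayleigh := (is_rayleigh n th th1 th2 be).
Let m : R := a + nn - 2.

(* The vorticity is 4 e^(-t) q(t) (x + iy)^n; q be = 0 makes it vanish for
   t >= be. *)
Definition is_selfsim (b : R) (lam : C) (psi eta q : R -> C) := [/\
  psi be = (expR (- nn * be))%:C, eta be = - n%:R, q be = 0 &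
  forall t, [/\ chasder psi t ((expR (- nn * t))%:C * eta t),
    chasder eta t ((expR (nn * t))%:C * q t) &
    chasder q t (((mu lam t - (b * m)%:C) * q t - 'i%C * (nn * p t)%:C * psi t) / (2 * b)%:C)]].

(* Vanishes iff the solution, continued to the left by an explicit power,
   has a stream function that is regular at the origin. *)
Definition selfsim_det (b : R) (lam : C) (eta q : C) : C :=
  (lam + 'i%C * (nn * c2)%:C + (b * (nn + 2 - a))%:C) * eta
  - (2 * b * expR (nn * al))%:C * q.

Definition ss_coef (b : R) (lam : C) (i j : 'I_3) t : C := match val i, val j with
  | 0%N, 1%N => (expR (- nn * t))%:C
  | 1%N, 2%N => (expR (nn * t))%:C
  | 2%N, 0%N => - ('i%C * (nn * p t)%:C) / (2 * b)%:C
  | 2%N, 2%N => (mu lam t - (b * m)%:C) / (2 * b)%:C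
  | _, _ => 0 end.

(** The system is affine in lambda, which enters only the last diagonal entry; [ode_taylor2] is
    therefore used with this first-order coefficient, no second-order one and zero error. *)
Definition ss_coef1 (b : R) (i j : 'I_3) (t : R) : C := match val i, val j with
  | 2%N, 2%N => 1 / (2 * b)%:C
  | _, _ => 0 end.

Definition triple (x0 x1 x2 : R -> C) (i : 'I_3) : R -> C :=
  match val i with 0%N => x0 | 1%N => x1 | _ => x2 end.

Lemma ss_sumE b lam (y : 'I_3 -> R -> C) i t :
  \sum_j ss_coef b lam i j t * y j t = match val i with
  | 0%N => (expR (- nn * t))%:C * y (@Ordinal 3 1 isT) t
  | 1%N => (expR (nn * t))%:C * y (@Ordinal 3 2 isT) t
  | _ => ((mu lam t - (b * m)%:C) * y (@Ordinal 3 2 isT) t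
     - 'i%C * (nn * p t)%:C * y (@Ordinal 3 0 isT) t) / (2 * b)%:C end.
Proof.
rewrite !big_ord_recl big_ord0.
have -> : ord0 = @Ordinal 3 0 isT by apply: val_inj.
have -> : lift (@Ordinal 3 0 isT) (ord0 : 'I_2) = @Ordinal 3 1 isT by apply: val_inj.
have -> : lift (@Ordinal 3 0 isT) (lift (ord0 : 'I_2) (ord0 : 'I_1)) = @Ordinal 3 2 isT by apply: val_inj.
case: i => -[|[|[|]]] //= hi; rewrite /ss_coef /=; ring.
Qed.

Lemma mu_continuous lam : ccontinuous (mu lam).
Proof. by apply: chasder_continuous => t; exact: chasder_ray_mu. Qed.

Lemma p_continuous : continuous (fun t => nn * p t).
Proof.
apply: contM; first exact: cont_cst.
by apply: contD; apply: hasder_continuous; [exact: Dth1|exact: Dth2].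
Qed.

Lemma ss_coef_continuous b lam i j : ccontinuous (ss_coef b lam i j).
Proof.
rewrite /ss_coef; case: i => -[|[|[|]]] //= _; case: j => -[|[|[|]]] //= _;
  try exact: (ccontinuous_cst 0); try (apply: ccontinuous_real; exact: expn_continuous).
- apply: ccontinuousM; last exact: ccontinuous_cst.
  have -> : (fun t => - ('i%C * (nn * p t)%:C)) = (fun t => (- 'i%C) * (nn * p t)%:C).
    by apply/funext => t; rewrite mulNr.
  apply: ccontinuousM; first exact: ccontinuous_cst.
  by apply: ccontinuous_real; exact: p_continuous.
- apply: ccontinuousM; last exact: ccontinuous_cst.
  by apply: ccontinuousD; [exact: mu_continuous|exact: ccontinuous_cst].
Qed.

Lemma selfsim_exists b lam : exists psi eta q, is_selfsim b lam psi eta q.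
Proof.
have [||y [yb Dy]] := @complex_ode_solution R 'I_3 (ss_coef b lam) (fun _ _ => 0)
  (fun i => match val i with 0%N => (expR (- nn * be))%:C | 1%N => - n%:R | _ => 0 end) be.
- by move=> i j; exact: ss_coef_continuous.
- by move=> i; exact: ccontinuous_cst.
exists (y (@Ordinal 3 0 isT)), (y (@Ordinal 3 1 isT)), (y (@Ordinal 3 2 isT)).
split; rewrite ?yb//= => t; split.
- by have := Dy (@Ordinal 3 0 isT) t; rewrite /cfield ss_sumE addr0.
- by have := Dy (@Ordinal 3 1 isT) t; rewrite /cfield ss_sumE addr0.
- by have := Dy (@Ordinal 3 2 isT) t; rewrite /cfield ss_sumE addr0.
Qed.

Lemma selfsim_taylor2 b (psi eta q : C -> R -> C) : 0 < b ->
  (forall lam, is_selfsim b lam (psi lam) (eta lam) (q lam)) ->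
  forall lam, taylor2 (fun z => selfsim_det b z (eta z al) (q z al)) lam.
Proof.
move=> b0 hs lam.
pose y z := triple (psi z) (eta z) (q z).
have T i : taylor2 (fun z => y z i al) lam.
  apply: (@ode_taylor2 R 'I_3 (ss_coef b) (ss_coef b lam) (ss_coef1 b) (fun _ _ _ => 0) y
    (fun i => match val i with 0%N => (expR (- nn * be))%:C | 1%N => - n%:R | _ => 0 end)
    lam al be 0 1) => //.
  - by move=> *; exact: ss_coef_continuous.
  - move=> i' j; rewrite /ss_coef1; case: i' => -[|[|[|]]] //= _; case: j => -[|[|[|]]] //= _;
    exact: ccontinuous_cst.
  - by move=> *; exact: (ccontinuous_cst 0).
  - move=> h i' j t _ _; rewrite [leRHS]mul0r.
    suff -> : ss_coef b (lam + h) i' j t -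
       (ss_coef b lam i' j t + ss_coef1 b i' j t * h + 0 * h ^+ 2) = 0 by rewrite sqn0.
    rewrite /ss_coef /ss_coef1; case: i' => -[|[|[|]]] //= _; case: j => -[|[|[|]]] //= _;
    rewrite /ray_mu; ring.
  - move=> h i' t _ _; rewrite ss_sumE /y; case: (hs (lam + h)) => _ _ _ /(_ t)[h1 h2 h3].
    by case: i' => -[|[|[|]]] //= _.
  - move=> h i' _; rewrite /y; case: (hs (lam + h)) => h1 h2 h3 _.
    by case: i' => -[|[|[|]]] //= _.
have T1 := T (@Ordinal 3 1 isT); have T2 := T (@Ordinal 3 2 isT).
rewrite /selfsim_det; apply: taylor2D.
  apply: taylor2M T1; apply: taylor2D; last exact: taylor2_cst.
  by apply: taylor2D; [exact: taylor2_id|exact: taylor2_cst].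
under eq_fun do rewrite -mulNr.
by apply: taylor2M T2; exact: taylor2_cst.
Qed.

(** Only [rho] depends on lambda, through 1/(mu + h) = 1/mu - h/mu^2 + h^2/mu^3 - h^3/(mu^3 (mu +
    h)). The last term is controlled on the disc |h| <= sig/2, where Re (lambda + h) stays above
    sig/2. *)
Lemma rayleigh_taylor2 (psi eta : C -> R -> C) :
  (forall lam, 0 < complex.Re lam -> rayleigh lam (psi lam) (eta lam)) ->
  forall lam, 0 < complex.Re lam -> taylor2 (fun z => eta z al) lam.
Proof.
move=> hs lam s0; set sig := complex.Re lam in s0.
pose y z (i : bool) := if i then eta z else psi z.
have [P [P1 hP]] := @ray_bounds R n th1 th2 th3 al be Dth1 Dth2 cth3.
have P0 : 0 <= P by lra.
pose d := sig ^+ 2 / 4.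
have d0 : 0 < d by rewrite divr_gt0// exprn_gt0.
have near h : sqn h <= d -> sig / 2 <= complex.Re (lam + h).
  move=> hd; rewrite ReImE -/sig.
  have := le_trans (Re_sqr_le h) hd; rewrite /d => h2.
  have : `|complex.Re h| <= sig / 2.
    rewrite -(ler_pXn2r (n := 2)) ?nnegrE ?divr_ge0 ?(ltW s0)// real_normK ?num_real//.
    by apply: (le_trans h2); rewrite le_eqVlt; apply/orP; left; apply/eqP; field.
  by rewrite ler_norml => /andP[]; lra.
have s20 : 0 < sig / 2 by lra.
have cinv (k : nat) : ccontinuous (fun t => (mu lam t)^-1 ^+ k).
  elim: k => [|k IH]; first exact: (ccontinuous_cst 1).
  under eq_fun do rewrite exprS; apply: ccontinuousM => //.
  apply: chasder_continuous => t; apply: chasderV; last exact: chasder_ray_mu.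
  exact: ray_mu_neq0.
pose e t : C := (expR (nn * t))%:C * ('i%C * (nn * p t)%:C).
have ce : ccontinuous e.
  apply: ccontinuousM; first by apply: ccontinuous_real; exact: expn_continuous.
  by apply: ccontinuousM; [exact: ccontinuous_cst|apply: ccontinuous_real; exact: p_continuous].
pose N k (c : C) (i j : bool) t : C := match i, j with
  | true, false => e t * (c * (mu lam t)^-1 ^+ k) | _, _ => 0 end.
have cN k c i j : ccontinuous (N k c i j).
  rewrite /N; case: i j => -[]; try exact: (ccontinuous_cst 0).
  by apply: ccontinuousM => //; apply: ccontinuousM => //; exact: ccontinuous_cst.
pose N0 i j t := ray_coef n th th1 th2 lam i j t.
pose V := ((sig / 2) ^+ 2)^-1.
have V0 : 0 <= V by rewrite invr_ge0 sqr_ge0.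
apply: (@ode_taylor2 R bool (ray_coef n th th1 th2) N0 (N 2%N (-1)) (N 3%N 1) y
  (fun i => if i then - n%:R else (expR (- nn * be))%:C) lam al be (P * P * (V ^+ 4)) d _ _ _ _ _ _ _ _ _ true) => //.
- by rewrite !mulr_ge0// exprn_ge0.
- by move=> i j; exact: ray_coef_continuous.
- move=> h i j t hd tab.
  have mh : mu (lam + h) t = mu lam t + h by rewrite /ray_mu; ring.
  have m0 : mu lam t != 0 by exact: ray_mu_neq0.
  have mh0 : mu lam t + h != 0.
    by rewrite -mh; apply: ray_mu_neq0; apply: lt_le_trans s20 _; exact: near.
  have q0 : 0 <= P * P * V ^+ 4 * sqn h ^+ 3.
    by rewrite !mulr_ge0 ?exprn_ge0 ?sqn_ge0.
  rewrite /N0 /N /ray_coef; case: i j => -[]; rewrite ?mul0r ?addr0 ?subrr ?sqn0//.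
  have -> : (expR (nn * t))%:C * rho (lam + h) t -
     ((expR (nn * t))%:C * rho lam t + e t * (-1 * (mu lam t)^-1 ^+ 2) * h +
      e t * (1 * (mu lam t)^-1 ^+ 3) * h ^+ 2) =
     - e t * ((mu lam t)^-1 ^+ 3 * (mu (lam + h) t)^-1) * h ^+ 3.
    rewrite /ray_rho /e mh; move: (mu lam t) m0 mh0 => M m0 mh0.
    by field; rewrite m0 mh0.
  case: (hP _ tab) => b1 b2 b3 b4 b5.
  rewrite sqnM sqnX; apply: ler_wpM2r; first by rewrite exprn_ge0 ?sqn_ge0.
  rewrite sqnM; apply: ler_pM; rewrite ?sqn_ge0//.
    by rewrite sqnN sqnM sqn_imag sqn_real; apply: ler_pM; rewrite ?sqr_ge0.
  rewrite sqnM sqnX [V ^+ 4]exprSr; apply: ler_pM; rewrite ?exprn_ge0 ?sqn_ge0//.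
    apply: lerXn2r; rewrite ?nnegrE ?sqn_ge0//.
    by apply: sqn_ray_mu_ge => //; rewrite -/sig; lra.
  by apply: sqn_ray_mu_ge => //; exact: near.
- move=> h i t hd tab; have [|h1 h2 h3 h4] := hs (lam + h); first by apply: lt_le_trans s20 _; exact: near.
  by rewrite ray_sumE /y; case: i.
- move=> h i hd; have [|h1 h2 h3 h4] := hs (lam + h); first by apply: lt_le_trans s20 _; exact: near.
  by rewrite /y; case: i.
Qed.

End SelfSimilarODE.
Lemma sqnD3_le {R : realType} (x y z : R[i]) :
  sqn (x + y + z) <= 4 * (sqn x + sqn y + sqn z).
Proof.
apply: le_trans (sqnD_le _ _) _; have := sqnD_le x y; have := sqn_ge0 z; lra.
Qed.

(** * Persistence of the eigenvalue for small b *)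

Section SpectralPersistence.
Context {R : realType}.
Local Notation C := R[i].
Context (n : nat) (th th1 th2 th3 : R -> R) (al be c2 a : R).
Hypothesis n0 : (0 < n)%N.
Hypothesis albe : al <= be.
Hypothesis Dth : forall t, hasder th t (th1 t).
Hypothesis Dth1 : forall t, hasder th1 t (th2 t).
Hypothesis Dth2 : forall t, hasder th2 t (th3 t).
Hypothesis cth3 : continuous th3.
Hypothesis p_right : forall t, be <= t -> th1 t + th2 t = 0.
Hypothesis p_left : forall t, t <= al -> th1 t + th2 t = 0.

Local Notation nn := (n%:R : R).
Local Notation p t := (th1 t + th2 t).
Local Notation mu := (ray_mu n th).
Local Notation rho := (ray_rho n th th1 th2).
Local Notation rho' := (ray_rho' n th th1 th2 th3).
Local Notation rayleigh := (is_rayleigh n th th1 th2 be).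
Local Notation selfsim := (is_selfsim n th th1 th2 be a).
Local Notation m := (a + nn - 2).

Lemma rayleigh_bounded (sig : R) : 0 < sig -> exists2 Y : R, 0 <= Y &
  forall lam psi eta, sig <= complex.Re lam -> rayleigh lam psi eta ->
  forall t, al <= t <= be -> sqn (psi t) <= Y /\ sqn (eta t) <= Y.
Proof.
move=> s0.
have [P [P1 hP]] := @ray_bounds R n th1 th2 th3 al be Dth1 Dth2 cth3.
have P0 : 0 <= P by lra.
have s20 : 0 <= (sig ^+ 2)^-1 by rewrite invr_ge0 sqr_ge0.
have Ps : 0 <= P / sig ^+ 2 by rewrite mulr_ge0.
pose K := P + P * (P / sig ^+ 2).
have K0 : 0 <= K by rewrite addr_ge0// mulr_ge0.
pose Y0 := P + nn ^+ 2.
have Y00 : 0 <= Y0 by rewrite addr_ge0 ?sqr_ge0.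
exists (2 * (expR ((#|bool : finType|%:R * (K + 1) + 1) * (be - al)) * (#|bool : finType|%:R * (4 ^+ #|bool : finType| * (K * Y0))) + Y0)).
  by rewrite mulr_ge0// addr_ge0// mulr_ge0 ?expR_ge0// !mulr_ge0 ?exprn_ge0.
move=> lam psi eta hs r t tab.
have h0 := lt_le_trans s0 hs.
have := @cfield0_bounded R bool (ray_coef n th th1 th2 lam) (fun i => if i then eta else psi)
  K Y0 al be K0 Y00.
have hM : forall i j t, al <= t <= be -> sqn (ray_coef n th th1 th2 lam i j t) <= K.
  move=> i j s sab; case: (hP _ sab) => b1 b2 b3 b4 b5.
  have [r1 _] := @ray_rho_bounds R n th th1 th2 th3 lam s sig P s0 hs P0 b1 b2 b3.
  have PP : 0 <= P * (P / sig ^+ 2) by rewrite mulr_ge0.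
  rewrite /ray_coef; case: i j => -[]; rewrite ?sqn0//.
    rewrite sqnM sqn_real; apply: (@le_trans _ _ (P * (P / sig ^+ 2))); last by rewrite lerDr.
    by rewrite ler_pM ?sqr_ge0 ?sqn_ge0.
  by rewrite sqn_real (le_trans b4)// lerDl.
move=> /(_ hM (fun i t _ => rayleigh_der r i t)).
have hb : forall i : bool, sqn ((if i then eta else psi) be) <= Y0.
  case: r => e1 e2 _ _; case; rewrite ?e1 ?e2 ?sqnN.
    by rewrite /sqn Re_nat Im_nat expr0n addr0 lerDr.
  rewrite sqn_real; have [|_ _ _ h4 _] := hP be; first by rewrite lexx albe.
  by rewrite (le_trans h4)// lerDl sqr_ge0.
by move=> /(_ hb) G; split; [exact: (G false t tab)|exact: (G true t tab)].
Qed.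

Lemma source_bound (M k1 k2 Y U V W : R) : 0 <= M -> 0 <= k1 -> 0 <= k2 ->
  0 <= Y -> 0 <= U -> 0 <= V -> 0 <= W ->
  4 * (M * W + k1 * (2 * (U + Y)) + k2 * (2 * (V + Y))) <=
  4 * (M + 2 * k1 * (1 + Y) + 2 * k2 * (1 + Y)) * (1 + U + V + W).
Proof.
move=> M0 k10 k20 Y0 U0 V0 W0; rewrite -mulrA ler_pM2l//.
have Z0 : 0 <= U + V + W by rewrite !addr_ge0.
have x1 : M * W <= M * (1 + U + V + W) by apply: ler_wpM2l => //; lra.
have x U' : 0 <= U' -> U' <= U + V + W -> U' + Y <= (1 + Y) * (1 + U + V + W).
  by move=> h1 h2; have := mulr_ge0 Y0 Z0; lra.
have x2 := ler_wpM2l k10 (x U U0 _); have x3 := ler_wpM2l k20 (x V V0 _).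
have {}x2 := x2 ltac:(lra); have {}x3 := x3 ltac:(lra).
lra.
Qed.

(** The comparison uses u, v and e = q - rho psi, the distance of the vorticity from its Rayleigh
    value. All three vanish at [be], where rho = 0, and e is driven by a source of size b. The
    energy estimate makes u and v of order sqrt(b) and e merely bounded, which is enough because
    [selfsim_det] multiplies q by b. *)
Lemma selfsim_limit (sig Lam : R) : 0 < sig -> 0 <= Lam -> exists K b1 : R,
  [/\ 0 <= K, 0 < b1, b1 <= 1 & forall (b : R) (lam : C) psi eta psi' eta' q',
    0 < b -> b <= b1 -> sig <= complex.Re lam -> sqn lam <= Lam ->
    rayleigh lam psi eta -> selfsim b lam psi' eta' q' ->
    sqn (selfsim_det n al c2 a b lam (eta' al) (q' al)
         - (lam + 'i%C * (nn * c2)%:C) * eta al) <= K * b].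
Proof.
move=> s0 Lam0.
have [P [P1 hP]] := @ray_bounds R n th1 th2 th3 al be Dth1 Dth2 cth3.
have P0 : 0 <= P by lra.
have [Y Y0 hY] := rayleigh_bounded s0.
have s20 : 0 <= (sig ^+ 2)^-1 by rewrite invr_ge0 sqr_ge0.
pose s := P / sig ^+ 2; have Ps : 0 <= s by rewrite mulr_ge0.
pose s' := 2 * (P / sig ^+ 2 + P ^+ 2 / sig ^+ 2 / sig ^+ 2).
have Ps' : 0 <= s' by rewrite mulr_ge0// addr_ge0// !mulr_ge0// exprn_ge0.
have m20 := sqr_ge0 m.
pose k1 := 2 * (m ^+ 2 * s + 4 * s').
have k10 : 0 <= k1 by rewrite mulr_ge0// addr_ge0// mulr_ge0.
pose k2 := 4 * (s * P); have k20 : 0 <= k2 by rewrite !mulr_ge0.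
(* One constant for all the bounds that [singular_energy] asks for: P for the exponentials, P s for
   the coupling [w], the rest for the source. *)
pose A := P + P * s + 4 * (m ^+ 2 + 2 * k1 * (1 + Y) + 2 * k2 * (1 + Y)).
have kY1 : 0 <= k1 * (1 + Y) by rewrite mulr_ge0// addr_ge0.
have kY2 : 0 <= k2 * (1 + Y) by rewrite mulr_ge0// addr_ge0.
have PPs : 0 <= P * s by rewrite mulr_ge0.
have Q0 : 0 <= 4 * (m ^+ 2 + 2 * k1 * (1 + Y) + 2 * k2 * (1 + Y)).
  by rewrite mulr_ge0//; apply: addr_ge0; [apply: addr_ge0 => //|]; rewrite -mulrA mulr_ge0.
have A0 : 0 <= A by rewrite !addr_ge0.
have PA : P <= A by rewrite /A -addrA lerDl addr_ge0.
have PsA : P * s <= A by rewrite /A [P + _]addrC -addrA lerDl addr_ge0.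
have T0 : 0 <= be - al by rewrite subr_ge0.
have [K K0 hK] := @singular_energy R sig A (be - al) s0 A0 T0.
pose b1 := Num.min 1 (sig / (1 + A)).
have A1 : 0 < 1 + A by rewrite ltr_wpDr.
have b10 : 0 < b1 by rewrite lt_min ltr01 divr_gt0.
pose L1 := 2 * (Lam + (nn * c2) ^+ 2).
have L10 : 0 <= L1 by rewrite mulr_ge0// addr_ge0// sqr_ge0.
pose N := (nn + 2 - a) ^+ 2; have N0 : 0 <= N by exact: sqr_ge0.
exists (4 * (L1 * K) + 8 * (N * (K + Y)) + 16 * (P * K)), b1; split => //.
- by apply: addr_ge0; [apply: addr_ge0|]; apply: mulr_ge0 => //; apply: mulr_ge0 => //; exact: addr_ge0.
- by rewrite ge_min lexx.
move=> b lam psi eta psi' eta' q' b0 bb1 hs hLam r ss.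
have b11 : b <= 1 by rewrite (le_trans bb1)// ge_min lexx.
have bA : b * (1 + A) <= sig.
  by rewrite -ler_pdivlMr// (le_trans bb1)// ge_min lexx orbT.
have h0 := lt_le_trans s0 hs.
case: (r) => r1 r2 Dpsi Deta; case: (ss) => e1 e2 e3 Dss.
pose u t := psi' t - psi t; pose v t := eta' t - eta t.
pose e t := q' t - rho lam t * psi' t.
pose u' t := (expR (- nn * t))%:C * v t.
pose w t := (expR (nn * t))%:C * rho lam t * u t.
pose e' t := ((mu lam t - (b * m)%:C) * q' t - 'i%C * (nn * p t)%:C * psi' t) / (2 * b)%:C
   - (rho' lam t * psi' t + rho lam t * ((expR (- nn * t))%:C * eta' t)).
(* The terms of size b in 2 b e': the shift b m q, rewritten through q = e + rho psi, and 2 b times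
   the derivative of rho psi. *)
pose S1 t := m%:C * e t + (m%:C * rho lam t + 2 * rho' lam t) * psi' t
   + 2 * rho lam t * (expR (- nn * t))%:C * eta' t.
pose S t := b%:C * S1 t.
have ube : u be = 0 by rewrite /u e1 r1 subrr.
have vbe : v be = 0 by rewrite /v e2 r2 subrr.
have ebe : e be = 0 by rewrite /e e3 /ray_rho p_right// !(mulr0, mul0r) subrr.
have b2 : (2 * b)%:C != 0 :> C by rewrite -sqn_eq0 sqn_real sqrf_eq0 mulf_neq0 ?gt_eqF.
have := hK b al be u v e u' w e' (mu lam) S (fun t => expR (nn * t)) b0 b11 bA albe (lexx _).
have HD t : al <= t <= be -> [/\ chasder u t (u' t),
     chasder v t ((expR (nn * t))%:C * e t + w t), chasder e t (e' t) &
     (2 * b)%:C * e' t = mu lam t * e t - S t].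
  move=> tab; case: (Dss t) => d1 d2 d3; split.
  - apply: chasder_eq; first exact: chasderB d1 (Dpsi t).
    by rewrite /u' /v; ring.
  - apply: chasder_eq; first exact: chasderB d2 (Deta t).
    by rewrite /e /w /u; ring.
  - by apply: chasderB d3 _; apply: chasderM d1; exact: chasder_ray_rho.
  - rewrite /e' mulrBr [_ * (_ / _)]mulrC divfK//.
    rewrite -(@ray_rho_mu R n th th1 th2 lam t h0) /S /S1 /e !rmorphM /=.
    have -> : 2%:C = 2 :> C by rewrite (rmorph_nat (real_complex R) 2).
    ring.
move=> /(_ HD) {}HD.
have HB t : al <= t <= be -> [/\ sqn (u' t) <= A * sqn (v t),
     sqn (w t) <= A * sqn (u t), expR (nn * t) ^+ 2 <= A, sig <= complex.Re (mu lam t) &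
     sqn (S t) <= b ^+ 2 * (A * (1 + sqn (u t) + sqn (v t) + sqn (e t)))].
  move=> tab; case: (hP _ tab) => i1 i2 i3 i4 i5.
  have [ps es] := hY _ _ _ hs r t tab.
  have [j1 j2] := @ray_rho_bounds R n th th1 th2 th3 lam t sig P s0 hs P0 i1 i2 i3.
  rewrite -/s in j1; rewrite -/s' in j2.
  split.
  - by rewrite sqnM sqn_real ler_wpM2r ?sqn_ge0// (le_trans i4).
  - rewrite sqnM ler_wpM2r ?sqn_ge0// (le_trans _ PsA)// sqnM sqn_real.
    by rewrite ler_pM ?sqr_ge0 ?sqn_ge0.
  - exact: le_trans PA.
  - by rewrite Re_ray_mu.
  rewrite sqnM sqn_real ler_wpM2l ?sqr_ge0//.
  have pu : sqn (psi' t) <= 2 * (sqn (u t) + Y).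
    have -> : psi' t = u t + psi t by rewrite /u; ring.
    by apply: le_trans (sqnD_le _ _) _; rewrite ler_pM2l// lerD2l.
  have ev : sqn (eta' t) <= 2 * (sqn (v t) + Y).
    have -> : eta' t = v t + eta t by rewrite /v; ring.
    by apply: le_trans (sqnD_le _ _) _; rewrite ler_pM2l// lerD2l.
  have sq2 : sqn (2 : C) = 4 by rewrite /sqn Re_nat Im_nat; ring.
  have q1 : sqn (m%:C * rho lam t + 2 * rho' lam t) <= k1.
    apply: le_trans (sqnD_le _ _) _; rewrite ler_pM2l//.
    rewrite (sqnM m%:C) (sqnM 2) sqn_real sq2; apply: lerD; first by rewrite ler_wpM2l.
    by rewrite ler_pM2l.
  have q2 : sqn (2 * rho lam t * (expR (- nn * t))%:C) <= k2.
    rewrite sqnM (sqnM 2) sq2 sqn_real -mulrA ler_pM2l//.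
    by rewrite ler_pM ?sqr_ge0 ?sqn_ge0.
  have U0 := sqn_ge0 (u t); have V0 := sqn_ge0 (v t); have E0 := sqn_ge0 (e t).
  have t1 : sqn ((m%:C * rho lam t + 2 * rho' lam t) * psi' t) <= k1 * (2 * (sqn (u t) + Y)).
    by rewrite sqnM ler_pM ?sqn_ge0.
  have t2 : sqn (2 * rho lam t * (expR (- nn * t))%:C * eta' t) <= k2 * (2 * (sqn (v t) + Y)).
    by rewrite sqnM ler_pM ?sqn_ge0.
  have t0 : sqn (m%:C * e t) = m ^+ 2 * sqn (e t) by rewrite sqnM sqn_real.
  have tS : sqn (S1 t) <= 4 * (m ^+ 2 * sqn (e t) + k1 * (2 * (sqn (u t) + Y))
      + k2 * (2 * (sqn (v t) + Y))).
    by apply: le_trans (sqnD3_le _ _ _) _; rewrite ler_pM2l// t0 !lerD.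
  apply: (le_trans tS); move: (sqn (u t)) (sqn (v t)) (sqn (e t)) U0 V0 E0 => U V W U0 V0 W0.
  apply: le_trans (source_bound m20 k10 k20 Y0 U0 V0 W0) _.
  apply: ler_wpM2r; first by rewrite !addr_ge0.
  by rewrite /A lerDr addr_ge0.
have E := HD HB ube vbe ebe.
have al_in : al <= al <= be by rewrite lexx albe.
have qe : q' al = e al by rewrite /e /ray_rho p_left// !(mulr0, mul0r) subr0.
have U0 := sqn_ge0 (u al); have V0 := sqn_ge0 (v al); have W0 := sqn_ge0 (e al).
have bW0 : 0 <= b * sqn (e al) by rewrite mulr_ge0// ltW.
have Kb0 : 0 <= K * b by rewrite mulr_ge0// ltW.
have vK : sqn (v al) <= K * b.
  by apply: le_trans E; rewrite -mulrA [_ + sqn (v al)]addrC -addrA lerDl addr_ge0// mulr_ge0.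
have bW : b * sqn (e al) <= K * b.
  apply: le_trans E; apply: (@le_trans _ _ (2 * (b * sqn (e al)))).
    by rewrite mulr_natl mulr2n lerDl.
  by rewrite -[2 * b * _]mulrA lerDr addr_ge0.
have [_ es] := hY _ _ _ hs r al al_in.
have ev : sqn (eta' al) <= 2 * (K + Y).
  have -> : eta' al = v al + eta al by rewrite /v; ring.
  apply: le_trans (sqnD_le _ _) _; rewrite ler_pM2l// lerD// (le_trans vK)//.
  by rewrite ler_piMr.
have -> : selfsim_det n al c2 a b lam (eta' al) (q' al) - (lam + 'i%C * (nn * c2)%:C) * eta al =
  (lam + 'i%C * (nn * c2)%:C) * v al + (b * (nn + 2 - a))%:C * eta' al
   - (2 * b * expR (nn * al))%:C * e al.
  by rewrite /selfsim_det qe /v; ring.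
have z1 : sqn ((lam + 'i%C * (nn * c2)%:C) * v al) <= L1 * (K * b).
  rewrite sqnM; apply: ler_pM; rewrite ?sqn_ge0//.
  by apply: le_trans (sqnD_le _ _) _; rewrite sqn_imag ler_pM2l// lerD2r.
have b2b : b ^+ 2 <= b by rewrite expr2 ler_piMr// ltW.
have z2 : sqn ((b * (nn + 2 - a))%:C * eta' al) <= b * (N * (2 * (K + Y))).
  have g1 : N * sqn (eta' al) <= N * (2 * (K + Y)) by rewrite ler_wpM2l.
  rewrite sqnM sqn_real exprMn -/N -mulrA; apply: ler_pM => //; first exact: sqr_ge0.
  by rewrite mulr_ge0 ?sqn_ge0.
have z3 : sqn ((2 * b * expR (nn * al))%:C * e al) <= 4 * (P * (K * b)).
  rewrite sqnM sqn_real.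
  have -> : (2 * b * expR (nn * al)) ^+ 2 * sqn (e al) = 4 * (expR (nn * al) ^+ 2 * (b * (b * sqn (e al)))) by ring.
  rewrite ler_pM2l//; apply: ler_pM; rewrite ?sqr_ge0//.
  - by rewrite mulr_ge0// ltW.
  - by case: (hP _ al_in).
  - by apply: le_trans bW; rewrite ler_piMl.
apply: le_trans (sqnD3_le _ _ _) _; rewrite sqnN.
rewrite [leRHS](_ : _ = 4 * (L1 * (K * b) + b * (N * (2 * (K + Y))) + 4 * (P * (K * b)))); last by ring.
by rewrite ler_pM2l// !lerD.
Qed.

(** As Re lambda grows, rho tends to 0 and the solution approaches the exterior one, for which eta =
    - n throughout. The Gronwall bound gives |eta(al) + n|^2 <= G / x^2, and this is below 1 for
    large x. *)
Lemma rayleigh_far lam0 : 0 < complex.Re lam0 -> exists2 X : R, 0 < X &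
  forall (x : R) psi eta, X <= x -> rayleigh (lam0 + x%:C) psi eta -> eta al != 0.
Proof.
move=> s0; set sig := complex.Re lam0 in s0.
have [P [P1 hP]] := @ray_bounds R n th1 th2 th3 al be Dth1 Dth2 cth3.
have P0 : 0 <= P by lra.
have s20 : 0 <= (sig ^+ 2)^-1 by rewrite invr_ge0 sqr_ge0.
have Ps : 0 <= P / sig ^+ 2 by rewrite mulr_ge0.
pose K := P + P * (P / sig ^+ 2).
have K0 : 0 <= K by rewrite addr_ge0// mulr_ge0.
pose G := expR ((#|bool : finType|%:R * (K + 1) + 1) * (be - al)) * #|bool : finType|%:R * P.
have G0 : 0 <= G by rewrite !mulr_ge0 ?expR_ge0.
exists (G + 1); first by lra.
move=> x psi eta Xx r; apply/eqP => eta0.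
have x0 : 0 < x by lra.
have hs : sig <= complex.Re (lam0 + x%:C) by rewrite ReImE /= -/sig; lra.
have hx : x <= complex.Re (lam0 + x%:C) by rewrite ReImE /= -/sig; lra.
have h0 := lt_le_trans s0 hs.
set lam := lam0 + x%:C in r hs hx h0.
(* The deviation from the exterior solution, which satisfies the system up to the source rho, of
   squared size at most P / x^2. *)
pose z (i : bool) t : C := if i then eta t + n%:R else psi t - (expR (- nn * t))%:C.
pose g (i : bool) t : C := if i then 'i%C * (nn * p t)%:C / mu lam t else 0.
have hM : forall i j t, al <= t <= be -> sqn (ray_coef n th th1 th2 lam i j t) <= K.
  move=> i j s sab; case: (hP _ sab) => b1 b2 b3 b4 b5.
  have [r1 _] := @ray_rho_bounds R n th th1 th2 th3 lam s sig P s0 hs P0 b1 b2 b3.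
  have PP : 0 <= P * (P / sig ^+ 2) by rewrite mulr_ge0.
  rewrite /ray_coef; case: i j => -[]; rewrite ?sqn0//.
    rewrite sqnM sqn_real; apply: (@le_trans _ _ (P * (P / sig ^+ 2))); last by rewrite lerDr.
    by rewrite ler_pM ?sqr_ge0 ?sqn_ge0.
  by rewrite sqn_real (le_trans b4)// lerDl.
have x20 : 0 <= (x ^+ 2)^-1 by rewrite invr_ge0 sqr_ge0.
have Px0 : 0 <= P / x ^+ 2 by rewrite mulr_ge0.
have hg : forall i t, al <= t <= be -> sqn (g i t) <= P / x ^+ 2.
  move=> i s sab; case: (hP _ sab) => b1 b2 b3 b4 b5.
  case: i; rewrite /g ?sqn0//.
  by have [r1 _] := @ray_rho_bounds R n th th1 th2 th3 lam s x P x0 hx P0 b1 b2 b3.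
have := @cfield_gronwall R bool (ray_coef n th th1 th2 lam) g z K (P / x ^+ 2) al be K0 Px0 albe hM hg.
have Dz i t : al <= t <= be -> chasder (z i) t (cfield (ray_coef n th th1 th2 lam) g z i t).
  move=> _; rewrite /cfield ray_sumE; case: r => _ _ D1 D2; case: i; rewrite /z /g.
    apply: chasder_eq; first exact: chasderD (D2 t) (chasder_cst _ _).
    have ee : (expR (nn * t))%:C * (expR (- nn * t))%:C = 1 :> C.
      by rewrite -rmorphM /= -expRD mulNr subrr expR0.
    rewrite addr0 /ray_rho mulrBr -[_ * _ * (expR (- nn * t))%:C]mulrA.
    rewrite [_ / _ * (expR (- nn * t))%:C]mulrC [_%:C * (_%:C * _)]mulrA ee mul1r; ring.
  apply: chasder_eq; first by apply: chasderB (D1 t) _; apply: chasder_real; exact: hasder_expn.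
  by rewrite addr0 rmorphM /= rmorphN /= (rmorph_nat (real_complex R)); ring.
move=> /(_ Dz).
have zb i : z i be = 0 by case: r => e1 e2 _ _; rewrite /z; case: i; rewrite ?e1 ?e2 ?addNr ?subrr.
move=> /(_ zb); rewrite big_bool => h1.
have {}h1 : sqn (z true al) + sqn (z false al) <= G / x ^+ 2.
  by apply: le_trans h1 _; rewrite /G !mulrA.
have : sqn (z true al) = nn ^+ 2.
  by rewrite /z eta0 add0r /sqn Re_nat Im_nat expr0n addr0.
have nn1 : 1 <= nn by rewrite ler1n.
have := sqn_ge0 (z false al).
have : G / x ^+ 2 < 1.
  rewrite ltr_pdivrMr ?exprn_gt0// mul1r expr2.
  have := mulr_ge0 (ltW x0) (_ : 0 <= x - 1); rewrite subr_ge0.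
  have x1 : 1 <= x by lra.
  move=> /(_ x1); lra.
have : 1 <= nn ^+ 2 by rewrite expr_ge1// (le_trans ler01).
lra.
Qed.

(** The lower bound [sig] for Re lambda is fixed before the upper bound [B] for b; this order of
    quantifiers is what later makes Re lambda / b as large as desired. *)
Theorem selfsim_eigenvalue (lam0 : C) psi0 eta0 :
  (forall t, t <= al -> th t = c2) ->
  0 < complex.Re lam0 -> rayleigh lam0 psi0 eta0 -> eta0 al = 0 ->
  exists2 sig : R, 0 < sig & forall B : R, 0 < B -> exists b lam psi eta q,
    [/\ 0 < b <= B, sig <= complex.Re lam, selfsim b lam psi eta q &
      selfsim_det n al c2 a b lam (eta al) (q al) = 0].
Proof.
move=> th_left l0 r0 e0.
have /choice[Y hY] : forall lam, exists Y : (R -> C) * (R -> C),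
    0 < complex.Re lam -> rayleigh lam Y.1 Y.2.
  move=> lam; have [h|h] := ltP 0 (complex.Re lam); last by exists (psi0, eta0).
  by have [psi [eta H]] := @rayleigh_exists R n th th1 th2 th3 be Dth Dth1 Dth2 lam h; exists (psi, eta).
pose D z := (Y z).2 al.
have uniq lam psi eta : 0 < complex.Re lam -> rayleigh lam psi eta -> eta al = D lam.
  move=> h r.
  exact: (@rayleigh_uniq R n th th1 th2 th3 al be albe Dth Dth1 Dth2 lam psi eta (Y lam).1 (Y lam).2 h r (hY lam h)).
have D0 : D lam0 = 0 by rewrite -(uniq _ _ _ l0 r0).
have T2D lam : 0 < complex.Re lam -> taylor2 D lam.
  by move=> h; apply: (@rayleigh_taylor2 R n th th1 th2 th3 al be albe Dth Dth1 Dth2 cth3 (fun z => (Y z).1) (fun z => (Y z).2)).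
have [X X0 hX] := rayleigh_far l0.
(* The zeros on the ray from [lam0] to the right. They are bounded by [rayleigh_far], and by
   continuity the supremum is itself a zero, so that the shooting function is non-zero further
   right, as [hurwitz] requires. *)
pose Z := [set x : R | 0 <= x /\ D (lam0 + x%:C) = 0].
have Repos x : 0 <= x -> 0 < complex.Re (lam0 + x%:C) by move=> h; rewrite ReImE /=; lra.
have Z0 : Z 0 by split => //; rewrite addr0.
have ubZ : ubound Z X.
  move=> x [x0 Dx]; rewrite leNgt; apply/negP => /ltW h.
  by have := hX x _ _ h (hY _ (Repos _ x0)); rewrite -/(D _) Dx eqxx.
have hsZ : has_sup Z by split; [exists 0|exists X].
pose xs := sup Z.
have xs0 : 0 <= xs by apply: ub_le_sup => //; exists X.
pose ls := lam0 + xs%:C.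
have Dls : D ls = 0.
  apply/eqP; rewrite -sqn_eq0; apply/eqP; apply: contrapT => /eqP ne.
  have p0 : 0 < sqn (D ls) by rewrite lt_def ne sqn_ge0.
  have p2 : 0 < sqn (D ls) / 2 by rewrite divr_gt0.
  have [d d0 hd] := taylor2_econt (T2D ls (Repos _ xs0)) p2.
  have e1 : 0 < Num.min 1 d by rewrite lt_min ltr01.
  have [x [x0 Dx] hx] := sup_adherent e1 hsZ.
  have xxs : x <= xs by apply: ub_le_sup => //; exists X.
  have := hd (x - xs)%:C; rewrite sqn_real.
  have hx1 : xs - x < Num.min 1 d by move: hx; rewrite -/xs; lra.
  have -> : ls + (x - xs)%:C = lam0 + x%:C by rewrite /ls rmorphB /=; ring.
  rewrite Dx sqn0 sub0r normrN ger0_norm ?sqn_ge0//.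
  have : (x - xs) ^+ 2 <= d.
    move: hx1; rewrite lt_min => /andP[h1 h2].
    have -> : (x - xs) ^+ 2 = (xs - x) * (xs - x) by ring.
    apply: (@le_trans _ _ (1 * (xs - x))); last by rewrite mul1r ltW.
    by apply: ler_wpM2r; [rewrite subr_ge0|exact: ltW].
  by move=> hh /(_ hh); lra.
have Dfar x : 0 < x -> D (ls + x%:C) != 0.
  move=> x0; apply/eqP => Dx.
  suff : xs + x <= xs by lra.
  apply: ub_le_sup; first by exists X.
  split; first lra.
  by rewrite rmorphD /= addrA.
(* The square of half-side [rr] around [ls] lies in the half-plane Re z >= [rr], and [rr] becomes
   the uniform lower bound for Re lambda. *)
pose rr := complex.Re ls / 2.
have Rls := Repos _ xs0; rewrite -/ls in Rls.
have rr0 : 0 < rr by rewrite divr_gt0.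
have ReQ z : sup_dist z ls <= rr -> rr <= complex.Re z.
  by rewrite /sup_dist ge_max => /andP[+ _]; rewrite ler_norml /rr => /andP[]; lra.
(* The limit of [selfsim_det] as b -> 0; the extra factor has positive real part near [ls] and adds
   no zero. *)
pose f z := (z + 'i%C * (nn * c2)%:C) * D z.
have T2f z : sup_dist z ls <= rr -> taylor2 f z.
  move=> /ReQ h; apply: taylor2M; last by apply: T2D; lra.
  by apply: taylor2D; [exact: taylor2_id|exact: taylor2_cst].
have [e e0' he] : exists2 e : R, 0 < e & forall g,
    (forall z, sup_dist z ls <= rr -> taylor2 g z) ->
    (forall z, sup_dist z ls <= rr -> sqn (g z - f z) <= e) ->
    exists2 z, sup_dist z ls <= rr & g z = 0.
  apply: (@hurwitz R f ls rr rr0 T2f); first by rewrite /f Dls mulr0.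
  move=> x x0 _; rewrite /f mulf_neq0 ?Dfar//.
  apply/eqP => /(congr1 (@complex.Re R)); rewrite !ReImE /=; lra.
exists rr => // B B0.
pose Lam := 2 * (2 * rr ^+ 2 + sqn ls).
have Lam0 : 0 <= Lam by rewrite mulr_ge0// addr_ge0 ?sqn_ge0// mulr_ge0// sqr_ge0.
have [K [b1 [K0 b10 b11 hK]]] := selfsim_limit rr0 Lam0.
pose b := Num.min B (Num.min b1 (e / (K + 1))).
have K1 : 0 < K + 1 by rewrite ltr_wpDl.
have b0 : 0 < b by rewrite !lt_min B0 b10 divr_gt0.
have bB : b <= B by rewrite ge_min lexx.
have bb1 : b <= b1 by rewrite !ge_min lexx !orbT.
have be' : K * b <= e.
  have : b <= e / (K + 1) by rewrite !ge_min lexx !orbT.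
  by rewrite ler_pdivlMr// => /(le_trans _); apply; rewrite mulrC ler_wpM2l ?lerDl// ltW.
have /choice[S hS] : forall lam, exists S : (R -> C) * (R -> C) * (R -> C),
    selfsim b lam S.1.1 S.1.2 S.2.
  move=> lam; have [psi [eta [q H]]] : exists psi eta q, selfsim b lam psi eta q.
    by eapply selfsim_exists; eassumption.
  by exists (psi, eta, q).
have [||z hz gz] := he (fun z => selfsim_det n al c2 a b z ((S z).1.2 al) ((S z).2 al)).
- move=> z _; exact: (selfsim_taylor2 c2 albe Dth Dth1 Dth2 b0 hS z).
- move=> z hz; have hR := ReQ _ hz; apply: le_trans be'.
  apply: (hK b z (Y z).1 (Y z).2 (S z).1.1 (S z).1.2 (S z).2) => //.
    have -> : z = (z - ls) + ls by ring.
    apply: le_trans (sqnD_le _ _) _; rewrite ler_pM2l// lerD2r.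
    exact: sup_dist_le_sqn.
  by apply: hY; lra.
exists b, z, (S z).1.1, (S z).1.2, (S z).2; split => //; first by rewrite b0.
exact: ReQ.
Qed.

End SpectralPersistence.

(** * Smooth functions on the line and regularity at the origin in s = e^t *)

Section SmoothLine.
Context {R : realType}.
Local Notation C := R[i].

(** The derivative is existential, so that closure under products and compositions is an induction
    that exhibits it. *)
Fixpoint Cn (k : nat) (f : R -> R) : Prop := match k with
  | 0%N => continuous f
  | k'.+1 => exists2 f', (forall t, hasder f t (f' t)) & Cn k' f' end.

Fixpoint cCn (k : nat) (f : R -> C) : Prop := match k with
  | 0%N => ccontinuous f
  | k'.+1 => exists2 f', (forall t, chasder f t (f' t)) & cCn k' f' end.

Lemma Cn_continuous k f : Cn k f -> continuous f.
Proof. by case: k => [//|k [f' h _]]; exact: hasder_continuous h. Qed.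

Lemma cCn_continuous k f : cCn k f -> ccontinuous f.
Proof. by case: k => [//|k [f' h _]]; exact: chasder_continuous h. Qed.

Lemma CnW k f : Cn k.+1 f -> Cn k f.
Proof.
elim: k f => [|k IH] f; first exact: Cn_continuous.
by case=> f' h hf'; exists f' => //; exact: IH.
Qed.

Lemma cCnW k f : cCn k.+1 f -> cCn k f.
Proof.
elim: k f => [|k IH] f; first exact: cCn_continuous.
by case=> f' h hf'; exists f' => //; exact: IH.
Qed.

Lemma Cn_cst k c : Cn k (fun=> c).
Proof.
elim: k c => [|k IH] c; first exact: cont_cst.
by exists (fun=> 0) => [t|]; [exact: hasder_cst|exact: IH].
Qed.

Lemma Cn_id k : Cn k (fun x => x).
Proof.
case: k => [|k]; first by move=> t; exact: cvg_id.
by exists (fun=> 1) => [t|]; [exact: hasder_id|exact: Cn_cst].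
Qed.

Lemma CnD k f g : Cn k f -> Cn k g -> Cn k (fun x => f x + g x).
Proof.
elim: k f g => [|k IH] f g; first exact: contD.
move=> [f' hf Cf] [g' hg Cg]; exists (fun x => f' x + g' x); last exact: IH.
by move=> t; apply: hasderD.
Qed.

Lemma CnM k f g : Cn k f -> Cn k g -> Cn k (fun x => f x * g x).
Proof.
elim: k f g => [|k IH] f g; first exact: contM.
move=> Hf Hg; have Cf := CnW Hf; have Cg := CnW Hg.
case: Hf Hg => [f' hf Cf'] [g' hg Cg'].
exists (fun x => f' x * g x + f x * g' x); last by apply: CnD; apply: IH.
by move=> t; exact: hasderM.
Qed.

Lemma CnN k f : Cn k f -> Cn k (fun x => - f x).
Proof.
move=> h; have := CnM (Cn_cst k (-1)) h.
by under eq_fun do rewrite mulN1r.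
Qed.

Lemma CnB k f g : Cn k f -> Cn k g -> Cn k (fun x => f x - g x).
Proof. by move=> hf hg; exact: CnD hf (CnN hg). Qed.

Lemma Cn_comp k f g : Cn k f -> Cn k g -> Cn k (fun x => f (g x)).
Proof.
elim: k f g => [|k IH] f g; first by move=> cf cg; exact: cont_comp.
move=> [f' hf Cf] Hg; have Cg := CnW Hg; case: Hg => g' hg Cg'.
exists (fun x => f' (g x) * g' x); last by apply: CnM => //; exact: IH.
by move=> t; exact: hasder_comp.
Qed.

Lemma Cn_exp k : Cn k (@expR R).
Proof.
elim: k => [|k IH]; first exact: continuous_expR.
by exists expR => // t; exact: is_derive_expR.
Qed.

Lemma cCn_cst k c : cCn k (fun=> c).
Proof.
elim: k c => [|k IH] c; first exact: ccontinuous_cst.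
by exists (fun=> 0) => [t|]; [exact: chasder_cst|exact: IH].
Qed.

Lemma cCnD k f g : cCn k f -> cCn k g -> cCn k (fun x => f x + g x).
Proof.
elim: k f g => [|k IH] f g; first exact: ccontinuousD.
move=> [f' hf Cf] [g' hg Cg]; exists (fun x => f' x + g' x); last exact: IH.
by move=> t; apply: chasderD.
Qed.

Lemma cCnM k f g : cCn k f -> cCn k g -> cCn k (fun x => f x * g x).
Proof.
elim: k f g => [|k IH] f g; first exact: ccontinuousM.
move=> Hf Hg; have Cf := cCnW Hf; have Cg := cCnW Hg.
case: Hf Hg => [f' hf Cf'] [g' hg Cg'].
exists (fun x => f' x * g x + f x * g' x); last by apply: cCnD; apply: IH.
by move=> t; exact: chasderM.
Qed.

Lemma cCnN k f : cCn k f -> cCn k (fun x => - f x).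
Proof.
move=> h; have := cCnM (cCn_cst k (-1)) h.
by under eq_fun do rewrite mulN1r.
Qed.

Lemma cCn_real k (f : R -> R) : Cn k f -> cCn k (fun x => (f x)%:C).
Proof.
elim: k f => [|k IH] f; first exact: ccontinuous_real.
by case=> f' hf Cf; exists (fun x => (f' x)%:C); [move=> t; exact: chasder_real|exact: IH].
Qed.

Lemma cCn_Re k f : cCn k f -> Cn k (fun x => complex.Re (f x)).
Proof.
elim: k f => [|k IH] f; first by case.
by case=> f' hf Cf; exists (fun x => complex.Re (f' x)); [move=> t; case: (hf t)|exact: IH].
Qed.

Lemma cCn_Im k f : cCn k f -> Cn k (fun x => complex.Im (f x)).
Proof.
elim: k f => [|k IH] f; first by case.
by case=> f' hf Cf; exists (fun x => complex.Im (f' x)); [move=> t; case: (hf t)|exact: IH].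
Qed.

Lemma cCnV k f : (forall x, f x != 0) -> cCn k f -> cCn k (fun x => (f x)^-1).
Proof.
move=> f0; elim: k => [|k IH].
  move=> [c1 c2].
  have cs : continuous (fun x => (sqn (f x))^-1).
    have c : continuous (fun x => sqn (f x)) by exact: ccontinuous_sqn.
    by move=> t; apply: (@continuousV _ R (fun x => sqn (f x)) t); [rewrite sqn_eq0 f0|exact: c].
  split; [under eq_fun do rewrite Re_inv|under eq_fun do rewrite Im_inv].
    exact: contM.
  by apply: contM => //; exact: contN.
move=> H; have h1 := IH (cCnW H); case: H => f' hf Cf.
exists (fun x => - f' x * ((f x)^-1 * (f x)^-1)).
  by move=> t; apply: chasder_eq (chasderV (f0 t) (hf t)) _; rewrite -invfM expr2.
by apply: cCnM; [exact: cCnN|exact: cCnM].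
Qed.

Lemma chasderX (f : R -> C) n t d : chasder f t d ->
  chasder (fun x => f x ^+ n) t (n%:R * f t ^+ n.-1 * d).
Proof.
move=> h; elim: n => [|n IH].
  by rewrite !mul0r; under eq_fun do rewrite expr0; exact: chasder_cst.
under eq_fun do rewrite exprS.
apply: chasder_eq; first exact: chasderM h IH.
case: n {IH} => [|n]; first by rewrite expr0 /=; ring.
by rewrite -pred_Sn -[in RHS]pred_Sn [n.+2%:R]mulrS exprS; ring.
Qed.

Lemma chasder_comp_real (f : R -> C) (g : R -> R) t d (dg : R) : chasder f (g t) d ->
  hasder g t dg -> chasder (fun x => f (g x)) t (d * dg%:C).
Proof.
move=> [h1 h2] hg; split; rewrite ReImE /= mulr0 ?subr0 ?add0r.
  exact: (@hasder_comp R (fun x => complex.Re (f x)) g).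
exact: (@hasder_comp R (fun x => complex.Im (f x)) g).
Qed.

Lemma chasder_near (f g : R -> C) t d : (\forall x \near t, f x = g x) ->
  chasder f t d -> chasder g t d.
Proof.
move=> fg [h1 h2]; split.
  by apply: hasder_near h1; apply: filterS fg => x ->.
by apply: hasder_near h2; apply: filterS fg => x ->.
Qed.

Lemma chasder_uniq (f : R -> C) t d d' : chasder f t d -> chasder f t d' -> d = d'.
Proof. by move=> [h1 h2] [h3 h4]; apply: complex_eq; apply: hasder_uniq; eassumption. Qed.

Lemma chasder0_cst (f : R -> C) (a b : R) : a <= b -> (forall t, a <= t <= b -> chasder f t 0) -> f a = f b.
Proof.
move=> ab h; apply: complex_eq.
  by apply: (hasder0_cst (f := fun x => complex.Re (f x)) ab) => t /h[].
by apply: (hasder0_cst (f := fun x => complex.Im (f x)) ab) => t /h[].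
Qed.

Lemma hasder0_quadratic (f : R -> R) (K : R) : 0 <= K -> f 0 = 0 ->
  (forall h, `|h| <= 1 -> `|f h| <= K * h ^+ 2) -> hasder f 0 0.
Proof.
move=> K0 f0 hf.
have hc : (fun h : R => h^-1 *: ((f \o shift 0) (h *: (1 : R)) - f 0)) @ 0^' --> (0 : R).
  apply/cvgrPdist_le => e e0.
  have K1 : 0 < K + 1 by lra.
  near=> h.
  have h0 : h != 0 by near: h; exact: nbhs_dnbhs_neq.
  have h1 : `|h| <= 1.
    near: h; apply: dnbhs0_le; lra.
  have h2 : `|h| <= e / (K + 1).
    near: h; apply: dnbhs0_le; exact: divr_gt0.
  rewrite /= addr0 f0 subr0 sub0r normrN /GRing.scale /= mulr1 normrM normfV.
  rewrite ler_pdivrMl ?normr_gt0//.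
  apply: le_trans (hf _ h1) _; rewrite -real_normK ?num_real// expr2 mulrCA.
  rewrite ler_wpM2l//; move: h2; rewrite ler_pdivlMr//.
  by have := normr_ge0 h; lra.
split; first by apply: cvgP; exact: hc.
by apply/cvg_lim => //; exact: hc.
Unshelve. all: by end_near. Qed.

(** A function of t = ln |X|^2 read as a function of s = |X|^2. Extending it by 0 to s <= 0 turns
    regularity at the origin of the plane into ordinary smoothness at s = 0. *)
Definition log_ext (chi : R -> C) (s : R) : C := if 0 < s then chi (ln s) else 0.

(** A derivative in s is a t-derivative times e^(-t). At each differentiation the bound |chi| <= C
    s^2 makes the derivative at s = 0 equal to 0; at the last stage |chi|^2 <= K s gives continuity
    there. *)
Fixpoint log_flat (al : R) (k : nat) (chi : R -> C) : Prop := match k with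
  | 0%N => ccontinuous chi /\
     exists K, 0 <= K /\ forall t, t < al -> sqn (chi t) <= K * expR t
  | k'.+1 => (exists K, 0 <= K /\ forall t, t < al -> sqn (chi t) <= K * expR t ^+ 4) /\
     exists2 chi', (forall t, chasder chi t (chi' t)) &
       log_flat al k' (fun t => chi' t * (expR (- t))%:C) end.

Lemma log_ext_near_neg (chi : R -> C) (s : R) : s < 0 -> \forall x \near s, 0 = log_ext chi x.
Proof.
move=> s0; near=> x; rewrite /log_ext ifN// -leNgt ltW//.
by near: x; exact: lt_nbhsl.
Unshelve. all: by end_near. Qed.

Lemma log_ext_near_pos (chi : R -> C) (s : R) : 0 < s -> \forall x \near s, chi (ln x) = log_ext chi x.
Proof.
move=> s0; near=> x; rewrite /log_ext ifT//.
by near: x; exact: lt_nbhsr.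
Unshelve. all: by end_near. Qed.

Lemma chasder_log_ext chi chi' al K : 0 <= K -> (forall t, t < al -> sqn (chi t) <= K * expR t ^+ 4) ->
  (forall t, chasder chi t (chi' t)) ->
  forall s, chasder (log_ext chi) s (log_ext (fun t => chi' t * (expR (- t))%:C) s).
Proof.
move=> K0 hK hd s.
have [s0|s0|s0] := ltgtP s 0.
- rewrite {2}/log_ext ifN ?ltNge ?(ltW s0)//.
  by apply: (chasder_near (log_ext_near_neg chi s0)); exact: chasder_cst.
- apply: (chasder_near (log_ext_near_pos chi s0)).
  rewrite /log_ext s0; apply: chasder_eq.
    apply: (@chasder_comp_real chi (@ln R)); first exact: hd.
    by apply: (hasder_eq (hasder_ln s0 (hasder_id s))); rewrite mulr1.
  by rewrite expRN lnK.
- rewrite s0 {2}/log_ext ltxx.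
  have bnd (f : C -> R) (h : R) : (forall z, f z ^+ 2 <= sqn z) -> `|h| < expR al -> f (log_ext chi h) ^+ 2 <= K * (h ^+ 2) ^+ 2.
    move=> hf hh; apply: le_trans (hf _) _; rewrite /log_ext; case: ifPn => h0; last first.
      by rewrite sqn0 mulr_ge0// sqr_ge0.
    have := hK (ln h); rewrite -ltr_expR lnK//.
    rewrite gtr0_norm// in hh; move=> /(_ hh).
    by rewrite -exprM.
  have root (x h : R) : x ^+ 2 <= K * (h ^+ 2) ^+ 2 -> `|x| <= (K + 1) * h ^+ 2.
    have K1 : 0 <= (K + 1) * h ^+ 2 by apply: mulr_ge0; [lra|exact: sqr_ge0].
    move=> hx; rewrite -(ler_pXn2r (n := 2)) ?nnegrE//.
    rewrite real_normK ?num_real//; apply: (le_trans hx); rewrite [leRHS]exprMn ler_wpM2r ?sqr_ge0//.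
    by have := sqr_ge0 K; lra.
  pose d := Num.min 1 (expR al / 2).
  have d0 : 0 < d by rewrite lt_min ltr01 divr_gt0 ?expR_gt0.
  (* Values beyond [d] are replaced by 0, so that the quadratic bound holds for all |h| <= 1 as
     [hasder0_quadratic] asks; the derivative at 0 does not notice the change. *)
  have trunc (f : C -> R) : f 0 = 0 -> (forall z, f z ^+ 2 <= sqn z) -> hasder (fun h => f (log_ext chi h)) 0 0.
    move=> f0 hf.
    apply: (@hasder_near _ (fun h => if `|h| < d then f (log_ext chi h) else 0)).
      near=> h; rewrite ifT//; near: h; exact: nbhs0_lt.
    apply: (@hasder0_quadratic _ (K + 1)); first lra.
      by rewrite normr0 d0 /log_ext ltxx.
    move=> h _; case: ifPn => hd'; last by rewrite normr0 mulr_ge0 ?sqr_ge0//; lra.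
    apply: root; apply: bnd => //; apply: lt_le_trans hd' _.
    by rewrite ge_min; apply/orP; right; have := expR_gt0 al; lra.
  by split; apply: trunc => // z; [exact: Re_sqr_le|exact: Im_sqr_le].
Unshelve. all: by end_near. Qed.

Theorem log_ext_smooth al k chi : log_flat al k chi -> cCn k (log_ext chi).
Proof.
elim: k chi => [|k IH] chi /=; last first.
  move=> [[K [K0 hK]] [chi' hd /IH hk]]; exists (log_ext (fun t => chi' t * (expR (- t))%:C)) => //.
  exact: (chasder_log_ext K0 hK hd).
move=> [[c1 c2] [K [K0 hK]]].
suff main (f : C -> R) : f 0 = 0 -> (forall z, f z ^+ 2 <= sqn z) ->
    continuous (fun t => f (chi t)) -> continuous (fun s => f (log_ext chi s)).
  by split; apply: main => // z; [exact: Re_sqr_le|exact: Im_sqr_le].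
move=> f0 hf cf s.
have [s0|s0|s0] := ltgtP s 0.
- have h := log_ext_near_neg chi s0.
  apply: (@hasder_cont _ _ _ 0).
  by apply: (@hasder_near _ (fun=> 0)); [by apply: filterS h => x <-; rewrite f0|exact: hasder_cst].
- have h := log_ext_near_pos chi s0.
  have cln : {for s, continuous (fun x => f (chi (ln x)))}.
    apply: (@continuous_comp _ _ _ (@ln R) (fun t => f (chi t))); first exact: continuous_ln.
    exact: cf.
  apply/(@cvgrPdist_lt _ R) => e e0.
  move/(@cvgrPdist_lt _ R) : cln => /(_ e e0) h2.
  by near=> x; have <- : chi (ln x) = log_ext chi x;
    [near: x|rewrite /log_ext s0; near: x].
- rewrite s0; apply/(@cvgrPdist_lt _ R) => e e0.
  have l0 : f (log_ext chi 0) = 0 by rewrite /log_ext ltxx f0.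
  have K1 : 0 < K + 1 by lra.
  have n1 : \forall x \near (0 : R), `|x| < expR al by apply: nbhs0_lt; exact: expR_gt0.
  have n2 : \forall x \near (0 : R), `|x| < e ^+ 2 / (K + 1).
    by apply: nbhs0_lt; rewrite divr_gt0 ?exprn_gt0.
  apply: filterS2 n1 n2 => x x1 x2; rewrite l0 sub0r normrN.
  rewrite -(ltr_pXn2r (n := 2)) ?nnegrE ?(ltW e0)// real_normK ?num_real//.
  apply: le_lt_trans (hf _) _; rewrite /log_ext; case: ifPn => x0; last by rewrite sqn0 exprn_gt0.
  rewrite gtr0_norm// in x1 x2.
  have := hK (ln x); rewrite -ltr_expR lnK// => /(_ x1) /le_lt_trans; apply.
  by move: x2; rewrite ltr_pdivlMr; lra.
Unshelve. all: by end_near. Qed.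

(** The complex exponential exp(k t). *)
Definition cexp (k : C) (t : R) : C :=
  (expR (complex.Re k * t))%:C * (cos (complex.Im k * t) +i* sin (complex.Im k * t)).

Lemma chasder_cexp k t : chasder (cexp k) t (k * cexp k t).
Proof.
have hl (c : R) : hasder (fun s => c * s) t c.
  by apply: hasder_eq; [apply: hasderZ; exact: hasder_id|rewrite mulr1].
split; rewrite /cexp !ReImE /=.
  apply: hasder_eq.
    apply: hasderB; apply: hasderM.
    - by apply: hasder_exp; exact: hl.
    - by apply: hasder_cos; exact: hl.
    - exact: hasder_cst.
    - by apply: hasder_sin; exact: hl.
  rewrite /=; ring.
apply: hasder_eq.
  apply: hasderD; apply: hasderM.
  - by apply: hasder_exp; exact: hl.
  - by apply: hasder_sin; exact: hl.
  - exact: hasder_cst.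
  - by apply: hasder_cos; exact: hl.
rewrite /=; ring.
Qed.

Lemma sqn_cexp k t : sqn (cexp k t) = expR (complex.Re k * t) ^+ 2.
Proof.
rewrite /cexp sqnM sqn_real -[RHS]mulr1; congr (_ * _).
by rewrite /sqn /= cos2Dsin2.
Qed.

Lemma cexpM k l t : cexp k t * cexp l t = cexp (k + l) t.
Proof.
rewrite /cexp !ReImE !mulrDl expRD cosD sinD.
apply: complex_eq; rewrite /= ?ReImE /=; ring.
Qed.

Lemma cexp_real (x : R) t : cexp x%:C t = (expR (x * t))%:C.
Proof.
by rewrite /cexp /= mul0r cos0 sin0; apply: complex_eq; rewrite /= ?ReImE /=; ring.
Qed.

Lemma expR_ratio_le (x y t al : R) : y <= x -> t < al ->
  expR (x * t) <= expR ((x - y) * al) * expR (y * t).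
Proof.
move=> yx tal; rewrite -expRD ler_expR.
have : (x - y) * t <= (x - y) * al by rewrite ler_wpM2l ?subr_ge0// ltW.
lra.
Qed.

(** To the left of [al] the function is the power c s^ka. Each derivative in s lowers the exponent
    by one, and the last one must still tend to 0, whence Re ka >= k + 1. The choice c = 0 covers
    functions that vanish there. *)
Lemma log_flat_power al k chi (c ka : C) : cCn k chi -> k%:R + 1 <= complex.Re ka ->
  (forall t, t < al -> chi t = c * cexp ka t) -> log_flat al k chi.
Proof.
elim: k chi c ka => [|k IH] chi c ka /=.
  move=> cc; rewrite add0r => k1 h; split => //.
  exists (sqn c * expR ((2 * complex.Re ka - 1) * al)); split.
    by rewrite mulr_ge0 ?sqn_ge0 ?expR_ge0.
  move=> t tal; rewrite h// sqnM sqn_cexp -mulrA ler_wpM2l ?sqn_ge0//.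
  rewrite -expRM_natl mulrA -[X in _ <= _ * expR X]mul1r; apply: expR_ratio_le => //; lra.
move=> [chi' hd Ck'] k1 h.
have k0 : 0 <= k%:R :> R by [].
have k1' : k%:R + 2 <= complex.Re ka by move: k1; rewrite -natr1; lra.
split.
  exists (sqn c * expR ((2 * complex.Re ka - 4) * al)); split.
    by rewrite mulr_ge0 ?sqn_ge0 ?expR_ge0.
  move=> t tal; rewrite h// sqnM sqn_cexp -mulrA ler_wpM2l ?sqn_ge0//.
  rewrite -!expRM_natl mulrA; apply: expR_ratio_le => //; lra.
exists chi' => //; apply: (IH _ (c * ka) (ka - 1)).
- apply: cCnM => //; apply: cCn_real; apply: Cn_comp; first exact: Cn_exp.
  by apply: CnN; exact: Cn_id.
- by rewrite !ReImE; have -> : complex.Re 1 = 1 :> R by []; lra.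
- move=> t tal.
  have E : chi' t = c * (ka * cexp ka t).
    apply: chasder_uniq (hd t) _.
    apply: (@chasder_near (fun s => c * cexp ka s)).
      by near=> s; rewrite h//; near: s; exact: lt_nbhsl.
    by apply: chasderZ; exact: chasder_cexp.
  have -> : (expR (- t))%:C = cexp (-1) t.
    have -> : -1 = (-1 : R)%:C :> C by rewrite rmorphN.
    by rewrite cexp_real mulN1r.
  by have e := cexpM ka (-1) t; rewrite E -e; ring.
Unshelve. all: by end_near. Qed.

End SmoothLine.

(** * Partial derivatives and radial functions in the plane *)

Section PlaneCalculus.
Context {R : realType}.
Local Notation C := R[i].
Implicit Types (f g F : R * R -> R) (X : R * R).

(** A partial derivative is an ordinary derivative along a coordinate line, so the calculus on the
    line applies; [pder1E] links it to the directional derivative. *)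
Definition pder1 f X d := hasder (fun x => f (x, X.2)) X.1 d.
Definition pder2 f X d := hasder (fun y => f (X.1, y)) X.2 d.

Lemma scale_add_pair (h : R) (v X : R * R) :
  h *: v + X = (h * v.1 + X.1, h * v.2 + X.2).
Proof. by case: v X => [a b] [c d]. Qed.

Lemma pder1E f X d : pder1 f X d <-> is_derive X ((1 : R), (0 : R)) f d.
Proof.
have E : (fun h : R => h^-1 *: (((fun x => f (x, X.2)) \o shift X.1) (h *: (1 : R)) - f (X.1, X.2)))
   = (fun h : R => h^-1 *: ((f \o shift X) (h *: ((1 : R), (0 : R))) - f X)).
  apply/funext => h; congr (_ *: (_ - _)); last by case: X.
  by rewrite /= scale_add_pair /= mulr0 add0r.
split => -[h1 h2]; split.
- by rewrite /derivable -E.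
- by rewrite /derive -E.
- by rewrite /derivable /= E.
- by rewrite /derive /= E.
Qed.

Lemma pder2E f X d : pder2 f X d <-> is_derive X ((0 : R), (1 : R)) f d.
Proof.
have E : (fun h : R => h^-1 *: (((fun y => f (X.1, y)) \o shift X.2) (h *: (1 : R)) - f (X.1, X.2)))
   = (fun h : R => h^-1 *: ((f \o shift X) (h *: ((0 : R), (1 : R))) - f X)).
  apply/funext => h; congr (_ *: (_ - _)); last by case: X.
  by rewrite /= scale_add_pair /= mulr0 add0r.
split => -[h1 h2]; split.
- by rewrite /derivable -E.
- by rewrite /derive -E.
- by rewrite /derivable /= E.
- by rewrite /derive /= E.
Qed.

Lemma d1E f X d : pder1 f X d -> d1 f X = d.
Proof. by move=> /pder1E h; apply: derive_val. Qed.

Lemma d2E f X d : pder2 f X d -> d2 f X = d.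
Proof. by move=> /pder2E h; apply: derive_val. Qed.

Lemma Ck_intro k f f1 f2 : continuous f -> (forall X, pder1 f X (f1 X)) ->
  (forall X, pder2 f X (f2 X)) -> Ck k f1 -> Ck k f2 -> Ck k.+1 f.
Proof.
move=> cf h1 h2 C1 C2; split => //.
- by move=> X; case: (proj1 (pder1E _ _ _) (h1 X)).
- by move=> X; case: (proj1 (pder2E _ _ _) (h2 X)).
- by rewrite (_ : d1 f = f1)//; apply/funext => X; exact: d1E.
- by rewrite (_ : d2 f = f2)//; apply/funext => X; exact: d2E.
Qed.

Lemma Ck_elim k f : Ck k.+1 f -> [/\ continuous f, forall X, pder1 f X (d1 f X),
  forall X, pder2 f X (d2 f X), Ck k (d1 f) & Ck k (d2 f)].
Proof.
move=> [cf h1 h2 C1 C2]; split; [exact: cf|move=> X|move=> X|exact: C1|exact: C2].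
- by apply/pder1E; exact: derivableP.
- by apply/pder2E; exact: derivableP.
Qed.

Lemma Ck_continuous k f : Ck k f -> continuous f.
Proof. by case: k => [//|k []]. Qed.

Lemma CkW k f : Ck k.+1 f -> Ck k f.
Proof.
elim: k f => [|k IH] f; first exact: Ck_continuous.
move=> /Ck_elim[cf h1 h2 C1 C2]; exact: (Ck_intro cf h1 h2 (IH _ C1) (IH _ C2)).
Qed.

Lemma Ck_cst k (c : R) : Ck k (fun _ : R * R => c).
Proof.
elim: k c => [|k IH] c; first exact: cont_cst.
apply: (@Ck_intro k _ (fun=> 0) (fun=> 0)) => //; first exact: cont_cst.
  by move=> X; exact: hasder_cst.
by move=> X; exact: hasder_cst.
Qed.

Lemma continuous_fst : continuous (fun X : R * R => X.1).
Proof. by move=> X; exact: cvg_fst. Qed.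

Lemma continuous_snd : continuous (fun X : R * R => X.2).
Proof. by move=> X; exact: cvg_snd. Qed.

Lemma Ck_fst k : Ck k (fun X => X.1).
Proof.
case: k => [|k]; first exact: continuous_fst.
apply: (@Ck_intro k _ (fun=> 1) (fun=> 0)); try exact: Ck_cst.
- exact: continuous_fst.
- by move=> X; exact: hasder_id.
- by move=> X; exact: hasder_cst.
Qed.

Lemma Ck_snd k : Ck k (fun X => X.2).
Proof.
case: k => [|k]; first exact: continuous_snd.
apply: (@Ck_intro k _ (fun=> 0) (fun=> 1)); try exact: Ck_cst.
- exact: continuous_snd.
- by move=> X; exact: hasder_cst.
- by move=> X; exact: hasder_id.
Qed.

Lemma CkD k f g : Ck k f -> Ck k g -> Ck k (fun X => f X + g X).
Proof.
elim: k f g => [|k IH] f g; first exact: contD.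
move=> /Ck_elim[cf f1 f2 F1 F2] /Ck_elim[cg g1 g2 G1 G2].
apply: (@Ck_intro k _ (fun X => d1 f X + d1 g X) (fun X => d2 f X + d2 g X)).
- exact: contD.
- by move=> X; apply: hasderD; [exact: f1|exact: g1].
- by move=> X; apply: hasderD; [exact: f2|exact: g2].
- exact: IH.
- exact: IH.
Qed.

Lemma CkM k f g : Ck k f -> Ck k g -> Ck k (fun X => f X * g X).
Proof.
elim: k f g => [|k IH] f g; first exact: contM.
move=> Hf Hg; have Cf := CkW Hf; have Cg := CkW Hg.
case/Ck_elim: Hf => cf f1 f2 F1 F2; case/Ck_elim: Hg => cg g1 g2 G1 G2.
apply: (@Ck_intro k _ (fun X => d1 f X * g X + f X * d1 g X) (fun X => d2 f X * g X + f X * d2 g X)).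
- exact: contM.
- move=> -[x y]; exact: hasderM (f1 (x, y)) (g1 (x, y)).
- move=> -[x y]; exact: hasderM (f2 (x, y)) (g2 (x, y)).
- by apply: CkD; exact: IH.
- by apply: CkD; exact: IH.
Qed.

Lemma CkN k f : Ck k f -> Ck k (fun X => - f X).
Proof.
by move=> h; have := CkM (Ck_cst k (-1)) h; under eq_fun do rewrite mulN1r.
Qed.

Lemma CkB k f g : Ck k f -> Ck k g -> Ck k (fun X => f X - g X).
Proof. by move=> hf hg; exact: CkD hf (CkN hg). Qed.

(** Radial profiles are functions of |X|^2 and not of |X|: the former is a polynomial, so smoothness
    at the origin passes to compositions. *)
Definition nsq X : R := X.1 ^+ 2 + X.2 ^+ 2.

Lemma nsq_ge0 X : 0 <= nsq X.
Proof. by rewrite addr_ge0 ?sqr_ge0. Qed.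

Lemma nsq_continuous : continuous nsq.
Proof. by apply: contD; apply: contX; [exact: continuous_fst|exact: continuous_snd]. Qed.

Lemma hasder_nsq1 X : hasder (fun x => nsq (x, X.2)) X.1 (2 * X.1).
Proof.
apply: hasder_eq; first exact: (@hasderD _ (fun x => x ^+ 2) (fun=> X.2 ^+ 2) _ _ _ (hasderX 2 (hasder_id _)) (hasder_cst _ _)).
by rewrite /=; ring.
Qed.

Lemma hasder_nsq2 X : hasder (fun y => nsq (X.1, y)) X.2 (2 * X.2).
Proof.
apply: hasder_eq; first exact: (@hasderD _ (fun=> X.1 ^+ 2) (fun x => x ^+ 2) _ _ _ (hasder_cst _ _) (hasderX 2 (hasder_id _))).
by rewrite /=; ring.
Qed.

Lemma Ck_radial k (r : R -> R) : Cn k r -> Ck k (fun X => r (nsq X)).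
Proof.
elim: k r => [|k IH] r; first by move=> cr; apply: cont_comp => //; exact: nsq_continuous.
move=> H; have cr := Cn_continuous H; case: H => r' hr Cr.
apply: (@Ck_intro k _ (fun X => r' (nsq X) * (2 * X.1)) (fun X => r' (nsq X) * (2 * X.2))).
- by apply: cont_comp => //; exact: nsq_continuous.
- by move=> [x y]; exact: (hasder_comp (hasder_nsq1 (x, y)) (hr (nsq (x, y)))).
- by move=> [x y]; exact: (hasder_comp (hasder_nsq2 (x, y)) (hr (nsq (x, y)))).
- by apply: CkM; [exact: IH|apply: CkM; [exact: Ck_cst|exact: Ck_fst]].
- by apply: CkM; [exact: IH|apply: CkM; [exact: Ck_cst|exact: Ck_snd]].
Qed.

Definition zc X : C := X.1 +i* X.2.

Definition cCk k (F : R * R -> C) := Ck k (fun X => complex.Re (F X)) /\ Ck k (fun X => complex.Im (F X)).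

Lemma cCkM k (F G : R * R -> C) : cCk k F -> cCk k G -> cCk k (fun X => F X * G X).
Proof.
move=> [f1 f2] [g1 g2]; split.
  by under eq_fun do rewrite Re_mul; apply: CkB; exact: CkM.
by under eq_fun do rewrite Im_mul; apply: CkD; exact: CkM.
Qed.

Lemma cCkD k (F G : R * R -> C) : cCk k F -> cCk k G -> cCk k (fun X => F X + G X).
Proof.
move=> [f1 f2] [g1 g2]; split.
  by under eq_fun do rewrite Re_add; exact: CkD.
by under eq_fun do rewrite Im_add; exact: CkD.
Qed.

Lemma cCk_cst k (c : C) : cCk k (fun=> c).
Proof. by split; exact: Ck_cst. Qed.

Lemma cCk_real k f : Ck k f -> cCk k (fun X => (f X)%:C).
Proof. by move=> h; split => //; exact: Ck_cst. Qed.

Lemma cCk_radial k (r : R -> C) : cCn k r -> cCk k (fun X => r (nsq X)).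
Proof.
move=> h; split.
  exact: (Ck_radial (cCn_Re h)).
exact: (Ck_radial (cCn_Im h)).
Qed.

Lemma cCkX k (F : R * R -> C) n : cCk k F -> cCk k (fun X => F X ^+ n).
Proof.
move=> h; elim: n => [|n IH]; first exact: (cCk_cst k 1).
by under eq_fun do rewrite exprS; exact: cCkM.
Qed.

Lemma cCk_zc k : cCk k zc.
Proof. by split; [exact: Ck_fst|exact: Ck_snd]. Qed.

Definition cpder1 (F : R * R -> C) X (d : C) := chasder (fun x => F (x, X.2)) X.1 d.
Definition cpder2 (F : R * R -> C) X (d : C) := chasder (fun y => F (X.1, y)) X.2 d.

Lemma cpder1_zc X : cpder1 zc X 1.
Proof. by split; [exact: hasder_id|exact: hasder_cst]. Qed.

Lemma cpder2_zc X : cpder2 zc X 'i%C.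
Proof. by split; [exact: hasder_cst|exact: hasder_id]. Qed.

Definition zb X : C := X.1 -i* X.2.

Lemma cpder1_zb X : cpder1 zb X 1.
Proof.
split; first exact: hasder_id.
by apply: (hasder_eq (hasderN (hasder_cst X.2 _))); rewrite oppr0.
Qed.

Lemma cpder2_zb X : cpder2 zb X (- 'i%C).
Proof.
by split; rewrite ?Re_opp ?Im_opp /= ?oppr0; [exact: hasder_cst|apply: hasderN; exact: hasder_id].
Qed.

Lemma zc_zb X : zc X * zb X = (nsq X)%:C.
Proof. by apply: complex_eq; rewrite !ReImE /= /nsq; ring. Qed.

Lemma cpder1_radial (r : R -> C) d X : chasder r (nsq X) d -> cpder1 (fun Y => r (nsq Y)) X (d * (2 * X.1)%:C).
Proof.
case: X => x y h; apply: chasder_comp_real; first exact: h.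
exact: (hasder_nsq1 (x, y)).
Qed.

Lemma cpder2_radial (r : R -> C) d X : chasder r (nsq X) d -> cpder2 (fun Y => r (nsq Y)) X (d * (2 * X.2)%:C).
Proof.
case: X => x y h; apply: chasder_comp_real; first exact: h.
exact: (hasder_nsq2 (x, y)).
Qed.

Lemma cpder1M (F G : R * R -> C) X a b : cpder1 F X a -> cpder1 G X b ->
  cpder1 (fun Y => F Y * G Y) X (a * G X + F X * b).
Proof. by case: X => x y ha hb; exact: chasderM ha hb. Qed.

Lemma cpder2M (F G : R * R -> C) X a b : cpder2 F X a -> cpder2 G X b ->
  cpder2 (fun Y => F Y * G Y) X (a * G X + F X * b).
Proof. by case: X => x y ha hb; exact: chasderM ha hb. Qed.

Lemma cpder1D (F G : R * R -> C) X a b : cpder1 F X a -> cpder1 G X b ->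
  cpder1 (fun Y => F Y + G Y) X (a + b).
Proof. by case: X => x y ha hb; exact: chasderD ha hb. Qed.

Lemma cpder2D (F G : R * R -> C) X a b : cpder2 F X a -> cpder2 G X b ->
  cpder2 (fun Y => F Y + G Y) X (a + b).
Proof. by case: X => x y ha hb; exact: chasderD ha hb. Qed.

Lemma cpder1X (F : R * R -> C) n X a : cpder1 F X a ->
  cpder1 (fun Y => F Y ^+ n) X (n%:R * F X ^+ n.-1 * a).
Proof. by case: X => x y ha; exact: chasderX ha. Qed.

Lemma cpder2X (F : R * R -> C) n X a : cpder2 F X a ->
  cpder2 (fun Y => F Y ^+ n) X (n%:R * F X ^+ n.-1 * a).
Proof. by case: X => x y ha; exact: chasderX ha. Qed.

Lemma cpder1_real f X (d : R) : pder1 f X d -> cpder1 (fun Y => (f Y)%:C) X d%:C.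
Proof. by case: X => x y h; exact: chasder_real. Qed.

Lemma cpder2_real f X (d : R) : pder2 f X d -> cpder2 (fun Y => (f Y)%:C) X d%:C.
Proof. by case: X => x y h; exact: chasder_real. Qed.

Lemma cpder1_Re (F : R * R -> C) X a : cpder1 F X a -> pder1 (fun Y => complex.Re (F Y)) X (complex.Re a).
Proof. by case. Qed.
Lemma cpder1_Im (F : R * R -> C) X a : cpder1 F X a -> pder1 (fun Y => complex.Im (F Y)) X (complex.Im a).
Proof. by case. Qed.
Lemma cpder2_Re (F : R * R -> C) X a : cpder2 F X a -> pder2 (fun Y => complex.Re (F Y)) X (complex.Re a).
Proof. by case. Qed.
Lemma cpder2_Im (F : R * R -> C) X a : cpder2 F X a -> pder2 (fun Y => complex.Im (F Y)) X (complex.Im a).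
Proof. by case. Qed.

End PlaneCalculus.

(** * Integration over the plane *)

Section PlaneIntegral.
Context {R : realType}.
Local Notation C := R[i].
Local Notation leb := (@lebesgue_measure R).
Local Notation mu := (leb \x leb)%E.
Local Notation plane := (measurableTypeR R * measurableTypeR R)%type.

(** The sigma-algebra on the plane is the product one, and an open set is a countable union of boxes
    with rational data. *)
Lemma open_plane_measurable (U : set (R * R)) : open U -> measurable (U : set plane).
Proof.
move=> oU.
pose box (q : rat * rat * rat) : set plane :=
  `]ratr q.1.1 - ratr q.2 : R, ratr q.1.1 + ratr q.2[ `*`
  `]ratr q.1.2 - ratr q.2 : R, ratr q.1.2 + ratr q.2[.
pose B (q : rat * rat * rat) : set plane := if `[< box q `<=` U >] then box q else set0.
have -> : U = \bigcup_(q in [set: rat * rat * rat]) B q.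
  apply/seteqP; split => [X UX|X [q _]]; last first.
    rewrite /B; case: ifPn => // /asboolP; exact.
  have [e e0 he] : exists2 e : R, 0 < e & forall Y : R * R, `|X.1 - Y.1| < e -> `|X.2 - Y.2| < e -> U Y.
    have : nbhs X U by exact: open_nbhs_nbhs.
    move=> -[[A1 A2] [/= /nbhs_ballP[e1 e10 h1] /nbhs_ballP[e2 e20 h2]] h].
    exists (Num.min e1 e2); first by rewrite lt_min e10.
    move=> Y; rewrite !lt_min => /andP[l1 _] /andP[_ l2]; apply: h; split.
      exact: h1.
    exact: h2.
  have [d hd] : exists d : rat, ratr d \in `]0, (e / 2)[%R.
    by apply: rat_in_itvoo; rewrite divr_gt0.
  move: hd; rewrite in_itv /= => /andP[d0 de].
  have [p1 hp1] : exists p : rat, ratr p \in `](X.1 - ratr d), (X.1 + ratr d)[%R.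
    by apply: rat_in_itvoo; lra.
  have [p2 hp2] : exists p : rat, ratr p \in `](X.2 - ratr d), (X.2 + ratr d)[%R.
    by apply: rat_in_itvoo; lra.
  move: hp1 hp2; rewrite !in_itv /= => /andP[a1 a2] /andP[b1 b2].
  exists (p1, p2, d) => //; rewrite /B.
  have sub : box (p1, p2, d) `<=` U.
    move=> Y; rewrite /box /= !in_itv /= => -[/andP[y1 y2] /andP[y3 y4]].
    by apply: he; rewrite ltr_norml; apply/andP; split; lra.
  rewrite ifT; last exact/asboolP.
  by rewrite /box /= !in_itv /=; split; apply/andP; split; lra.
apply: countable_bigcupT_measurable => // q; rewrite /B; case: ifPn => // _.
by apply: measurableX; exact: measurable_itv.
Qed.

Lemma continuous_plane_measurable (f : R * R -> R) : continuous f ->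
  measurable_fun [set: plane] f.
Proof.
move=> /continuousP cf; apply: (measurability _ (measurable_realfun.RGenOpens.measurableE R)).
move=> _ [_ [a [b ->] <-]]; rewrite setTI; apply: open_plane_measurable.
exact/cf/interval_open.
Qed.

Definition bounded_support (T : nmodType) (f : R * R -> T) :=
  exists2 M : R, 0 <= M & forall X, (M < `|X.1|) || (M < `|X.2|) -> f X = 0.

Lemma box_measure (M : R) : 0 <= M ->
  mu (`[- M, M] `*` `[- M, M]) = ((2 * M) * (2 * M))%:E.
Proof.
move=> M0; rewrite product_measure1E//= !lebesgue_measure_itv /=.
rewrite lte_fin; case: ltP => h; first by rewrite -EFinD -EFinM; congr EFin; ring.
have -> : M = 0 by lra.
by rewrite mule0 !mulr0.
Qed.

Lemma continuous_box_bounded (f : R * R -> R) (M : R) : 0 <= M -> continuous f ->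
  exists2 K : R, 0 <= K & forall X, `|X.1| <= M -> `|X.2| <= M -> `|f X| <= K.
Proof.
move=> M0 cf.
pose A := (`[- M, M] `*` `[- M, M]) : set (R * R).
have cA : compact A by apply: compact_setX; exact: segment_compact.
have A0 : A !=set0 by exists (0, 0); split; rewrite /= in_itv /=; apply/andP; split; lra.
have cnf : continuous (fun X => `|f X|) by exact: cont_norm.
have [X _ hX] := @compact_EVT_max _ R (fun X => `|f X|) A A0 cA (continuous_subspaceT cnf).
exists `|f X| => // Y h1 h2; apply: hX; rewrite inE; split; rewrite /= in_itv /= -ler_norml//.
Qed.

Lemma integrable_bounded_support (f : R * R -> R) :
  measurable_fun [set: plane] f -> bounded_support f ->
  (forall M : R, 0 <= M -> exists K : R, forall X, `|X.1| <= M -> `|X.2| <= M -> `|f X| <= K) ->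
  mu.-integrable setT (EFin \o f).
Proof.
move=> mf [M M0 hM] hK.
pose A : set plane := `[- M, M] `*` `[- M, M].
have mA : measurable A by apply: measurableX; exact: measurable_itv.
have -> : EFin \o f = (EFin \o f) \_ A.
  apply/funext => X; rewrite patchE; case: ifPn => // /negP hA; rewrite /= hM//.
  case: (ltP M `|X.1|) => //= h1; case: (ltP M `|X.2|) => //= h2; exfalso; apply: hA.
  by rewrite inE; split; rewrite /= in_itv /= -ler_norml.
rewrite -integrable_mkcond//; apply: measurable_bounded_integrable => //.
- exact: (eq_ind_r (fun z => (z < +oo)%E) (ltry _) (box_measure M0)).
- exact: measurable_funS mf.
- have [K hK'] := hK M M0; exists K; split; first exact: num_real.
  move=> k Kk X [/=]; rewrite !in_itv /= -!ler_norml => h1 h2.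
  by apply: le_trans (ltW Kk); exact: hK'.
Qed.

Lemma continuous_integrable (f : R * R -> R) : continuous f -> bounded_support f ->
  mu.-integrable setT (EFin \o f).
Proof.
move=> cf bf; apply: integrable_bounded_support => //; first exact: continuous_plane_measurable.
by move=> M M0; have [K _ hK] := continuous_box_bounded M0 cf; exists K.
Qed.

Lemma integral_hasder (F f : R -> R) (M : R) : 0 < M -> continuous f ->
  (forall x, hasder F x (f x)) -> (forall x, M < `|x| -> f x = 0) ->
  F M = F (- M) -> (\int[leb]_x (f x)%:E = 0)%E.
Proof.
move=> M0 cf hF f0 FM.
have -> : (\int[leb]_x (f x)%:E = \int[leb]_(x in `[(- M)%R, M%R]%classic) (f x)%:E)%E.
  rewrite [RHS]integral_mkcond; apply: eq_integral => x _; rewrite patchE.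
  case: ifPn => // /negP hA; rewrite f0//; rewrite ltNge; apply/negP => h; apply: hA.
  by rewrite inE /= in_itv /= -ler_norml.
have cF : continuous F by exact: hasder_continuous hF.
rewrite (@continuous_FTC2 R f F (- M) M).
- by rewrite FM -EFinB subrr.
- lra.
- exact: continuous_subspaceT.
- split.
  + by move=> x _; exact: hasder_derivable (hF x).
  + by apply: cvg_at_right_filter; exact: cF.
  + by apply: cvg_at_left_filter; exact: cF.
- by move=> x _; exact: hasder_derive1 (hF x).
Qed.

Lemma continuous_section1 (f : R * R -> R) y : continuous f -> continuous (fun x => f (x, y)).
Proof.
move=> cf x; apply: (@continuous_comp _ _ _ (fun x => (x, y)) f); last exact: cf.
by apply: (@cvg_pair _ _ _ _ (nbhs x) (nbhs y)) => /=; [exact: cvg_id|exact: cvg_cst].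
Qed.

Lemma continuous_section2 (f : R * R -> R) x : continuous f -> continuous (fun y => f (x, y)).
Proof.
move=> cf y; apply: (@continuous_comp _ _ _ (fun y => (x, y)) f); last exact: cf.
by apply: (@cvg_pair _ _ _ _ (nbhs x) (nbhs y)) => /=; [exact: cvg_cst|exact: cvg_id].
Qed.

Lemma bounded_support_pos (f : R * R -> R) : bounded_support f ->
  exists2 M : R, 0 < M & forall X, (M <= `|X.1|) || (M <= `|X.2|) -> f X = 0.
Proof.
move=> [M M0 hM]; exists (M + 1); first lra.
by move=> X /orP[h|h]; apply: hM; apply/orP; [left|right]; lra.
Qed.

(** By Fubini's theorem, each horizontal line contributes the difference of F at two points outside
    its support. *)
Lemma integral_pder1 (F f : R * R -> R) : continuous f -> bounded_support F ->
  (forall X, pder1 F X (f X)) -> bounded_support f -> (\int[mu]_X (f X)%:E = 0)%E.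
Proof.
move=> cf bF hF bf.
have [M M0 hM] := bounded_support_pos bF; have [N N0 hN] := bounded_support_pos bf.
have intf := continuous_integrable cf bf.
rewrite -(integral21_prod_meas1 intf) /fubini_G.
apply: integral0_eq => y _ /=.
pose K := M + N.
apply: (@integral_hasder (fun x => F (x, y)) (fun x => f (x, y)) K).
- by rewrite /K; lra.
- exact: continuous_section1.
- by move=> x; exact: (hF (x, y)).
- by move=> x hx; apply: hN; rewrite (le_trans _ (ltW hx))// /K; lra.
- rewrite !hM//= ?normrN gtr0_norm /K; lra.
Qed.

Lemma integral_pder2 (F f : R * R -> R) : continuous f -> bounded_support F ->
  (forall X, pder2 F X (f X)) -> bounded_support f -> (\int[mu]_X (f X)%:E = 0)%E.
Proof.
move=> cf bF hF bf.
have [M M0 hM] := bounded_support_pos bF; have [N N0 hN] := bounded_support_pos bf.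
have intf := continuous_integrable cf bf.
rewrite -(integral12_prod_meas1 intf) /fubini_F.
apply: integral0_eq => x _ /=.
pose K := M + N.
apply: (@integral_hasder (fun y => F (x, y)) (fun y => f (x, y)) K).
- by rewrite /K; lra.
- exact: continuous_section2.
- by move=> y; exact: (hF (x, y)).
- by move=> y hy; apply: hN; rewrite (le_trans _ (ltW hy)) ?orbT// /K; lra.
- have hK : K = `|K| by rewrite gtr0_norm /K; lra.
  by rewrite !hM//= ?normrN -hK; apply/orP; right; rewrite /K; lra.
Qed.

End PlaneIntegral.

(** * Complex integrals and the divergence theorem *)

Section ComplexPlaneIntegral.
Context {R : realType}.
Local Notation C := R[i].
Local Notation leb := (@lebesgue_measure R).
Local Notation mu := (leb \x leb)%E.
Local Notation plane := (measurableTypeR R * measurableTypeR R)%type.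
Implicit Types (f g : R * R -> R) (F G H : R * R -> C) (X : R * R).

Definition cintegrable F :=
  mu.-integrable setT (EFin \o (fun X => complex.Re (F X))) /\
  mu.-integrable setT (EFin \o (fun X => complex.Im (F X))).

Lemma integrable_sum f g : mu.-integrable setT (EFin \o f) -> mu.-integrable setT (EFin \o g) ->
  mu.-integrable setT (EFin \o (fun X => f X + g X)).
Proof. by move=> hf hg; exact: (integrableD measurableT hf hg). Qed.

Lemma integrable_scale (r : R) f : mu.-integrable setT (EFin \o f) ->
  mu.-integrable setT (EFin \o (fun X => r * f X)).
Proof. by move=> hf; exact: (integrableZl measurableT r hf). Qed.

Lemma cintegrableD F G : cintegrable F -> cintegrable G -> cintegrable (fun X => F X + G X).
Proof.
move=> [f1 f2] [g1 g2]; split.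
  by under eq_fun do rewrite Re_add; exact: integrable_sum.
by under eq_fun do rewrite Im_add; exact: integrable_sum.
Qed.

Lemma cintegrableZ (k : C) F : cintegrable F -> cintegrable (fun X => k * F X).
Proof.
move=> [f1 f2]; split.
  under eq_fun do rewrite Re_mul -mulNr; apply: integrable_sum; exact: integrable_scale.
by under eq_fun do rewrite Im_mul; apply: integrable_sum; exact: integrable_scale.
Qed.

Lemma cintegrableN F : cintegrable F -> cintegrable (fun X => - F X).
Proof. by move=> /(cintegrableZ (-1)); under eq_fun do rewrite mulN1r. Qed.

Lemma cintegrableB F G : cintegrable F -> cintegrable G -> cintegrable (fun X => F X - G X).
Proof. by move=> hF hG; exact: (cintegrableD hF (cintegrableN hG)). Qed.

Lemma cintD F G : cintegrable F -> cintegrable G ->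
  cint (fun X => F X + G X) = cint F + cint G.
Proof.
move=> [f1 f2] [g1 g2]; apply: complex_eq; rewrite ReImE /cint.
  by under eq_Rintegral do rewrite Re_add; exact: RintegralD.
by under [LHS]eq_Rintegral do rewrite Im_add; exact: RintegralD.
Qed.

Lemma cintZ (k : C) F : cintegrable F -> cint (fun X => k * F X) = k * cint F.
Proof.
move=> [f1 f2]; apply: complex_eq; rewrite ReImE /cint /=.
  under eq_Rintegral do rewrite Re_mul.
  by rewrite RintegralB//; try exact: integrable_scale; rewrite !RintegralZl.
under eq_Rintegral do rewrite Im_mul.
by rewrite RintegralD//; try exact: integrable_scale; rewrite !RintegralZl.
Qed.

Lemma cintN F : cintegrable F -> cint (fun X => - F X) = - cint F.
Proof.
move=> hF; rewrite -mulN1r -cintZ//; congr cint; apply/funext => X; by rewrite mulN1r.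
Qed.

Lemma cintB F G : cintegrable F -> cintegrable G ->
  cint (fun X => F X - G X) = cint F - cint G.
Proof. by move=> hF hG; rewrite cintD//; [rewrite cintN|exact: cintegrableN]. Qed.

Lemma bounded_supportMl (T : pzSemiRingType) (F G : R * R -> T) :
  bounded_support F -> bounded_support (fun X => F X * G X).
Proof. by move=> [M M0 h]; exists M => // X hX; rewrite h// mul0r. Qed.

Lemma bounded_supportMr (T : pzSemiRingType) (F G : R * R -> T) :
  bounded_support G -> bounded_support (fun X => F X * G X).
Proof. by move=> [M M0 h]; exists M => // X hX; rewrite h// mulr0. Qed.

Lemma bounded_supportN (T : zmodType) (F : R * R -> T) :
  bounded_support F -> bounded_support (fun X => - F X).
Proof. by move=> [M M0 h]; exists M => // X hX; rewrite h// oppr0. Qed.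

Lemma bounded_supportD (T : nmodType) (F G : R * R -> T) :
  bounded_support F -> bounded_support G -> bounded_support (fun X => F X + G X).
Proof.
move=> [M M0 h] [N N0 k]; exists (M + N); first lra.
by move=> X /orP[hX|hX]; rewrite h ?k ?addr0//; apply/orP; [left|left|right|right]; lra.
Qed.

Lemma bounded_support_real f : bounded_support f -> bounded_support (fun X => (f X)%:C).
Proof. by move=> [M M0 h]; exists M => // X hX; rewrite h. Qed.

Lemma bounded_support_Re F : bounded_support F -> bounded_support (fun X => complex.Re (F X)).
Proof. by move=> [M M0 h]; exists M => // X hX; rewrite h. Qed.

Lemma bounded_support_Im F : bounded_support F -> bounded_support (fun X => complex.Im (F X)).
Proof. by move=> [M M0 h]; exists M => // X hX; rewrite h. Qed.

Lemma cintegrable_continuous F : cCk 0 F -> bounded_support F -> cintegrable F.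
Proof.
move=> [c1 c2] b; split; apply: continuous_integrable => //.
  exact: bounded_support_Re.
exact: bounded_support_Im.
Qed.

Lemma near_norm_gt (x M : R) : M < `|x| -> \forall z \near x, M < `|z|.
Proof.
move=> hx; have e0 : 0 < `|x| - M by rewrite subr_gt0.
apply: filterS (@nbhsx_ballx R R x _ e0) => z; rewrite /ball /= => hz.
by have := ler_normD (x - z) z; rewrite subrK; lra.
Qed.

Lemma cpder1_bounded_support F F1 : (forall X, cpder1 F X (F1 X)) ->
  bounded_support F -> bounded_support F1.
Proof.
move=> hF [M M0 h]; exists M => // -[x y] /= hX.
apply: chasder_uniq (hF (x, y)) _ => /=.
apply: (@chasder_near _ (fun=> 0)); last exact: chasder_cst.
case/orP: hX => hX; last by near=> x'; rewrite h//= hX orbT.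
have hz : \forall z \near x, M < `|z| by exact: near_norm_gt.
by apply: filterS hz => z hz; rewrite h//= hz.
Unshelve. all: by end_near. Qed.

Lemma cpder2_bounded_support F F2 : (forall X, cpder2 F X (F2 X)) ->
  bounded_support F -> bounded_support F2.
Proof.
move=> hF [M M0 h]; exists M => // -[x y] /= hX.
apply: chasder_uniq (hF (x, y)) _ => /=.
apply: (@chasder_near _ (fun=> 0)); last exact: chasder_cst.
case/orP: hX => hX; first by near=> x'; rewrite h//= hX.
have hz : \forall z \near y, M < `|z| by exact: near_norm_gt.
by apply: filterS hz => z hz; rewrite h//= hz orbT.
Unshelve. all: by end_near. Qed.

Lemma cint_pder1 F F1 : cCk 0 F1 -> (forall X, cpder1 F X (F1 X)) -> bounded_support F -> cint F1 = 0.
Proof.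
move=> [c1 c2] hF b; have b1 := cpder1_bounded_support hF b.
apply: complex_eq; rewrite /cint /Rintegral /=.
  rewrite (@integral_pder1 _ (fun X => complex.Re (F X)) (fun X => complex.Re (F1 X)))//.
  - exact: bounded_support_Re.
  - by move=> X; exact: cpder1_Re.
  - exact: bounded_support_Re.
rewrite (@integral_pder1 _ (fun X => complex.Im (F X)) (fun X => complex.Im (F1 X)))//.
- exact: bounded_support_Im.
- by move=> X; exact: cpder1_Im.
- exact: bounded_support_Im.
Qed.

Lemma cint_pder2 F F2 : cCk 0 F2 -> (forall X, cpder2 F X (F2 X)) -> bounded_support F -> cint F2 = 0.
Proof.
move=> [c1 c2] hF b; have b1 := cpder2_bounded_support hF b.
apply: complex_eq; rewrite /cint /Rintegral /=.
  rewrite (@integral_pder2 _ (fun X => complex.Re (F X)) (fun X => complex.Re (F2 X)))//.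
  - exact: bounded_support_Re.
  - by move=> X; exact: cpder2_Re.
  - exact: bounded_support_Re.
rewrite (@integral_pder2 _ (fun X => complex.Im (F X)) (fun X => complex.Im (F2 X)))//.
- exact: bounded_support_Im.
- by move=> X; exact: cpder2_Im.
- exact: bounded_support_Im.
Qed.

(** The integration by parts behind all statements on classical solutions: there F and G are
    products of a smooth factor with a test function. *)
Theorem cint_divergence F G F1 G2 : cCk 0 F1 -> cCk 0 G2 ->
  (forall X, cpder1 F X (F1 X)) -> (forall X, cpder2 G X (G2 X)) ->
  bounded_support F -> bounded_support G -> cint (fun X => F1 X + G2 X) = 0.
Proof.
move=> cF cG hF hG bF bG; rewrite cintD ?(cint_pder1 cF hF bF) ?(cint_pder2 cG hG bG) ?addr0//.
  by apply: cintegrable_continuous => //; exact: cpder1_bounded_support hF bF.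
by apply: cintegrable_continuous => //; exact: cpder2_bounded_support hG bG.
Qed.

Lemma cint_eq F G : cintegrable F -> cintegrable G -> cint (fun X => F X - G X) = 0 -> cint F = cint G.
Proof. by move=> hF hG; rewrite cintB// => /subr0_eq. Qed.

Lemma cintegrable_loc F G : loc_integrable_complex F -> cCk 0 G -> bounded_support G ->
  cintegrable (fun X => F X * G X).
Proof.
move=> [F1 F2] [G1 G2] bG.
have main f g : loc_integrable f -> continuous g -> bounded_support g ->
    mu.-integrable setT (EFin \o (fun X => f X * g X)).
  move=> [mf lf] cg [M M0 hM].
  have mg := continuous_plane_measurable cg.
  pose A : set plane := `[- M, M] `*` `[- M, M].
  have mA : measurable A by apply: measurableX; exact: measurable_itv.
  have [K K0 hK] := continuous_box_bounded M0 cg.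
  have -> : EFin \o (fun X => f X * g X) = (EFin \o (fun X => f X * g X)) \_ A.
    apply/funext => X; rewrite patchE; case: ifPn => // /negP hA; rewrite /= [g X]hM ?mulr0//.
    case: (ltP M `|X.1|) => //= h1; case: (ltP M `|X.2|) => //= h2; exfalso; apply: hA.
    by rewrite inE; split; rewrite /= in_itv /= -ler_norml.
  rewrite -integrable_mkcond//.
  have fA : mu.-integrable A (EFin \o f).
    apply/integrableP; split; first by apply/measurable_EFinP; exact: measurable_funS mf.
    by apply: lf; apply: compact_setX; exact: segment_compact.
  apply: (@le_integrable _ _ _ _ _ mA _ (fun X => K%:E * (EFin \o f) X)%E).
  - by apply/measurable_EFinP; apply: measurable_funM; [exact: measurable_funS mf|exact: measurable_funS mg].
  - move=> X [/=]; rewrite !in_itv /= -!ler_norml => h1 h2.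
    rewrite lee_fin !normrM mulrC ler_wpM2r// (le_trans (hK _ h1 h2))//; exact: ler_norm.
  - exact: integrableZl.
split.
  under eq_fun do rewrite Re_mul -mulNr.
  apply: integrable_sum; apply: main => //; try exact: bounded_support_Re; try exact: bounded_support_Im.
  case: F2 => m l; split; first exact: measurable_funN.
  by move=> K /l; under eq_integral do rewrite -normrN.
under eq_fun do rewrite Im_mul.
by apply: integrable_sum; apply: main => //; [exact: bounded_support_Im|exact: bounded_support_Re].
Qed.

Lemma Lfun2_bounded_support f : continuous f -> bounded_support f -> f \in Lfun mu 2%:E.
Proof.
move=> cf bf; apply/andP; split; first by rewrite inE; exact: continuous_plane_measurable.
rewrite !inE /= /finite_norm unlock poweR_lty//.
have -> : (fun X : plane => (`|f X| `^ 2)%:E) = EFin \o (fun X => f X * f X).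
  by apply/funext => X; rewrite /= powR_mulrn// -normrX ger0_norm ?sqr_ge0.
have := continuous_integrable (contM cf cf) (bounded_supportMl f bf).
move=> /integrableP[_]; apply: le_lt_trans; apply: ge0_le_integral => //.
- by move=> X _; rewrite lee_fin -expr2 sqr_ge0.
- by apply/measurable_EFinP; apply: continuous_plane_measurable; exact: contM.
- by apply: measurableT_comp => //; apply/measurable_EFinP; apply: continuous_plane_measurable; exact: contM.
- by move=> X _; rewrite /= lee_fin ler_norm.
Qed.

Lemma cintegrable_L2 F G : L2 F -> cCk 0 G -> bounded_support G -> cintegrable (fun X => F X * G X).
Proof.
move=> [F1 F2] [G1 G2] bG.
have main f g : f \in Lfun mu 2%:E -> continuous g -> bounded_support g ->
    mu.-integrable setT (EFin \o (fun X => f X * g X)).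
  move=> hf cg bg; apply/Lfun1_integrable.
  by apply: Lfun2_mul_Lfun1 => //; exact: Lfun2_bounded_support.
split.
  under eq_fun do rewrite Re_mul -mulNr.
  apply: integrable_sum; first by apply: main => //; exact: bounded_support_Re.
  under eq_fun do rewrite mulNr -mulN1r.
  by apply: integrable_scale; apply: main => //; exact: bounded_support_Im.
under eq_fun do rewrite Im_mul.
by apply: integrable_sum; apply: main => //; [exact: bounded_support_Im|exact: bounded_support_Re].
Qed.

End ComplexPlaneIntegral.

(** * Classical solutions satisfy the distributional equations *)

Section ClassicalSolutions.
Context {R : realType}.
Local Notation C := R[i].
Local Notation leb := (@lebesgue_measure R).
Local Notation mu := (leb \x leb)%E.
Local Notation plane := (measurableTypeR R * measurableTypeR R)%type.
Implicit Types (f g phi : R * R -> R) (F G W : R * R -> C) (X : R * R).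

Lemma compact_bounded_support f : compact (closure [set X | f X != 0]) -> bounded_support f.
Proof.
move=> /compact_bounded [M [_ hM]]; exists (`|M| + 1); first by have := normr_ge0 M; lra.
move=> X hX; apply: contrapT => /eqP fX.
have : `|X| <= `|M| + 1.
  apply: hM; last exact: subset_closure.
  by have := ler_norm M; lra.
by rewrite prod_normE ge_max => /andP[h1 h2]; move: hX; rewrite !ltNge h1 h2.
Qed.

Lemma bounded_support_compact f : bounded_support f -> compact (closure [set X | f X != 0]).
Proof.
move=> [M M0 hM].
have cA : compact (`[- M, M] `*` `[- M, M] : set (R * R)) by apply: compact_setX; exact: segment_compact.
apply: (subclosed_compact _ cA); first exact: closed_closure.
have clA : closed (`[- M, M] `*` `[- M, M] : set (R * R)).
  by apply: compact_closed => //; exact: Rhausdorff2.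
rewrite closure_id in clA; rewrite clA; apply: closure_subset => X /= /eqP fX.
have : ~~ ((M < `|X.1|) || (M < `|X.2|)) by apply/negP => /hM.
by rewrite negb_or -!leNgt !in_itv /= -!ler_norml => /andP.
Qed.

Lemma test_function_Ck phi k : test_function phi -> Ck k phi.
Proof. by move=> /(_ k)[]. Qed.

Lemma test_function_bounded_support phi : test_function phi -> bounded_support phi.
Proof. by move=> /(_ 0%N)[_ /compact_bounded_support]. Qed.

Lemma cCkN k F : cCk k F -> cCk k (fun X => - F X).
Proof.
move=> [h1 h2]; split.
  by under eq_fun do rewrite Re_opp; exact: CkN.
by under eq_fun do rewrite Im_opp; exact: CkN.
Qed.

Local Ltac smooth := repeat first [assumption | exact: Ck_fst | exact: Ck_snd
  | apply: cCkD | apply: cCkN | apply: cCkM | apply: cCk_real | apply: CkD | apply: CkM].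

Section Transport.
Variables (A : R * R -> R * R) (W W1 W2 : R * R -> C).
Hypotheses (A1 : Ck 1 (fun X => (A X).1)) (A2 : Ck 1 (fun X => (A X).2)).
Hypotheses (CW : cCk 0 W) (CW1 : cCk 0 W1) (CW2 : cCk 0 W2).
Hypotheses (dW1 : forall X, cpder1 W X (W1 X)) (dW2 : forall X, cpder2 W X (W2 X)).

Lemma transport_classical phi : test_function phi -> transport A W phi =
  cint (fun X => (((A X).1)%:C * W1 X + ((A X).2)%:C * W2 X) * (phi X)%:C).
Proof.
move=> tphi; have bphi := test_function_bounded_support tphi.
have Cp := test_function_Ck 0 tphi.
have [_ p1 p2 Cp1 Cp2] := Ck_elim (CkM (test_function_Ck 1 tphi) A1).
have [_ q1 q2 Cq1 Cq2] := Ck_elim (CkM (test_function_Ck 1 tphi) A2).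
have b1 : bounded_support (fun Y => phi Y * (A Y).1) by exact: bounded_supportMl.
have b2 : bounded_support (fun Y => phi Y * (A Y).2) by exact: bounded_supportMl.
have C1 := CkW A1; have C2 := CkW A2.
rewrite /transport /div /=.
have bd1 : bounded_support (fun X => (d1 (fun Y => phi Y * (A Y).1) X)%:C).
  apply: (@cpder1_bounded_support _ (fun X => (phi X * (A X).1)%:C)); last exact: bounded_support_real.
  by move=> X; exact: cpder1_real.
have bd2 : bounded_support (fun X => (d2 (fun Y => phi Y * (A Y).2) X)%:C).
  apply: (@cpder2_bounded_support _ (fun X => (phi X * (A X).2)%:C)); last exact: bounded_support_real.
  by move=> X; exact: cpder2_real.
have iD : cintegrable (fun X => W X * (d1 (fun Y => phi Y * (A Y).1) X + d2 (fun Y => phi Y * (A Y).2) X)%:C).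
  apply: cintegrable_continuous.
    by smooth.
  under eq_fun do rewrite rmorphD.
  by apply: bounded_supportMr; exact: bounded_supportD.
have iG : cintegrable (fun X => (((A X).1)%:C * W1 X + ((A X).2)%:C * W2 X) * (phi X)%:C).
  apply: cintegrable_continuous; last by apply: bounded_supportMr; exact: bounded_support_real.
  by smooth.
apply/eqP; rewrite -subr_eq0 -opprD oppr_eq0 -cintD//; apply/eqP.
rewrite -[RHS](@cint_divergence _ (fun X => W X * (phi X * (A X).1)%:C) (fun X => W X * (phi X * (A X).2)%:C)
  (fun X => W1 X * (phi X * (A X).1)%:C + W X * (d1 (fun Y => phi Y * (A Y).1) X)%:C)
  (fun X => W2 X * (phi X * (A X).2)%:C + W X * (d2 (fun Y => phi Y * (A Y).2) X)%:C)).
- by congr cint; apply/funext => X; rewrite !rmorphD !rmorphM /=; ring.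
- by smooth.
- by smooth.
- by move=> X; apply: cpder1M => //; exact: cpder1_real.
- by move=> X; apply: cpder2M => //; exact: cpder2_real.
- by apply: bounded_supportMr; exact: bounded_support_real.
- by apply: bounded_supportMr; exact: bounded_support_real.
Qed.

End Transport.

Section Velocity.
Variables (W V1 V2 V11 V12 V21 V22 : R * R -> C).
Hypotheses (CW : cCk 0 W) (CV1 : cCk 0 V1) (CV2 : cCk 0 V2).
Hypotheses (CV11 : cCk 0 V11) (CV12 : cCk 0 V12) (CV21 : cCk 0 V21) (CV22 : cCk 0 V22).
Hypotheses (dV11 : forall X, cpder1 V1 X (V11 X)) (dV12 : forall X, cpder2 V1 X (V12 X)).
Hypotheses (dV21 : forall X, cpder1 V2 X (V21 X)) (dV22 : forall X, cpder2 V2 X (V22 X)).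
Hypothesis divV : forall X, V11 X + V22 X = 0.
Hypothesis curlV : forall X, V21 X - V12 X = W X.
Hypothesis V1oo : vanishes_at_infinity V1.
Hypothesis V2oo : vanishes_at_infinity V2.

Lemma continuous_loc_integrable F : cCk 0 F -> loc_integrable_complex F.
Proof.
have main f : continuous f -> loc_integrable f.
  move=> cf; split; first exact: continuous_plane_measurable.
  move=> K cK.
  have mK : measurable (K : set plane).
    have -> : K = ~` (~` K) by rewrite setCK.
    apply: measurableC; apply: open_plane_measurable; apply: closed_openC.
    by apply: compact_closed => //; exact: Rhausdorff2.
  have [M [_ hM]] := compact_bounded cK.
  pose N := `|M| + 1.
  have N0 : 0 <= N by rewrite /N; have := normr_ge0 M; lra.
  have [L L0 hL] := continuous_box_bounded N0 cf.
  have KX X : K X -> `|X.1| <= N /\ `|X.2| <= N.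
    move=> KX; have : `|X| <= N by apply: hM => //; rewrite /N; have := ler_norm M; lra.
    by rewrite prod_normE ge_max => /andP.
  apply: (@le_lt_trans _ _ (\int[mu]_(X in K) (cst L%:E X))%E).
    apply: ge0_le_integral => //.
    - by apply/measurable_EFinP; apply: measurableT_comp => //; apply: measurable_funS (continuous_plane_measurable cf).
    - by move=> X /KX[h1 h2]; rewrite lee_fin; exact: hL.
  rewrite integral_cst// lte_mul_pinfty ?lee_fin//.
  apply: (@le_lt_trans _ _ (mu (`[- N, N] `*` `[- N, N]))); last exact: (eq_ind_r (fun z => (z < +oo)%E) (ltry _) (box_measure N0)).
  apply: le_measure; rewrite ?inE//; first by apply: measurableX; exact: measurable_itv.
  by move=> X /KX[h1 h2]; split; rewrite /= in_itv /= -ler_norml.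
by move=> [c1 c2]; split; exact: main.
Qed.

Lemma biot_savart_classical : biot_savart W (fun X => (V1 X, V2 X)).
Proof.
split => //=.
- by split; exact: continuous_loc_integrable.
- move=> phi tphi.
  have bphi := bounded_support_real (test_function_bounded_support tphi).
  have [Cp p1 p2 Cp1 Cp2] := Ck_elim (test_function_Ck 1 tphi).
  rewrite -[RHS](@cint_divergence _ (fun X => V1 X * (phi X)%:C) (fun X => V2 X * (phi X)%:C)
    (fun X => V11 X * (phi X)%:C + V1 X * (d1 phi X)%:C)
    (fun X => V22 X * (phi X)%:C + V2 X * (d2 phi X)%:C)).
  + congr cint; apply/funext => X; have /eqP := divV X; rewrite addr_eq0 => /eqP ->.
    by rewrite mulNr addrACA addNr add0r.
  + by smooth.
  + by smooth.
  + by move=> X; apply: cpder1M => //; exact: cpder1_real.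
  + by move=> X; apply: cpder2M => //; exact: cpder2_real.
  + exact: bounded_supportMr.
  + exact: bounded_supportMr.
- move=> phi tphi.
  have bphi := bounded_support_real (test_function_bounded_support tphi).
  have [Cp p1 p2 Cp1 Cp2] := Ck_elim (test_function_Ck 1 tphi).
  have bp1 : bounded_support (fun X => (d1 phi X)%:C).
    by apply: cpder1_bounded_support bphi => X; exact: cpder1_real.
  have bp2 : bounded_support (fun X => (d2 phi X)%:C).
    by apply: cpder2_bounded_support bphi => X; exact: cpder2_real.
  apply: cint_eq.
  + apply: cintegrable_continuous.
      by smooth.
    apply: bounded_supportD; first by apply: bounded_supportMr; exact: bp2.
    by apply: bounded_supportN; apply: bounded_supportMr; exact: bp1.
  + apply: cintegrable_continuous; last exact: bounded_supportMr.
    by smooth.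
  rewrite -[RHS](@cint_divergence _ (fun X => (- V2 X) * (phi X)%:C) (fun X => V1 X * (phi X)%:C)
    (fun X => (- V21 X) * (phi X)%:C + (- V2 X) * (d1 phi X)%:C)
    (fun X => V12 X * (phi X)%:C + V1 X * (d2 phi X)%:C)).
  + congr cint; apply/funext => X; rewrite -(curlV X).
    by rewrite mulrBl opprB !mulNr addrC addrACA [RHS]addrC.
  + by smooth.
  + by smooth.
  + move=> X; apply: (@cpder1M _ (fun Y => - V2 Y)); last exact: cpder1_real.
    exact: (chasderN (dV21 X)).
  + by move=> X; apply: cpder2M => //; exact: cpder2_real.
  + exact: bounded_supportMr.
  + exact: bounded_supportMr.
Qed.

End Velocity.

Section Eigen.
Variables (A : R * R -> R * R) (Om : R * R -> R) (W W1 W2 V1 V2 : R * R -> C) (a b : R) (lam : C).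
Hypotheses (A1 : Ck 1 (fun X => (A X).1)) (A2 : Ck 1 (fun X => (A X).2)) (COm : Ck 1 Om).
Hypotheses (CW : cCk 0 W) (CW1 : cCk 0 W1) (CW2 : cCk 0 W2).
Hypotheses (dW1 : forall X, cpder1 W X (W1 X)) (dW2 : forall X, cpder2 W X (W2 X)).
Hypotheses (CV1 : cCk 0 V1) (CV2 : cCk 0 V2).
Hypothesis eqn : forall X,
  - (((A X).1)%:C * W1 X + ((A X).2)%:C * W2 X)
  - (V1 X * (d1 Om X)%:C + V2 X * (d2 Om X)%:C)
  + b%:C * (a%:C * W X + ((X.1)%:C * W1 X + (X.2)%:C * W2 X)) = lam * W X.

Lemma selfsim_equation_classical phi : test_function phi ->
  self_similar_linearized a b A Om W (fun X => (V1 X, V2 X)) phi = lam * cint (fun X => W X * (phi X)%:C).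
Proof.
move=> tphi; have bphi := bounded_support_real (test_function_bounded_support tphi).
have Cp := test_function_Ck 0 tphi.
have [_ _ _ Co1 Co2] := Ck_elim COm.
rewrite /self_similar_linearized /linearized /=.
rewrite (transport_classical A1 A2 CW CW1 CW2 dW1 dW2 tphi).
rewrite (@transport_classical (fun X => X) _ _ _ (Ck_fst 1) (Ck_snd 1) CW CW1 CW2 dW1 dW2 _ tphi).
have int F : cCk 0 F -> cintegrable (fun X => F X * (phi X)%:C).
  move=> cF; apply: cintegrable_continuous; last exact: bounded_supportMr.
  by smooth.
pose f1 X := (((A X).1)%:C * W1 X + ((A X).2)%:C * W2 X) * (phi X)%:C.
pose f2 X := (V1 X * (d1 Om X)%:C + V2 X * (d2 Om X)%:C) * (phi X)%:C.
pose f3 X := W X * (phi X)%:C.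
pose f4 X := ((X.1)%:C * W1 X + (X.2)%:C * W2 X) * (phi X)%:C.
have CA1 := CkW A1; have CA2 := CkW A2.
have i1 : cintegrable f1 by apply: int; smooth.
have i2 : cintegrable f2 by apply: int; smooth.
have i3 : cintegrable f3 by apply: int; smooth.
have i4 : cintegrable f4 by apply: int; smooth.
rewrite -/f1 -/f2 -/f3 -/f4.
have i5 := cintegrableZ a%:C i3; have i45 := cintegrableD i5 i4; have i1' := cintegrableN i1.
rewrite -(cintZ a%:C i3) -(cintZ lam i3) -(cintD i5 i4) -(cintZ b%:C i45) -(cintN i1) -(cintB i1' i2).
rewrite -(cintD (cintegrableB i1' i2) (cintegrableZ _ i45)).
congr cint; apply/funext => X; rewrite /f1 /f2 /f3 /f4 [RHS]mulrA -eqn.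
move: (A X).1%:C (A X).2%:C (V1 X) (V2 X) (W X) (W1 X) (W2 X) (d1 Om X)%:C (d2 Om X)%:C (phi X)%:C b%:C a%:C X.1%:C X.2%:C => *; ring.
Qed.

End Eigen.

Lemma lt_normc F (del : R) X : 0 < del -> sqn (F X) < del ^+ 2 -> `|F X| < del%:C.
Proof.
move=> d0 h; rewrite normc_def ltcE /= eqxx /= -(ger0_norm (ltW d0)) -sqrtr_sqr ltr_sqrt ?exprn_gt0//.
Qed.

End ClassicalSolutions.

(** * Angular modes f(|X|^2) (x + iy)^m *)

Section AngularModes.
Context {R : realType}.
Local Notation C := R[i].
Local Notation leb := (@lebesgue_measure R).
Local Notation mu := (leb \x leb)%E.
Implicit Types (f g : R -> C) (X : R * R).

(** With (x + iy)^m in place of r^m e^(i m theta), smoothness at the origin and partial derivatives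
    need no polar coordinates. *)
Definition mode f (m : nat) X : C := f (nsq X) * zc X ^+ m.

Lemma cCk_mode k f m : cCn k f -> cCk k (mode f m).
Proof. by move=> cf; apply: cCkM; [exact: cCk_radial|apply: cCkX; exact: cCk_zc]. Qed.

Lemma cpder1_mode f f1 m X : (forall s, chasder f s (f1 s)) ->
  cpder1 (mode f m) X (2 * X.1%:C * mode f1 m X + m%:R * mode f m.-1 X).
Proof.
move=> hf; rewrite (_ : _ + _ = f1 (nsq X) * (2 * X.1)%:C * zc X ^+ m + f (nsq X) * (m%:R * zc X ^+ m.-1 * 1)).
  by apply: cpder1M; [exact: cpder1_radial|exact/cpder1X/cpder1_zc].
by rewrite rmorphM rmorph_nat /mode; ring.
Qed.

Lemma cpder2_mode f f1 m X : (forall s, chasder f s (f1 s)) ->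
  cpder2 (mode f m) X (2 * X.2%:C * mode f1 m X + 'i%C * (m%:R * mode f m.-1 X)).
Proof.
move=> hf; rewrite (_ : _ + _ = f1 (nsq X) * (2 * X.2)%:C * zc X ^+ m + f (nsq X) * (m%:R * zc X ^+ m.-1 * 'i%C)).
  by apply: cpder2M; [exact: cpder2_radial|exact/cpder2X/cpder2_zc].
by rewrite rmorphM rmorph_nat /mode; ring.
Qed.

Lemma sqn_zc X : sqn (zc X) = nsq X.
Proof. by []. Qed.

Lemma zc_polar (r th : R) : zc (r * cos th, r * sin th) = r%:C * (cos th +i* sin th).
Proof. by apply: complex_eq; rewrite !ReImE /=; ring. Qed.

Lemma de_moivre (th : R) m : (cos th +i* sin th) ^+ m = (cos (m%:R * th) +i* sin (m%:R * th)) :> C.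
Proof.
elim: m => [|m IH]; first by rewrite expr0 mul0r cos0 sin0.
rewrite exprS IH -natr1 mulrDl mul1r cosD sinD.
by apply: complex_eq; rewrite !ReImE /=; ring.
Qed.

Lemma nsq_polar (r th : R) : nsq (r * cos th, r * sin th) = r ^+ 2.
Proof. by rewrite /nsq /= !exprMn -mulrDr cos2Dsin2 mulr1. Qed.

Lemma mode_polar f m (r th : R) : mode f m (r * cos th, r * sin th) =
  (f (r ^+ 2) * (r%:C) ^+ m) * (cos (m%:R * th) +i* sin (m%:R * th)).
Proof. by rewrite /mode nsq_polar zc_polar exprMn de_moivre mulrA. Qed.

Lemma mode_bounded_support f m (S : R) : (forall s, S <= s -> f s = 0) -> bounded_support (mode f m).
Proof.
move=> hf; exists (`|S| + 1); first by have := normr_ge0 S; lra.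
have sq (x : R) : `|S| + 1 < `|x| -> S <= x ^+ 2.
  move=> hx; have h1 := ler_norm S; have h2 := normr_ge0 S.
  rewrite -real_normK ?num_real// expr2; nra.
move=> [x y] /orP[] /= h; rewrite /mode hf ?mul0r// /nsq /=.
  by have := sq _ h; have := sqr_ge0 y; lra.
by have := sq _ h; have := sqr_ge0 x; lra.
Qed.

Lemma L2_mode f m (S : R) : ccontinuous f -> (forall s, S <= s -> f s = 0) -> L2 (mode f m).
Proof.
move=> cf hf; have b := mode_bounded_support m hf.
have [c1 c2] := @cCk_mode 0 f m cf.
split; apply: Lfun2_bounded_support => //; [exact: bounded_support_Re|exact: bounded_support_Im].
Qed.

Lemma U_mode f m (S : R) : ccontinuous f -> (forall s, S <= s -> f s = 0) -> U m (mode f m).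
Proof.
move=> cf hf; split; first exact: (L2_mode m cf hf).
exists (fun r => f (r ^+ 2) * (r%:C) ^+ m); apply: aeW => X r th _ ->; exact: mode_polar.
Qed.

Lemma open_box_measure_gt0 (a b c d : R) : a < b -> c < d ->
  (0 < mu (`]a, b[ `*` `]c, d[))%E.
Proof.
move=> ab cd; rewrite product_measure1E//= !lebesgue_measure_itv /= !lte_fin ab cd.
by rewrite -!EFinD -EFinM lte_fin mulr_gt0// subr_gt0.
Qed.

Lemma continuous_not_ae0 (F : R * R -> C) X : cCk 0 F -> F X != 0 -> ~ {ae mu, forall Y, F Y = 0}.
Proof.
move=> [c1 c2] FX [N [mN N0 hN]].
have cs : continuous (fun Y => sqn (F Y)) by apply: contD; exact: contX.
have oV : open ((fun Y => sqn (F Y)) @^-1` `]0, +oo[%classic).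
  by move/continuousP : cs; apply; exact: interval_open.
have VX : nbhs X ((fun Y => sqn (F Y)) @^-1` `]0, +oo[%classic).
  apply: open_nbhs_nbhs; split => //=; rewrite in_itv /= andbT lt_neqAle sqn_ge0 eq_sym sqn_eq0 FX//.
move: VX => -[[A1 A2] [/= /nbhs_ballP[e1 e10 h1] /nbhs_ballP[e2 e20 h2]] h].
pose B : set (R * R) := `]X.1 - e1, X.1 + e1[ `*` `]X.2 - e2, X.2 + e2[.
have BN : B `<=` N.
  move=> Y [/=]; rewrite !in_itv /= => /andP[y1 y2] /andP[y3 y4]; apply: hN => /= FY.
  have : 0 < sqn (F Y).
    have : (A1 `*` A2) Y.
      by split; [apply: h1|apply: h2]; rewrite /ball /= ltr_norml; apply/andP; split; lra.
    by move=> /h /=; rewrite in_itv /= andbT.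
  by rewrite FY sqn0 ltxx.
have mB : measurable (B : set (measurableTypeR R * measurableTypeR R)).
  by apply: measurableX; exact: measurable_itv.
have : (mu B <= mu N)%E by apply: le_measure => //; rewrite inE.
rewrite N0; apply/negP; rewrite -ltNge.
apply: open_box_measure_gt0; move: e10 e20 => /=; lra.
Qed.


Lemma vanishes_at_infinity_sqn (F : R * R -> C) (K S : R) : 0 <= K -> 0 < S ->
  (forall X, S <= nsq X -> sqn (F X) * nsq X <= K) -> vanishes_at_infinity F.
Proof.
move=> K0 S0 hF del d0; exists (S + K / del ^+ 2 + 1); apply: aeW => X.
have p0 : 0 <= K / del ^+ 2 by rewrite divr_ge0 ?sqr_ge0.
set Q := K / del ^+ 2 in p0 * => hX.
have sX : S + Q < nsq X.
  have e0 : 0 <= enorm X by exact: sqrtr_ge0.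
  have -> : nsq X = enorm X ^+ 2 by rewrite sqr_sqrtr// nsq_ge0.
  by rewrite expr2; nra.
apply: lt_normc => //.
have S1 : S <= nsq X by lra.
have X0 : 0 < nsq X by lra.
have := hF X S1; rewrite -ler_pdivlMr// => /le_lt_trans; apply.
rewrite ltr_pdivrMr// mulrC -ltr_pdivrMr ?exprn_gt0// -/Q; lra.
Qed.

End AngularModes.

(** * From radial profiles to an eigenfunction in the plane *)

Section AngularEigenfunction.
Context {R : realType}.
Local Notation C := R[i].
Variables (k : nat) (th : R -> R) (Om Om1 : R -> R) (om om1 psi psi1 psi2 : R -> C) (a b S : R) (lam : C).
(** Second derivatives lower the power of x + iy by two; writing n as k + 2 makes n - 1 and n - 2
    genuine predecessors. *)
Let n := k.+2.
Hypotheses (Cth : Cn 1 th) (COm : Cn 1 Om) (dOm : forall s, hasder Om s (Om1 s)).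
Hypotheses (Com : cCn 2 om) (dom : forall s, chasder om s (om1 s)).
Hypotheses (Cpsi2 : ccontinuous psi2) (dpsi : forall s, chasder psi s (psi1 s))
  (dpsi1 : forall s, chasder psi1 s (psi2 s)).
(** The Laplacian of psi(|X|^2) (x + iy)^n is 4 (s psi'' + (n + 1) psi') (x + iy)^n. *)
Hypothesis poisson : forall s : R, 0 <= s -> 4 * (s%:C * psi2 s + n.+1%:R * psi1 s) = om s.
(** On these modes the background transport is i n theta, X . grad is 2 s d/ds + n, and V . grad Om
    is - 2 i n Om' psi. *)
Hypothesis eigen : forall s : R, 0 <= s ->
  - ('i%C * n%:R * (th s)%:C * om s) + 2 * 'i%C * n%:R * (Om1 s)%:C * psi s
  + b%:C * (a%:C * om s + 2 * s%:C * om1 s + n%:R * om s) = lam * om s.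
Hypotheses (S0 : 0 < S) (om_far : forall s, S <= s -> om s = 0).
Hypotheses (psi_far : forall s, S <= s -> psi s = (s ^- n)%:C)
  (psi1_far : forall s, S <= s -> psi1 s = - n%:R * (s ^- n.+1)%:C).
Hypothesis om_neq0 : exists2 s : R, 0 < s & om s != 0.

Let A X : R * R := (th (nsq X) * - X.2, th (nsq X) * X.1).
Let Psi1 X : C := 2 * X.1%:C * mode psi1 n X + n%:R * mode psi n.-1 X.
Let Psi2 X : C := 2 * X.2%:C * mode psi1 n X + 'i%C * (n%:R * mode psi n.-1 X).
Let W := mode om n.

Let Psi11 X : C := 2 * mode psi1 n X
  + 2 * X.1%:C * (2 * X.1%:C * mode psi2 n X + n%:R * mode psi1 n.-1 X)
  + n%:R * (2 * X.1%:C * mode psi1 n.-1 X + n.-1%:R * mode psi n.-1.-1 X).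
Let Psi21 X : C := 2 * X.2%:C * (2 * X.1%:C * mode psi2 n X + n%:R * mode psi1 n.-1 X)
  + 'i%C * (n%:R * (2 * X.1%:C * mode psi1 n.-1 X + n.-1%:R * mode psi n.-1.-1 X)).
Let Psi12 X : C := 2 * X.1%:C * (2 * X.2%:C * mode psi2 n X + 'i%C * (n%:R * mode psi1 n.-1 X))
  + n%:R * (2 * X.2%:C * mode psi1 n.-1 X + 'i%C * (n.-1%:R * mode psi n.-1.-1 X)).
Let Psi22 X : C := 2 * mode psi1 n X
  + 2 * X.2%:C * (2 * X.2%:C * mode psi2 n X + 'i%C * (n%:R * mode psi1 n.-1 X))
  + 'i%C * (n%:R * (2 * X.2%:C * mode psi1 n.-1 X + 'i%C * (n.-1%:R * mode psi n.-1.-1 X))).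

Let dPsi11 X : cpder1 Psi1 X (Psi11 X).
Proof.
have dx : cpder1 (fun Y => 2 * Y.1%:C) X 2.
  by apply: chasder_eq; [apply: chasderZ; apply: chasder_real; exact: hasder_id|rewrite mulr1].
apply: cpder1D; first by apply: cpder1M => //; exact: cpder1_mode.
by apply: chasderZ; exact: cpder1_mode.
Qed.

Let dPsi12 X : cpder2 Psi1 X (Psi12 X).
Proof.
have dx : cpder2 (fun Y => 2 * Y.1%:C) X 0 by exact: (@chasder_cst _ (2 * X.1%:C) X.2).
apply: cpder2D; last by apply: chasderZ; exact: cpder2_mode.
apply: (chasder_eq (cpder2M dx (cpder2_mode n X dpsi1))).
by rewrite mul0r add0r.
Qed.

Let dPsi21 X : cpder1 Psi2 X (Psi21 X).
Proof.
have dx : cpder1 (fun Y => 2 * Y.2%:C) X 0 by exact: (@chasder_cst _ (2 * X.2%:C) X.1).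
apply: cpder1D; last by apply: chasderZ; apply: chasderZ; exact: cpder1_mode.
apply: (chasder_eq (cpder1M dx (cpder1_mode n X dpsi1))).
by rewrite mul0r add0r.
Qed.

Let dPsi22 X : cpder2 Psi2 X (Psi22 X).
Proof.
have dx : cpder2 (fun Y => 2 * Y.2%:C) X 2.
  by apply: chasder_eq; [apply: chasderZ; apply: chasder_real; exact: hasder_id|rewrite mulr1].
apply: cpder2D; first by apply: cpder2M => //; exact: cpder2_mode.
by apply: chasderZ; apply: chasderZ; exact: cpder2_mode.
Qed.

Let zE (X : R * R) : zc X = X.1%:C + 'i%C * X.2%:C.
Proof. by apply: complex_eq; rewrite !ReImE /=; ring. Qed.

Let ii : 'i%C * 'i%C = -1 :> C.
Proof. by rewrite -expr2 sqr_i. Qed.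

Let sE (X : R * R) : (nsq X)%:C = X.1%:C * X.1%:C + X.2%:C * X.2%:C :> C.
Proof. by rewrite -!rmorphM -rmorphD. Qed.

Let laplace X : Psi11 X + Psi22 X = W X.
Proof.
rewrite /W /mode -poisson ?nsq_ge0// sE /Psi11 /Psi22 /mode /n /=.
rewrite !exprS -[k.+3]addn3 -[k.+2]addn2 -[k.+1]addn1 !natrD.
have := zE X; move: (X.1)%:C (X.2)%:C (zc X) (zc X ^+ k) (psi2 _) (psi1 _) (psi _) k%:R => x y z P p2 p1 p K hz.
ring: ii hz.
Qed.

Let mixed X : - Psi21 X + Psi12 X = 0.
Proof.
rewrite /Psi21 /Psi12; move: (X.1)%:C (X.2)%:C (mode psi2 n X) (mode psi1 n.-1 X) (mode psi n.-1.-1 X) n%:R n.-1%:R => x y p2 p1 p N M.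
ring.
Qed.

Let Cpsi1 : cCn 1 psi1. Proof. by exists psi2. Qed.
Let Cpsi : cCn 2 psi. Proof. by exists psi1. Qed.
Let Cx j : cCk j (fun X : R * R => X.1%:C). Proof. by apply: cCk_real; exact: Ck_fst. Qed.
Let Cy j : cCk j (fun X : R * R => X.2%:C). Proof. by apply: cCk_real; exact: Ck_snd. Qed.
Let Cm0 m : cCk 0 (mode psi m). Proof. by apply: cCk_mode; exact: cCn_continuous Cpsi. Qed.
Let Cm1 m : cCk 0 (mode psi1 m). Proof. by apply: cCk_mode; exact: cCn_continuous Cpsi1. Qed.
Let Cm2 m : cCk 0 (mode psi2 m). Proof. exact: cCk_mode. Qed.

Let Com0 : ccontinuous om. Proof. exact: cCn_continuous Com. Qed.
Let Com1 : ccontinuous om1.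
Proof.
apply: (@cCn_continuous _ 1).
by case: Com => o h ho; rewrite (_ : om1 = o)//; apply/funext => s; exact: chasder_uniq (dom s) (h s).
Qed.
Let Cmo m : cCk 0 (mode om m). Proof. exact: cCk_mode. Qed.
Let Cmo1 m : cCk 0 (mode om1 m). Proof. exact: cCk_mode. Qed.

Local Ltac smooth := repeat match goal with
  | |- cCk _ (fun X => mode psi _ X) => exact: Cm0
  | |- cCk _ (fun X => mode psi1 _ X) => exact: Cm1
  | |- cCk _ (fun X => mode psi2 _ X) => exact: Cm2
  | |- cCk _ (fun X => mode om _ X) => exact: Cmo
  | |- cCk _ (fun X => mode om1 _ X) => exact: Cmo1
  | |- cCk _ (fun X => (fst X)%:C) => exact: Cx
  | |- cCk _ (fun X => (snd X)%:C) => exact: Cy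
  | |- cCk _ (fun=> _) => exact: cCk_cst
  | |- cCk _ (fun X => @?f X + @?g X) => apply: (@cCkD _ _ f g)
  | |- cCk _ (fun X => - @?f X) => apply: (@cCkN _ _ f)
  | |- cCk _ (fun X => @?f X * @?g X) => apply: (@cCkM _ _ f g)
  end.

(** One bound for both velocity components: z is i or 1 and x is the matching coordinate. The
    constant is 10 = 2 (4 + 1), from the two terms 2 x psi' (x + iy)^n and n psi (x + iy)^(n-1). *)
Let decay (z : C) (x : R) X : sqn z = 1 -> x ^+ 2 <= nsq X -> S <= nsq X ->
  sqn (2 * x%:C * mode psi1 n X + z * (n%:R * mode psi n.-1 X)) * nsq X <= 10 * n%:R ^+ 2 * S ^- n.
Proof.
move=> z1 xs hS; rewrite /mode psi_far// psi1_far//.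
have s0 : 0 < nsq X := lt_le_trans S0 hS.
have nC : n%:R = (n%:R : R)%:C :> C by rewrite rmorph_nat.
have twoC : 2 = (2 : R)%:C :> C by rewrite rmorph_nat.
apply: (@le_trans _ _ (10 * n%:R ^+ 2 * (nsq X) ^- n)); last first.
  by rewrite ler_wpM2l ?mulr_ge0 ?sqr_ge0// lef_pV2 ?posrE ?exprn_gt0// lerXn2r ?nnegrE// ltW.
apply: le_trans (ler_wpM2r (ltW s0) (sqnD_le _ _)) _.
rewrite nC twoC !sqnM !sqnX sqnN !sqn_real sqn_zc z1.
rewrite mul1r [in leLHS]/n -pred_Sn !exprS !invfM; set s := nsq X in s0 xs *.
have p0 : 0 < s ^+ k by rewrite exprn_gt0.
move: (s ^+ k) p0 n%:R => p p0 N.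
rewrite (_ : _ * s = N ^+ 2 * (s^-1 * (s^-1 * p^-1)) * (8 * (x ^+ 2 / s) + 2)); last by field; rewrite !gt_eqF.
rewrite [leRHS](_ : _ = N ^+ 2 * (s^-1 * (s^-1 * p^-1)) * 10); last by ring.
have si : 0 <= s^-1 by rewrite invr_ge0 ltW.
have pi : 0 <= p^-1 by rewrite invr_ge0 ltW.
apply: ler_wpM2l; first by apply: mulr_ge0; [exact: sqr_ge0|rewrite !mulr_ge0].
have : x ^+ 2 / s <= 1 by rewrite ler_pdivrMr// mul1r.
lra.
Qed.

Let V1oo : vanishes_at_infinity (fun X => - Psi2 X).
Proof.
apply: (@vanishes_at_infinity_sqn _ _ (10 * n%:R ^+ 2 * S ^- n) S) => //.
  by rewrite !mulr_ge0 ?invr_ge0 ?exprn_ge0// ltW.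
move=> X hX; rewrite sqnN; apply: decay => //; first by rewrite /sqn /=; ring.
by rewrite /nsq lerDr sqr_ge0.
Qed.

Let V2oo : vanishes_at_infinity Psi1.
Proof.
apply: (@vanishes_at_infinity_sqn _ _ (10 * n%:R ^+ 2 * S ^- n) S) => //.
  by rewrite !mulr_ge0 ?invr_ge0 ?exprn_ge0// ltW.
move=> X hX; rewrite /Psi1 -[n%:R * mode psi n.-1 X]mul1r; apply: decay => //; first by rewrite /sqn /=; ring.
by rewrite /nsq lerDl sqr_ge0.
Qed.

Let dOm1 X : d1 (fun Y => Om (nsq Y)) X = Om1 (nsq X) * (2 * X.1).
Proof. by case: X => x y; apply: d1E; exact: (hasder_comp (hasder_nsq1 (x, y)) (dOm _)). Qed.

Let dOm2 X : d2 (fun Y => Om (nsq Y)) X = Om1 (nsq X) * (2 * X.2).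
Proof. by case: X => x y; apply: d2E; exact: (hasder_comp (hasder_nsq2 (x, y)) (dOm _)). Qed.

Let W1 X : C := 2 * X.1%:C * mode om1 n X + n%:R * mode om n.-1 X.
Let W2 X : C := 2 * X.2%:C * mode om1 n X + 'i%C * (n%:R * mode om n.-1 X).

Let eigen_plane X :
  - (((A X).1)%:C * W1 X + ((A X).2)%:C * W2 X)
  - (- Psi2 X * (d1 (fun Y => Om (nsq Y)) X)%:C + Psi1 X * (d2 (fun Y => Om (nsq Y)) X)%:C)
  + b%:C * (a%:C * W X + ((X.1)%:C * W1 X + (X.2)%:C * W2 X)) = lam * W X.
Proof.
rewrite dOm1 dOm2 /W /mode [RHS]mulrA -(eigen (nsq_ge0 X)) sE /A /= /W1 /W2 /Psi1 /Psi2 /mode /n /=.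
rewrite !rmorphM !rmorphN !rmorph_nat !exprS.
have := zE X; set r := (real_complex R : {rmorphism R -> C}); rewrite -?[real_complex R]/(r : R -> C).
move: (r X.1) (r X.2) (zc X) (zc X ^+ k) (psi1 _) (psi _) (om _) (om1 _) (r (Om1 _)) (r (th _)) (r a) (r b) k.+2%:R
  => x y z P p1 p o o1 O t a' b' K hz.
ring: ii hz.
Qed.

Theorem angular_eigenfunction :
  eigenfunction (self_similar_linearized a b A (fun X => Om (nsq X))) n lam W /\ Cck_complex 2 W.
Proof.
have CW : cCk 2 W by exact: cCk_mode.
have CW0 : cCk 0 W by exact: Cmo.
have CW1 : cCk 0 W1 by rewrite /W1; smooth.
have CW2 : cCk 0 W2 by rewrite /W2; smooth.
have CP1 : cCk 0 Psi1 by rewrite /Psi1; smooth.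
have CP2 : cCk 0 (fun X => - Psi2 X) by rewrite /Psi2; smooth.
split; last first.
  have [c1 c2] := CW; have bs := mode_bounded_support n om_far.
  split; split => //; apply: bounded_support_compact; [exact: bounded_support_Re|exact: bounded_support_Im].
split.
- exact: (U_mode n Com0 om_far).
- case: om_neq0 => s s0 os; apply: (@continuous_not_ae0 _ _ (Num.sqrt s, 0)) => //.
  rewrite /W /mode mulf_neq0 ?expf_neq0//.
    by rewrite /nsq /= sqr_sqrtr ?(ltW s0)// expr0n addr0.
  by rewrite -sqn_eq0 sqn_zc /nsq /= sqr_sqrtr ?(ltW s0)// expr0n addr0 gt_eqF.
(* The velocity is the rotated gradient (- d2, d1) of the stream function psi(|X|^2) (x + iy)^n. *)
exists (fun X => (- Psi2 X, Psi1 X)).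
  apply: (@biot_savart_classical _ W (fun X => - Psi2 X) Psi1 (fun X => - Psi21 X) (fun X => - Psi22 X) Psi11 Psi12).
  - by [].
  - by [].
  - by [].
  - by rewrite /Psi21; smooth.
  - by rewrite /Psi22; smooth.
  - by rewrite /Psi11; smooth.
  - by rewrite /Psi12; smooth.
  - by move=> X; exact: (chasderN (dPsi21 X)).
  - by move=> X; exact: (chasderN (dPsi22 X)).
  - exact: dPsi11.
  - exact: dPsi12.
  - exact: mixed.
  - by move=> X; rewrite opprK; exact: laplace.
  - exact: V1oo.
  - exact: V2oo.
move=> phi tphi; apply: (@selfsim_equation_classical _ A (fun X => Om (nsq X)) W W1 W2) => //.
- by apply: CkM; [exact: Ck_radial|apply: CkN; exact: Ck_snd].
- by apply: CkM; [exact: Ck_radial|exact: Ck_fst].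
- exact: Ck_radial.
- by move=> X; exact: cpder1_mode.
- by move=> X; exact: cpder2_mode.
Qed.

End AngularEigenfunction.

(** * Background profiles as functions of |X|^2 *)

Section RealLog.
Context {R : realType}.

(** The counterpart of [log_ext] for background profiles, which near the origin equal a constant c;
    the extension by that same c is smooth. *)
Definition rlog (chi : R -> R) (c s : R) : R := if 0 < s then chi (ln s) else c.

Lemma rlog_near_pos (chi : R -> R) (c s : R) : 0 < s -> \forall x \near s, chi (ln x) = rlog chi c x.
Proof.
move=> s0; near=> x; rewrite /rlog ifT//; near: x; exact: lt_nbhsr.
Unshelve. all: by end_near. Qed.

Lemma rlog_flat chi c al s : (forall t, t < al -> chi t = c) -> s < expR al -> rlog chi c s = c.
Proof.
move=> hc sal; rewrite /rlog; case: ifPn => // s0; apply: hc.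
by rewrite -ltr_expR lnK.
Qed.

Lemma hasder_rlog chi chi' c al : (forall t, t < al -> chi t = c) -> (forall t, hasder chi t (chi' t)) ->
  forall s, hasder (rlog chi c) s (rlog (fun t => chi' t * expR (- t)) 0 s).
Proof.
move=> hc hd s; have [s0|s0] := ltP 0 s.
  apply: (hasder_near (rlog_near_pos chi c s0)); rewrite /rlog s0.
  apply: hasder_eq; first exact: (hasder_comp (hasder_ln s0 (hasder_id s)) (hd _)).
  by rewrite expRN lnK// mulr1.
rewrite {2}/rlog ifN -?leNgt//; apply: (@hasder_near _ (fun=> c)); last exact: hasder_cst.
have sal : s < expR al by apply: le_lt_trans s0 _; exact: expR_gt0.
by apply: filterS (lt_nbhsl sal) => x hx; rewrite (rlog_flat hc).
Qed.

Lemma rlog_smooth k chi c al : Cn k chi -> (forall t, t < al -> chi t = c) -> Cn k (rlog chi c).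
Proof.
elim: k chi c => [|k IH] chi c /=.
  move=> cchi hc s; have [s0|s0] := ltP 0 s.
    have cln : {for s, continuous (fun x => chi (ln x))}.
      by apply: (@continuous_comp _ _ _ (@ln R) chi); [exact: continuous_ln|exact: cchi].
    rewrite /continuous_at -(nbhs_singleton (rlog_near_pos chi c s0)).
    by apply: cvg_trans cln; apply: near_eq_cvg; exact: rlog_near_pos.
  apply: (@hasder_cont _ _ _ 0).
  have sal : s < expR al by apply: le_lt_trans s0 _; exact: expR_gt0.
  apply: (@hasder_near _ (fun=> c)); last exact: hasder_cst.
  by apply: filterS (lt_nbhsl sal) => x hx; rewrite (rlog_flat hc).
case=> chi' hd Ck' hc; exists (rlog (fun t => chi' t * expR (- t)) 0); first exact: hasder_rlog hc hd.
apply: IH; first by apply: CnM => //; apply: Cn_comp; [exact: Cn_exp|apply: CnN; exact: Cn_id].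
move=> t tal; rewrite (_ : chi' t = 0) ?mul0r//; apply: hasder_uniq (hd t) _.
apply: (@hasder_near _ (fun=> c)); last exact: hasder_cst.
by apply: filterS (lt_nbhsl tal) => x hx; rewrite hc.
Qed.

End RealLog.

(** * The self-similar eigenfunction and its regularity *)

Section SelfSimilarProfile.
Context {R : realType}.
Local Notation C := R[i].

Lemma cdot_scale (z w : C) (r : R) : cdot z (w * z * r%:C) = complex.Re w * r * sqn z.
Proof. by rewrite /cdot /sqn !ReImE /=; ring. Qed.

Context (k : nat) (th th1 th2 th3 : R -> R) (al be c2 a b : R) (lam : C) (psi eta q : R -> C).
Let n := k.+2.
Local Notation nn := (n%:R : R).
Hypothesis albe : al <= be.
Hypothesis Dth : forall t, hasder th t (th1 t).
Hypothesis Dth1 : forall t, hasder th1 t (th2 t).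
Hypothesis Dth2 : forall t, hasder th2 t (th3 t).
Hypothesis cth3 : continuous th3.
Hypothesis p_right : forall t, be <= t -> th1 t + th2 t = 0.
Hypothesis p_left : forall t, t <= al -> th1 t + th2 t = 0.
Hypothesis th_left : forall t, t <= al -> th t = c2.
Hypothesis b0 : 0 < b.
Hypothesis sol : is_selfsim n th th1 th2 be a b lam psi eta q.
Hypothesis det0 : selfsim_det n al c2 a b lam (eta al) (q al) = 0.
(** This says (Re lambda - b m) / (2 b) >= 4, that is, Re kap >= 4. A C^2 profile asks for the
    exponent 3 in [log_flat_power], and the vorticity 4 e^(-t) q loses one more power. *)
Hypothesis large : b * (a + nn + 6) <= complex.Re lam.

Let m : R := a + nn - 2.
(** The exponent of q as a function of t to the left of [al], where the background rotates rigidly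
    and p = 0. *)
Let kap : C := (lam + 'i%C * (nn * c2)%:C - (b * m)%:C) / (2 * b)%:C.

Let Cth2 : Cn 1 th2. Proof. by exists th3. Qed.
Let Cth1 : Cn 2 th1. Proof. by exists th2. Qed.
Let Cth : Cn 3 th. Proof. by exists th1. Qed.

Let th1_left t : t < al -> th1 t = 0.
Proof.
move=> tal; apply: hasder_uniq (Dth t) _; apply: (@hasder_near _ (fun=> c2)); last exact: hasder_cst.
by apply: filterS (lt_nbhsl tal) => x hx; rewrite th_left// ltW.
Qed.

Let dpsi t : chasder psi t ((expR (- nn * t))%:C * eta t). Proof. by case: sol => _ _ _ /(_ t)[]. Qed.
Let deta t : chasder eta t ((expR (nn * t))%:C * q t). Proof. by case: sol => _ _ _ /(_ t)[]. Qed.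
Let dq t : chasder q t ((((lam + 'i%C * (nn * th t)%:C) - (b * m)%:C) * q t - 'i%C * (nn * (th1 t + th2 t))%:C * psi t) / (2 * b)%:C).
Proof. by case: sol => _ _ _ /(_ t)[]. Qed.

Let Cexpn (r : R) j : cCn j (fun t => (expR (r * t))%:C).
Proof. by apply: cCn_real; apply: Cn_comp; [exact: Cn_exp|apply: CnM; [exact: Cn_cst|exact: Cn_id]]. Qed.

(** Bootstrap through the first-order system. The coefficients contain theta and its first two
    derivatives, and the third is continuous, which allows two rounds. *)
Let smooth j : (j <= 2)%N -> [/\ cCn j psi, cCn j eta & cCn j q].
Proof.
elim: j => [_|j IH j2].
  by split; apply: chasder_continuous; [exact: dpsi|exact: deta|exact: dq].
have [cp ce cq] := IH (ltnW j2).
have Wth : Cn j th by case: j j2 {IH cp ce cq} => [|[|//]] _; [exact: Cn_continuous Cth|exact/CnW/CnW].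
have Wth1 : Cn j th1 by case: j j2 {IH cp ce cq Wth} => [|[|//]] _; [exact: Cn_continuous Cth1|exact/CnW].
have Wth2 : Cn j th2 by case: j j2 {IH cp ce cq Wth Wth1} => [|[|//]] _; [exact: Cn_continuous Cth2|].
have Cr (f : R -> R) : Cn j f -> cCn j (fun t => (nn * f t)%:C).
  by move=> hf; apply: cCn_real; apply: CnM => //; exact: Cn_cst.
split.
- by exists (fun t => (expR (- nn * t))%:C * eta t) => //; apply: cCnM.
- by exists (fun t => (expR (nn * t))%:C * q t) => //; apply: cCnM.
- eexists; first exact: dq.
  apply: cCnM; last exact: cCn_cst.
  apply: cCnD; last apply: cCnN; apply: cCnM => //.
    apply: cCnD; last exact: cCn_cst.
    by apply: cCnD; [exact: cCn_cst|apply: cCnM; [exact: cCn_cst|exact: Cr]].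
  by apply: cCnM; [exact: cCn_cst|apply: Cr; exact: CnD].
Qed.

(** Beyond [be] the equation of q is homogeneous, so |q|^2 e^(-r t) is constant, and it is 0 at
    [be]. *)
Let q_right t : be <= t -> q t = 0.
Proof.
case: sol => _ _ q0 _ bt; pose r := (complex.Re lam - b * m) / b.
suff : sqn (q be) * expR (- r * be) = sqn (q t) * expR (- r * t).
  rewrite q0 sqn0 mul0r => /esym/eqP; rewrite mulf_eq0 [expR _ == 0]gt_eqF ?expR_gt0// orbF.
  by rewrite sqn_eq0 => /eqP.
apply: (@hasder0_cst _ (fun x => sqn (q x) * expR (- r * x))) => // x /andP[bx _].
apply: hasder_eq.
  apply: hasderM; first by apply: hasder_sqn; exact: dq.
  by apply: hasder_exp; apply: hasderZ; exact: hasder_id.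
rewrite p_right// mulr0 mulr0 mul0r subr0 -fmorphV cdot_scale !ReImE /= /r.
by field; rewrite gt_eqF.
Qed.

Let eta_right t : be <= t -> eta t = - n%:R.
Proof.
case: sol => _ <- _ _ bt; apply/esym; apply: chasder0_cst => // x /andP[bx _].
by apply: (chasder_eq (deta x)); rewrite q_right// mulr0.
Qed.

Let psi_right t : be <= t -> psi t = (expR (- nn * t))%:C.
Proof.
case: sol => p0 _ _ _ bt.
suff : psi be - (expR (- nn * be))%:C = psi t - (expR (- nn * t))%:C.
  by rewrite p0 subrr => /esym/eqP; rewrite subr_eq0 => /eqP.
apply: (@chasder0_cst _ (fun x => psi x - (expR (- nn * x))%:C)) => // x /andP[bx _].
apply: chasder_eq.
  apply: chasderB; first exact: dpsi.
  apply: chasder_real; apply: hasder_exp; apply: hasderZ; exact: hasder_id.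
rewrite eta_right// mulr1 !rmorphM rmorphN rmorph_nat /=; ring.
Qed.

Let Re_kap : 4 <= complex.Re kap.
Proof.
have -> : complex.Re kap = (complex.Re lam - b * m) / (2 * b).
  by rewrite /kap -fmorphV !ReImE /=; ring.
by rewrite ler_pdivlMr ?mulr_gt0//; have := large; rewrite /m; lra.
Qed.

Let twob : (2 * b)%:C != 0 :> C.
Proof. by rewrite -sqn_eq0 sqn_real sqrf_eq0 mulf_neq0 ?gt_eqF. Qed.

Let c0 : C := q al * cexp (- kap) al.

Let q_left t : t <= al -> q t = c0 * cexp kap t.
Proof.
move=> tal.
suff : q t * cexp (- kap) t = c0.
  move=> <-; rewrite -mulrA cexpM addNr.
  by rewrite (_ : cexp 0 t = 1) ?mulr1// cexp_real mul0r expR0.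
apply: (@chasder0_cst _ (fun x => q x * cexp (- kap) x)) => // x /andP[_ xal].
apply: chasder_eq; first by apply: chasderM; [exact: dq|exact: chasder_cexp].
rewrite th_left// p_left// /kap; move: twob; move: (2 * b)%:C => d d0.
by field.
Qed.

Let kap_neq0 : kap != 0.
Proof. by apply/negP => /eqP E; have := Re_kap; rewrite E /=; lra. Qed.

Let nkap_neq0 : n%:R + kap != 0.
Proof.
apply/negP => /eqP /(congr1 (@complex.Re R)); rewrite ReImE Re_nat /= => E.
have := Re_kap; have : 0 <= nn by []; lra.
Qed.

Let expnE t : (expR (nn * t))%:C = cexp n%:R t.
Proof. by rewrite -cexp_real rmorph_nat. Qed.

Let expnNE t : (expR (- nn * t))%:C = cexp (- n%:R) t.
Proof. by rewrite -cexp_real rmorphN rmorph_nat. Qed.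

(** The power on the right solves the equation of eta, and [det0] says precisely that eta meets it
    at [al]. Otherwise eta would keep an additive constant and psi a multiple of e^(-nt), singular
    at the origin. *)
Let eta_left t : t <= al -> eta t = c0 / (n%:R + kap) * cexp (n%:R + kap) t.
Proof.
move=> tal; pose E x := c0 / (n%:R + kap) * cexp (n%:R + kap) x.
have Eal : eta al = E al.
  have h : 2 * b%:C * (n%:R + kap) * eta al = 2 * b%:C * (c0 * cexp (n%:R + kap) al).
    have /eqP := det0; rewrite /selfsim_det subr_eq0 => /eqP h.
    have -> : c0 * cexp (n%:R + kap) al = q al * (expR (nn * al))%:C.
      by rewrite /c0 expnE -mulrA cexpM addrCA addNr addr0.
    transitivity ((2 * b * expR (nn * al))%:C * q al).
      rewrite -h; congr (_ * _).
      have -> : 2 * b%:C * (n%:R + kap) = (2 * b)%:C * n%:R + (2 * b)%:C * kap by rewrite -mulrDr rmorphM rmorph_nat.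
      have -> : (b * (nn + 2 - a))%:C = (2 * b)%:C * n%:R - (b * m)%:C.
        have -> : n%:R = nn%:C :> C by rewrite rmorph_nat.
        by rewrite -rmorphM -rmorphB; congr (_%:C); rewrite /m; ring.
      by rewrite /kap [_ * (_ / _)]mulrC divfK//; ring.
    by rewrite !rmorphM rmorph_nat; ring.
  rewrite /E; move: twob nkap_neq0 h; rewrite rmorphM rmorph_nat.
  move: (2 * b%:C) (n%:R + kap) (c0) (cexp _ al) (eta al) => d nk z w e d0 nk0 h.
  apply: (mulfI d0); apply: (mulfI nk0).
  rewrite [LHS](_ : _ = d * nk * e); last by ring.
  by rewrite h; field.
apply/eqP; rewrite -subr_eq0; apply/eqP.
have -> : 0 = eta al - E al by rewrite Eal subrr.
apply: (@chasder0_cst _ (fun x => eta x - E x)) => // x /andP[_ xal].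
apply: chasder_eq.
  by apply: chasderB; [exact: deta|apply: chasderZ; exact: chasder_cexp].
rewrite q_left// expnE -(cexpM n%:R kap) [c0 / _ * _]mulrA divfK//.
by move: (cexp _ x) (cexp _ x) (c0) => u v w; ring.
Qed.

(** The value of the stream profile at the origin; subtracting it leaves a pure power, to which
    [log_flat_power] applies. *)
Let psi0 : C := psi al - c0 / (n%:R + kap) / kap * cexp kap al.

Let psi_left t : t <= al -> psi t - psi0 = c0 / (n%:R + kap) / kap * cexp kap t.
Proof.
move=> tal; pose E x := c0 / (n%:R + kap) / kap * cexp kap x.
have -> : psi t - psi0 = (psi t - E t) - (psi al - E al) + E t by rewrite /psi0 /E; ring.
rewrite (_ : psi t - E t = psi al - E al) ?subrr ?add0r//.
apply: (@chasder0_cst _ (fun x => psi x - E x)) => // x /andP[_ xal].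
apply: chasder_eq.
  by apply: chasderB; [exact: dpsi|apply: chasderZ; exact: chasder_cexp].
rewrite eta_left// expnNE.
have -> : cexp kap x = cexp (- n%:R) x * cexp (n%:R + kap) x by rewrite cexpM addKr.
rewrite [c0 / _ / _ * _]mulrA divfK//.
by move: (cexp _ x) (cexp _ x) (c0 / _) => u v w; ring.
Qed.

(** [chi1] is the t-derivative of psi, and [chi1] e^(-t) its s-derivative; [chi2] is the
    t-derivative of the latter. [chiom] = 4 e^(-t) q is the vorticity profile. Each further e^(-t)
    converts a t-derivative into an s-derivative. *)
Let chi1 t : C := (expR (- nn * t))%:C * eta t.
Let chi2 t : C := (q t - n.+1%:R * chi1 t) * (expR (- t))%:C.
Let chiom t : C := 4 * ((expR (- t))%:C * q t).
Let q1 t : C := (((lam + 'i%C * (nn * th t)%:C) - (b * m)%:C) * q t - 'i%C * (nn * (th1 t + th2 t))%:C * psi t) / (2 * b)%:C.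
Let chiom1 t : C := 4 * ((expR (- t))%:C * (q1 t - q t)).

Let dexpN t : hasder (fun s : R => expR (- s)) t (- expR (- t)).
Proof. by apply: hasder_eq; [apply: hasder_exp; apply: hasderN; exact: hasder_id|rewrite mulrN1]. Qed.

Let dchi1 t : chasder (fun s => chi1 s * (expR (- s))%:C) t (chi2 t).
Proof.
apply: chasder_eq.
  apply: chasderM; last by apply: chasder_real; exact: dexpN.
  apply: chasderM; last exact: deta.
  by apply: chasder_real; apply: hasder_exp; apply: hasderZ; exact: hasder_id.
have e : (expR (- nn * t))%:C * ((expR (nn * t))%:C * q t) = q t.
  by rewrite mulrA -rmorphM -expRD mulNr addNr expR0 mul1r.
rewrite /chi2 /chi1 e mulr1 !rmorphM !rmorphN rmorph_nat -[n.+1%:R]natr1.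
by move: n%:R => N; ring.
Qed.

Let dchiom t : chasder chiom t (chiom1 t).
Proof.
apply: chasder_eq.
  by apply: chasderZ; apply: chasderM; [apply: chasder_real; exact: dexpN|exact: dq].
by rewrite rmorphN -/(q1 t) /chiom1; ring.
Qed.

Let psiflat : log_flat al 2 (fun t => psi t - psi0).
Proof.
apply: (@log_flat_power _ _ _ _ (c0 / (n%:R + kap) / kap) kap).
- by apply: cCnD; [case: (smooth (leqnn 2))|exact: cCn_cst].
- by have := Re_kap; lra.
- by move=> t tal; apply: psi_left; exact: ltW.
Qed.

Let omflat : log_flat al 2 chiom.
Proof.
apply: (@log_flat_power _ _ _ _ (4 * c0) (kap - 1)).
- apply: cCnM; first exact: cCn_cst.
  apply: cCnM; last by case: (smooth (leqnn 2)).
  by apply: cCn_real; apply: Cn_comp; [exact: Cn_exp|apply: CnN; exact: Cn_id].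
- have -> : complex.Re (kap - 1) = complex.Re kap - 1 by rewrite !ReImE.
  by have := Re_kap; lra.
- move=> t tal; rewrite /chiom q_left ?(ltW tal)// -(cexpM kap (-1)).
  have -> : (expR (- t))%:C = cexp (-1) t.
    have -> : -1 = (-1 : R)%:C :> C by rewrite rmorphN.
    by rewrite cexp_real mulN1r.
  by move: (cexp _ t) (cexp _ t) (c0) => u v w; ring.
Qed.

Let psiS s := psi0 + log_ext (fun t => psi t - psi0) s.
Let psi1S := log_ext (fun t => chi1 t * (expR (- t))%:C).
Let psi2S := log_ext (fun t => chi2 t * (expR (- t))%:C).
Let omS := log_ext chiom.
Let om1S := log_ext (fun t => chiom1 t * (expR (- t))%:C).

Let psi_regular : [/\ forall s, chasder psiS s (psi1S s), forall s, chasder psi1S s (psi2S s) & ccontinuous psi2S].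
Proof.
have [[K [K0 hK]] [f hf flat1]] := psiflat.
have fE : f = chi1.
  apply/funext => t; apply: chasder_uniq (hf t) _.
  by apply: chasder_eq; [apply: chasderB; [exact: dpsi|exact: chasder_cst]|rewrite subr0].
move: flat1 hf; rewrite fE => -[[L [L0 hL]] [g hg flat2]] hf.
have gE : g = chi2 by apply/funext => t; exact: chasder_uniq (hg t) (dchi1 t).
move: flat2 hg; rewrite gE => flat2 hg.
split.
- move=> s; apply: chasder_eq; first by apply: chasderD; [exact: chasder_cst|exact: (chasder_log_ext K0 hK hf)].
  by rewrite add0r.
- exact: (chasder_log_ext L0 hL hg).
- exact: (@log_ext_smooth _ al 0 _ flat2).
Qed.

Let om_regular : cCn 2 omS /\ forall s, chasder omS s (om1S s).
Proof.
split; first exact: (log_ext_smooth omflat).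
have [[K [K0 hK]] _] := omflat.
exact: (chasder_log_ext K0 hK dchiom).
Qed.

Let log_extE (f : R -> C) (s : R) : 0 < s -> log_ext f s = f (ln s).
Proof. by rewrite /log_ext => ->. Qed.

Let log_ext0 (f : R -> C) : log_ext f 0 = 0.
Proof. by rewrite /log_ext ltxx. Qed.

Let expN_ln (s : R) : 0 < s -> expR (- ln s) = s^-1.
Proof. by move=> s0; rewrite expRN lnK. Qed.

(** If q vanished identically, eta would be constant; but it is - n at [be], and by [eta_left] it
    would be 0 at [al]. *)
Let q_neq0 : exists t, q t != 0.
Proof.
apply: contrapT => h.
have q0 t : q t = 0 by apply: contrapT => /eqP qt; apply: h; exists t.
have : eta al = 0 by rewrite eta_left// /c0 q0 !mul0r.
have : eta al = eta be.
  by apply: chasder0_cst => // t _; apply: (chasder_eq (deta t)); rewrite q0 mulr0.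
by rewrite (eta_right (lexx be)) => -> /eqP; rewrite oppr_eq0 pnatr_eq0.
Qed.

Theorem selfsim_eigenfunction : exists W, eigenfunction (self_similar_linearized a b
    (fun X : R * R => (rlog th c2 (nsq X) * - X.2, rlog th c2 (nsq X) * X.1))
    (fun X : R * R => rlog (fun t => 2 * (th t + th1 t)) (2 * c2) (nsq X))) n lam W /\ Cck_complex 2 W.
Proof.
have [dp1 dp2 cp] := psi_regular; have [cO dO] := om_regular.
pose Om1 := rlog (fun t => 2 * (th1 t + th2 t) * expR (- t)) 0.
exists (mode omS n).
apply: (@angular_eigenfunction _ k (rlog th c2) (rlog (fun t => 2 * (th t + th1 t)) (2 * c2)) Om1 omS om1S psiS psi1S psi2S a b (expR be) lam) => //.
- by apply: (@rlog_smooth _ _ _ _ al); [exact/CnW/CnW|move=> t tal; rewrite th_left// ltW].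
- apply: (@rlog_smooth _ _ _ _ al); last by move=> t tal; rewrite th_left ?ltW// th1_left// addr0.
  by apply: CnM; [exact: Cn_cst|apply: CnD; [exact/CnW/CnW|exact/CnW]].
- apply: (@hasder_rlog _ _ _ _ al); first by move=> t tal; rewrite th_left ?ltW// th1_left// addr0.
  by move=> t; apply: hasderZ; apply: hasderD.
- move=> s; rewrite le_eqVlt => /predU1P[<-|s0].
    by rewrite /psi2S /psi1S /omS !log_ext0 !mulr0 addr0 mulr0.
  rewrite /psi2S /psi1S /omS !log_extE// /chi2 /chiom expN_ln//.
  have sC : s%:C * (s^-1)%:C = 1 :> C by rewrite -rmorphM divff ?gt_eqF.
  rewrite /n; move: (chi1 _) (q _) k.+3%:R (s%:C) ((s^-1)%:C) sC => u v N x y xy.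
  ring: xy.
- move=> s; rewrite le_eqVlt => /predU1P[<-|s0].
    by rewrite /om1S /omS /Om1 !log_ext0 /rlog ltxx !mulr0 mul0r !addr0 !mulr0 oppr0 addr0.
  rewrite /psiS /omS /om1S /Om1 !log_extE// /rlog s0 /chiom1 /chiom expN_ln// [psi0 + _]addrC subrK.
  have sC : s%:C * (s^-1)%:C = 1 :> C by rewrite -rmorphM divff ?gt_eqF.
  pose E := ((lam + 'i%C * (nn * th (ln s))%:C) - (b * m)%:C) * q (ln s) - 'i%C * (nn * (th1 (ln s) + th2 (ln s)))%:C * psi (ln s).
  have bq : (2 * b)%:C * q1 (ln s) = E by rewrite /q1 -/E mulrC divfK.
  apply/eqP; rewrite -subr_eq0; apply/eqP.
  rewrite (_ : _ - _ = 4 * (s^-1)%:C * ((2 * b)%:C * q1 (ln s) - E)); first by rewrite bq subrr mulr0.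
  have nC : n%:R = nn%:C :> C by rewrite rmorph_nat.
  rewrite nC /E /m; move: nn => N.
  rewrite !rmorphM !rmorphB !rmorphD rmorph1 /=.
  move: N%:C (q1 _) (q _) (psi _) (th _)%:C (th1 _)%:C (th2 _)%:C s%:C (s^-1)%:C sC => M u v w x x1 x2 y y1 yy.
  by move: a%:C b%:C => a' b'; ring: yy.
- exact: expR_gt0.
- move=> s hs; have s0 : 0 < s := lt_le_trans (expR_gt0 _) hs.
  by rewrite /omS log_extE// /chiom q_right ?mulr0// -ler_expR lnK.
- move=> s hs; have s0 : 0 < s := lt_le_trans (expR_gt0 _) hs.
  rewrite /psiS log_extE// [psi0 + _]addrC subrK psi_right; last by rewrite -ler_expR lnK.
  by rewrite mulNr expRN expRM_natl lnK.
- move=> s hs; have s0 : 0 < s := lt_le_trans (expR_gt0 _) hs.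
  rewrite /psi1S log_extE// /chi1 eta_right; last by rewrite -ler_expR lnK.
  have e : expR (- nn * ln s) = (s ^+ n)^-1 by rewrite mulNr expRN expRM_natl lnK.
  by rewrite e expN_ln// mulrAC -rmorphM -invfM -exprSr mulrC.
- case: q_neq0 => t qt; exists (expR t); first exact: expR_gt0.
  rewrite /omS log_extE ?expR_gt0// expRK /chiom !mulf_neq0// ?pnatr_eq0//.
  by rewrite -sqn_eq0 sqn_real sqrf_eq0 gt_eqF ?expR_gt0.
Qed.

End SelfSimilarProfile.

(** * The mollified vortex in logarithmic radius *)

Section MollifiedVortex.
Context {R : realType}.
Local Notation leb := (@lebesgue_measure R).

Lemma ftc_itv (F f : R -> R) (a b : R) : a < b -> continuous f -> (forall x, hasder F x (f x)) ->
  \int[leb]_(x in `[a, b]) f x = F b - F a.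
Proof.
move=> ab cf hF; have cF : continuous F by exact: hasder_continuous hF.
rewrite /Rintegral (@continuous_FTC2 R f F a b)//.
- exact: continuous_subspaceT.
- split.
  + by move=> x _; exact: hasder_derivable (hF x).
  + by apply: cvg_at_right_filter; exact: cF.
  + by apply: cvg_at_left_filter; exact: cF.
- by move=> x _; exact: hasder_derive1 (hF x).
Qed.

Lemma Cn_derive1n (f : R -> R) : (forall k x, derivable (derive1n k f) x 1) -> forall k, Cn k f.
Proof.
move=> hf k.
have D j t : hasder (derive1n j f) t (derive1n j.+1 f t).
  by rewrite derive1nS; split; [exact: hf|rewrite derive1E].
suff : forall j, Cn k (derive1n j f) by move=> /(_ 0%N).
elim: k => [|k IH] j; first exact: hasder_continuous (D j).
by exists (derive1n j.+1 f); [exact: D|exact: IH].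
Qed.

(** Besides describing the mollified profile, H is the smooth step from which the cut-offs of the
    duality argument are built. *)
Lemma mollifier_antiderivative (eta : R -> R) : standard_mollifier eta ->
  exists H : R -> R, [/\ forall k, Cn k H, forall t, hasder H t (eta t),
    forall x, x <= -1 -> H x = 0 & forall x, 1 <= x -> H x = 1].
Proof.
move=> [/Cn_derive1n sm [_ sub] _ int1].
have eta0 x : x <= -1 \/ 1 <= x -> eta x = 0.
  move=> hx; apply: contrapT => /eqP ex.
  have /sub : closure [set x | eta x != 0] x by exact: subset_closure.
  by rewrite /= in_itv /=; move=> /andP[h1 h2]; case: hx => h3; lra.
have [H [H0 hH]] := antiderivative (-1) (sm 0%N).
have left x : x <= -1 -> H x = 0.
  move=> hx; rewrite -H0; apply: hasder0_cst => // t /andP[_ ht].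
  by rewrite -(eta0 t (or_introl ht)); exact: hH.
have H1 : H 1 = 1.
  have h11 : (-1 : R) < 1 by lra.
  have := ftc_itv h11 (sm 0%N) hH; rewrite H0 subr0 => <-.
  rewrite -[RHS]int1 Rintegral_mkcond; congr Rintegral; apply/funext => x; rewrite patchE.
  case: ifPn => // /negP hA; rewrite eta0//.
  have [h1|h1] := leP x (-1); first by left.
  right; rewrite leNgt; apply/negP => h2; apply: hA.
  by rewrite inE /= in_itv /= !ltW.
exists H; split => //.
- by case=> [|k]; [exact: hasder_continuous hH|exists eta].
- move=> x hx; rewrite -H1; apply/esym; apply: hasder0_cst => // t /andP[ht _].
  by rewrite -(eta0 t (or_intror ht)); exact: hH.
Qed.

Variables (r1 r2 eps : R) (eta H : R -> R).
Hypotheses (r10 : 0 < r1) (r12 : r1 < r2) (e0 : 0 < eps) (er1 : 3 * eps < r1) (er2 : 3 * eps < r2 - r1).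
Hypotheses (SH : forall k, Cn k H) (dH : forall t, hasder H t (eta t)) (ceta : continuous eta).
Hypotheses (H0 : forall x, x <= -1 -> H x = 0) (H1 : forall x, 1 <= x -> H x = 1).

(** The convolution integral is evaluated by the fundamental theorem, the integrand being the
    derivative of - H ((s - t) / eps) in t. *)
Lemma mollified_indicE s : mollified_indic r1 r2 eta eps s = H ((s - r1) / eps) - H ((s - r2) / eps).
Proof.
have hd t : hasder (fun t => - H ((s - t) / eps)) t (eps^-1 * eta ((s - t) / eps)).
  apply: hasder_eq.
    apply: hasderN; apply: (@hasder_comp _ H); last exact: dH.
    apply: (@hasderM _ (fun t => s - t) (fun=> eps^-1)); last exact: hasder_cst.
    by apply: hasderB; [exact: hasder_cst|exact: hasder_id].
  by rewrite /=; ring.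
have ce : continuous (fun t => eps^-1 * eta ((s - t) / eps)).
  apply: contM; first exact: cont_cst.
  apply: (@cont_comp _ R (fun t => (s - t) / eps) eta) => //.
  by apply: contM; [apply: contB; [exact: cont_cst|move=> t; exact: cvg_id]|exact: cont_cst].
have := ftc_itv r12 ce hd; rewrite opprK addrC => <-.
have ib : leb.-integrable `[r1, r2[%classic (EFin \o (fun t => eps^-1 * eta ((s - t) / eps))).
  apply: (@integrableS _ _ _ leb `[r1, r2]%classic) => //.
    by apply: subset_itvl; rewrite bnd_simp.
  by apply: continuous_compact_integrable; [exact: segment_compact|exact: continuous_subspaceT].
rewrite -Rintegral_itv_bndo_bndc// Rintegral_mkcond; congr Rintegral; apply/funext => t.
by rewrite patchE indicE /eta_eps; case: ifPn => _; rewrite ?mul1r ?mul0r.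
Qed.

(** The angular velocity [barVtheta] / R at R = e^(t/2) in a single formula: the two coefficients
    are v1 / R and v2 / R, and the cut-offs switch at r1 and r2. Since eps is small their
    transitions do not overlap, so on each piece of [barVtheta] at most one of them varies. *)
Definition vortex_theta (t : R) : R :=
  c r1 r2 / 2 * (1 - H ((expR (t / 2) - r1) / eps)) +
  (r2 ^+ 2 * expR (- t) - 1) / 2 * (H ((expR (t / 2) - r1) / eps) - H ((expR (t / 2) - r2) / eps)).

Lemma vortex_theta_smooth k : Cn k vortex_theta.
Proof.
have Ce r : Cn k (fun t => H ((expR (t / 2) - r) / eps)).
  apply: Cn_comp => //; apply: CnM; last exact: Cn_cst.
  apply: CnB; last exact: Cn_cst.
  by apply: Cn_comp; [exact: Cn_exp|apply: CnM; [exact: Cn_id|exact: Cn_cst]].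
apply: CnD; apply: CnM.
- exact: Cn_cst.
- by apply: CnB => //; exact: Cn_cst.
- apply: CnM; last exact: Cn_cst.
  apply: CnB; last exact: Cn_cst.
  apply: CnM; first exact: Cn_cst.
  by apply: Cn_comp; [exact: Cn_exp|apply: CnN; exact: Cn_id].
- exact: CnB.
Qed.

Lemma cutoff_left (r s : R) : s <= r - eps -> H ((s - r) / eps) = 0.
Proof. by move=> h; apply: H0; rewrite ler_pdivrMr//; lra. Qed.

Lemma cutoff_right (r s : R) : r + eps <= s -> H ((s - r) / eps) = 1.
Proof. by move=> h; apply: H1; rewrite ler_pdivlMr//; lra. Qed.

Lemma barVthetaE (s : R) : 0 < s -> barVtheta r1 r2 eta eps s = s * vortex_theta (ln (s ^+ 2)).
Proof.
move=> s0; have s2 : 0 < s ^+ 2 by rewrite exprn_gt0.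
have es : expR (ln (s ^+ 2) / 2) = s.
  by rewrite lnXn// -[ln s *+ 2]mulr_natl mulrAC divff ?pnatr_eq0// mul1r lnK.
have q1 := r10; have q2 := r12; have q3 := e0; have q4 := er1; have q5 := er2.
rewrite /vortex_theta es expRN lnK// /barVtheta mollified_indicE.
have E2 (u : R) : v1 r1 r2 s + (v2 r2 s - v1 r1 r2 s) * u = s * (c r1 r2 / 2 * (1 - u) + (r2 ^+ 2 / s ^+ 2 - 1) / 2 * u).
  by rewrite /v1 /v2 expr_div_n; field; rewrite gt_eqF.
case: (leP s (r1 - eps)) => h1.
  have h2 : s <= r2 - eps by lra.
  by rewrite (cutoff_left h1) (cutoff_left h2) /v1; field; rewrite gt_eqF.
case: ifPn => [h2|].
  have h3 : s <= r2 - eps by lra.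
  by rewrite (cutoff_left h3) subr0 E2.
rewrite -leNgt => h2; rewrite (cutoff_right h2); case: ifPn => [h3|].
  by rewrite (cutoff_left h3) /v2 expr_div_n; field; rewrite gt_eqF.
rewrite -ltNge => h3; case: ifPn => h4; first by rewrite /v2 expr_div_n; field; rewrite !gt_eqF.
rewrite -leNgt in h4.
by rewrite (cutoff_right h4); field; rewrite gt_eqF.
Qed.

Lemma vortex_theta_left (t : R) : t <= 2 * ln (r1 - eps) -> vortex_theta t = c r1 r2 / 2.
Proof.
move=> ht; have h : expR (t / 2) <= r1 - eps.
  have p : 0 < r1 - eps by have := e0; have := er1; lra.
  rewrite -[leRHS](lnK p).
  by rewrite ler_expR ler_pdivrMr// mulrC.
have h2 : expR (t / 2) <= r2 - eps by have := r12; lra.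
by rewrite /vortex_theta (cutoff_left h) (cutoff_left h2) subrr mulr0 addr0 subr0 mulr1.
Qed.

Lemma vortex_theta_right (t : R) : 2 * ln (r2 + eps) <= t -> vortex_theta t = 0.
Proof.
move=> ht; have h : r2 + eps <= expR (t / 2).
  have p : 0 < r2 + eps by have := r10; have := r12; have := e0; lra.
  rewrite -[leLHS](lnK p).
  by rewrite ler_expR ler_pdivlMr// mulrC.
have h2 : r1 + eps <= expR (t / 2) by have := r12; lra.
by rewrite /vortex_theta (cutoff_right h) (cutoff_right h2) !subrr !mulr0 addr0.
Qed.

Lemma barV_radial X : barV r1 r2 eta eps X =
  (rlog vortex_theta (c r1 r2 / 2) (nsq X) * - X.2, rlog vortex_theta (c r1 r2 / 2) (nsq X) * X.1).
Proof.
have eX : enorm X ^+ 2 = nsq X by rewrite sqr_sqrtr ?nsq_ge0.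
(* At the origin the quotients by [enorm X] are harmless: both coordinates vanish, so both sides are
   0. *)
have [e00|e1] := eqVneq (enorm X) 0.
  have : nsq X = 0 by rewrite -eX e00 expr0n.
  move=> /eqP; rewrite paddr_eq0 ?sqr_ge0// !sqrf_eq0 => /andP[/eqP h1 /eqP h2].
  by rewrite /barV h1 h2 oppr0 !mul0r !mulr0.
have e2 : 0 < enorm X by rewrite lt_neqAle eq_sym e1 sqrtr_ge0.
rewrite /barV barVthetaE// eX /rlog -eX exprn_gt0//.
by congr (_, _); field.
Qed.

(** In t = ln R^2 one has (1/R) d/dR (R^2 theta) = 2 (theta + theta_t). *)
Lemma barOmega_radial (th1 : R -> R) : (forall t, hasder vortex_theta t (th1 t)) -> forall X,
  barOmega r1 r2 eta eps X = rlog (fun t => 2 * (vortex_theta t + th1 t)) (2 * (c r1 r2 / 2)) (nsq X).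
Proof.
move=> hth X; rewrite /barOmega /barW.
have eX : enorm X ^+ 2 = nsq X by rewrite sqr_sqrtr ?nsq_ge0.
have [e00|e1] := eqVneq (enorm X) 0.
  by rewrite -eX e00 expr0n /rlog ltxx; field.
have e2 : 0 < enorm X by rewrite lt_neqAle eq_sym e1 sqrtr_ge0.
rewrite /rlog -eX exprn_gt0//; move: (enorm X) e1 e2 => s s1 s0 {eX}.
have h : hasder (fun t => t * barVtheta r1 r2 eta eps t) s (2 * s * (vortex_theta (ln (s ^+ 2)) + th1 (ln (s ^+ 2)))).
  apply: (@hasder_near _ (fun t => t ^+ 2 * vortex_theta (ln (t ^+ 2)))).
    by apply: filterS (lt_nbhsr s0) => x x0; rewrite barVthetaE// mulrA -expr2.
  apply: hasder_eq.
    apply: hasderM; first by apply: hasderX; exact: hasder_id.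
    apply: (@hasder_comp _ vortex_theta); last exact: hth.
    by apply: hasder_ln; [exact: exprn_gt0|apply: hasderX; exact: hasder_id].
  by rewrite /=; field.
rewrite (hasder_derive1 h); by field.
Qed.

End MollifiedVortex.

(** * Weak equations tested with complex functions *)

Section ComplexTestFunctions.
Context {R : realType}.
Local Notation C := R[i].
Implicit Types (F G : R * R -> C) (X : R * R).

(** The dual solutions carry the factor (x - iy)^n, so complex test functions are required;
    identities known for real ones extend through real and imaginary parts. *)
Definition ctest F := (forall k, cCk k F) /\ bounded_support F.

Lemma ctest_Re F : ctest F -> test_function (fun X => complex.Re (F X)).
Proof.
move=> [sF bF] k; split; first by case: (sF k).
by apply: bounded_support_compact; exact: bounded_support_Re.
Qed.

Lemma ctest_Im F : ctest F -> test_function (fun X => complex.Im (F X)).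
Proof.
move=> [sF bF] k; split; first by case: (sF k).
by apply: bounded_support_compact; exact: bounded_support_Im.
Qed.

Lemma cpder1_cCk k F F1 : cCk k.+1 F -> (forall X, cpder1 F X (F1 X)) -> cCk k F1.
Proof.
move=> [/Ck_elim[_ _ _ c1 _] /Ck_elim[_ _ _ c2 _]] h; split.
  by rewrite (_ : (fun X => _) = d1 (fun X => complex.Re (F X)))//; apply/funext => X; rewrite (d1E (cpder1_Re (h X))).
by rewrite (_ : (fun X => _) = d1 (fun X => complex.Im (F X)))//; apply/funext => X; rewrite (d1E (cpder1_Im (h X))).
Qed.

Lemma cpder2_cCk k F F2 : cCk k.+1 F -> (forall X, cpder2 F X (F2 X)) -> cCk k F2.
Proof.
move=> [/Ck_elim[_ _ _ _ c1] /Ck_elim[_ _ _ _ c2]] h; split.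
  by rewrite (_ : (fun X => _) = d2 (fun X => complex.Re (F X)))//; apply/funext => X; rewrite (d2E (cpder2_Re (h X))).
by rewrite (_ : (fun X => _) = d2 (fun X => complex.Im (F X)))//; apply/funext => X; rewrite (d2E (cpder2_Im (h X))).
Qed.

Lemma complex_split (z : C) : z = (complex.Re z)%:C + 'i%C * (complex.Im z)%:C.
Proof. by apply: complex_eq; rewrite !ReImE /=; ring. Qed.

Lemma complex_splitM (c z : C) :
  c * z = c * (complex.Re z)%:C + 'i%C * (c * (complex.Im z)%:C).
Proof. by rewrite {1}[z]complex_split mulrDr mulrCA. Qed.

Section Tested.
Variables (F F1 F2 : R * R -> C).
Hypotheses (tF : ctest F) (dF1 : forall X, cpder1 F X (F1 X)) (dF2 : forall X, cpder2 F X (F2 X)).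

Let u X := complex.Re (F X).
Let v X := complex.Im (F X).

Let bF1 : bounded_support F1. Proof. exact: (cpder1_bounded_support dF1 tF.2). Qed.
Let bF2 : bounded_support F2. Proof. exact: (cpder2_bounded_support dF2 tF.2). Qed.
Let cF : cCk 0 F. Proof. exact: tF.1. Qed.
Let cF1 : cCk 0 F1. Proof. exact: (cpder1_cCk (tF.1 1%N) dF1). Qed.
Let cF2 : cCk 0 F2. Proof. exact: (cpder2_cCk (tF.1 1%N) dF2). Qed.
Let cre G : cCk 0 G -> cCk 0 (fun X => (complex.Re (G X))%:C).
Proof. by move=> [c _]; exact: cCk_real. Qed.
Let cim G : cCk 0 G -> cCk 0 (fun X => (complex.Im (G X))%:C).
Proof. by move=> [_ c]; exact: cCk_real. Qed.
Let bre G : bounded_support G -> bounded_support (fun X => (complex.Re (G X))%:C).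
Proof. by move=> b; apply: bounded_support_real; exact: bounded_support_Re. Qed.
Let bim G : bounded_support G -> bounded_support (fun X => (complex.Im (G X))%:C).
Proof. by move=> b; apply: bounded_support_real; exact: bounded_support_Im. Qed.

Let u1 X : d1 u X = complex.Re (F1 X). Proof. exact: (d1E (cpder1_Re (dF1 X))). Qed.
Let u2 X : d2 u X = complex.Re (F2 X). Proof. exact: (d2E (cpder2_Re (dF2 X))). Qed.
Let v1 X : d1 v X = complex.Im (F1 X). Proof. exact: (d1E (cpder1_Im (dF1 X))). Qed.
Let v2 X : d2 v X = complex.Im (F2 X). Proof. exact: (d2E (cpder2_Im (dF2 X))). Qed.

Lemma cint_split (P Q : R * R -> C) : cintegrable P -> cintegrable Q ->
  cint (fun X => P X + 'i%C * Q X) = cint P + 'i%C * cint Q.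
Proof. by move=> iP iQ; rewrite cintD ?cintZ//; exact: cintegrableZ. Qed.

Variables (w : R * R -> C) (V : R * R -> C * C).
Hypotheses (Lw : L2 w) (BS : biot_savart w V).

Let V1loc : loc_integrable_complex (fun X => (V X).1). Proof. by case: BS => -[]. Qed.
Let V2loc : loc_integrable_complex (fun X => (V X).2). Proof. by case: BS => -[]. Qed.

Lemma velocity_solenoidal : cint (fun X => (V X).1 * F1 X + (V X).2 * F2 X) = 0.
Proof.
have [_ _ H _] := BS.
have i1 : cintegrable (fun X => (V X).1 * (d1 u X)%:C + (V X).2 * (d2 u X)%:C).
  apply: cintegrableD; under eq_fun do rewrite ?u1 ?u2; apply: cintegrable_loc => //; by [exact: cre|exact: bre].
have i2 : cintegrable (fun X => (V X).1 * (d1 v X)%:C + (V X).2 * (d2 v X)%:C).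
  apply: cintegrableD; under eq_fun do rewrite ?v1 ?v2; apply: cintegrable_loc => //; by [exact: cim|exact: bim].
transitivity (cint (fun X => ((V X).1 * (d1 u X)%:C + (V X).2 * (d2 u X)%:C)
    + 'i%C * ((V X).1 * (d1 v X)%:C + (V X).2 * (d2 v X)%:C))).
  congr cint; apply/funext => X; rewrite u1 u2 v1 v2 {1}[F1 X]complex_split {1}[F2 X]complex_split; ring.
by rewrite cint_split// (H _ (ctest_Re tF)) (H _ (ctest_Im tF)) mulr0 addr0.
Qed.

Lemma velocity_curl : cint (fun X => (V X).1 * F2 X - (V X).2 * F1 X) = cint (fun X => w X * F X).
Proof.
have [_ _ _ H] := BS.
have i1 : cintegrable (fun X => (V X).1 * (d2 u X)%:C - (V X).2 * (d1 u X)%:C).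
  apply: cintegrableB; under eq_fun do rewrite ?u1 ?u2; apply: cintegrable_loc => //; by [exact: cre|exact: bre].
have i2 : cintegrable (fun X => (V X).1 * (d2 v X)%:C - (V X).2 * (d1 v X)%:C).
  apply: cintegrableB; under eq_fun do rewrite ?v1 ?v2; apply: cintegrable_loc => //; by [exact: cim|exact: bim].
have j1 : cintegrable (fun X => w X * (u X)%:C) by apply: cintegrable_L2 => //; [exact: cre|exact: bre tF.2].
have j2 : cintegrable (fun X => w X * (v X)%:C) by apply: cintegrable_L2 => //; [exact: cim|exact: bim tF.2].
transitivity (cint (fun X => ((V X).1 * (d2 u X)%:C - (V X).2 * (d1 u X)%:C)
    + 'i%C * ((V X).1 * (d2 v X)%:C - (V X).2 * (d1 v X)%:C))).
  congr cint; apply/funext => X; rewrite u1 u2 v1 v2 {1}[F1 X]complex_split {1}[F2 X]complex_split; ring.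
rewrite cint_split// (H _ (ctest_Re tF)) (H _ (ctest_Im tF)) -cint_split//.
by congr cint; apply/funext => X; rewrite -complex_splitM.
Qed.

Variables (A : R * R -> R * R) (Om Om1 Om2 : R * R -> R) (lam : C) (A11 A22 : R * R -> R).
Hypotheses (cA1 : Ck 0 (fun X => (A X).1)) (cA2 : Ck 0 (fun X => (A X).2)).
Hypotheses (dA1 : forall X, pder1 (fun Y => (A Y).1) X (A11 X)) (dA2 : forall X, pder2 (fun Y => (A Y).2) X (A22 X)).
Hypothesis divA : forall X, A11 X + A22 X = 0.
Hypotheses (cOm1 : Ck 0 (d1 Om)) (cOm2 : Ck 0 (d2 Om)).
Hypothesis eigen : forall phi, test_function phi -> linearized A Om w V phi = lam * cint (fun X => w X * (phi X)%:C).

(** The background field A is divergence free, so div (phi A) is A . grad phi and no derivative of A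
    remains. *)
Let real_eigen phi : test_function phi ->
  cint (fun X => w X * ((A X).1 * d1 phi X + (A X).2 * d2 phi X)%:C)
  - cint (fun X => ((V X).1 * (d1 Om X)%:C + (V X).2 * (d2 Om X)%:C) * (phi X)%:C)
  = lam * cint (fun X => w X * (phi X)%:C).
Proof.
move=> tphi; rewrite -eigen// /linearized /transport opprK; congr (cint _ - _).
apply/funext => X; congr (_ * _%:C); rewrite /div.
have [_ h1 h2 _ _] := Ck_elim (test_function_Ck 1 tphi).
have -> : d1 (fun Y => phi Y * (A Y).1) X = d1 phi X * (A X).1 + phi X * A11 X.
  by apply: d1E; case: X => x y; exact: (hasderM (h1 (x, y)) (dA1 (x, y))).
have -> : d2 (fun Y => phi Y * (A Y).2) X = d2 phi X * (A X).2 + phi X * A22 X.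
  by apply: d2E; case: X => x y; exact: (hasderM (h2 (x, y)) (dA2 (x, y))).
by have /eqP := divA X; rewrite addr_eq0 => /eqP ->; ring.
Qed.

Lemma vorticity_eigen :
  cint (fun X => w X * ((A X).1%:C * F1 X + (A X).2%:C * F2 X))
  - cint (fun X => ((V X).1 * (d1 Om X)%:C + (V X).2 * (d2 Om X)%:C) * F X)
  = lam * cint (fun X => w X * F X).
Proof.
have AC : cCk 0 (fun X => ((A X).1)%:C) by exact: cCk_real.
have BC : cCk 0 (fun X => ((A X).2)%:C) by exact: cCk_real.
have i1 : cintegrable (fun X => w X * ((A X).1 * d1 u X + (A X).2 * d2 u X)%:C).
  under eq_fun do rewrite u1 u2 rmorphD !rmorphM /=; apply: cintegrable_L2 => //.
    by apply: cCkD; apply: cCkM => //; exact: cre.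
  by apply: bounded_supportD; apply: bounded_supportMr; exact: bre.
have i2 : cintegrable (fun X => w X * ((A X).1 * d1 v X + (A X).2 * d2 v X)%:C).
  under eq_fun do rewrite v1 v2 rmorphD !rmorphM /=; apply: cintegrable_L2 => //.
    by apply: cCkD; apply: cCkM => //; exact: cim.
  by apply: bounded_supportD; apply: bounded_supportMr; exact: bim.
have k G : cCk 0 G -> bounded_support G -> cintegrable (fun X => ((V X).1 * (d1 Om X)%:C + (V X).2 * (d2 Om X)%:C) * G X).
  move=> cG bG.
  rewrite (_ : (fun X => _) = fun X => (V X).1 * ((d1 Om X)%:C * G X) + (V X).2 * ((d2 Om X)%:C * G X)); last first.
    by apply/funext => X; rewrite mulrDl !mulrA.
  apply: cintegrableD.
  - by apply: cintegrable_loc; [exact: V1loc|exact: (cCkM (cCk_real cOm1) cG)|exact: bounded_supportMr].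
  - by apply: cintegrable_loc; [exact: V2loc|exact: (cCkM (cCk_real cOm2) cG)|exact: bounded_supportMr].
have k1 := k _ (cre cF) (bre tF.2); have k2 := k _ (cim cF) (bim tF.2).
have j1 : cintegrable (fun X => w X * (u X)%:C) by apply: cintegrable_L2 => //; [exact: cre|exact: bre tF.2].
have j2 : cintegrable (fun X => w X * (v X)%:C) by apply: cintegrable_L2 => //; [exact: cim|exact: bim tF.2].
have e1 := real_eigen (ctest_Re tF); have e2 := real_eigen (ctest_Im tF).
have -> : (fun X => w X * F X) = (fun X => w X * (u X)%:C + 'i%C * (w X * (v X)%:C)).
  by apply/funext => X; exact: complex_splitM.
have -> : (fun X => w X * ((A X).1%:C * F1 X + (A X).2%:C * F2 X)) =
    (fun X => w X * ((A X).1 * d1 u X + (A X).2 * d2 u X)%:C + 'i%C * (w X * ((A X).1 * d1 v X + (A X).2 * d2 v X)%:C)).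
  apply/funext => X; rewrite u1 u2 v1 v2 {1}[F1 X]complex_split {1}[F2 X]complex_split.
  by rewrite !rmorphD !rmorphM /=; ring.
have -> : (fun X => ((V X).1 * (d1 Om X)%:C + (V X).2 * (d2 Om X)%:C) * F X) =
    (fun X => ((V X).1 * (d1 Om X)%:C + (V X).2 * (d2 Om X)%:C) * (u X)%:C + 'i%C * (((V X).1 * (d1 Om X)%:C + (V X).2 * (d2 Om X)%:C) * (v X)%:C)).
  by apply/funext => X; exact: complex_splitM.
rewrite !cint_split// mulrDr [lam * ('i%C * _)]mulrCA -e1 -e2.
by move: (cint _) (cint _) (cint _) (cint _) => p q r s; ring.
Qed.

End Tested.

End ComplexTestFunctions.

(** * The adjoint Rayleigh problem *)

Section DualStream.
Context {R : realType}.
Local Notation C := R[i].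

Lemma Cn_der (f f' : R -> R) : (forall j, Cn j f) -> (forall t, hasder f t (f' t)) -> forall j, Cn j f'.
Proof.
move=> hf hd j; have [h hh ch] := hf j.+1.
by rewrite (_ : f' = h)//; apply/funext => t; exact: hasder_uniq (hd t) (hh t).
Qed.

Lemma cCn_der (f f' : R -> C) : (forall j, cCn j f) -> (forall t, chasder f t (f' t)) -> forall j, cCn j f'.
Proof.
move=> hf hd j; have [h hh ch] := hf j.+1.
by rewrite (_ : f' = h)//; apply/funext => t; exact: chasder_uniq (hd t) (hh t).
Qed.

Lemma cCn_expn (r : R) j : cCn j (fun t => (expR (r * t))%:C).
Proof. by apply: cCn_real; apply: Cn_comp; [exact: Cn_exp|apply: CnM; [exact: Cn_cst|exact: Cn_id]]. Qed.

Context (k : nat) (th th1 th2 th3 : R -> R) (al be c2 : R) (lam0 : C) (psi eta : R -> C) (g : R -> R).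
Let n := k.+2.
Local Notation nn := (n%:R : R).
Hypothesis albe : al <= be.
Hypothesis Sth : forall j, Cn j th.
Hypothesis Dth : forall t, hasder th t (th1 t).
Hypothesis Dth1 : forall t, hasder th1 t (th2 t).
Hypothesis Dth2 : forall t, hasder th2 t (th3 t).
Hypothesis p_right : forall t, be <= t -> th1 t + th2 t = 0.
Hypothesis p_left : forall t, t <= al -> th1 t + th2 t = 0.
Hypothesis lam0_gt0 : 0 < complex.Re lam0.
Hypothesis ray : is_rayleigh n th th1 th2 be lam0 psi eta.
Hypothesis eta_neq0 : eta al != 0.
Hypothesis Sg : forall j, Cn j g.

Let n0 : (0 < n)%N. Proof. by []. Qed.
Let Sth1 : forall j, Cn j th1. Proof. exact: Cn_der Sth Dth. Qed.
Let Sth2 : forall j, Cn j th2. Proof. exact: Cn_der Sth1 Dth1. Qed.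
Let cth3 : continuous th3. Proof. exact: (Cn_der Sth2 Dth2 0%N). Qed.

Let rho := ray_rho n th th1 th2 lam0.

Let Smu j : cCn j (ray_mu n th lam0).
Proof.
apply: cCnD; first exact: cCn_cst.
by apply: cCnM; [exact: cCn_cst|apply: cCn_real; apply: CnM; [exact: Cn_cst|exact: Sth]].
Qed.

Let Srho j : cCn j rho.
Proof.
apply: cCnM; last by apply: cCnV => [t|]; [exact: ray_mu_neq0|exact: Smu].
apply: cCnM; first exact: cCn_cst.
by apply: cCn_real; apply: CnM; [exact: Cn_cst|apply: CnD; [exact: Sth1|exact: Sth2]].
Qed.

Let rho0 t : th1 t + th2 t = 0 -> rho t = 0.
Proof. by move=> h; rewrite /rho /ray_rho h mulr0 mulr0 mul0r. Qed.

Let gt t : C := (g (expR t))%:C.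
Let Sgt j : cCn j gt.
Proof. by apply: cCn_real; apply: Cn_comp; [exact: Sg|exact: Cn_exp]. Qed.

Lemma dual_stream : exists (chi E : R -> C) (ka c0 : C), [/\
  forall t, chasder chi t ((expR (- nn * t))%:C * E t),
  forall t, chasder E t ((expR (nn * t))%:C * (rho t * (chi t - gt t))),
  forall t, t <= al -> E t = 0 /\ chi t = c0 &
  forall t, be <= t -> E t = - n%:R * ka /\ chi t = ka * (expR (- nn * t))%:C].
Proof.
have cs : ccontinuous (fun t => - ((expR (nn * t))%:C * (rho t * gt t))).
  apply: (@cCn_continuous _ 0); apply: cCnN; apply: cCnM; first exact: cCn_expn.
  by apply: cCnM; [exact: Srho|exact: Sgt].
have [y [e [y0 e0 dy de]]] := @rayleigh_inhomogeneous R n th th1 th2 th3 be Dth Dth1 Dth2 lam0 _ lam0_gt0 cs.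
have [psi0 eta0 dpsi deta] := ray.
pose ka := - e al / eta al.
pose chi t := y t + ka * psi t; pose E t := e t + ka * eta t.
have dchi t : chasder chi t ((expR (- nn * t))%:C * E t).
  apply: chasder_eq; first by apply: chasderD; [exact: dy|apply: chasderZ; exact: dpsi].
  by rewrite /E; ring.
have dE t : chasder E t ((expR (nn * t))%:C * (rho t * (chi t - gt t))).
  apply: chasder_eq; first by apply: chasderD; [exact: de|apply: chasderZ; exact: deta].
  by rewrite /chi -/rho; ring.
exists chi, E, ka, (chi al); split => //.
- have E0 t : t <= al -> E t = 0.
    move=> tal; have -> : 0 = E al by rewrite /E /ka mulNr mulNr divfK// subrr.
    by apply: chasder0_cst => // x /andP[_ xal]; apply: (chasder_eq (dE x)); rewrite rho0 ?p_left// mul0r mulr0.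
  move=> t tal; split; first exact: E0.
  by apply: chasder0_cst => // x /andP[_ xal]; apply: (chasder_eq (dchi x)); rewrite E0// mulr0.
- have EE t : be <= t -> E t = - n%:R * ka.
    move=> bt; have -> : - n%:R * ka = E be by rewrite /E e0 eta0 add0r mulrC.
    by apply/esym; apply: chasder0_cst => // x /andP[xbe _]; apply: (chasder_eq (dE x)); rewrite rho0 ?p_right// mul0r mulr0.
  move=> t bt; split; first exact: EE.
  suff : chi be - ka * (expR (- nn * be))%:C = chi t - ka * (expR (- nn * t))%:C.
    by rewrite {1}/chi y0 psi0 add0r subrr => /esym/eqP; rewrite subr_eq0 => /eqP.
  apply: (@chasder0_cst _ (fun x => chi x - ka * (expR (- nn * x))%:C)) => // x /andP[xbe _].
  apply: chasder_eq.
    apply: chasderB; first exact: dchi.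
    apply: chasderZ; apply: chasder_real; apply: hasder_exp; apply: hasderZ; exact: hasder_id.
  rewrite EE// mulr1 !rmorphM rmorphN rmorph_nat /=; ring.
Qed.

(** The dual equation in s = |X|^2, with the denominator mu cleared so that it can be multiplied by
    test profiles. The profile is constant near the origin, so its extension to s <= 0 is smooth. *)
Lemma dual_radial : exists (X0 X1 X2 : R -> C) (ka : C), [/\
  forall j, cCn j X0, forall s, chasder X0 s (X1 s), forall s, chasder X1 s (X2 s),
  forall s, 0 <= s -> (2 * s%:C * X2 s + (2 * n.+1%:R) * X1 s) * (lam0 + 'i%C * n%:R * (rlog th c2 s)%:C)
     = 'i%C * n%:R * (rlog (fun t => 2 * (th1 t + th2 t) * expR (- t)) 0 s)%:C * (X0 s - (g s)%:C) &
  forall s, expR be <= s -> X0 s = ka * (s ^- n)%:C /\ X1 s = - n%:R * ka * (s ^- n.+1)%:C].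
Proof.
have [chi [E [ka [c0 [dchi dE left right]]]]] := dual_stream.
have S2 j : cCn j chi /\ cCn j E.
  elim: j => [|j [IH1 IH2]].
    by split; apply: chasder_continuous; [exact: dchi|exact: dE].
  split; eexists; first exact: dchi.
  - by apply: cCnM => //; exact: cCn_expn.
  - exact: dE.
  - apply: cCnM; first exact: cCn_expn.
    by apply: cCnM => //; apply: cCnD => //; apply: cCnN.
pose chi1 t := (expR (- nn * t))%:C * E t.
pose chi2 t := (rho t * (chi t - gt t) - n.+1%:R * chi1 t) * (expR (- t))%:C.
have dexpN t : hasder (fun s : R => expR (- s)) t (- expR (- t)).
  by apply: hasder_eq; [apply: hasder_exp; apply: hasderN; exact: hasder_id|rewrite mulrN1].
have dchi1 t : chasder (fun s => chi1 s * (expR (- s))%:C) t (chi2 t).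
  apply: chasder_eq.
    apply: chasderM; last by apply: chasder_real; exact: dexpN.
    apply: chasderM; last exact: dE.
    by apply: chasder_real; apply: hasder_exp; apply: hasderZ; exact: hasder_id.
  have e z : (expR (- nn * t))%:C * ((expR (nn * t))%:C * z) = z.
    by rewrite mulrA -rmorphM -expRD mulNr addNr expR0 mul1r.
  rewrite /chi2 /chi1 e mulr1 !rmorphM !rmorphN rmorph_nat -[n.+1%:R]natr1.
  by move: n%:R => N; ring.
pose X0 s := c0 + log_ext (fun t => chi t - c0) s.
pose X1 := log_ext (fun t => chi1 t * (expR (- t))%:C).
pose X2 := log_ext (fun t => chi2 t * (expR (- t))%:C).
have dX0 s : chasder X0 s (X1 s).
  apply: chasder_eq; first apply: chasderD; first exact: chasder_cst.
    apply: (@chasder_log_ext _ _ chi1 al 0 (lexx 0)).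
      by move=> t tal; rewrite mul0r (left _ (ltW tal)).2 subrr sqn0.
    by move=> t; apply: chasder_eq; [apply: chasderB; [exact: dchi|exact: chasder_cst]|rewrite subr0].
  by rewrite add0r.
have dX1 s : chasder X1 s (X2 s).
  apply: (@chasder_log_ext _ _ chi2 al 0 (lexx 0)) => //.
  by move=> t tal; rewrite mul0r /chi1 (left _ (ltW tal)).1 mulr0 mul0r sqn0.
have log_extE (f : R -> C) (s : R) : 0 < s -> log_ext f s = f (ln s) by rewrite /log_ext => ->.
have expN_ln (s : R) : 0 < s -> expR (- ln s) = s^-1 by move=> s0; rewrite expRN lnK.
exists X0, X1, X2, ka; split => //.
- move=> j; apply: cCnD; first exact: cCn_cst.
  (* The coefficient of the power is 0, since chi - c0 vanishes to the left of [al]; any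
     sufficiently large exponent serves. *)
  apply: log_ext_smooth; apply: (@log_flat_power _ al j _ 0 (j.+2%:R)).
  + by apply: cCnD; [exact: (S2 j).1|exact: cCn_cst].
  + by rewrite Re_nat -natr1 -[in leRHS]natr1; lra.
  + by move=> t tal; rewrite mul0r (left _ (ltW tal)).2 subrr.
- move=> s; rewrite le_eqVlt => /predU1P[<-|s0].
    have -> : X1 0 = 0 by rewrite /X1 /log_ext ltxx.
    by rewrite /rlog ltxx !mulr0 addr0 !mul0r.
  rewrite /X0 /X1 /X2 !log_extE// [c0 + _]addrC subrK /rlog s0 /chi2 expN_ln//.
  have sC : s%:C * (s^-1)%:C = 1 :> C by rewrite -rmorphM divff ?gt_eqF.
  have gE : gt (ln s) = (g s)%:C by rewrite /gt lnK.
  have mE : lam0 + 'i%C * n%:R * (th (ln s))%:C = ray_mu n th lam0 (ln s).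
    by rewrite /ray_mu rmorphM rmorph_nat mulrA.
  have rE : rho (ln s) * ray_mu n th lam0 (ln s) = 'i%C * (nn * (th1 (ln s) + th2 (ln s)))%:C.
    by rewrite /rho /ray_rho divfK// ray_mu_neq0.
  rewrite mE gE; set r := rho (ln s) in rE *; set m := ray_mu _ _ _ _ in rE *; set G := (g s)%:C.
  have -> : 'i%C * n%:R * (2 * (th1 (ln s) + th2 (ln s)) * s^-1)%:C * (chi (ln s) - G)
      = 2 * (r * m) * (s^-1)%:C * (chi (ln s) - G).
    by rewrite rE !rmorphM !rmorph_nat; ring.
  rewrite -[n.+1]/(k.+3); move: (chi _) (chi1 _) k.+3%:R (s%:C) ((s^-1)%:C) sC => u v N x y xy.
  ring: xy.
- move=> s hs; have s0 : 0 < s := lt_le_trans (expR_gt0 _) hs.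
  have bs : be <= ln s by rewrite -ler_expR lnK.
  have [hE hchi] := right _ bs.
  have e : expR (- nn * ln s) = (s ^+ n)^-1 by rewrite mulNr expRN expRM_natl lnK.
  rewrite /X0 /X1 !log_extE// [c0 + _]addrC subrK hchi e /chi1 hE expN_ln// e; split => //.
  by rewrite mulrAC -rmorphM -invfM -exprSr mulrC.
Qed.

End DualStream.

(** * Conjugate modes f(|X|^2) (x - iy)^m *)

Section ConjugateModes.
Context {R : realType}.
Local Notation C := R[i].
Implicit Types (f g : R -> C) (X : R * R).

(** The product of a conjugate mode with an element of [U m] is radial, so the angle drops out. *)
Definition bmode f (m : nat) X : C := f (nsq X) * zb X ^+ m.

Lemma cCk_zb k : cCk k (@zb R).
Proof. by split; [exact: Ck_fst|apply: CkN; exact: Ck_snd]. Qed.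

Lemma cCk_bmode k f m : cCn k f -> cCk k (bmode f m).
Proof. by move=> cf; apply: cCkM; [exact: cCk_radial|apply: cCkX; exact: cCk_zb]. Qed.

Lemma cpder1_bmode f f1 m X : (forall s, chasder f s (f1 s)) ->
  cpder1 (bmode f m) X (2 * X.1%:C * bmode f1 m X + m%:R * bmode f m.-1 X).
Proof.
move=> hf; rewrite (_ : _ + _ = f1 (nsq X) * (2 * X.1)%:C * zb X ^+ m + f (nsq X) * (m%:R * zb X ^+ m.-1 * 1)).
  by apply: cpder1M; [exact: cpder1_radial|exact/cpder1X/cpder1_zb].
by rewrite rmorphM rmorph_nat /bmode; ring.
Qed.

Lemma cpder2_bmode f f1 m X : (forall s, chasder f s (f1 s)) ->
  cpder2 (bmode f m) X (2 * X.2%:C * bmode f1 m X - 'i%C * (m%:R * bmode f m.-1 X)).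
Proof.
move=> hf; rewrite (_ : _ - _ = f1 (nsq X) * (2 * X.2)%:C * zb X ^+ m + f (nsq X) * (m%:R * zb X ^+ m.-1 * - 'i%C)).
  by apply: cpder2M; [exact: cpder2_radial|exact/cpder2X/cpder2_zb].
by rewrite rmorphM rmorph_nat /bmode; ring.
Qed.

Lemma radial_bounded_support f (F : R * R -> C) (S : R) : (forall s, S <= s -> f s = 0) ->
  bounded_support (fun X => f (nsq X) * F X).
Proof.
by move=> hf; apply: bounded_supportMl; have := mode_bounded_support 0 hf;
  rewrite /mode; under eq_fun do rewrite expr0 mulr1.
Qed.

Lemma ctest_bmode f m (S : R) : (forall j, cCn j f) -> (forall s, S <= s -> f s = 0) -> ctest (bmode f m).
Proof.
move=> sf hf; split; first by move=> j; exact: cCk_bmode.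
exact: radial_bounded_support hf.
Qed.

Lemma sqn_zb X : sqn (zb X) = nsq X.
Proof. by rewrite /sqn /zb /= sqrrN. Qed.

End ConjugateModes.

(** * Bounds for integrals over boxes *)

Section SmallIntegrals.
Context {R : realType}.
Local Notation C := R[i].
Local Notation leb := (@lebesgue_measure R).
Local Notation mu := (leb \x leb)%E.
Local Notation plane := (measurableTypeR R * measurableTypeR R)%type.

Lemma norm_Rintegral_le (f : R * R -> R) (K N : R) : mu.-integrable setT (EFin \o f) -> 0 <= K -> 0 <= N ->
  {ae mu, forall X, `|f X| <= K} -> (forall X, (N < `|X.1|) || (N < `|X.2|) -> f X = 0) ->
  `|\int[mu]_X f X| <= K * ((2 * N) * (2 * N)).
Proof.
move=> intf K0 N0 fK f0; apply: (le_trans (le_normr_Rintegral measurableT intf)).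
pose A : set plane := `[- N, N] `*` `[- N, N].
have mA : measurable A by apply: measurableX; exact: measurable_itv.
have mf : measurable_fun setT f by case/integrableP : intf => /measurable_EFinP.
have E : (\int[mu]_X (cst K%:E \_ A) X = (K * ((2 * N) * (2 * N)))%:E)%E.
  by rewrite -integral_mkcond integral_cst// [RHS]EFinM; congr (_ * _)%E; exact: box_measure.
have le1 : (\int[mu]_X `|f X|%:E <= (K * ((2 * N) * (2 * N)))%:E)%E.
  rewrite -E; apply: ae_ge0_le_integral => //.
  - by apply/measurable_EFinP; exact: measurableT_comp.
  - by move=> X _; rewrite patchE; case: ifPn => // _; rewrite lee_fin.
  - exact: ((measurable_restrictT _ mA).1 (measurable_cst _)).
  - case: fK => Z [mZ Z0 hZ]; exists Z; split => // X /= hX; apply: hZ => /= h; apply: hX => _.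
    rewrite patchE; case: ifPn => [_|/negP nA]; first by rewrite lee_fin.
    rewrite f0 ?normr0//; case: (ltP N `|X.1|) => //= h1; case: (ltP N `|X.2|) => //= h2; exfalso; apply: nA.
    by rewrite inE; split; rewrite /= in_itv /= -ler_norml.
rewrite /Rintegral -lee_fin fineK//; rewrite ge0_fin_numE; last by apply: integral_ge0 => X _; rewrite lee_fin.
by apply: le_lt_trans le1 _; exact: ltry.
Qed.

Lemma normc_lt1 (z : C) : `|z| < 1%:C -> sqn z < 1.
Proof.
rewrite normc_def ltcE /= eqxx /= => h.
have := h; rewrite -(@ltr_pXn2r _ 2) ?nnegrE ?sqrtr_ge0// expr1n sqr_sqrtr//.
by rewrite addr_ge0 ?sqr_ge0.
Qed.

End SmallIntegrals.

(** * Vanishing of the conjugate radial moments *)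

Section Duality.
Context {R : realType}.
Local Notation C := R[i].
Context (k : nat) (thS Om Om1 g K0 K1 K2 : R -> R) (lam : C) (X0 X1 X2 : R -> C) (ka : C) (S0 S M : R).
Let n := k.+2.
Hypotheses (Sth : forall j, Cn j thS) (dOm : forall s, hasder Om s (Om1 s)) (cOm1 : continuous Om1).
Hypotheses (S01 : 1 <= S0) (Om1_far : forall s, S0 <= s -> Om1 s = 0).
Hypotheses (lam_gt0 : 0 < complex.Re lam) (Sg : forall j, Cn j g) (g_far : forall s, S <= s -> g s = 0).
Hypotheses (SX0 : forall j, cCn j X0) (dX0 : forall s, chasder X0 s (X1 s)) (dX1 : forall s, chasder X1 s (X2 s)).
Hypothesis ode : forall s : R, 0 <= s ->
  (2 * s%:C * X2 s + (2 * n.+1%:R) * X1 s) * (lam + 'i%C * n%:R * (thS s)%:C)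
  = 'i%C * n%:R * (Om1 s)%:C * (X0 s - (g s)%:C).
Hypothesis far : forall s, S0 <= s -> X0 s = ka * (s ^- n)%:C /\ X1 s = - n%:R * ka * (s ^- n.+1)%:C.
Hypotheses (SK : forall j, Cn j K0) (dK0 : forall u, hasder K0 u (K1 u)) (dK1 : forall u, hasder K1 u (K2 u)).
Hypotheses (K_near : forall u, u < 1 -> [/\ K0 u = 1, K1 u = 0 & K2 u = 0])
  (K_far : forall u, 3 < u -> [/\ K0 u = 0, K1 u = 0 & K2 u = 0]).
(** For X0 = ka s^(-n) this combination, at u = q s, is what the derivatives of the cut-off leave in
    the residual [D]. *)
Hypothesis K_bound : forall u, ((2 - 2 * n%:R) * K1 u + 2 * u * K2 u) ^+ 2 <= M.

Let Om_cutoff (q s : R) : 0 < q -> q * S0 <= 1 -> Om1 s * (1 - K0 (q * s)) = 0.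
Proof.
move=> q0 qS; have [h|h] := ltP (q * s) 1; first by case: (K_near h) => -> _ _; rewrite subrr mulr0.
by rewrite Om1_far ?mul0r// -(ler_pM2l q0) (le_trans qS).
Qed.

Section Cutoff.
Variable q : R.
Hypotheses (q0 : 0 < q) (qS : q * S0 <= 1).

Let k0 s : C := (K0 (q * s))%:C.
Let k1 s : C := (q * K1 (q * s))%:C.
Let k2 s : C := (q * (q * K2 (q * s)))%:C.

Let hq s : hasder (fun s => q * s) s q.
Proof. by apply: hasder_eq; [apply: hasderZ; exact: hasder_id|rewrite mulr1]. Qed.

Let dk0 s : chasder k0 s (k1 s).
Proof.
apply: chasder_real; apply: hasder_eq; first exact: (hasder_comp (hq s) (dK0 _)).
by rewrite mulrC.
Qed.

Let dk1 s : chasder k1 s (k2 s).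
Proof.
apply: chasder_real; apply: hasderZ; apply: hasder_eq; first exact: (hasder_comp (hq s) (dK1 _)).
by rewrite mulrC.
Qed.

Let Y0 s := X0 s * k0 s.
Let Y1 s := X1 s * k0 s + X0 s * k1 s.
Let Y2 s := (X2 s * k0 s + X1 s * k1 s) + (X1 s * k1 s + X0 s * k2 s).

Let dY0 s : chasder Y0 s (Y1 s). Proof. exact: chasderM. Qed.
Let dY1 s : chasder Y1 s (Y2 s). Proof. by apply: chasderD; exact: chasderM. Qed.

Let SY0 j : cCn j Y0.
Proof.
apply: cCnM => //; apply: cCn_real; apply: (@Cn_comp _ _ K0) => //.
by apply: CnM; [exact: Cn_cst|exact: Cn_id].
Qed.
Let SY1 : forall j, cCn j Y1. Proof. exact: cCn_der SY0 dY0. Qed.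
Let SY2 : forall j, cCn j Y2. Proof. exact: cCn_der SY1 dY1. Qed.

Let muS s : C := lam + 'i%C * n%:R * (thS s)%:C.

Let muS_neq0 s : muS s != 0.
Proof.
have E : complex.Re (muS s) = complex.Re lam.
  have -> : muS s = lam + 'i%C * (n%:R * thS s)%:C by rewrite /muS rmorphM rmorph_nat mulrA.
  by rewrite !ReImE /=; ring.
by apply: contraTneq lam_gt0 => h; rewrite -E h ltxx.
Qed.

Let SmuS j : cCn j muS.
Proof. by apply: cCnD; [exact: cCn_cst|apply: cCnM; [exact: cCn_cst|exact: cCn_real]]. Qed.

(** [Y0] enters the curl equation, [f3] the eigenvalue equation and [f1] the divergence equation,
    each times (x - iy)^n. On conjugate modes A . grad is - i n theta, so with F the mode of [f3]
    and Y that of [Y0] this choice gives lambda F - A . grad F + Y = g (x - iy)^n. *)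
Let f3 s : C := ((g s)%:C - Y0 s) / muS s.
Let Sf3 j : cCn j f3.
Proof.
apply: cCnM; last exact: cCnV.
by apply: cCnD; [exact: cCn_real|exact: cCnN].
Qed.

(** After the first two equations the velocity is tested with (d2 Y, - d1 Y) - F grad Om. This [f1]
    makes the gradient of f1 (x - iy)^n agree with that field in the angular direction; [D] measures
    what is left in the radial one. *)
Let f1 s : C := - ('i%C / n%:R) * (2 * s%:C * Y1 s + n%:R * Y0 s).
Let f11 s : C := - ('i%C / n%:R) * (2 * s%:C * Y2 s + (n%:R + 2) * Y1 s).

Let df1 s : chasder f1 s (f11 s).
Proof.
apply: chasderZ; apply: chasder_eq.
  apply: chasderD; last by apply: chasderZ; exact: dY0.
  apply: chasderM; last exact: dY1.
  by apply: chasderZ; apply: chasder_real; exact: hasder_id.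
by move: n%:R => N; ring.
Qed.

Let Sf1 j : cCn j f1.
Proof.
apply: cCnM; first exact: cCn_cst.
apply: cCnD; apply: cCnM => //; last exact: cCn_cst.
by apply: cCnM; [exact: cCn_cst|apply: cCn_real; exact: Cn_id].
Qed.

Let far_cut s : 4 * q^-1 <= s -> [/\ k0 s = 0, k1 s = 0 & k2 s = 0].
Proof.
move=> hs; have /K_far[h1 h2 h3] : 3 < q * s.
  by move: hs; rewrite ler_pdivrMr// mulrC; lra.
by rewrite /k0 /k1 /k2 h1 h2 h3 !mulr0.
Qed.

Let Y0_far s : 4 * q^-1 <= s -> Y0 s = 0.
Proof. by move=> /far_cut[h _ _]; rewrite /Y0 h mulr0. Qed.
Let Y1_far s : 4 * q^-1 <= s -> Y1 s = 0.
Proof. by move=> /far_cut[h h1 _]; rewrite /Y1 h h1 !mulr0 addr0. Qed.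

Let t1 : ctest (bmode f1 n).
Proof.
by apply: (@ctest_bmode _ _ _ (4 * q^-1) Sf1) => s hs; rewrite /f1 Y0_far// Y1_far// !mulr0 addr0 mulr0.
Qed.
Let t2 : ctest (bmode Y0 n).
Proof. exact: (@ctest_bmode _ _ _ (4 * q^-1) SY0). Qed.
Let t3 : ctest (bmode f3 n).
Proof.
apply: (@ctest_bmode _ _ _ (Num.max S (4 * q^-1)) Sf3) => s; rewrite ge_max => /andP[h1 h2].
by rewrite /f3 g_far// Y0_far// subrr mul0r.
Qed.

Let D s : C := f3 s * (Om1 s)%:C - 'i%C * Y1 s + f11 s.

Let n_neq0 : n%:R != 0 :> C. Proof. by rewrite pnatr_eq0. Qed.

(** The dual equation cancels everything except the terms in which the cut-off is differentiated.
    The factor n clears the 1/n in [f1]. *)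
Let DE s : 0 <= s -> n%:R * D s = - 'i%C * (4 * s%:C * X1 s * k1 s + 2 * s%:C * X0 s * k2 s + 2 * n.+1%:R * X0 s * k1 s).
Proof.
move=> s0; have cut : (Om1 s)%:C * (1 - k0 s) = 0 by rewrite /k0 -rmorphB -rmorphM Om_cutoff.
have e1 : n%:R * D s = n%:R * (f3 s * (Om1 s)%:C) - 'i%C * (2 * s%:C * Y2 s + 2 * n.+1%:R * Y1 s).
  rewrite /D /f11 -[n.+1%:R]natr1; move: n_neq0; move: n%:R => N N0; field => //.
pose P := 2 * s%:C * X2 s + (2 * n.+1%:R) * X1 s.
(* On the support of [Om1] the cut-off is 1, so a factor [k0] may be inserted next to [Om1]; this
   lets the equation of the uncut profile X0 be used. *)
have e2 : n%:R * (f3 s * (Om1 s)%:C) = 'i%C * k0 s * P.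
  have e3 : n%:R * (Om1 s)%:C * ((g s)%:C - Y0 s) = 'i%C * k0 s * P * muS s.
    have := ode s0; rewrite -/(muS s) -/P => e.
    rewrite -[RHS]mulrA e /Y0; move: (Om1 s)%:C (k0 s) (g s)%:C (X0 s) n%:R cut => O K G X N.
    move=> /eqP; rewrite mulrBr mulr1 subr_eq0 => /eqP OK.
    have ii : 'i%C * 'i%C = -1 :> C by rewrite -expr2 sqr_i.
    transitivity (N * O * G - N * X * (O * K)); first by ring.
    transitivity (- ('i%C * 'i%C) * (N * (O * K) * G - N * X * (O * K))); last by ring.
    by rewrite ii -OK; ring.
  have hf : f3 s * muS s = (g s)%:C - Y0 s by rewrite /f3 divfK.
  by apply: (mulIf (muS_neq0 s)); rewrite -e3 -hf; move: (f3 s) (muS s) n%:R => *; ring.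
rewrite e1 e2 /P /Y1 /Y2; move: (k0 s) (k1 s) (k2 s) n.+1%:R => *; ring.
Qed.

Let D_near s : 0 <= s -> q * s < 1 -> D s = 0.
Proof.
move=> s0 /K_near[_ h1 h2]; have := DE s0.
rewrite /k1 /k2 h1 h2 !mulr0 !addr0 mulr0 => /eqP.
by rewrite mulf_eq0 (negbTE n_neq0) => /eqP.
Qed.

Let D_far s : 0 <= s -> 3 < q * s -> D s = 0.
Proof.
move=> s0 /K_far[_ h1 h2]; have := DE s0.
rewrite /k1 /k2 h1 h2 !mulr0 !addr0 mulr0 => /eqP.
by rewrite mulf_eq0 (negbTE n_neq0) => /eqP.
Qed.

Let D_bound s : 0 <= s -> 1 <= q * s -> sqn (D s) <= sqn ka * M * q ^+ 2 * (s ^- n) ^+ 2.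
Proof.
move=> s0 qs; have sS : S0 <= s by rewrite -(ler_pM2l q0) (le_trans qS).
have [hX0 hX1] := far sS.
have s1 : 0 < s by apply: lt_le_trans sS; have := S01; lra.
pose B := (2 - 2 * n%:R) * K1 (q * s) + 2 * (q * s) * K2 (q * s).
have e : n%:R * D s = - 'i%C * (ka * (s ^- n)%:C * (q * B)%:C).
  rewrite DE// hX0 hX1; congr (_ * _).
  have -> : (s ^- n.+1)%:C = (s ^- n)%:C * (s^-1)%:C :> C by rewrite -rmorphM -invfM -exprSr.
  have sC : s%:C * (s^-1)%:C = 1 :> C by rewrite -rmorphM divff ?gt_eqF.
  have nC : n%:R = (n%:R : R)%:C :> C by rewrite rmorph_nat.
  rewrite /k1 /k2 /B -[n.+1%:R]natr1 nC; move: (n%:R : R) => N'.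
  rewrite !rmorphM !rmorphD !rmorphM !rmorphB !rmorphM !rmorphD rmorph1 /=.
  move: (N'%:C) ((s ^- n)%:C) q%:C (K1 _)%:C (K2 _)%:C (s%:C) ((s^-1)%:C) sC => N p Q a b x y xy.
  ring: xy.
have := congr1 (@sqn _) e; rewrite !sqnM sqnN !sqn_real => E.
have nE : sqn (n%:R : C) = n%:R ^+ 2 by rewrite -[n%:R](rmorph_nat (real_complex R)) sqn_real.
have n1 : 1 <= sqn (n%:R : C) by rewrite nE -natrX ler1n.
have iE : sqn ('i%C : C) = 1 by rewrite /sqn /=; ring.
apply: (@le_trans _ _ (sqn (n%:R : C) * sqn (D s))); first by rewrite ler_peMl ?sqn_ge0.
rewrite E iE mul1r exprMn.
rewrite [leRHS](_ : _ = sqn ka * (s ^- n) ^+ 2 * (q ^+ 2 * M)); last by ring.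
apply: ler_wpM2l; first by apply: mulr_ge0; [exact: sqn_ge0|exact: sqr_ge0].
by apply: ler_wpM2l; [exact: sqr_ge0|exact: K_bound].
Qed.

Let M_ge0 : 0 <= M. Proof. exact: le_trans (sqr_ge0 _) (K_bound 0). Qed.

(* The cut-off at |X|^2 ~ 1/q leaves the error err, of size O(q^(3/2)) on an
   annulus of area O(1/q): it disappears as q -> 0 since V is bounded there. *)
Let err (x : R) X : C := - (2 * x%:C * bmode D n X).

(** On the annulus s >= 1/q and s >= 1, so n >= 2 gives s^(1-n) <= 1/s <= q: the third power of q,
    beside the q^2 of [D_bound]. *)
Let err_bound (x : R) X : x ^+ 2 <= nsq X -> sqn (err x X) <= 4 * sqn ka * M * q ^+ 3.
Proof.
move=> hx; rewrite /err sqnN /bmode.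
have r0 : 0 <= 4 * sqn ka * M * q ^+ 3 by do 2!(apply: mulr_ge0 => //); rewrite ?mulr_ge0 ?sqn_ge0 ?exprn_ge0 ?(ltW q0).
have [h|h] := ltP (q * nsq X) 1; first by rewrite D_near ?nsq_ge0// mul0r mulr0 sqn0.
have s1 : 0 < nsq X.
  by rewrite lt_neqAle nsq_ge0 andbT; apply: contraTneq h => <-; rewrite mulr0 -ltNge ltr01.
have twoC : 2 = (2 : R)%:C :> C by rewrite rmorph_nat.
have zE : sqn (zb X ^+ n) = nsq X ^+ n by rewrite sqnX sqn_zb.
move: (zb X ^+ n) zE => z zE; rewrite twoC !sqnM !sqn_real zE; move: hx h (D_bound (nsq_ge0 X) h) s1.
move: (nsq X) (sqn (D (nsq X))) (sqn_ge0 (D (nsq X))) => s d d0 hx h hd s1.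
have sn : 0 <= s ^+ n by rewrite exprn_ge0// ltW.
have c0 : 0 <= sqn ka * M * q ^+ 2 by rewrite !mulr_ge0 ?sqn_ge0 ?exprn_ge0 ?(ltW q0).
have sS : 1 <= s.
  have := S01; have : S0 <= s by rewrite -(ler_pM2l q0) (le_trans qS).
  lra.
have sinv : s * s ^- n <= q.
  have sk : s <= s ^+ k.+1 by rewrite exprS ler_peMr ?(ltW s1)// exprn_ege1.
  have -> : s * s ^- n = (s ^+ k.+1)^-1.
    by rewrite /n [s ^+ k.+2]exprS invfM mulrA divff ?gt_eqF// mul1r.
  apply: (@le_trans _ _ s^-1); first by rewrite lef_pV2// posrE exprn_gt0.
  by rewrite -(ler_pM2r s1) mulVf ?gt_eqF.
have snn : s ^- n * s ^+ n = 1 by rewrite mulVf// gt_eqF// exprn_gt0.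
apply: (@le_trans _ _ (4 * s * (sqn ka * M * q ^+ 2 * (s ^- n) ^+ 2 * s ^+ n))).
  apply: ler_pM; first by rewrite mulr_ge0 ?sqr_ge0.
  - by rewrite mulr_ge0.
  - by rewrite (_ : 2 ^+ 2 = 4 :> R) ?ler_wpM2l//; ring.
  - by rewrite ler_wpM2r.
rewrite [leLHS](_ : _ = 4 * (sqn ka * M * q ^+ 2) * (s * s ^- n) * (s ^- n * s ^+ n)); last by ring.
rewrite snn mulr1 [leRHS](_ : _ = 4 * (sqn ka * M * q ^+ 2) * q); last by ring.
by rewrite ler_wpM2l// mulr_ge0.
Qed.

(** The moment of g is split into terms tested with [f3] and [Y0]; the eigenvalue and curl equations
    turn them into integrals of the velocity, and the divergence equation for [f1] removes the
    gradient part, leaving the error fields. *)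
Lemma dual_identity (w : R * R -> C) (V : R * R -> C * C) : L2 w -> biot_savart w V ->
  (forall phi, test_function phi ->
    linearized (fun X => (thS (nsq X) * - X.2, thS (nsq X) * X.1)) (fun X => Om (nsq X)) w V phi
    = lam * cint (fun X => w X * (phi X)%:C)) ->
  exists e1 e2 : R * R -> C, [/\ cCk 0 e1 /\ cCk 0 e2,
    forall X, (q * nsq X < 1) || (3 < q * nsq X) -> e1 X = 0 /\ e2 X = 0,
    forall X, sqn (e1 X) <= 4 * sqn ka * M * q ^+ 3 /\ sqn (e2 X) <= 4 * sqn ka * M * q ^+ 3 &
    cint (fun X => w X * bmode (fun s => (g s)%:C) n X) = cint (fun X => (V X).1 * e1 X + (V X).2 * e2 X)].
Proof.
move=> Lw BS eigen; exists (fun X => err X.1 X), (fun X => err X.2 X).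
have [thS1 dth cth1] := Sth 1.
have [f31 df3 cf31] := Sf3 1.
pose Gg := bmode (fun s => (g s)%:C) n.
pose A X : R * R := (thS (nsq X) * - X.2, thS (nsq X) * X.1).
pose a1 X := 2 * X.1%:C * bmode f11 n X + n%:R * bmode f1 n.-1 X.
pose a2 X := 2 * X.2%:C * bmode f11 n X - 'i%C * (n%:R * bmode f1 n.-1 X).
pose b1 X := 2 * X.1%:C * bmode Y1 n X + n%:R * bmode Y0 n.-1 X.
pose b2 X := 2 * X.2%:C * bmode Y1 n X - 'i%C * (n%:R * bmode Y0 n.-1 X).
pose c1 X := 2 * X.1%:C * bmode f31 n X + n%:R * bmode f3 n.-1 X.
pose c2 X := 2 * X.2%:C * bmode f31 n X - 'i%C * (n%:R * bmode f3 n.-1 X).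
have da1 X : cpder1 (bmode f1 n) X (a1 X) by exact: cpder1_bmode.
have da2 X : cpder2 (bmode f1 n) X (a2 X) by exact: cpder2_bmode.
have db1 X : cpder1 (bmode Y0 n) X (b1 X) by exact: cpder1_bmode.
have db2 X : cpder2 (bmode Y0 n) X (b2 X) by exact: cpder2_bmode.
have dc1 X : cpder1 (bmode f3 n) X (c1 X) by exact: cpder1_bmode.
have dc2 X : cpder2 (bmode f3 n) X (c2 X) by exact: cpder2_bmode.
have E2 := velocity_solenoidal t1 da1 da2 BS.
have E3 := velocity_curl t2 db1 db2 Lw BS.
have Cnth j : Cn j thS by [].
have cA1 : Ck 0 (fun X => (A X).1) by apply: CkM; [exact: Ck_radial|apply: CkN; exact: Ck_snd].
have cA2 : Ck 0 (fun X => (A X).2) by apply: CkM; [exact: Ck_radial|exact: Ck_fst].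
have dOm1 X : d1 (fun Y => Om (nsq Y)) X = Om1 (nsq X) * (2 * X.1).
  by case: X => x y; apply: d1E; exact: (hasder_comp (hasder_nsq1 (x, y)) (dOm _)).
have dOm2 X : d2 (fun Y => Om (nsq Y)) X = Om1 (nsq X) * (2 * X.2).
  by case: X => x y; apply: d2E; exact: (hasder_comp (hasder_nsq2 (x, y)) (dOm _)).
have cO1 : Ck 0 (d1 (fun Y => Om (nsq Y))).
  rewrite (_ : d1 _ = fun X => Om1 (nsq X) * (2 * X.1)); last exact/funext.
  by apply: CkM; [exact: (@Ck_radial _ 0)|apply: CkM; [exact: Ck_cst|exact: Ck_fst]].
have cO2 : Ck 0 (d2 (fun Y => Om (nsq Y))).
  rewrite (_ : d2 _ = fun X => Om1 (nsq X) * (2 * X.2)); last exact/funext.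
  by apply: CkM; [exact: (@Ck_radial _ 0)|apply: CkM; [exact: Ck_cst|exact: Ck_snd]].
have dA1 X : pder1 (fun Y => (A Y).1) X (thS1 (nsq X) * (2 * X.1) * - X.2).
  case: X => x y; apply: hasder_eq.
    exact: (@hasderM _ (fun z => thS (nsq (z, y))) (fun=> - y) x _ _ (hasder_comp (hasder_nsq1 (x, y)) (dth _)) (hasder_cst _ _)).
  by rewrite /= mulr0 addr0.
have dA2 X : pder2 (fun Y => (A Y).2) X (thS1 (nsq X) * (2 * X.2) * X.1).
  case: X => x y; apply: hasder_eq.
    exact: (@hasderM _ (fun z => thS (nsq (x, z))) (fun=> x) y _ _ (hasder_comp (hasder_nsq2 (x, y)) (dth _)) (hasder_cst _ _)).
  by rewrite /= mulr0 addr0.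
have divA (X : R * R) : thS1 (nsq X) * (2 * X.1) * - X.2 + thS1 (nsq X) * (2 * X.2) * X.1 = 0 by ring.
have E1 := vorticity_eigen t3 dc1 dc2 Lw BS cA1 cA2 dA1 dA2 divA cO1 cO2 eigen.
have V1loc : loc_integrable_complex (fun X => (V X).1) by case: BS => -[].
have V2loc : loc_integrable_complex (fun X => (V X).2) by case: BS => -[].
have iV F G : cCk 0 F -> cCk 0 G -> bounded_support F -> bounded_support G ->
    cintegrable (fun X => (V X).1 * F X + (V X).2 * G X).
  by move=> cF cG bF bG; apply: cintegrableD; exact: cintegrable_loc.
have iw F : cCk 0 F -> bounded_support F -> cintegrable (fun X => w X * F X).
  by move=> cF bF; exact: cintegrable_L2.
have [s1 bs1] := t1; have [s2 bs2] := t2; have [s3 bs3] := t3.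
have ca1 := cpder1_cCk (s1 1%N) da1; have ca2 := cpder2_cCk (s1 1%N) da2.
have cb1 := cpder1_cCk (s2 1%N) db1; have cb2 := cpder2_cCk (s2 1%N) db2.
have cc1 := cpder1_cCk (s3 1%N) dc1; have cc2 := cpder2_cCk (s3 1%N) dc2.
have ba1 := cpder1_bounded_support da1 bs1; have ba2 := cpder2_bounded_support da2 bs1.
have bb1 := cpder1_bounded_support db1 bs2; have bb2 := cpder2_bounded_support db2 bs2.
have bc1 := cpder1_bounded_support dc1 bs3; have bc2 := cpder2_bounded_support dc2 bs3.
have cOC1 := cCk_real cO1; have cOC2 := cCk_real cO2.
have cAC1 := cCk_real cA1; have cAC2 := cCk_real cA2.
pose o1 X := (d1 (fun Y => Om (nsq Y)) X)%:C * bmode f3 n X.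
pose o2 X := (d2 (fun Y => Om (nsq Y)) X)%:C * bmode f3 n X.
have co1 : cCk 0 o1 := cCkM cOC1 (s3 0%N).
have co2 : cCk 0 o2 := cCkM cOC2 (s3 0%N).
have bo1 : bounded_support o1 by exact: bounded_supportMr.
have bo2 : bounded_support o2 by exact: bounded_supportMr.
have i1 := iV _ _ co1 co2 bo1 bo2.
have i2 := iV _ _ cb2 (cCkN cb1) bb2 (bounded_supportN bb1).
have i3 := iV _ _ ca1 ca2 ba1 ba2.
have ii : 'i%C * 'i%C = -1 :> C by rewrite -expr2 sqr_i.
have zbE (X : R * R) : zb X = X.1%:C - 'i%C * X.2%:C by apply: complex_eq; rewrite !ReImE /=; ring.
have zcE (X : R * R) : zc X = X.1%:C + 'i%C * X.2%:C by apply: complex_eq; rewrite !ReImE /=; ring.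
have nf1 s : n%:R * f1 s = - 'i%C * (2 * s%:C * Y1 s + n%:R * Y0 s).
  by rewrite /f1; move: n_neq0; move: n%:R (_ + _) => N U N0; field.
have e1E X : err X.1 X = b2 X - o1 X - a1 X.
  rewrite /err /b2 /o1 /a1 dOm1 /bmode /D ![n%:R * (f1 _ * _)]mulrA nf1 -zc_zb zcE.
  rewrite /n -pred_Sn !exprS !rmorphM rmorph_nat.
  have := zbE X; set r := (real_complex R : {rmorphism R -> C}); rewrite -?[real_complex R]/(r : R -> C).
  move: (zb X) (zb X ^+ k) k.+2%:R (f3 _) (f11 _) (Y1 _) (Y0 _) (r (Om1 _)) (r X.1) (r X.2) => z P N u v y1 y0 o x y zE.
  ring: ii zE.
have e2E X : err X.2 X = - b1 X - o2 X - a2 X.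
  rewrite /err /b1 /o2 /a2 dOm2 /bmode /D ![n%:R * (f1 _ * _)]mulrA nf1 -zc_zb zcE.
  rewrite /n -pred_Sn !exprS !rmorphM rmorph_nat.
  have := zbE X; set r := (real_complex R : {rmorphism R -> C}); rewrite -?[real_complex R]/(r : R -> C).
  move: (zb X) (zb X ^+ k) k.+2%:R (f3 _) (f11 _) (Y1 _) (Y0 _) (r (Om1 _)) (r X.1) (r X.2) => z P N u v y1 y0 o x y zE.
  ring: ii zE.
have wE X : Gg X = lam * bmode f3 n X - ((A X).1%:C * c1 X + (A X).2%:C * c2 X) + bmode Y0 n X.
  have gE : (g (nsq X))%:C = f3 (nsq X) * muS (nsq X) + Y0 (nsq X) by rewrite /f3 divfK// subrK.
  rewrite /Gg /bmode gE /c1 /c2 /bmode /A /muS /=.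
  rewrite /n !exprS !rmorphM !rmorphN.
  have := zbE X; set r := (real_complex R : {rmorphism R -> C}); rewrite -?[real_complex R]/(r : R -> C).
  move: (zb X) (zb X ^+ k) k.+2%:R (f3 _) (f31 _) (Y0 _) (r (thS _)) (r X.1) (r X.2) => z P N u v y0 o x y zE.
  ring: ii zE.
split.
- split.
    by rewrite (_ : (fun X => _) = fun X => b2 X - o1 X - a1 X); [apply: cCkD; [apply: cCkD => //|]; exact: cCkN|exact/funext].
  by rewrite (_ : (fun X => _) = fun X => - b1 X - o2 X - a2 X); [apply: cCkD; [apply: cCkD|]; exact: cCkN|exact/funext].
- move=> X h; have D0 : D (nsq X) = 0 by case/orP: h => h; [apply: D_near|apply: D_far]; rewrite ?nsq_ge0.
  by rewrite /err /bmode D0 !mul0r !mulr0 oppr0.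
- by move=> X; split; apply: err_bound; rewrite /nsq ?lerDl ?lerDr sqr_ge0.
have j1 := iw _ (s3 0%N) bs3; have j2 := iw _ (s2 0%N) bs2.
have j3 : cintegrable (fun X => w X * ((A X).1%:C * c1 X + (A X).2%:C * c2 X)).
  apply: iw; first by apply: cCkD; exact: cCkM.
  by apply: bounded_supportD; exact: bounded_supportMr.
transitivity (cint (fun X => lam * (w X * bmode f3 n X) - w X * ((A X).1%:C * c1 X + (A X).2%:C * c2 X) + w X * bmode Y0 n X)).
  by congr cint; apply/funext => X; rewrite -/(Gg X) wE; ring.
have j4 := cintegrableZ lam j1.
rewrite (cintD (cintegrableB j4 j3) j2) (cintB j4 j3) (cintZ lam j1) -E1 -E3.
rewrite (_ : (fun X => (V X).1 * err X.1 X + (V X).2 * err X.2 X) = fun X =>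
   ((V X).1 * b2 X + (V X).2 * - b1 X) - ((V X).1 * o1 X + (V X).2 * o2 X) - ((V X).1 * a1 X + (V X).2 * a2 X)); last first.
  by apply/funext => X; rewrite e1E e2E; ring.
rewrite (cintB (cintegrableB i2 i1) i3) (cintB i2 i1) E2 subr0.
rewrite (_ : (fun X => ((V X).1 * (d1 _ X)%:C + _) * _) = fun X => (V X).1 * o1 X + (V X).2 * o2 X); last first.
  have distr (x y u v z : C) : (x * y + u * v) * z = x * (y * z) + u * (v * z).
    by rewrite mulrDl !mulrA.
  by apply/funext => X; exact: distr.
rewrite (_ : (fun X => (V X).1 * b2 X - (V X).2 * b1 X) = fun X => (V X).1 * b2 X + (V X).2 * - b1 X); last first.
  by apply/funext => X; rewrite mulrN.
by move: (cint _) (cint _) (cint _) => p1 p2 p3; ring.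
Qed.

End Cutoff.

(** With q = p^2 the error is of size p^3 on a box of side 4/p, and the velocity is below 1 on the
    annulus; the moment is therefore O(p) for every small p. *)
Theorem dual_annihilation (w : R * R -> C) (V : R * R -> C * C) : L2 w -> biot_savart w V ->
  (forall phi, test_function phi ->
    linearized (fun X => (thS (nsq X) * - X.2, thS (nsq X) * X.1)) (fun X => Om (nsq X)) w V phi
    = lam * cint (fun X => w X * (phi X)%:C)) ->
  cint (fun X => w X * bmode (fun s => (g s)%:C) n X) = 0.
Proof.
move=> Lw BS eigen; set Z := cint _.
have [[V1loc V2loc] [V1oo V2oo] _ _] := BS.
have [rho1 h1] := V1oo 1 ltr01; have [rho2 h2] := V2oo 1 ltr01.
pose L := 4 * sqn ka * M.
have M0 : 0 <= M by exact: le_trans (sqr_ge0 _) (K_bound 0).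
have L0 : 0 <= L by rewrite !mulr_ge0 ?sqn_ge0.
have L4 : 4 * L <= (2 * (L + 1)) ^+ 2 by rewrite expr2; nra.
(* Beyond radius B both velocity components are below 1 in modulus almost everywhere. The condition
   p B < 1 places the annulus |X| >= 1/p beyond B and, as S0 <= B, the cut-off beyond the vorticity
   gradient. *)
pose B := S0 + (`|rho1| + (`|rho2| + 1)).
have [r1B r2B SB] : [/\ rho1 <= B, rho2 <= B & S0 <= B].
  have S00 : 0 <= S0 by exact: le_trans ler01 S01.
  split; rewrite /B.
  - by rewrite ler_wpDl// (le_trans (ler_norm _))// lerDl addr_ge0.
  - by rewrite ler_wpDl// ler_wpDl// (le_trans (ler_norm _))// lerDl.
  - by rewrite lerDl !addr_ge0.
have B1 : 1 <= B by exact: le_trans SB.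
have B0 : 0 < B by exact: lt_le_trans B1.
have L1 : 0 < 64 * (L + 1) by rewrite mulr_gt0// ltr_wpDl.
(* Stated for a real-valued f so that real and imaginary parts are treated at once; [fint] records
   that f commutes with the integral. *)
have small p : 0 < p -> p * B < 1 -> forall f : C -> R, (forall z, f z ^+ 2 <= sqn z) ->
    (forall e1 e2 : R * R -> C, cintegrable (fun X => (V X).1 * e1 X + (V X).2 * e2 X) ->
      cint (fun X => w X * bmode (fun s => (g s)%:C) n X) = cint (fun X => (V X).1 * e1 X + (V X).2 * e2 X) ->
      f Z = \int[(@lebesgue_measure R \x @lebesgue_measure R)%E]_X f ((V X).1 * e1 X + (V X).2 * e2 X)
      /\ (@lebesgue_measure R \x @lebesgue_measure R)%E.-integrable setT (EFin \o (fun X => f ((V X).1 * e1 X + (V X).2 * e2 X)))) ->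
    `|f Z| <= 32 * (L + 1) * p.
  move=> p0 pB f f2 fint.
  have q0 : 0 < p ^+ 2 by rewrite exprn_gt0.
  have p1 : p <= 1 by rewrite (le_trans _ (ltW pB))// ler_peMr// ltW.
  have qS : p ^+ 2 * S0 <= 1.
    have pS : p * S0 <= 1.
      by apply: le_trans (ltW pB); rewrite ler_wpM2l// ltW.
    have : p * (p * S0) <= p * 1 by rewrite ler_wpM2l// ltW.
    by rewrite expr2 -mulrA mulr1 => /le_trans; exact.
  have [e1 [e2 [[c1 c2] supp bnd eqZ]]] := dual_identity q0 qS Lw BS eigen.
  have far2 X : (2 / p < `|X.1|) || (2 / p < `|X.2|) -> e1 X = 0 /\ e2 X = 0.
    move=> hX; apply: supp; apply/orP; right.
    have far1 (x : R) : 2 / p < `|x| -> 3 < p ^+ 2 * x ^+ 2.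
      rewrite ltr_pdivrMr// => h.
      have -> : p ^+ 2 * x ^+ 2 = (`|x| * p) ^+ 2 by rewrite exprMn real_normK ?num_real// mulrC.
      apply: (@lt_trans _ _ (2 * 2)); first by rewrite -natrM ltr_nat.
      by rewrite expr2 ltr_pM.
    have x0 := mulr_ge0 (ltW q0) (sqr_ge0 X.1); have y0 := mulr_ge0 (ltW q0) (sqr_ge0 X.2).
    by rewrite /nsq mulrDr; case/orP: hX => /far1 /lt_le_trans; apply; rewrite (lerDl, lerDr).
  have dp0 : 0 <= 2 / p by rewrite divr_ge0// ltW.
  have b1 : bounded_support e1 by exists (2 / p) => // X /far2[].
  have b2 : bounded_support e2 by exists (2 / p) => // X /far2[].
  have iV : cintegrable (fun X => (V X).1 * e1 X + (V X).2 * e2 X).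
    by apply: cintegrableD; apply: cintegrable_loc.
  have [fE fi] := fint e1 e2 iV eqZ.
  have f0 : f 0 = 0.
    by apply/eqP; rewrite -sqrf_eq0 eq_le sqr_ge0 andbT -(@sqn0 R) f2.
  have KP : 0 <= 2 * (L + 1) * p ^+ 3 by rewrite !mulr_ge0 ?exprn_ge0 ?addr_ge0// ltW.
  rewrite fE; apply: le_trans (norm_Rintegral_le (K := 2 * (L + 1) * p ^+ 3) (N := 2 / p) fi KP dp0 _ _) _.
  - apply: (@filterS2 _ _ (ae_filter_ringOfSetsType _) _ _ _ _ h1 h2) => X hV1 hV2.
    have [h|h] := ltP (p ^+ 2 * nsq X) 1.
      have [-> ->] : e1 X = 0 /\ e2 X = 0 by apply: supp; rewrite h.
      by rewrite !mulr0 addr0 f0 normr0.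
    have eX : B < enorm X.
      have e0 : 0 <= enorm X by exact: sqrtr_ge0.
      rewrite ltNge; apply/negP => eB.
      have h3 : p * enorm X <= p * B by rewrite ler_wpM2l// ltW.
      have E : p ^+ 2 * nsq X = (p * enorm X) ^+ 2 by rewrite exprMn sqr_sqrtr ?nsq_ge0.
      have h4 := mulr_ge0 (ltW p0) e0; rewrite E in h.
      by move: h; rewrite leNgt expr_lt1// (le_lt_trans h3).
    have v1 : sqn (V X).1 < 1.
      by apply: normc_lt1; apply: hV1; exact: le_lt_trans eX.
    have v2 : sqn (V X).2 < 1.
      by apply: normc_lt1; apply: hV2; exact: le_lt_trans eX.
    have [g1 g2] := bnd X.
    rewrite -(ler_pXn2r (n := 2)) ?nnegrE ?normr_ge0// real_normK ?num_real//.
    apply: le_trans (f2 _) _; apply: le_trans (sqnD_le _ _) _; rewrite !sqnM.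
    have u1 : sqn (V X).1 * sqn (e1 X) <= L * p ^+ 6.
      by rewrite (exprM p 2 3) /L; apply: le_trans g1; rewrite ler_piMl ?sqn_ge0// ltW.
    have u2 : sqn (V X).2 * sqn (e2 X) <= L * p ^+ 6.
      by rewrite (exprM p 2 3) /L; apply: le_trans g2; rewrite ler_piMl ?sqn_ge0// ltW.
    have p6 : 0 <= p ^+ 6 by rewrite exprn_ge0// ltW.
    rewrite exprMn -exprM; apply: (@le_trans _ _ (2 * (L * p ^+ 6 + L * p ^+ 6))).
      by rewrite ler_pM2l// lerD.
    by rewrite (_ : 2 * (_ + _) = 4 * L * p ^+ 6); [rewrite ler_wpM2r|ring].
  - by move=> X /far2[-> ->]; rewrite !mulr0 addr0.
  - rewrite le_eqVlt; apply/orP; left; apply/eqP; field; exact: lt0r_neq0.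
have zero (f : C -> R) : (forall p, 0 < p -> p * B < 1 -> `|f Z| <= 32 * (L + 1) * p) -> f Z = 0.
  move=> hf; apply/eqP; rewrite -normr_le0 leNgt; apply/negP => a0.
  pose p := Num.min (2 * B)^-1 (`|f Z| / (64 * (L + 1))).
  have p0 : 0 < p by rewrite lt_min invr_gt0 mulr_gt0//= divr_gt0.
  have pa : p <= (2 * B)^-1 by rewrite ge_min lexx.
  have pb : p <= `|f Z| / (64 * (L + 1)) by rewrite ge_min lexx orbT.
  have pB : p * B < 1.
    apply: (@le_lt_trans _ _ ((2 * B)^-1 * B)); first by rewrite ler_wpM2r// ltW.
    by rewrite invfM -mulrA mulVf ?gt_eqF// mulr1 invf_lt1// ltr1n.
  move: pb; rewrite ler_pdivlMr// (_ : p * (64 * (L + 1)) = 2 * (32 * (L + 1) * p)); last by ring.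
  move=> /(le_trans (ler_wpM2l (ler0n R 2) (hf p p0 pB))).
  by rewrite mulr_natl mulr2n gerDl leNgt a0.
apply: complex_eq; apply: zero => p p0 pB; apply: (small p p0 pB) => //.
- exact: Re_sqr_le.
- by move=> e1 e2 [i1 _] eZ; split => //; rewrite /Z eZ.
- exact: Im_sqr_le.
- by move=> e1 e2 [_ i2] eZ; split => //; rewrite /Z eZ.
Qed.
End Duality.

(** * Null sets, lines through the origin and radial functions *)

Section PlaneNullSets.
Context {R : realType}.
Local Notation leb := (@lebesgue_measure R).
Local Notation mu := (leb \x leb)%E.
Local Notation line := (measurableTypeR R).
Local Notation plane := (measurableTypeR R * measurableTypeR R)%type.

Lemma ae0_measure (f : line -> \bar R) : measurable_fun setT f -> (forall x, 0 <= f x)%E ->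
  (\int[leb]_x f x = 0)%E <-> {ae leb, forall x, f x = 0%E}.
Proof.
move=> mf f0; have -> : (\int[leb]_x f x = \int[leb]_x `|f x|)%E.
  by apply: eq_integral => x _; rewrite gee0_abs.
rewrite (ae_eq_integral_abs leb measurableT mf); split.
  by apply: (@filterS _ _ (ae_filter_ringOfSetsType _)) => x; exact.
by apply: (@filterS _ _ (ae_filter_ringOfSetsType _)) => x h _.
Qed.

Lemma null_xsection (N : set plane) : measurable N ->
  mu N = 0%E <-> {ae leb, forall x, leb (xsection N x) = 0%E}.
Proof. by move=> mN; apply: ae0_measure => //; exact: measurable_fun_xsection. Qed.

Lemma null_ysection (N : set plane) : measurable N ->
  mu N = 0%E <-> {ae leb, forall y, leb (ysection N y) = 0%E}.
Proof.
move=> mN; have -> : mu N = (leb \x^ leb)%E N.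
  by apply: product_measure_unique => // B C mB mC/=; rewrite product_measure2E.
by apply: ae0_measure => //; exact: measurable_fun_ysection.
Qed.

(** The measure c times the length of the preimage under x |-> c x agrees with Lebesgue measure on
    intervals, hence everywhere by uniqueness. *)
Lemma null_scale (E : set line) (c : R) : measurable E -> 0 < c -> leb E = 0%E ->
  leb [set x | E (c * x)] = 0%E.
Proof.
move=> mE c0 E0.
have mc : measurable_fun [set: line] ( *%R c : line -> line) by exact: mulrl_measurable.
pose nu : {measure set line -> \bar R} :=
  mscale (NngNum (ltW c0)) (pushforward leb ( *%R c : line -> line)).
have nuE : forall A : set line, measurable A -> leb A = nu mc A.
  apply: lebesgue_measure_unique => _ [[a b]] _ <-.
  transitivity (c%:E * leb (( *%R c : line -> line) @^-1` `]a, b]))%E; last by [].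
  have -> : ( *%R c : line -> line) @^-1` `]a, b] = `]a / c, b / c]%classic.
    apply/seteqP; split => x /=; rewrite !in_itv /= => /andP[h1 h2]; apply/andP; split.
    - by rewrite ltr_pdivrMr// mulrC.
    - by rewrite ler_pdivlMr// mulrC.
    - by move: h1; rewrite ltr_pdivrMr// mulrC.
    - by move: h2; rewrite ler_pdivlMr// mulrC.
  rewrite !lebesgue_measure_itv /= !lte_fin ltr_pM2r ?invr_gt0//; case: ifPn => h; last by rewrite mule0.
  by rewrite -!EFinD -EFinM; congr EFin; field; rewrite gt_eqF.
have := nuE E mE; rewrite E0 /nu /mscale /= /pushforward => /esym/eqP.
by rewrite mule_eq0 eqe gt_eqF//= => /eqP.
Qed.

Lemma measurable_scale_preimage (E : set line) (c : R) : measurable E -> measurable ([set x | E (c * x)] : set line).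
Proof.
move=> mE; rewrite -[X in measurable X]setTI; apply: measurable_funM => //.
Qed.

Lemma null_scale_neq0 (E : set line) (c : R) : measurable E -> c != 0 -> leb E = 0%E ->
  leb [set x | E (c * x)] = 0%E.
Proof.
move=> mE c0 E0; have [h|h] := ltP 0 c; first exact: null_scale.
have h' : 0 < - c by rewrite oppr_gt0 lt_neqAle c0.
have mEN : measurable ([set x | E (- x)] : set line).
  rewrite (_ : [set x | E (- x)] = [set x | E (-1 * x)]); last by apply/funext => x /=; rewrite mulN1r.
  exact: measurable_scale_preimage.
have := @null_scale [set x | E (- x)] (- c) mEN h'.
have -> : [set x | [set x0 | E (- x0)] (- c * x)] = [set x | E (c * x)].
  by apply/funext => x /=; rewrite mulNr opprK.
apply; rewrite -E0 -(lebesgue_measureN mE); by rewrite /pushforward.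
Qed.

(** Sections at fixed second variable m are the lines y = m x; at fixed first variable x the map is
    a scaling. This chart plays the part of polar coordinates. *)
Definition slope_map (X : plane) : plane := (X.1, X.2 * X.1).

Lemma measurable_slope_map : measurable_fun [set: plane] slope_map.
Proof.
apply: measurable_fun_pair; first exact: measurable_fst.
by apply: measurable_funM; [exact: measurable_snd|exact: measurable_fst].
Qed.

Lemma ae_neq0 : {ae leb, forall x : R, x != 0}.
Proof.
exists [set 0]; split => //; first by rewrite lebesgue_measure_set1.
by move=> x /= /negP; rewrite negbK => /eqP.
Qed.

(** Sections of the preimage under [slope_map] are computed in both orders. At fixed x they are
    rescaled vertical sections of N, with x = 0 as a null exception; at fixed m they are the traces
    of N on lines through the origin. *)
Lemma null_slope (N : set plane) : measurable N ->
  mu N = 0%E <-> {ae leb, forall m, leb [set x | N (x, m * x)] = 0%E}.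
Proof.
move=> mN; have mN' : measurable (slope_map @^-1` N).
  by rewrite -[X in measurable X]setTI; exact: measurable_slope_map.
have slopeE m : ysection (slope_map @^-1` N) m = [set x | N (x, m * x)].
  by apply/seteqP; split => x; rewrite /ysection /= inE.
have xE x : xsection (slope_map @^-1` N) x = [set m | xsection N x (x * m)].
  by apply/seteqP; split => m; rewrite /xsection /= !inE /slope_map /= mulrC.
have mX x : measurable (xsection N x) by exact: measurable_xsection.
apply: (iff_trans (null_xsection mN)).
apply: (@iff_trans _ (mu (slope_map @^-1` N) = 0%E)).
  apply: iff_sym; apply: (iff_trans (null_xsection mN')); split.
    apply: (@filterS2 _ _ (ae_filter_ringOfSetsType _) _ _ _ _ ae_neq0) => x x0; rewrite xE => h.
    have := @null_scale_neq0 _ x^-1 (measurable_scale_preimage _ (mX x)) _ h.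
    rewrite (_ : [set y | _] = xsection N x); first by apply; rewrite invr_eq0.
    by apply/seteqP; split => y /=; rewrite mulrA divff// mul1r.
  apply: (@filterS2 _ _ (ae_filter_ringOfSetsType _) _ _ _ _ ae_neq0) => x x0 h; rewrite xE.
  exact: null_scale_neq0.
apply: (iff_trans (null_ysection mN')).
by split; apply: (@filterS _ _ (ae_filter_ringOfSetsType _)) => m; rewrite slopeE.
Qed.

Lemma ae_exists (P : line -> Prop) : {ae leb, forall m, P m} -> exists m, P m.
Proof.
move=> [N [mN N0 PN]]; apply: contrapT => /forallNP nP.
have le1 : (leb `[0%R, 1%R]%classic <= leb N)%E.
  by apply: le_measure; rewrite ?inE// => m _; apply: PN; exact: nP.
by move: le1; rewrite lebesgue_measure_itv /= N0 lte_fin ltr01 -EFinD lee_fin subr0 leNgt ltr01.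
Qed.

Lemma measurable_nsq : measurable_fun [set: plane] (nsq : plane -> line).
Proof.
by apply: measurable_funD; apply: measurable_funX; [exact: measurable_fst|exact: measurable_snd].
Qed.

Lemma measurable_sqrtr : measurable_fun [set: line] (Num.sqrt : line -> line).
Proof. by apply: continuous_measurable_fun => x; exact: sqrt_continuous. Qed.

(* A.e. line y = m0 x through the origin meets the exceptional set in a null
   set; h restricted to one such line is the Borel representative. *)
Lemma radial_version (h : plane -> line) (k : R -> R) : measurable_fun setT h ->
  {ae mu, forall X, h X = k (nsq X)} ->
  exists2 kt : line -> line, measurable_fun setT kt & {ae mu, forall X, h X = kt (nsq X)}.
Proof.
move=> mh [N [mN N0 hN]].
have [m0 Em0] := ae_exists ((null_slope mN).1 N0).
(* The point (x, m0 x) has squared norm d x^2, so x = sqrt(s / d) marks the point of the chosen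
   half-line at squared radius s. *)
set E0 := [set x | _] in Em0; set d := 1 + m0 ^+ 2.
have d0 : 0 < d by rewrite /d; have := sqr_ge0 m0; lra.
have m1 : measurable_fun [set: line] (fun x : line => (x, m0 * x) : plane).
  by apply: measurable_fun_pair; [exact: measurable_id|exact: mulrl_measurable].
have mE0 : measurable (E0 : set line).
  by rewrite -[X in measurable X]setTI; exact: m1.
have mr : measurable_fun [set: line] (fun s : line => Num.sqrt (s / d) : line).
  apply: (measurableT_comp measurable_sqrtr).
  by apply: measurable_funM => //; exact: measurable_id.
exists (fun s => h (Num.sqrt (s / d), m0 * Num.sqrt (s / d))).
  exact: (measurableT_comp mh (measurableT_comp m1 mr)).
(* The points whose circle about the origin meets the chosen half-line in the exceptional set. Every
   line through the origin meets N' in scaled copies of E0 and of its reflection, hence in a null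
   set. *)
pose N' : set plane := [set X | E0 (Num.sqrt (nsq X / d))].
have mN' : measurable N'.
  rewrite -[X in measurable X]setTI; exact: (measurableT_comp mr measurable_nsq).
have N'0 : mu N' = 0%E.
  apply: (null_slope mN').2; apply: aeW => m.
  have [e e0 he] : exists2 e : R, 0 < e & forall x, Num.sqrt (nsq (x, m * x) / d) = e * `|x|.
    exists (Num.sqrt ((1 + m ^+ 2) / d)).
      by rewrite sqrtr_gt0 divr_gt0//; have := sqr_ge0 m; lra.
    move=> x; rewrite -sqrtr_sqr -sqrtrM; last by rewrite divr_ge0 ?(ltW d0)//; have := sqr_ge0 m; lra.
    by congr Num.sqrt; rewrite /nsq /=; ring.
  have p1 : leb [set x | E0 (e * x)] = 0%E by apply: null_scale.
  have p2 : leb [set x | E0 (- e * x)] = 0%E by apply: null_scale_neq0; rewrite ?oppr_eq0 ?gt_eqF.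
  apply: (@subset_measure0 _ _ _ leb _ ([set x | E0 (e * x)] `|` [set x | E0 (- e * x)])).
  - rewrite -[X in measurable X]setTI.
    have ms : measurable_fun [set: line] (fun x : line => (x, m * x) : plane).
      by apply: measurable_fun_pair; [exact: measurable_id|exact: mulrl_measurable].
    exact: ms.
  - by apply: measurableU; exact: measurable_scale_preimage.
  - move=> x; rewrite /N' /= he; case: (ger0P x) => _; first by left.
    by rewrite mulrN -mulNr; right.
  - have q1 := measurable_scale_preimage e mE0; have q2 := measurable_scale_preimage (- e) mE0.
    by apply/(negligibleP leb (measurableU _ _ q1 q2)); apply: negligibleU; apply/(negligibleP leb).
have hN' : {ae mu, forall X, ~ N' X} by exists N'; split => // X /contrapT.
have hN2 : {ae mu, forall X, ~ N X} by exists N; split => // X /contrapT.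
apply: (@filterS2 _ _ (ae_filter_ringOfSetsType _) _ _ _ _ hN' hN2) => X n1 n2.
have kE Y : ~ N Y -> h Y = k (nsq Y) by move=> nY; apply: contrapT => nE; exact/nY/hN.
rewrite (kE _ n2) kE//; congr k.
have h1 : Num.sqrt (nsq X / d) ^+ 2 = nsq X / d by rewrite sqr_sqrtr// divr_ge0 ?(ltW d0)// addr_ge0 ?sqr_ge0.
rewrite {2}/nsq /= exprMn -[X in X + _]mul1r -mulrDl h1 -/d mulrCA divff ?mulr1//; exact: lt0r_neq0.
Qed.

(** Smooth steps converge to indicators of half-lines, and half-lines generate the Borel sets as a
    pi-system. So F has integral 0 over nsq in B for every Borel set B, in particular for the set on
    which kt is positive. *)
Lemma radial_pos (H : R -> R) (F : plane -> R) (kt : line -> line) :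
  (forall j, Cn j H) -> (forall x, x <= -1 -> H x = 0) -> (forall x, 1 <= x -> H x = 1) ->
  mu.-integrable [set: plane] (EFin \o F) ->
  (forall g : R -> R, (forall j, Cn j g) -> \int[mu]_X (F X * g (nsq X)) = 0) ->
  measurable_fun setT kt -> {ae mu, forall X, F X = kt (nsq X)} ->
  {ae mu, forall X, ~ 0 < F X}.
Proof.
move=> SH H0 H1 iF F0 mkt Fk.
have mpre (B : set line) : measurable B -> measurable (nsq @^-1` B : set plane).
  by move=> mB; rewrite -[X in measurable X]setTI; exact: measurable_nsq.
have mF : measurable_fun [set: plane] (EFin \o F) by case/integrableP: iF.
have iS (A : set plane) : measurable A -> mu.-integrable A (EFin \o F).
  by move=> mA; exact: (@integrableS _ _ _ _ _ _ _ measurableT mA (@subsetT _ A) iF).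
have [M M0 HM] : exists2 M : R, 0 <= M & forall x, `|H x| <= M.
  have [M hM] : exists M : R, forall x, -1 <= x <= 1 -> `|H x| <= M.
    have cH : continuous H by exact: (SH 0%N).
    have cN : continuous (fun x => `|H x|).
      by move=> x; apply: continuous_comp; [exact: cH|exact: norm_continuous].
    by have [M _ hM] := continuous_bounded (-1) 1 cN; exists M.
  have M0 : 0 <= M by apply: le_trans (hM 0 _) => //; lra.
  exists (Num.max M 1); first by rewrite le_max M0.
  move=> x; rewrite le_max; have [h|h] := ltP x (-1); first by rewrite H0 ?normr0 ?M0// ltW.
  have [h'|h'] := ltP 1 x; first by rewrite H1 ?normr1 ?lexx ?orbT// ltW.
  by rewrite hM// h.
have cg g : (forall j, Cn j g) -> measurable_fun [set: plane] (fun X : plane => g (nsq X)).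
  move=> Sg; apply: (measurableT_comp _ measurable_nsq).
  by apply: continuous_measurable_fun; exact: (Sg 0%N).
have PT : (\int[mu]_X (F X)%:E = 0)%E.
  have fin : (\int[mu]_X (F X)%:E \is a fin_num)%E by apply: integrable_fin_num.
  rewrite -(fineK fin); congr EFin.
  rewrite -[RHS](F0 (fun=> 1)); last by move=> j; exact: Cn_cst.
  by rewrite /Rintegral; congr fine; apply: eq_integral => X _; rewrite mulr1.
have PG a : (\int[mu]_(X in nsq @^-1` `]a, +oo[) (F X)%:E = 0)%E.
  (* The step is 0 for s <= a and reaches 1 as soon as j (s - a) >= 2, so it converges to the
     indicator of s > a. *)
  pose gj (j : nat) (s : R) := H (j%:R * (s - a) - 1).
  have Sgj j i : Cn i (gj j).
    apply: (@Cn_comp _ _ H (fun s => j%:R * (s - a) - 1)); first exact: SH.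
    apply: CnB; last exact: Cn_cst.
    by apply: CnM; [exact: Cn_cst|apply: CnB; [exact: Cn_id|exact: Cn_cst]].
  pose fj (j : nat) (X : plane) : \bar R := (F X * gj j (nsq X))%:E.
  have mfj j : measurable_fun [set: plane] (fj j).
    apply/measurable_EFinP; apply: measurable_funM; last exact: cg.
    exact/measurable_EFinP.
  have ig : mu.-integrable [set: plane] (fun X : plane => (M * `|F X|)%:E).
    rewrite (_ : (fun X => _) = (fun X => M%:E * `|(EFin \o F) X|)%E).
      by apply: integrableZl => //; exact: integrable_abse.
    by apply/funext => X /=; rewrite EFinM.
  have bd j X : (`|fj j X| <= (M * `|F X|)%:E)%E.
    by rewrite /fj [leLHS]/= lee_fin normrM mulrC; apply: ler_wpM2r => //; exact: HM.
  have lim X : fj ^~ X @ \oo --> ((EFin \o F) \_ (nsq @^-1` `]a, +oo[)) X.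
    rewrite patchE; case: ifPn => hX; last first.
      have {}hX : nsq X <= a by move: hX; rewrite notin_setE /= in_itv /= andbT => /negP; rewrite -leNgt.
      apply: cvg_near_cst; apply: nearW => j; rewrite /fj /gj H0 ?mulr0//.
      have : (j%:R : R) * (nsq X - a) <= 0 by rewrite mulr_ge0_le0// subr_le0.
      lra.
      have {}hX : a < nsq X by move: hX; rewrite inE /= in_itv /= andbT.
      apply: cvg_near_cst.
      have d0 : 0 < nsq X - a by rewrite subr_gt0.
      near=> j; rewrite /fj /gj H1 ?mulr1//.
      have : 2 <= (j%:R : R) * (nsq X - a).
        by rewrite -ler_pdivrMr//; near: j; exact: nbhs_infty_ger.
      lra.
  have fing (X : plane) : [set: plane] X -> (M * `|F X|)%:E \is a fin_num by [].
  have := @dominated_cvg _ _ _ mu _ measurableT fj _ _ mfj (fun X _ => lim X) fing ig (fun j X _ => bd j X).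
  rewrite -integral_mkcond.
  have -> : (fun j => \int[mu]_X fj j X)%E = fun=> 0%E.
    apply/funext => j; have fin : (\int[mu]_X fj j X \is a fin_num)%E.
      apply: integrable_fin_num => //; apply: le_integrable ig => //.
      by move=> X _; rewrite [leRHS]gee0_abs ?lee_fin ?mulr_ge0//; exact: bd.
    by rewrite -(fineK fin); congr EFin; exact: (F0 (gj j)).
  by move=> cv; apply: (cvg_unique (@ereal_hausdorff _) cv); exact: cvg_cst.
have P (B : set line) : measurable B -> (\int[mu]_(X in nsq @^-1` B) (F X)%:E = 0)%E.
  move=> mB; move: (mB); rewrite measurable_realfun.RGenOInfty.measurableE.
  apply: (@dynkin_induction _ line _ (fun B => \int[mu]_(X in nsq @^-1` B) (F X)%:E = 0)%E).
  - exact: measurable_realfun.RGenOInfty.measurableE.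
  - move=> _ _ [a ->] [b ->]; exists (Num.max a b); apply/seteqP.
    by split => x /=; rewrite !in_itv /= !andbT gt_max => /andP.
  - by rewrite preimage_setT.
  - by move=> _ [a ->].
  - move=> S mS S0; have := PT.
    rewrite -(setUv (nsq @^-1` S)) integral_setU.
    + by rewrite S0 add0e.
    + exact: mpre.
    + by apply: measurableC; exact: mpre.
    + by rewrite setUv.
    + by apply/disj_set2P; rewrite setICr.
  - move=> S mS tS S0; rewrite preimage_bigcup integral_bigcup.
    + by apply: eseries0 => i _ _; exact: S0.
    + by move=> i j _ _ [X [hi hj]]; apply: tS => //; exists (nsq X).
    + by move=> i; exact: mpre.
    + apply: iS; apply: bigcup_measurable => i _; exact: mpre.
pose A : set plane := nsq @^-1` [set s : line | 0 < kt s].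
have mB : measurable [set s : line | 0 < kt s].
  rewrite (_ : [set s | _] = kt @^-1` `]0%R, +oo[); first by rewrite -[X in measurable X]setTI; exact: mkt.
  by apply/seteqP; split => s /=; rewrite in_itv /= andbT.
have mA : measurable A by exact: mpre.
have mkn : measurable_fun A (fun X : plane => (kt (nsq X))%:E).
  apply: (measurable_funS measurableT) => //.
  by apply/measurable_EFinP; exact: (measurableT_comp mkt measurable_nsq).
have A0 : (\int[mu]_(X in A) (kt (nsq X))%:E = 0)%E.
  rewrite -[RHS](P _ mB); apply: ae_eq_integral => //.
  - exact: (measurable_funS measurableT).
  - by apply: (@filterS _ _ (ae_filter_ringOfSetsType _) _ _ _ Fk) => X ->.
have : (\int[mu]_(X in A) `|(kt (nsq X))%:E| = 0)%E.
  by rewrite -[RHS]A0; apply: eq_integral => X; rewrite inE => XA; rewrite gee0_abs// lee_fin ltW.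
move/(ae_eq_integral_abs mu mA mkn) => hae.
apply: (@filterS2 _ _ (ae_filter_ringOfSetsType _) _ _ _ _ Fk hae) => X -> h k0.
by move: (h k0) => [kE]; move: k0; rewrite kE ltxx.
Unshelve. all: by end_near.
Qed.

Lemma radial_ae0 (H : R -> R) (F : plane -> R) (k : R -> R) :
  (forall j, Cn j H) -> (forall x, x <= -1 -> H x = 0) -> (forall x, 1 <= x -> H x = 1) ->
  mu.-integrable [set: plane] (EFin \o F) ->
  (forall g : R -> R, (forall j, Cn j g) -> \int[mu]_X (F X * g (nsq X)) = 0) ->
  {ae mu, forall X, F X = k (nsq X)} -> {ae mu, forall X, F X = 0}.
Proof.
move=> SH H0 H1 iF F0 Fk.
have mF : measurable_fun [set: plane] F by apply/measurable_EFinP; case/integrableP: iF.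
have [kt mkt Fkt] := radial_version mF Fk.
have pos := radial_pos SH H0 H1 iF F0 mkt Fkt.
have neg : {ae mu, forall X, ~ 0 < - F X}.
  apply: (@radial_pos H (fun X => - F X) (fun s => - kt s) SH H0 H1).
  - rewrite (_ : EFin \o _ = (fun X => - (EFin \o F) X)%E); first exact: integrableN.
    by apply/funext.
  - move=> g Sg; rewrite -[RHS](F0 (fun s => - g s)); last by move=> j; exact: CnN.
    by rewrite /Rintegral; congr fine; apply: eq_integral => X _; rewrite mulNr mulrN.
  - by apply: measurableT_comp.
  - by apply: (@filterS _ _ (ae_filter_ringOfSetsType _) _ _ _ Fkt) => X ->.
apply: (@filterS2 _ _ (ae_filter_ringOfSetsType _) _ _ _ _ pos neg) => X p n.
apply/eqP; rewrite eq_le -[_ <= 0]negbK -ltNge; apply/andP; split; first exact/negP.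
by rewrite leNgt -oppr_gt0; exact/negP.
Qed.

Lemma nsq_ae_neq0 : {ae mu, forall X : plane, nsq X != 0}.
Proof.
have mN : measurable ([set X : plane | X.1 = 0]).
  rewrite (_ : [set X | _] = [set 0] `*` [set: line]); first exact: measurableX.
  by apply/seteqP; split => X /=; [|case].
exists [set X : plane | X.1 = 0]; split => //.
  apply: (null_xsection mN).2.
  apply: (@filterS _ _ (ae_filter_ringOfSetsType _) _ _ _ ae_neq0) => x x0.
  rewrite (_ : xsection _ _ = set0) ?measure0//; apply/seteqP; split => // y.
  by rewrite /xsection /= inE /= => xE; move: x0; rewrite xE eqxx.
move=> X /= /negP; rewrite negbK /nsq paddr_eq0 ?sqr_ge0// sqrf_eq0 => /andP[/eqP].
by [].
Qed.

Lemma polar_angle (X : R * R) : exists th, X = (Num.sqrt (nsq X) * cos th, Num.sqrt (nsq X) * sin th).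
Proof.
case: X => x y; set r := Num.sqrt _; have n0 : 0 <= nsq (x, y) by rewrite addr_ge0 ?sqr_ge0.
have rE : r ^+ 2 = x ^+ 2 + y ^+ 2 by rewrite sqr_sqrtr.
have r0 : 0 <= r by exact: sqrtr_ge0.
have [r00|rn0] := eqVneq r 0.
  exists 0; rewrite r00 !mul0r; move: rE; rewrite r00 expr0n /= => /esym/eqP.
  by rewrite paddr_eq0 ?sqr_ge0// !sqrf_eq0 => /andP[/eqP -> /eqP ->].
have rp : 0 < r by rewrite lt_neqAle eq_sym rn0.
have xr : -1 <= x / r <= 1.
  rewrite -ler_norml normrM normfV (ger0_norm r0) ler_pdivrMr// mul1r.
  by rewrite -(@ler_pXn2r _ 2)// ?nnegrE// real_normK ?num_real// rE lerDl sqr_ge0.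
have sE : sin (acos (x / r)) = `|y| / r.
  rewrite sin_acos// -[RHS]ger0_norm ?divr_ge0// -sqrtr_sqr; congr Num.sqrt.
  rewrite !exprMn real_normK ?num_real// exprVn rE; field.
  by rewrite -rE expf_neq0.
have cE : cos (acos (x / r)) = x / r by rewrite acosK// in_itv.
have rK u : r * (u / r) = u by rewrite mulrCA divff ?mulr1.
have [y0|y0] := leP 0 y.
  by exists (acos (x / r)); rewrite sE cE !rK ger0_norm.
by exists (- acos (x / r)); rewrite sinN cosN sE cE mulrN !rK ltr0_norm ?opprK.
Qed.

End PlaneNullSets.

(** * A mode without radial moments vanishes *)

Section AnnihilatedModes.
Context {R : realType}.
Local Notation C := R[i].
Local Notation leb := (@lebesgue_measure R).
Local Notation mu := (leb \x leb)%E.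
Local Notation plane := (measurableTypeR R * measurableTypeR R)%type.

Lemma zb_polar (r th : R) : zb (r * cos th, r * sin th) = r%:C * (cos (- th) +i* sin (- th)).
Proof. by rewrite /zb /= cosN sinN; simpc. Qed.

(** Times a conjugate power w becomes radial, and times a cut-off integrable; [radial_ae0] then
    gives w = 0 on every disc away from the origin, which is a null set. *)
Lemma annihilated_mode_ae0 (H : R -> R) (w : R * R -> C) (m : nat) :
  (forall j, Cn j H) -> (forall x, x <= -1 -> H x = 0) -> (forall x, 1 <= x -> H x = 1) ->
  U m w ->
  (forall (g : R -> R) S, (forall j, Cn j g) -> (forall s, S <= s -> g s = 0) ->
    cint (fun X => w X * bmode (fun s => (g s)%:C) m X) = 0) ->
  {ae mu, forall X, w X = 0}.
Proof.
move=> SH H0 H1 [wL2 [wm hw]] w0.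
suff loc (L : nat) : {ae mu, forall X, nsq X <= L%:R -> w X = 0}.
  apply: (@filterS _ _ (ae_filter_ringOfSetsType _) _ _ _ (ae_foralln loc)) => X h.
  apply: (h (Num.truncn (nsq X)).+1); apply: ltW; rewrite truncnS_gt//.
pose g0 (s : R) := 1 - H (s - (L%:R + 1)).
have Sg0 j : Cn j g0.
  apply: CnB; first exact: Cn_cst.
  by apply: (Cn_comp (SH j)); apply: CnB; [exact: Cn_id|exact: Cn_cst].
have g0far s : L%:R + 2 <= s -> g0 s = 0 by move=> hs; rewrite /g0 H1 ?subrr//; lra.
have g0near s : s <= L%:R -> g0 s = 1 by move=> hs; rewrite /g0 H0 ?subr0//; lra.
pose K X := w X * bmode (fun s => (g0 s)%:C) m X.
have iK : cintegrable K.
  apply: cintegrable_L2 => //; first by apply: cCk_bmode; apply: cCn_real; exact: Sg0.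
  apply: (@radial_bounded_support _ (fun s => (g0 s)%:C) _ (L%:R + 2)) => s hs.
  by rewrite g0far.
have K0 g : (forall j, Cn j g) -> cint (fun X => K X * (g (nsq X))%:C) = 0.
  move=> Sg; rewrite -[RHS](w0 (fun s => g0 s * g s) (L%:R + 2)).
  - congr cint; apply/funext => X; rewrite /K /bmode rmorphM /=; ring.
  - by move=> j; exact: CnM.
  - by move=> s hs; rewrite g0far// mul0r.
have ReM (z : C) (t : R) : complex.Re (z * t%:C) = complex.Re z * t.
  by case: z => u v; simpc.
have ImM (z : C) (t : R) : complex.Im (z * t%:C) = complex.Im z * t.
  by case: z => u v; simpc.
pose k (s : R) : C := wm (Num.sqrt s) * ((g0 s)%:C * (Num.sqrt s)%:C ^+ m).
have Kk : {ae mu, forall X, K X = k (nsq X)}.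
  apply: (@filterS _ _ (ae_filter_ringOfSetsType _) _ _ _ hw) => X hX.
  have [th Xth] := polar_angle X.
  have zbX : zb X = (Num.sqrt (nsq X))%:C * (cos (- th) +i* sin (- th)) by rewrite {1}Xth zb_polar.
  rewrite /K (hX _ _ (sqrtr_ge0 _) Xth) /k /bmode zbX exprMn de_moivre mulrN cosN sinN.
  set z := cos _ +i* sin _; have zz : z * (cos (m%:R * th) -i* sin (m%:R * th)) = 1.
    rewrite /z; have := cos2Dsin2 (m%:R * th); move: (cos _) (sin _) => u v h.
    by apply/eqP; rewrite eq_complex /=; apply/andP; split; apply/eqP; [rewrite -h|]; ring.
  transitivity (wm (Num.sqrt (nsq X)) * ((g0 (nsq X))%:C * (Num.sqrt (nsq X))%:C ^+ m) *
    (z * (cos (m%:R * th) -i* sin (m%:R * th)))); last by rewrite zz mulr1.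
  ring.
have cI (z : C) : z = 0 -> complex.Re z = 0 /\ complex.Im z = 0 by move=> ->.
have Re0 : {ae mu, forall X, complex.Re (K X) = 0}.
  apply: (radial_ae0 SH H0 H1 iK.1 (k := fun s => complex.Re (k s))).
    move=> g Sg; rewrite -(cI _ (K0 g Sg)).1 /cint /=.
    by congr Rintegral; apply/funext => X; rewrite ReM.
  by apply: (@filterS _ _ (ae_filter_ringOfSetsType _) _ _ _ Kk) => X ->.
have Im0 : {ae mu, forall X, complex.Im (K X) = 0}.
  apply: (radial_ae0 SH H0 H1 iK.2 (k := fun s => complex.Im (k s))).
    move=> g Sg; rewrite -(cI _ (K0 g Sg)).2 /cint /=.
    by congr Rintegral; apply/funext => X; rewrite ImM.
  by apply: (@filterS _ _ (ae_filter_ringOfSetsType _) _ _ _ Kk) => X ->.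
have KK : {ae mu, forall X, K X = 0}.
  apply: (@filterS2 _ _ (ae_filter_ringOfSetsType _) _ _ _ _ Re0 Im0) => X hr hi.
  by apply/eqP; rewrite eq_complex hr hi /= !eqxx.
apply: (@filterS2 _ _ (ae_filter_ringOfSetsType _) _ _ _ _ KK nsq_ae_neq0) => X + n0 XL.
rewrite /K /bmode g0near// mul1r => /eqP; rewrite mulf_eq0 expf_eq0 => /orP[/eqP//|/andP[_ /eqP z0]].
by move: n0; rewrite -sqn_zb z0 /sqn /= !expr0n /= addr0 eqxx.
Qed.

End AnnihilatedModes.

(** * Derivatives on half-lines of constancy *)

Section LocallyConstant.
Context {R : realType}.

Lemma hasder_flat_lt (f f1 : R -> R) v b : (forall t, hasder f t (f1 t)) ->
  (forall t, t < b -> f t = v) -> forall t, t < b -> f1 t = 0.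
Proof.
move=> hf fv t tb; apply: (hasder_uniq (hf t)); apply: (@hasder_near _ (fun=> v)); last exact: hasder_cst.
by apply: filterS (lt_nbhsl tb) => s sb; rewrite fv.
Qed.

Lemma hasder_flat_gt (f f1 : R -> R) v b : (forall t, hasder f t (f1 t)) ->
  (forall t, b < t -> f t = v) -> forall t, b < t -> f1 t = 0.
Proof.
move=> hf fv t tb; apply: (hasder_uniq (hf t)); apply: (@hasder_near _ (fun=> v)); last exact: hasder_cst.
by apply: filterS (lt_nbhsr tb) => s sb; rewrite fv.
Qed.

End LocallyConstant.

(** * The unstable eigenvalue is a zero of the shooting function *)

Section UnstableVortex.
Context {R : realType}.
Local Notation C := R[i].
Variables (k : nat) (r1 r2 eps : R) (eta H th1 th2 th3 : R -> R).
Hypotheses (r10 : 0 < r1) (r12 : r1 < r2) (e0 : 0 < eps) (er1 : 3 * eps < r1) (er2 : 3 * eps < r2 - r1).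
Hypotheses (SH : forall j, Cn j H) (dH : forall t, hasder H t (eta t)).
Hypotheses (H0 : forall x, x <= -1 -> H x = 0) (H1 : forall x, 1 <= x -> H x = 1).
Local Notation n := k.+2.
Local Notation th := (vortex_theta r1 r2 eps H).
Local Notation c2 := (c r1 r2 / 2).
(** The margins of 1 here and in [be] place the end points inside the regions where theta is
    constant, so that its derivatives vanish there as well. *)
Local Notation al := (2 * ln (r1 - eps) - 1).
Local Notation be := (2 * ln (r2 + eps) + 1).
Hypotheses (Dth : forall t, hasder th t (th1 t)) (Dth1 : forall t, hasder th1 t (th2 t))
  (Dth2 : forall t, hasder th2 t (th3 t)).

Lemma vortex_al_be : al <= be.
Proof.
have : ln (r1 - eps) <= ln (r2 + eps).
  have := r10; have := r12; have := e0; have := er1 => h1 h2 h3 h4.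
  by rewrite ler_ln ?posrE; lra.
lra.
Qed.

Lemma vortex_th_left t : t <= al -> th t = c2.
Proof. by move=> h; apply: (vortex_theta_left r12 e0 er1 H0); lra. Qed.

Lemma vortex_p_left t : t <= al -> th1 t + th2 t = 0.
Proof.
move=> h; have z1 : forall t, t < 2 * ln (r1 - eps) -> th1 t = 0.
  by apply: (hasder_flat_lt Dth) => s /ltW hs; exact: (vortex_theta_left r12 e0 er1 H0).
by rewrite z1 1?(hasder_flat_lt Dth1 z1) ?addr0//; lra.
Qed.

Lemma vortex_p_right t : be <= t -> th1 t + th2 t = 0.
Proof.
move=> h; have z1 : forall t, 2 * ln (r2 + eps) < t -> th1 t = 0.
  by apply: (hasder_flat_gt Dth) => s /ltW hs; exact: (vortex_theta_right r10 r12 e0 H1).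
by rewrite z1 1?(hasder_flat_gt Dth1 z1) ?addr0//; lra.
Qed.

Lemma unstable_rayleigh (lam0 : C) (w : R * R -> C) (psi0 eta0 : R -> C) : 0 < complex.Re lam0 ->
  eigenfunction (vortex_L r1 r2 eta eps) n lam0 w ->
  is_rayleigh n th th1 th2 be lam0 psi0 eta0 -> eta0 al = 0.
Proof.
move=> lam_gt0 [Uw w_neq0 [V bs weq]] ray; apply: contrapT => /eqP ne; apply: w_neq0.
have Seta : forall j, Cn j eta := Cn_der SH dH.
have ceta : continuous eta := Seta 0%N.
have VE := funext (barV_radial r10 r12 e0 er1 er2 dH ceta H0 H1).
have OE := funext (barOmega_radial r10 r12 e0 er1 er2 dH ceta H0 H1 Dth).
rewrite /vortex_L VE OE in weq.
have [eta' deta ceta'] := Seta 1%N.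
have Sth := vortex_theta_smooth r1 r2 eps SH.
have z1 : forall t, t < 2 * ln (r1 - eps) -> th1 t = 0.
  by apply: (hasder_flat_lt Dth) => s /ltW hs; exact: (vortex_theta_left r12 e0 er1 H0).
apply: (annihilated_mode_ae0 SH H0 H1 Uw) => g S Sg g_far.
have [X0 [X1 [X2 [ka [SX0 dX0 dX1 ode far]]]]] :=
  dual_radial c2 Sth Dth Dth1 Dth2 vortex_p_right vortex_p_left lam_gt0 ray ne Sg.
have Sth1 := Cn_der Sth Dth; have Sth2 := Cn_der Sth1 Dth1.
(* The cut-off 1 - H (u - 2) is 1 for u <= 1 and 0 for u >= 3, as H makes its transition on
   [-1, 1]. *)
pose sh (u : R) := u - 2.
have dsh u : hasder sh u 1.
  by rewrite -[1]subr0; apply: hasderB; [exact: hasder_id|exact: hasder_cst].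
have dK0 u : hasder (fun u => 1 - H (sh u)) u (- eta (sh u)).
  rewrite -[- _]sub0r; apply: hasderB; first exact: hasder_cst.
  by apply: hasder_eq; [exact: (hasder_comp (dsh u) (dH _))|rewrite mulr1].
have dK1 u : hasder (fun u => - eta (sh u)) u (- eta' (sh u)).
  by apply: hasderN; apply: hasder_eq; [exact: (hasder_comp (dsh u) (deta _))|rewrite mulr1].
have el : forall t, t < -1 -> eta t = 0.
  by apply: (hasder_flat_lt dH) => t /ltW ht; exact: H0.
have er : forall t, 1 < t -> eta t = 0.
  by apply: (hasder_flat_gt dH) => t /ltW ht; exact: H1.
have el' := hasder_flat_lt deta el; have er' := hasder_flat_gt deta er.
(* The maximum with 1 serves the comparison of powers of s in the error bound. *)
pose S0 : R := Num.max 1 (expR be).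
have [M hM] : exists M : R, forall u, ((2 - 2 * n%:R) * - eta (sh u) + 2 * u * - eta' (sh u)) ^+ 2 <= M.
  have csh (f : R -> R) : Cn 0 f -> Cn 0 (fun u => f (sh u)).
    by move=> cf; apply: (Cn_comp cf); apply: CnB; [exact: Cn_id|exact: Cn_cst].
  have cE : Cn 0 (fun u => (2 - 2 * n%:R) * - eta (sh u) + 2 * u * - eta' (sh u)).
    apply: CnD; apply: CnM.
    - exact: Cn_cst.
    - by apply: CnN; apply: csh; exact: ceta.
    - by apply: CnM; [exact: Cn_cst|exact: Cn_id].
    - by apply: CnN; apply: csh; exact: ceta'.
  (* Outside [1, 3] both derivatives of the cut-off vanish, so a bound on this compact interval is a
     global one. *)
  have [M M0 hM] := continuous_bounded 1 3 (CnM cE cE : continuous _).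
  exists M => u; have [u1|u1] := ltP u 1.
    by rewrite /sh el ?el' ?oppr0 ?mulr0 ?addr0 ?expr0n//=; lra.
  have [u3|u3] := ltP 3 u.
    by rewrite /sh er ?er' ?oppr0 ?mulr0 ?addr0 ?expr0n//=; lra.
  by rewrite expr2; apply: hM; rewrite u1 u3.
have := @dual_annihilation _ k (rlog th c2) (rlog (fun t => 2 * (th t + th1 t)) (2 * c2))
  (rlog (fun t => 2 * (th1 t + th2 t) * expR (- t)) 0) g
  (fun u => 1 - H (sh u)) (fun u => - eta (sh u)) (fun u => - eta' (sh u))
  lam0 X0 X1 X2 ka S0 S M.
apply.
- move=> j; apply: (@rlog_smooth _ _ _ _ al) => // t tal; exact: vortex_th_left (ltW tal).
- apply: (@hasder_rlog _ _ _ _ al).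
    move=> t tal; rewrite vortex_th_left ?ltW// z1 ?addr0//; lra.
  by move=> t; apply: hasderZ; exact: hasderD.
- have cE : Cn 0 (fun t => 2 * (th1 t + th2 t) * expR (- t)).
    apply: CnM; first by apply: CnM; [exact: Cn_cst|apply: CnD; [exact: Sth1|exact: Sth2]].
    by apply: (Cn_comp (Cn_exp 0)); apply: CnN; exact: Cn_id.
  apply: (@rlog_smooth _ 0 _ 0 al cE) => t tal.
  by rewrite vortex_p_left ?mulr0 ?mul0r// ltW.
- by rewrite le_max lexx.
- move=> s; rewrite ge_max => /andP[s1 sb]; have s0 : 0 < s by lra.
  by rewrite /rlog s0 vortex_p_right ?mulr0 ?mul0r// -ler_expR lnK.
- exact: lam_gt0.
- exact: Sg.
- exact: g_far.
- exact: SX0.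
- exact: dX0.
- exact: dX1.
- exact: ode.
- by move=> s; rewrite ge_max => /andP[_]; exact: far.
- move=> j; apply: CnB; first exact: Cn_cst.
  by apply: (Cn_comp (SH j)); apply: CnB; [exact: Cn_id|exact: Cn_cst].
- exact: dK0.
- exact: dK1.
- move=> u u1; rewrite /sh H0 ?el ?el' ?subr0 ?oppr0; [by []|lra..].
- move=> u u1; rewrite /sh H1 ?er ?er' ?subrr ?oppr0; [by []|lra..].
- exact: hM.
- exact: Uw.1.
- exact: bs.
- exact: weq.
Qed.

End UnstableVortex.

(** * Existence of the self-similar eigenfunction *)

Unset Implicit Arguments.

Theorem theorem2p7 (R : realType) (n : nat) (r1 r2 : R)
  (eta : R -> R) (eps a : R)
  (hn : (2 <= n)%N)
  (hr1 : 0 < r1) (hr12 : r1 < r2)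
  (hroots : nonreal_roots (vortex_poly r1 r2 n))
  (heta : standard_mollifier eta)
  (heps0 : 0 < eps) (heps : eps < 3^-1 * Num.min r1 (r2 - r1))
  (hunstable : exists (lambda0 : R[i]) (w : R * R -> R[i]),
     0 < complex.Re lambda0 /\
     eigenfunction (vortex_L r1 r2 eta eps) n lambda0 w)
  (ha0 : 0 < a) (ha1 : a <= 1) :
  exists (b : R) (m : nat) (lambda : R[i]) (W : R * R -> R[i]),
    [/\ 0 < b <= 1,
        (1 <= m)%N,
        0 < complex.Re lambda,
        eigenfunction (vortex_Lb r1 r2 eta eps a b) m lambda W &
        Cck_complex 2 W].
Proof.
have [m_gt mlt] : 3 * eps < r1 /\ 3 * eps < r2 - r1.
  have : 3 * eps < Num.min r1 (r2 - r1) by rewrite mulrC -ltr_pdivlMr// mulrC.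
  by rewrite lt_min => /andP[].
case: n hn hroots hunstable => [|[|k]]// _ _ [lam0 [w [lam0_gt0 hw]]].
have [H [SH dH H0 H1]] := mollifier_antiderivative heta.
have Sth := vortex_theta_smooth r1 r2 eps SH.
have [th1 Dth _] := Sth 1%N; have Sth1 := Cn_der Sth Dth.
have [th2 Dth1 _] := Sth1 1%N; have Sth2 := Cn_der Sth1 Dth1.
have [th3 Dth2 cth3] := Sth2 1%N.
have albe := vortex_al_be hr1 hr12 heps0 m_gt.
have p_left := vortex_p_left hr12 heps0 m_gt H0 Dth Dth1.
have p_right := vortex_p_right hr1 hr12 heps0 H1 Dth Dth1.
have th_left := vortex_th_left hr12 heps0 m_gt H0.
have [psi0 [eta0 ray]] := rayleigh_exists k.+2 (2 * ln (r2 + eps) + 1) Dth Dth1 Dth2 lam0_gt0.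
have eta00 := unstable_rayleigh hr1 hr12 heps0 m_gt mlt SH dH H0 H1 Dth Dth1 Dth2 lam0_gt0 hw ray.
have [sig sig0 hsig] := selfsim_eigenvalue a (ltn0Sn _) albe Dth Dth1 Dth2 cth3 p_right p_left
  th_left lam0_gt0 ray eta00.
have d0 : 0 < a + (k.+2%:R : R) + 6 by have := ler0n R k.+2; lra.
(* The bound b <= sig / (a + n + 6), with Re lambda >= sig and sig independent of b, is the
   largeness condition that makes the eigenfunction C^2 at the origin. *)
have [|b [lam [psi [et [q [/andP[b0 bB] lam_sig sol det0]]]]]] := hsig (Num.min 1 (sig / (a + k.+2%:R + 6))).
  by rewrite lt_min ltr01 divr_gt0.
move: bB; rewrite le_min => /andP[b1 bs].
have [|W [hW regW]] := selfsim_eigenfunction albe Dth Dth1 Dth2 cth3 p_right p_left th_left b0 sol det0.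
  by apply: le_trans lam_sig; rewrite -ler_pdivlMr.
exists b, k.+2, lam, W; split.
- by rewrite b0.
- by [].
- exact: lt_le_trans lam_sig.
- have ceta : continuous eta := Cn_der SH dH 0%N.
  have VE : barV r1 r2 eta eps = _ := funext (barV_radial hr1 hr12 heps0 m_gt mlt dH ceta H0 H1).
  have OE : barOmega r1 r2 eta eps = _ := funext (barOmega_radial hr1 hr12 heps0 m_gt mlt dH ceta H0 H1 Dth).
  by rewrite /vortex_Lb VE OE; exact: hW.
- exact: regW.
Qed.
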